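(* Let $X$ be a complex surface and $\Omega\Subset X$ a relatively compact domain with $C^3$-smooth Levi-flat boundary $M=\partial\Omega$. Fix a continuous leafwise hermitian metric $\omega$ on the Levi foliation of $M$. Suppose that $\Omega$ possesses a $C^3$-smooth boundary distance function $\delta$ whose local Diederich--Fornaess exponent $\eta_\delta(p)$ is constant equal to $\eta$, $0<\eta<1$, for all $p$ in a compact saturated set $\mathcal{M}\subset M$ of the Levi foliation, and put $\alpha=(\eta^{-1}-1)^{-1}$. If the transversals of $\mathcal{M}$ have positive finite Hausdorff measure of dimension exactly $\alpha$, that is, $0<\mathcal{H}_\alpha(\mathcal{M}_U)<\infty$ for the transversals $\mathcal{M}_U$ of $\mathcal{M}$ in the foliated charts $U$ meeting $\mathcal{M}$ of a finite cover of $M$ by foliated charts, then $\mathcal{M}$ admits a conformal harmonic measure with exponent $\alpha$.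
   Context: Let $J_X$ be the complex structure of $X$. Boundary distance function: a $C^2$-smooth function $\delta:\overline{\Omega}\to\mathbb{R}$ such that $\Omega=\{\delta>0\}$ and $d\delta\neq0$ on $\partial\Omega$ (so $\delta=0$ on $\partial\Omega$). Local Diederich--Fornaess exponent: for $p\in\partial\Omega$, $\eta_\delta(p)$ is the supremum of $\eta\in(0,1)$ such that $-\delta^\eta$ is strictly plurisubharmonic on $U\cap\Omega$ for some neighborhood $U$ of $p$ in $X$; $\eta_\delta(p)=0$ if there is no such $\eta$. Levi-flatness: a smooth real hypersurface $M\subset X$ is Levi-flat if it locally separates $X$ into two Stein domains; equivalently, $M$ has a foliation $\mathcal{F}$ (the Levi foliation), with tangent bundle $TM\cap J_XTM$, by non-singular complex hypersurfaces of $X$ (here complex curves). When $M$ is $C^3$-smooth, $\mathcal{F}$ is $C^3$-smooth (Barrett--Fornaess). A foliated chart is a chart $(z'_U,t_U):U\to D_U\times T_U\subset\mathbb{C}\times\mathbb{R}$ of $M$ whose plaques $\{t_U=\text{const}\}$ are contained in leaves and on which $z'_U$ is a holomorphic coordinate along the leaves. On overlaps $t_V$ is locally a function of $t_U$. A saturated set is a union of leaves. For a compact saturated set $\mathcal{M}$ and a finite cover $\{U\}$ of $M$ by foliated charts, the transversals of $\mathcal{M}$ are $\mathcal{M}_U=t_U(\mathcal{M}\cap U)\subset T_U\subset\mathbb{R}$. $\mathcal{H}_\alpha$ denotes the $\alpha$-dimensional Hausdorff measure. The metric $\omega$ is a hermitian metric on the leaves which is continuous on $M$, and $\mathrm{vol}_\omega$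 is its associated leafwise volume form. Conformal transverse measures: given a finite cover $\{U\}$ of $M$ by foliated charts, a collection of transverse measures $\{\nu_U\}$ is conformal of exponent $\alpha>0$ adapted to $\mathcal{M}$ if (i) each $\nu_U$ is a finite Borel measure supported on $\mathcal{M}_U$; (ii) whenever two foliated charts $U$ and $V$ intersect, $t_V^*(\nu_V)=\left|\frac{dt_V}{dt_U}\right|^\alpha\cdot\nu_U$, where $t_V$ is regarded as a function of $t_U$. Conformal harmonic measure: a measure $\mu$ supported on $\mathcal{M}$ is a conformal harmonic measure of exponent $\alpha$ if there exists a finite cover $\{U\}$ of $M$ by foliated charts with which $\mu$ has a local disintegration $\mu|_U=h_U\,\mathrm{vol}_\omega\otimes\nu_U$ on each $U$ such that (1) $\{\nu_U\}$ is a collection of transverse measures, conformal of exponent $\alpha$ adapted to $\mathcal{M}$; (2) $h_U$ is a non-negative real-valued function on $U$ which is integrable with respect to $\mathrm{vol}_\omega\otimes\nu_U$, and $\log h_U$ is bounded on $\mathcal{M}\cap U$; (3) on $\nu_U$-almost every plaque of $\mathcal{M}$, $h_U$ is positive and $\partial_b\overline{\partial}_b$-closed, i.e. $\partial_b\overline{\partial}_bh_U=0$, where $\partial_b,\overline{\partial}_b$ are the $(1,0)$- and $(0,1)$-parts of the exterior derivative along the leaves. *)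

(* Defs.v *)
From HB Require Import structures.
From mathcomp Require Import all_boot all_order all_algebra.
From mathcomp Require Import all_classical all_reals all_analysis.
From mathcomp Require Import complex.
From Stdlib Require Import Relation_Operators.

Set Implicit Arguments.
Unset Strict Implicit.
Unset Printing Implicit Defensive.

Import Order.TTheory GRing.Theory Num.Theory.
Import numFieldNormedType.Exports.

Local Open Scope classical_set_scope.
Local Open Scope ring_scope.

(** * Smooth and holomorphic maps

The complex line is modelled by the real normed space [R * R], the pair
[(x, y)] standing for [x + iy], and the complex plane of dimension two by
[C1 R * C1 R]; multiplication by [i] is the linear map [J1], resp. [J2]. *)

Notation C1 R := (R * R)%type.
Notation C2 R := ((R * R) * (R * R))%type.

Definition J1 (R : realType) (v : C1 R) : C1 R := (- v.2, v.1).
Definition J2 (R : realType) (v : C2 R) : C2 R := (J1 v.1, J1 v.2).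

(* [Ck k A f]: [f] is of class C^k (over the reals) on the open set [A]. *)
Fixpoint Ck (R : realType) (V W : normedModType R) (k : nat) (A : set V)
    (f : V -> W) : Prop :=
  {in A, continuous f} /\
  match k with
  | 0%N => True
  | k'.+1 => forall v : V,
      (forall z, A z -> derivable f z v) /\ Ck k' A (fun z => 'D_v f z)
  end.

(* Cauchy-Riemann: differentiable with differential commuting with [i]. *)
Definition holomorphic (R : realType) (V W : normedModType R) (JV : V -> V)
    (JW : W -> W) (A : set V) (f : V -> W) : Prop :=
  forall z, A z ->
    differentiable f z /\ forall v : V, 'd f z (JV v) = JW ('d f z v).

(** * Wirtinger derivatives *)

Section Wirtinger.
Context (R : realType) (V : normedModType R) (J : V -> V).
Local Open Scope complex_scope.

Definition cderive (v : V) (f : V -> R[i]) (z : V) : R[i] :=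
  'D_v (fun x => complex.Re (f x)) z +i* 'D_v (fun x => complex.Im (f x)) z.

(* d/dz_e = (d/dx - i d/dy) / 2 and d/dzbar_e = (d/dx + i d/dy) / 2, where
   [e] and [J e] are the directions of the real coordinates x and y. *)
Definition d_dz (e : V) (f : V -> R[i]) (z : V) : R[i] :=
  (cderive e f z - 'i * cderive (J e) f z) / 2%:R.

Definition d_dzbar (e : V) (f : V -> R[i]) (z : V) : R[i] :=
  (cderive e f z + 'i * cderive (J e) f z) / 2%:R.

Definition ddbar (e e' : V) (u : V -> R) (z : V) : R[i] :=
  d_dz e (d_dzbar e' (fun x => (u x)%:C)) z.

End Wirtinger.

Definition e2 (R : realType) (j : 'I_2) : C2 R :=
  if j == ord0 then ((1, 0), 0) else (0, (1, 0)).

Definition pos_complex_hessian (R : realType) (u : C2 R -> R) (z : C2 R) :=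
  forall w : 'rV[R[i]]_2, w != 0 ->
    0 < \sum_(j < 2) \sum_(k < 2)
          ddbar (@J2 R) (e2 R j) (e2 R k) u z * w 0 j * conjc (w 0 k).

(** * Complex surfaces

The underlying space is pointed (hence nonempty) because the measurable types
of the library are; the point plays no role. *)

Record chart (R : realType) (X : topologicalType) := Chart {
  cdom : set X;
  cmap : X -> C2 R;
  cinv : C2 R -> X }.

Definition is_chart (R : realType) (X : topologicalType) (c : chart R X) :=
  [/\ open (cdom c), open (cmap c @` cdom c),
      {in cdom c, continuous (cmap c)},
      {in cmap c @` cdom c, continuous (cinv c)} &
      {in cdom c, cancel (cmap c) (cinv c)}].

Record complexSurface (R : realType) := ComplexSurface {
  csurf :> ptopologicalType;
  csurf_hausdorff : hausdorff_space csurf;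
  csurf_second_countable : @second_countable csurf;
  atlas : set (chart R csurf);
  atlas_chart : forall c, atlas c -> is_chart c;
  atlas_cover : forall p : csurf, exists2 c, atlas c & cdom c p;
  atlas_holomorphic : forall c d, atlas c -> atlas d ->
    holomorphic (@J2 R) (@J2 R) (cmap c @` (cdom c `&` cdom d))
      (cmap d \o cinv c) }.

Section Surface.
Context (R : realType) (X : complexSurface R).

(* For [W] open in [X]. *)
Definition CkX (k : nat) (W : set X) (f : X -> R) : Prop :=
  forall c, atlas c -> Ck k (cmap c @` (cdom c `&` W)) (f \o cinv c).

Definition d_neq0 (f : X -> R) (p : X) : Prop :=
  forall c, atlas c -> cdom c p ->
    exists v : C2 R, 'D_v (f \o cinv c) (cmap c p) != 0.

Definition strictly_psh (W : set X) (f : X -> R) : Prop :=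
  CkX 2 W f /\
  forall c, atlas c -> forall p, cdom c p -> W p ->
    pos_complex_hessian (f \o cinv c) (cmap c p).

Definition bd (A : set X) : set X := closure A `\` interior A.

(* Relatively compact domain. *)
Definition rc_domain (Omega : set X) : Prop :=
  [/\ open Omega, Omega !=set0, connected Omega & compact (closure Omega)].

Definition Ck_boundary (k : nat) (Omega : set X) : Prop :=
  forall p, bd Omega p -> exists (O : set X) (rho : X -> R),
    [/\ open_nbhs p O, CkX k O rho,
        Omega `&` O = [set q | O q /\ 0 < rho q],
        bd Omega `&` O = [set q | O q /\ rho q = 0] &
        forall q, O q -> bd Omega q -> d_neq0 rho q].

(* Only the values of [delta] on the closure of [Omega] matter; smoothness on
   the closure means local existence of smooth extensions. *)
Definition boundary_distance (k : nat) (Omega : set X) (delta : X -> R) :=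
  [/\ forall p, closure Omega p -> exists (O : set X) (f : X -> R),
        [/\ open_nbhs p O, CkX k O f,
            forall q, O q -> closure Omega q -> f q = delta q &
            bd Omega p -> d_neq0 f p],
      Omega = [set p | closure Omega p /\ 0 < delta p] &
      forall p, bd Omega p -> delta p = 0].

(* [sup set0 = 0], in accordance with the convention for an empty set of
   exponents. *)
Definition local_DF_exponent (Omega : set X) (delta : X -> R) (p : X) : R :=
  sup [set eta : R | 0 < eta < 1 /\
    exists2 U : set X, open_nbhs p U &
      strictly_psh (U `&` Omega) (fun q => - (delta q `^ eta))].

(** * Levi foliation *)

(* A candidate foliated chart: its domain [U], the coordinates [z'] and [t],
   their ranges [D] and [T], and the inverse parametrization of [U]. *)
Record fchart := FChart {
  fdom : set X;
  fz : X -> C1 R;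
  ft : X -> R;
  fD : set (C1 R);
  fT : set R;
  fpar : C1 R * R -> X }.

(* Smoothness of the chart is expressed through its inverse, a C^3 immersion
   which is a homeomorphism onto an open subset of [M]. The plaques are complex
   curves contained in [M], hence are tangent to TM \cap J TM. *)
Definition foliated_chart (M : set X) (c : fchart) : Prop :=
  [/\ (exists2 O : set X, open O & fdom c = M `&` O),
      [/\ open (fD c), connected (fD c), open (fT c) & is_interval (fT c)],
      [/\ forall p, fdom c p ->
            [/\ fD c (fz c p), fT c (ft c p) & fpar c (fz c p, ft c p) = p],
          forall x, (fD c `*` fT c) x ->
            [/\ fdom c (fpar c x), fz c (fpar c x) = x.1 &
                ft c (fpar c x) = x.2],
          {within fdom c, continuous (fz c)},
          {within fdom c, continuous (ft c)} &
          {in fD c `*` fT c, continuous (fpar c)}],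
      forall a, atlas a ->
        let A := (fD c `*` fT c) `&` fpar c @^-1` cdom a in
        Ck 3 A (cmap a \o fpar c) /\
        forall x v, A x -> 'D_v (cmap a \o fpar c) x = 0 -> v = 0 &
      forall a, atlas a -> forall t, fT c t ->
        holomorphic (@J1 R) (@J2 R)
          [set z | fD c z /\ cdom a (fpar c (z, t))]
          (fun z => cmap a (fpar c (z, t)))].

Definition levi_flat (M : set X) : Prop :=
  forall p, M p -> exists2 c, foliated_chart M c & fdom c p.

Definition same_plaque (M : set X) (p q : X) : Prop :=
  exists2 c, foliated_chart M c & [/\ fdom c p, fdom c q & ft c p = ft c q].

Definition leaf (M : set X) (p : X) : set X :=
  [set q | clos_refl_trans X (same_plaque M) p q].

Definition saturated (M S : set X) : Prop :=
  S `<=` M /\ S = \bigcup_(p in S) leaf M p.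

Definition foliated_cover (M : set X) (n : nat) (c : 'I_n -> fchart) : Prop :=
  (forall i, foliated_chart M (c i)) /\ M = \bigcup_i fdom (c i).

Definition leaf_transversal (S : set X) (c : fchart) : set R :=
  ft c @` (S `&` fdom c).

(* |dz'_d / dz'_c|^2 along the plaque of [c] through [p]. *)
Definition sqnorm_dz (c d : fchart) (p : X) : R :=
  let w := 'D_((1, 0) : C1 R) (fun z => fz d (fpar c (z, ft c p))) (fz c p) in
  w.1 ^+ 2 + w.2 ^+ 2.

(* A continuous leafwise hermitian metric, given in each foliated chart [c] by
   g c |dz'|^2; its volume form on the plaques is g c dx /\ dy. *)
Definition leafwise_metric (M : set X) (g : fchart -> X -> R) : Prop :=
  (forall c, foliated_chart M c ->
     {within fdom c, continuous (g c)} /\ forall p, fdom c p -> 0 < g c p) /\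
  (forall c d, foliated_chart M c -> foliated_chart M d ->
     forall p, fdom c p -> fdom d p -> g c p = g d p * sqnorm_dz c d p).

End Surface.

(** * Hausdorff measure on the real line *)

Section Hausdorff.
Context (R : realType).
Local Open Scope ereal_scope.

(* The diameter of the empty set is -oo, and [-oo `^ alpha = 0] for
   [alpha != 0]. *)
Definition ediam (E : set R) : \bar R :=
  ereal_sup [set (`|xy.1 - xy.2|%R)%:E | xy in E `*` E].

Definition hausdorff_premeasure (alpha eps : R) (A : set R) : \bar R :=
  ereal_inf [set \sum_(0 <= k <oo) (ediam (E k) `^ alpha) | E in
    [set E : nat -> set R |
       A `<=` \bigcup_k E k /\ forall k, ediam (E k) <= eps%:E]].

Definition hausdorff_measure (alpha : R) (A : set R) : \bar R :=
  ereal_sup [set hausdorff_premeasure alpha eps A | eps in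
    [set eps : R | (0 < eps)%R]].

End Hausdorff.

(** * Conformal harmonic measures *)

Notation borel Y := (g_sigma_algebraType (@open Y)).

Section ConformalHarmonic.
Context (R : realType) (X : complexSurface R).

Notation transverse_measure :=
  {finite_measure set (measurableTypeR R) -> \bar R}.

(* [tau] is [t_V] as a function of [t_U] on the open subset [W] of the
   intersection of the two charts; such a function exists only locally. *)
Definition conformal_measures (M S : set X) (alpha : R) (n : nat)
    (c : 'I_n -> fchart X) (nu : 'I_n -> transverse_measure) : Prop :=
  (forall i, nu i (~` leaf_transversal S (c i)) = 0%E) /\
  (forall (i j : 'I_n) (O : set X) (tau : R -> R),
     let W := M `&` O in
     open O -> W `<=` fdom (c i) `&` fdom (c j) ->
     (forall p, W p -> ft (c j) p = tau (ft (c i) p)) ->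
     {in ft (c i) @` W &, injective tau} ->
     forall B : set (measurableTypeR R), measurable B -> B `<=` ft (c i) @` W ->
       nu j (tau @` B) =
       (\int[nu i]_(s in B) (`|derive1 tau s| `^ alpha)%:E)%E).

(* Lebesgue measure in the coordinate z' times the transverse measure. *)
Definition chart_measure (nu : transverse_measure) :=
  ((@lebesgue_measure R \x @lebesgue_measure R) \x nu)%E.

(* The zero measure satisfies all the other conditions trivially; a conformal
   harmonic measure is required to be nonzero. *)
Definition conformal_harmonic_measure (M S : set X) (g : fchart X -> X -> R)
    (alpha : R) (mu : {measure set (borel X) -> \bar R}) : Prop :=
  [/\ mu (~` S) = 0%E, mu setT <> 0%E &
   exists (n : nat) (c : 'I_n -> fchart X) (nu : 'I_n -> transverse_measure)
     (h : 'I_n -> X -> R),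
   [/\ foliated_cover M c,
       conformal_measures M S alpha c nu,
       forall i,
         let F x := h i (fpar (c i) x) * g (c i) (fpar (c i) x) in
         (forall p, fdom (c i) p -> 0 <= h i p) /\
         (chart_measure (nu i)).-integrable (fD (c i) `*` fT (c i)) (EFin \o F)
         /\ (exists K : R, forall p, S p -> fdom (c i) p ->
               0 < h i p /\ `|ln (h i p)| <= K),
       forall i, {ae nu i, forall t, leaf_transversal S (c i) t ->
         let u z := h i (fpar (c i) (z, t)) in
         [/\ forall z, fD (c i) z -> 0 < u z, Ck 2 (fD (c i)) u &
             forall z, fD (c i) z -> ddbar (@J1 R) (1, 0) (1, 0) u z = 0]} &
       forall i (B : set (borel X)), measurable B -> B `<=` fdom (c i) ->
         mu B = (\int[chart_measure (nu i)]_(x in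
                    (fD (c i) `*` fT (c i)) `&` fpar (c i) @^-1` B)
                  (h i (fpar (c i) x) * g (c i) (fpar (c i) x))%:E)%E]].

End ConformalHarmonic.

(* Main.v *)
Require Import Defs.
From HB Require Import structures.
From mathcomp Require Import all_boot all_order all_algebra.
From mathcomp Require Import all_classical all_reals all_analysis.
From mathcomp Require Import complex measurable_realfun.
From mathcomp Require Import ring lra.

Set Implicit Arguments.
Unset Strict Implicit.
Unset Printing Implicit Defensive.

Import Order.TTheory GRing.Theory Num.Theory.
Import numFieldNormedType.Exports.

Local Open Scope classical_set_scope.
Local Open Scope ring_scope.

(** Let [h] be the derivative of the boundary distance [delta] in a direction
transverse to the boundary, [J d/dt] in a foliated chart [(z, t)]; it is defined
on the boundary, does not vanish, and is of class C^2. It carries the whole proof,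
through two properties.

First, along a leaf, [|h|^alpha] is harmonic where the exponent is [eta]. Near the
boundary the Levi form of [- delta^eta], divided by [eta delta^eta], is evaluated on
the plane spanned by the leaf direction and the transverse direction. When the base
point tends to the boundary, correcting the leaf direction to first order in
[delta], the entries of this form converge, and the limit of the determinant is
  [- (1 - eta) Delta h / h + (1 - 2 eta) |grad h|^2 / h^2],
where the Laplacian and the gradient are taken along the leaf (the terms in [delta]
of order zero vanish because the boundary is Levi-flat). The determinant is affine in
[eta], must be nonnegative when [- delta^eta] is plurisubharmonic on one side, and
strict positivity at the point gives plurisubharmonicity nearby; so it vanishes at
the supremum of the admissible exponents (exponent_laplacian). The equation
  [h Delta h = (1 - eta / (1 - eta)) |grad h|^2]
obtained in this way says that [|h|^(eta / (1 - eta))] is harmonic along the leaves in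
the compact set (leaf_normal_laplacian, harmonic_power).

Secondly, when the foliated chart is changed, [h] is multiplied by the derivative of
the transverse coordinate (chart_transition). The Hausdorff measure of dimension
[alpha] of the transversals is multiplied by the power [alpha] of this derivative
(haus_change), and this is conformality of exponent [alpha]. So in
[|h|^alpha vol (x) nu] the Hausdorff measure [nu] of the transversals and the density
[|h|^alpha] transform oppositely, while the leafwise volume is invariant. The measures
defined in the charts agree on the overlaps (mchart_eq) and glue to a measure on the
surface.

The holonomy being only strictly differentiable, all changes of variables are done by
comparing measures locally up to a factor close to one (le_of_local): at small scales
a transition is almost a similarity on the transversal, and almost a complex
multiplication on the plaques. For the plaques the comparison of areas is reduced to
the fact that planar Lebesgue measure is a Hausdorff measure, for which the effect of
Lipschitz maps is immediate (leb2_near_conformal). Finally the given charts are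
restricted to small boxes on which [h] is bounded above and below, and one box is
kept on which the transverse measure is not zero (good_cover). *)

(** * Finite-dimensional calculus *)

Section Coordinates.
Context (R : realType).

Definition coordinates (V : normedModType R) (d : nat) (e : 'I_d -> V)
    (x : 'I_d -> V -> R) :=
  [/\ forall i (a : R) u v, x i (a *: u + v) = a * x i u + x i v,
      forall v, v = \sum_i x i v *: e i &
      forall i v, `|x i v| <= `|v|].

Definition fin_dim (V : normedModType R) :=
  exists (d : nat) (e : 'I_d -> V) (x : 'I_d -> V -> R), coordinates e x.

Lemma fin_dim_real : fin_dim R.
Proof.
exists 1%N, (fun=> 1), (fun _ v => v); split => //.
by move=> v; rewrite big_ord1 /GRing.scale /= mulr1.
Qed.

Lemma fin_dim_prod (V W : normedModType R) :
  fin_dim V -> fin_dim W -> fin_dim (V * W)%type.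
Proof.
move=> [d [e [x [xl xe xn]]]] [d' [e' [x' [xl' xe' xn']]]].
exists (d + d')%N.
exists (fun i : 'I_(d + d') =>
  match fintype.split i with inl j => (e j, 0) | inr j => (0, e' j) end).
exists (fun (i : 'I_(d + d')) (v : V * W) =>
  match fintype.split i with inl j => x j v.1 | inr j => x' j v.2 end).
split.
- by move=> i a u v; case: fintype.split => j; rewrite ?xl ?xl'.
- move=> [v w]; rewrite big_split_ord /=.
  under eq_bigr => i _ do rewrite (unsplitK (inl i)) /=.
  under [X in _ + X]eq_bigr => i _ do rewrite (unsplitK (inr i)) /=.
  have l1 : forall (r : seq 'I_d) (c : 'I_d -> R),
      \sum_(i <- r) c i *: ((e i, 0) : V * W) = (\sum_(i <- r) c i *: e i, 0).
    move=> r c; elim: r => [|i r IH]; first by rewrite !big_nil.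
    by rewrite !big_cons IH; congr pair => /=; rewrite scaler0 addr0.
  have l2 : forall (r : seq 'I_d') (c : 'I_d' -> R),
      \sum_(i <- r) c i *: ((0, e' i) : V * W) = (0, \sum_(i <- r) c i *: e' i).
    move=> r c; elim: r => [|i r IH]; first by rewrite !big_nil.
    by rewrite !big_cons IH; congr pair => /=; rewrite scaler0 addr0.
  by rewrite l1 l2 -xe -xe'; congr pair => /=; rewrite ?addr0 ?add0r.
- move=> i [v w]; rewrite prod_normE /= le_max.
  by case: fintype.split => j; rewrite ?xn ?xn' ?orbT.
Qed.

End Coordinates.

Section StrictDifferential.
Context (R : realType).

(** Strict differentiability: the increment between two arbitrary nearby points
    is controlled. It is what C^1 regularity gives, and unlike mere
    differentiability it passes to local inverses and gives Lipschitz bounds. *)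
Definition sdiff (V W : normedModType R) (f : V -> W) (z : V) (L : V -> W) :=
  [/\ forall (a : R) u v, L (a *: u + v) = a *: L u + L v,
      exists C : R, forall v, `|L v| <= C * `|v| &
      forall e : R, 0 < e -> exists2 r : R, 0 < r &
        forall x y, ball z r x -> ball z r y ->
          `|f x - f y - L (x - y)| <= e * `|x - y|].

Section Consequences.
Context (V W : normedModType R) (f : V -> W) (z : V) (L : V -> W).
Hypothesis fL : sdiff f z L.

Lemma sdiff0 : L 0 = 0.
Proof.
case: fL => /(_ 1 0 0) + _ _; rewrite !scale1r addr0 => E.
by apply: (addrI (L 0)); rewrite addr0 -E.
Qed.

Lemma sdiffZ a v : L (a *: v) = a *: L v.
Proof. by case: (fL) => /(_ a v 0) + _ _; rewrite !addr0 sdiff0 addr0. Qed.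

Lemma sdiffD u v : L (u + v) = L u + L v.
Proof. by case: (fL) => /(_ 1 u v) + _ _; rewrite !scale1r. Qed.

Lemma sdiffN v : L (- v) = - L v.
Proof. by rewrite -scaleN1r sdiffZ scaleN1r. Qed.

Lemma sdiffB u v : L (u - v) = L u - L v.
Proof. by rewrite sdiffD sdiffN. Qed.

Lemma sdiff_lip : exists2 C : R, 0 < C & exists2 r : R, 0 < r &
  forall x y, ball z r x -> ball z r y -> `|f x - f y| <= C * `|x - y|.
Proof.
case: (fL) => _ [C LC] /(_ 1 ltr01) [r r0 H].
exists (`|C| + 1); first by rewrite ltr_wpDl.
exists r => // x y xr yr.
rewrite -[f x - f y](subrK (L (x - y))).
rewrite (le_trans (ler_normD _ _)) // addrC mulrDl lerD //; last exact: H.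
by rewrite (le_trans (LC _)) // ler_wpM2r // ler_norm.
Qed.

Lemma sdiff_continuous : {for z, continuous f}.
Proof.
have [C C0 [r r0 H]] := sdiff_lip.
apply/cvgrPdist_lt => e e0.
have re0 : 0 < Num.min r (e / C) by rewrite lt_min r0 divr_gt0.
apply/nbhs_ballP; exists (Num.min r (e / C)) => //= y; rewrite -ball_normE /= lt_min => /andP[zr ze].
rewrite (le_lt_trans (H _ _ _ _)) -?ball_normE /= ?subrr ?normr0 //.
by rewrite mulrC -ltr_pdivlMr.
Qed.

Lemma sdiff_differentiable : differentiable f z /\ forall v, 'd f z v = L v.
Proof.
case: (fL) => lin [C LC] H.
pose Lm := GRing.isLinear.Build R V W *:%R L lin.
pose L' : {linear V -> W} := HB.pack L Lm.
have cL : continuous L'.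
  apply/linear_bounded_continuous; apply/linear_boundedP.
  exists (`|C| + 1); split; first by rewrite realE addr_ge0.
  move=> M CM v; rewrite (le_trans (LC v)) // ler_wpM2r //.
  by rewrite (le_trans (ler_norm _)) // (le_trans _ (ltW CM)) // lerDl.
have E : f \o shift z = cst (f z) + L' +o_0 id.
  apply/eqaddoP => e e0.
  have [r r0 Hr] := H _ e0.
  near=> h.
  have := Hr (h + z) z.
  rewrite addrK; set lhs := f _ - _ - _.
  have -> : (f \o shift z - (cst (f z) + L')) h = lhs.
    by rewrite /lhs /= !fctE /= opprD addrA.
  apply; last exact: ballxx.
  rewrite -ball_normE /= opprD addrA addrAC subrr add0r normrN.
  near: h; exact: nbhs0_lt.
have dE := diff_unique cL E.
split; last by move=> v; rewrite dE.
apply/diff_locallyP; rewrite dE; split => //.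
Unshelve. all: by end_near. Qed.

Lemma sdiff_derive v : derivable f z v /\ 'D_v f z = L v.
Proof.
have [df dE] := sdiff_differentiable.
by split; [exact: diff_derivable|rewrite deriveE].
Qed.

End Consequences.

Lemma sdiff_unique (V W : normedModType R) (f : V -> W) z L L' :
  sdiff f z L -> sdiff f z L' -> L = L'.
Proof.
move=> fL fL'; apply/funext => v.
by rewrite -(sdiff_derive fL v).2 -(sdiff_derive fL' v).2.
Qed.

Lemma sdiff_comp (U V W : normedModType R) (f : V -> W) (g : U -> V) z L M :
  sdiff g z M -> sdiff f (g z) L -> sdiff (f \o g) z (L \o M).
Proof.
move=> gM fL; have [K K0 [s s0 gK]] := sdiff_lip gM.
have cg := sdiff_continuous gM.
case: (gM) => Ml [C MC] gr; case: (fL) => Ll [D LD] fr; split.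
- by move=> a u v /=; rewrite Ml Ll.
- exists (`|D| * C) => v /=; rewrite (le_trans (LD _)) //.
  rewrite (@le_trans _ _ (`|D| * `|M v|)) //; first by rewrite ler_wpM2r ?ler_norm.
  by rewrite -mulrA ler_wpM2l.
- move=> e e0.
  have e1 : 0 < e / (K *+ 2) by rewrite divr_gt0 // mulrn_wgt0.
  have [r1 r10 H1] := fr _ e1.
  have e2 : 0 < e / ((`|D| + 1) *+ 2) by rewrite divr_gt0 // mulrn_wgt0 // ltr_wpDl.
  have [r2 r20 H2] := gr _ e2.
  have /cvgrPdist_lt/(_ _ r10)/nbhs_ballP[r3 /= r30 H3] := cg.
  exists (Num.min s (Num.min r2 r3)); first by rewrite !lt_min s0 r20.
  move=> x y; rewrite -!ball_normE /= !lt_min => /and3P[x1 x2 x3] /and3P[y1 y2 y3].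
  have -> : f (g x) - f (g y) - L (M (x - y)) =
      (f (g x) - f (g y) - L (g x - g y)) + L (g x - g y - M (x - y)).
    by rewrite (sdiffB fL (g x - g y)) addrA subrK.
  rewrite (le_trans (ler_normD _ _)) // [e]splitr mulrDl lerD //.
    rewrite (le_trans (H1 _ _ _ _)) -?ball_normE //=;
      [by apply: H3; rewrite -ball_normE|by apply: H3; rewrite -ball_normE|].
    rewrite (@le_trans _ _ (e / (K *+ 2) * (K * `|x - y|))) //.
      by apply: ler_wpM2l; [exact: ltW|apply: gK; rewrite -ball_normE].
    rewrite mulrA ler_wpM2r // -mulr_natr.
    by rewrite le_eqVlt; apply/orP; left; apply/eqP; field; rewrite gt_eqF.
  rewrite (le_trans (LD _)) // (@le_trans _ _ ((`|D| + 1) *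
     (e / ((`|D| + 1) *+ 2) * `|x - y|))) //.
    rewrite (@le_trans _ _ ((`|D| + 1) * `|g x - g y - M (x - y)|)) //.
      by rewrite ler_wpM2r // (le_trans (ler_norm _)) // lerDl.
    by rewrite ler_wpM2l //; apply: H2; rewrite -ball_normE.
  rewrite mulrA ler_wpM2r // -mulr_natr.
  have D0 : `|D| + 1 != 0 by rewrite gt_eqF // ltr_wpDl.
  by rewrite le_eqVlt; apply/orP; left; apply/eqP; field.
Qed.

Lemma sdiff_pair (U V W : normedModType R) (f : U -> V) (g : U -> W) z L M :
  sdiff f z L -> sdiff g z M ->
  sdiff (fun x => (f x, g x)) z (fun v => (L v, M v)).
Proof.
move=> [Ll [C LC] fr] [Ml [D MD] gr]; split.
- by move=> a u v; rewrite Ll Ml.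
- exists (Num.max C D) => v; rewrite prod_normE /= ge_max.
  rewrite (le_trans (LC v)) ?ler_wpM2r ?le_max ?lexx //=.
  by rewrite (le_trans (MD v)) ?ler_wpM2r ?le_max ?lexx ?orbT.
- move=> e e0; have [r r0 Hr] := fr _ e0; have [s s0 Hs] := gr _ e0.
  exists (Num.min r s); first by rewrite lt_min r0.
  move=> x y; rewrite -!ball_normE /= !lt_min => /andP[x1 x2] /andP[y1 y2].
  rewrite prod_normE /= ge_max; apply/andP; split.
    by apply: Hr; rewrite -ball_normE.
  by apply: Hs; rewrite -ball_normE.
Qed.

Lemma sdiff_linear (V W : normedModType R) (L : V -> W) z :
  (forall (a : R) u v, L (a *: u + v) = a *: L u + L v) ->
  (exists C : R, forall v, `|L v| <= C * `|v|) -> sdiff L z L.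
Proof.
move=> lin bd; split => // e e0; exists 1 => // x y _ _.
have -> : L (x - y) = L x - L y.
  by have := lin (-1) y x; rewrite !scaleN1r [- y + _]addrC [- L y + _]addrC.
by rewrite subrr normr0 mulr_ge0 // ltW.
Qed.

Lemma sdiff_fst (V W : normedModType R) (z : V * W) :
  sdiff (fun x : V * W => x.1) z (fun x => x.1).
Proof.
apply: sdiff_linear => //; exists 1 => v.
by rewrite mul1r prod_normE le_max lexx.
Qed.

Lemma sdiff_snd (V W : normedModType R) (z : V * W) :
  sdiff (fun x : V * W => x.2) z (fun x => x.2).
Proof.
apply: sdiff_linear => //; exists 1 => v.
by rewrite mul1r prod_normE le_max lexx orbT.
Qed.

Lemma sdiff_near (V W : normedModType R) (f g : V -> W) z L :
  {near z, f =1 g} -> sdiff f z L -> sdiff g z L.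
Proof.
move=> /nbhs_ballP[r /= r0 fg] [lin bd H]; split => // e e0.
have [s s0 Hs] := H _ e0.
exists (Num.min r s); first by rewrite lt_min r0.
move=> x y; rewrite -!ball_normE /= !lt_min => /andP[x1 x2] /andP[y1 y2].
have bx : ball z r x by rewrite -ball_normE.
have b_y : ball z r y by rewrite -ball_normE.
by rewrite -(fg _ bx) -(fg _ b_y); apply: Hs; rewrite -ball_normE.
Qed.

End StrictDifferential.

Section LineDerivative.
Context (R : realType) (V W : normedModType R).

Lemma is_derive_line (f : V -> W) (y e : V) (t : R) :
  derivable f (y + t *: e) e ->
  is_derive t 1 (fun s : R => f (y + s *: e)) ('D_e f (y + t *: e)).
Proof.
move=> df.
have E : (fun h : R => h^-1 *: (((fun s : R => f (y + s *: e)) \o shift t) (h *: 1)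
      - f (y + t *: e))) =
    (fun h => h^-1 *: ((f \o shift (y + t *: e)) (h *: e) - f (y + t *: e))).
  apply/funext => h /=; congr (_ *: (f _ - _)).
  have -> : h *: (1 : R) = h by exact: mulr1.
  by rewrite scalerDl addrCA.
by split; rewrite /derivable ?/derive E.
Qed.

End LineDerivative.

Section C1.
Context (R : realType) (V : normedModType R).

(** The mean value theorem along a segment of direction [e]. *)
Lemma line_increment (f : V -> R) (y e : V) (c D eps : R) :
  (forall t : R, `|t| <= `|c| -> derivable f (y + t *: e) e /\
     `|'D_e f (y + t *: e) - D| <= eps) ->
  `|f (y + c *: e) - f y - c * D| <= eps * `|c|.
Proof.
move=> H.
pose g := fun s : R => f (y + s *: e).
pose dg := fun s : R => 'D_e f (y + s *: e).
have dH (t : R) : `|t| <= `|c| -> is_derive t 1 g (dg t).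
  by move=> /H[dt _]; exact: is_derive_line.
have g0 : g 0 = f y by rewrite /g scale0r addr0.
have key : exists2 t, `|t| <= `|c| & g c - g 0 = dg t * c.
  have [c0|c0] := leP 0 c.
    have [] := @MVT_segment _ g dg 0 c c0.
    - move=> x; rewrite in_itv /= => /andP[x0 xc]; apply: dH.
      by rewrite !ger0_norm // ltW.
    - apply: derivable_within_continuous => x; rewrite in_itv /= => /andP[x0 xc].
      by have [] := dH x; rewrite // !ger0_norm.
    - move=> t; rewrite in_itv /= subr0 => /andP[t0 tc] ->; exists t => //.
      by rewrite !ger0_norm.
  have [] := @MVT_segment _ g dg c 0 (ltW c0).
  - move=> x; rewrite in_itv /= => /andP[x0 xc]; apply: dH.
    by rewrite !ltr0_norm // lerN2 ltW.
  - apply: derivable_within_continuous => x; rewrite in_itv /= => /andP[x0 xc].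
    by have [] := dH x; rewrite // !ler0_norm // ?lerN2 // ltW.
  - move=> t; rewrite in_itv /= sub0r => /andP[t0 tc] E; exists t.
      by rewrite !ler0_norm // ?lerN2 // ltW.
    by rewrite -opprB E mulrN opprK.
have [t tc E] := key.
rewrite -g0 -/(g c) E mulrC -mulrBr normrM mulrC ler_wpM2r //.
by have [] := H _ tc.
Qed.

Lemma Ck_cont (W : normedModType R) k (A : set V) (f : V -> W) z :
  Ck k A f -> A z -> {for z, continuous f}.
Proof. by case: k => [|k] [cf _] Az; apply: cf; rewrite inE. Qed.

Lemma Ck_derivable (W : normedModType R) k (A : set V) (f : V -> W) z v :
  Ck k.+1 A f -> A z -> derivable f z v.
Proof. by move=> [_ /(_ v)[df _]] Az; exact: df. Qed.

Lemma Ck_derive (W : normedModType R) k (A : set V) (f : V -> W) v :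
  Ck k.+1 A f -> Ck k A (fun z => 'D_v f z).
Proof. by move=> [_ /(_ v)[]]. Qed.

Lemma C1_sdiff (A : set V) (f : V -> R) z : fin_dim V ->
  open A -> Ck 1 A f -> A z -> sdiff f z (fun v => 'D_v f z).
Proof.
move=> [d [e [x [xl xe xn]]]] oA cf Az.
pose N := \sum_i `|e i|.
have N0 : 0 <= N by rewrite sumr_ge0.
have eN i : `|e i| <= N by rewrite /N (bigD1 i) //= lerDl sumr_ge0.
have key (s : seq 'I_d) : forall eps : R, 0 < eps -> exists2 r : R, 0 < r &
    forall y, ball z r y -> forall c : 'I_d -> R, (forall i, `|c i| < r) ->
    `|f (y + \sum_(i <- s) c i *: e i) - f y - \sum_(i <- s) c i * 'D_(e i) f z|
      <= eps * \sum_(i <- s) `|c i|.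
  elim: s => [|i s IH] eps eps0.
    exists 1 => // y _ c _; rewrite !big_nil addr0 subrr subr0 normr0 mulr0 //.
  have [r r0 Hr] := IH _ eps0.
  have /cvgrPdist_lt/(_ _ eps0)/nbhs_ballP[q /= q0 Hq] :=
    Ck_cont (Ck_derive (e i) cf) Az.
  have /nbhs_ballP[a /= a0 Ha] : nbhs z A by exact: open_nbhs_nbhs.
  pose r1 := Num.min r (Num.min q a).
  have r10 : 0 < r1 by rewrite !lt_min r0 q0.
  pose r' := r1 / (N + 2).
  have N2 : 0 < N + 2 by rewrite ltr_wpDl.
  have r'0 : 0 < r' by rewrite divr_gt0.
  have r'1 : r' <= r1 by rewrite ler_pdivrMr // ler_peMr ?ltW //; lra.
  have mov y t : ball z r' y -> `|t| <= r' -> ball z r1 (y + t *: e i).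
    rewrite -!ball_normE /= => zy tr.
    rewrite opprD addrA (le_lt_trans (ler_normB _ _)) // normrZ.
    rewrite (@lt_le_trans _ _ (r' + r' * N)) ?ltr_leD ?ler_pM //.
    have -> : r1 = r' * (N + 2) by rewrite divfK // gt_eqF.
    by rewrite -[X in X + _ <= _]mulr1 -mulrDr ler_wpM2l ?ltW //; lra.
  exists r' => // y zy c cr; rewrite !big_cons.
  have zy' : ball z r (y + c i *: e i).
    have := mov y (c i) zy (ltW (cr i)); apply: le_ball.
    by rewrite /r1 ge_min lexx.
  have cr' j : `|c j| < r.
    by rewrite (lt_le_trans (cr j)) // (le_trans r'1) // /r1 ge_min lexx.
  have H1 := Hr _ zy' _ cr'.
  have H2 : `|f (y + c i *: e i) - f y - c i * 'D_(e i) f z| <= eps * `|c i|.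
    apply: line_increment => t tc.
    have tr : `|t| <= r' by rewrite (le_trans tc) // ltW.
    have b1 := mov y t zy tr; split.
      have Ay : A (y + t *: e i).
        by apply: Ha; apply: le_ball b1; rewrite /r1 !ge_min lexx !orbT.
      exact: (Ck_derivable cf Ay).
    rewrite distrC ltW //; apply: Hq; rewrite /=.
    by apply: le_ball b1; rewrite /r1 !ge_min lexx !orbT.
  rewrite addrA mulrDr.
  set S := \sum_(j <- s) _ in H1 *.
  set S' := \sum_(j <- s) c j * _ in H1 *.
  set S'' := \sum_(j <- s) `|c j| in H1 *.
  have -> : f (y + c i *: e i + S) - f y - (c i * 'D_(e i) f z + S') =
     (f (y + c i *: e i) - f y - c i * 'D_(e i) f z) +
     (f (y + c i *: e i + S) - f (y + c i *: e i) - S') by lra.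
  by rewrite (le_trans (ler_normD _ _)) // lerD.
pose L v := \sum_i x i v * 'D_(e i) f z.
have sL : sdiff f z L.
  split.
  - move=> a u v; rewrite /L scaler_sumr -big_split /=.
    by apply: eq_bigr => i _; rewrite xl mulrDl -mulrA.
  - exists (\sum_i `|'D_(e i) f z|) => v.
    rewrite (le_trans (ler_norm_sum _ _ _)) // mulr_suml ler_sum // => i _.
    by rewrite normrM mulrC ler_wpM2l.
  - move=> eps eps0.
    have d0 : 0 < d.+1%:R :> R by rewrite ltr0n.
    have [r r0 Hr] := key (index_enum 'I_d) (eps / d.+1%:R) (divr_gt0 eps0 d0).
    exists (r / 2); first by rewrite divr_gt0.
    move=> u y; rewrite -!ball_normE /= => zu zy.
    have uy : `|u - y| < r.
      have -> : u - y = (z - y) - (z - u) by rewrite opprB [RHS]addrC addrA subrK.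
      by rewrite (le_lt_trans (ler_normB _ _)) // [r]splitr ltrD.
    have := Hr y _ (fun i => x i (u - y)) _.
    rewrite -xe addrCA subrr addr0 => H.
    have zry : ball z r y.
      by rewrite -ball_normE /=; rewrite (lt_le_trans zy) // ler_pdivrMr //; lra.
    have xr i : `|x i (u - y)| < r by rewrite (le_lt_trans (xn _ _)).
    apply: (le_trans (H zry xr)); rewrite -mulrA; apply: ler_wpM2l; first exact: ltW.
    rewrite ler_pdivrMl //.
    rewrite (@le_trans _ _ (\sum_(i < d) `|u - y|)) ?ler_sum // sumr_const.
    by rewrite card_ord -[leLHS]mulr_natl ler_wpM2r // ler_nat.
have -> // : (fun v => 'D_v f z) = L.
by apply/funext => v; rewrite (sdiff_derive sL v).2.
Qed.

End C1.

(** * The algebra of C^k functions *)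

Section CkAlgebra.
Context (R : realType) (V : normedModType R).
Implicit Types (A B : set V) (k : nat).

Lemma Ck_ext (W : normedModType R) k A (f g : V -> W) :
  open A -> (forall z, A z -> f z = g z) -> Ck k A f -> Ck k A g.
Proof.
move=> oA; elim: k f g => [|k IH] f g fg [cf df].
  split => // z; rewrite inE => Az.
  have ne : {near z, f =1 g} by near=> y; apply: fg; near: y; exact: open_nbhs_nbhs.
  rewrite /prop_for /continuous_at -(fg z Az).
  by apply: cvg_trans (cf z _); [exact: near_eq_cvg|rewrite inE].
have ne z : A z -> {near z, f =1 g}.
  by move=> Az; near=> y; apply: fg; near: y; exact: open_nbhs_nbhs.
split.
  have := IH f g fg; case: (k) => [|k'] IH'.
    by have [] := IH' (conj cf I).
  move=> z; rewrite inE => Az.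
  rewrite /prop_for /continuous_at -(fg z Az).
  by apply: cvg_trans (cf z _); [exact/near_eq_cvg/ne|rewrite inE].
move=> v; have [dv ck] := df v; split.
  by move=> z Az; apply: near_eq_derivable (dv z Az); exact: ne.
apply: IH ck => z Az; apply: near_eq_derive; exact: ne.
Unshelve. all: by end_near. Qed.

Lemma Ck_sub (W : normedModType R) k A B (f : V -> W) :
  A `<=` B -> Ck k B f -> Ck k A f.
Proof.
move=> AB; elim: k f => [|k IH] f [cf df].
  by split => // z; rewrite inE => /AB Bz; apply: cf; rewrite inE.
split; first by move=> z; rewrite inE => /AB Bz; apply: cf; rewrite inE.
move=> v; have [dv ck] := df v; split; last exact: IH.
by move=> z /AB; exact: dv.
Qed.

Lemma CkS (W : normedModType R) k A (f : V -> W) : Ck k.+1 A f -> Ck k A f.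
Proof.
elim: k f => [|k IH] f [cf df]; first by split.
by split => // v; have [dv ck] := df v; split => //; exact: IH.
Qed.

Lemma Ck_le (W : normedModType R) j k A (f : V -> W) :
  (j <= k)%N -> Ck k A f -> Ck j A f.
Proof.
by move/subnK <-; elim: (k - j)%N => [//|m IH] /CkS; exact: IH.
Qed.

Lemma Ck_cst (W : normedModType R) k A (c : W) : Ck k A (fun=> c).
Proof.
elim: k c => [|k IH] c; first by split => // z _; exact: cst_continuous.
split; first by move=> z _; exact: cst_continuous.
move=> v; split; first by move=> z _; exact: derivable_cst.
have -> : 'D_v (fun=> c) = (fun=> 0) :> (V -> W).
  by apply/funext => z; exact: derive_cst.
exact: IH.
Qed.

Lemma CkD (W : normedModType R) k A (f g : V -> W) : open A ->
  Ck k A f -> Ck k A g -> Ck k A (fun z => f z + g z).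
Proof.
move=> oA; elim: k f g => [|k IH] f g [cf df] [cg dg].
  by split => // z Az; apply: cvgD; [exact: cf|exact: cg].
split; first by move=> z Az; apply: cvgD; [exact: cf|exact: cg].
move=> v; have [fv ckf] := df v; have [gv ckg] := dg v; split.
  by move=> z Az; apply: derivableD; [exact: fv|exact: gv].
apply: (Ck_ext oA) (IH _ _ ckf ckg) => z Az /=.
by rewrite deriveD; [|exact: fv|exact: gv].
Qed.

Lemma CkM k A (f g : V -> R) : open A ->
  Ck k A f -> Ck k A g -> Ck k A (fun z => f z * g z).
Proof.
move=> oA; elim: k f g => [|k IH] f g cf cg.
  case: cf cg => cf _ [cg _].
  by split => // z Az; apply: cvgM; [exact: cf|exact: cg].
have [cf0 df] := cf; have [cg0 dg] := cg.
split; first by move=> z Az; apply: cvgM; [exact: cf0|exact: cg0].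
move=> v; have [fv ckf] := df v; have [gv ckg] := dg v; split.
  by move=> z Az; apply: derivableM; [exact: fv|exact: gv].
apply: (Ck_ext oA) (CkD oA (IH _ _ (CkS cf) ckg) (IH _ _ (CkS cg) ckf)) => z Az /=.
by rewrite (deriveM (fv z Az) (gv z Az)).
Qed.

Lemma Ck_sum (I : Type) (r : seq I) k A (f : I -> V -> R) : open A ->
  (forall i, Ck k A (f i)) -> Ck k A (fun z => \sum_(i <- r) f i z).
Proof.
move=> oA H; elim: r => [|i r IH].
  apply: (Ck_ext oA) (Ck_cst k A (0 : R)) => z _; by rewrite big_nil.
apply: (Ck_ext oA) (CkD oA (H i) IH) => z _; by rewrite big_cons.
Qed.

Lemma CkN k A (f : V -> R) : open A -> Ck k A f -> Ck k A (fun z => - f z).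
Proof.
move=> oA cf; apply: (Ck_ext oA) (CkM oA (Ck_cst k A (-1 : R)) cf) => z _.
by rewrite mulN1r.
Qed.

(** Directional derivatives are derivatives of functions of one variable. *)
Lemma is_derive_lineP (W : normedModType R) (f : V -> W) (z v : V) (D : W) :
  is_derive z v f D <-> is_derive (0 : R) 1 (fun s : R => f (z + s *: v)) D.
Proof.
have E : (fun h : R => h^-1 *: (((fun s : R => f (z + s *: v)) \o shift 0) (h *: 1)
      - f (z + (0 : R) *: v))) =
    (fun h => h^-1 *: ((f \o shift z) (h *: v) - f z)).
  apply/funext => h /=; rewrite scale0r !addr0; congr (_ *: (f _ - _)).
  have -> : h *: (1 : R) = h by exact: mulr1.
  by rewrite addrC.
split=> -[df dE].
  by split; rewrite /derivable ?/derive E.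
by split; move: df dE; rewrite /derivable /derive E.
Qed.

Lemma is_derive_comp1 (g : R -> R) (f : V -> R) (z v : V) (a b : R) :
  is_derive z v f a -> is_derive (f z) 1 g b ->
  is_derive z v (fun x => g (f x)) (b * a).
Proof.
move=> /is_derive_lineP fa gb; apply/is_derive_lineP.
apply: (@is_derive1_comp _ g (fun s : R => f (z + s *: v))) => //.
by rewrite scale0r addr0.
Qed.

Lemma Ck_powR k A (f : V -> R) (a : R) : open A -> (forall z, A z -> 0 < f z) ->
  Ck k A f -> Ck k A (fun z => f z `^ a).
Proof.
move=> oA f0; elim: k a => [|k IH] a cf.
  split => // z; rewrite inE => Az.
  have cz := Ck_cont cf Az.
  apply: (@continuous_comp _ _ _ f (fun x : R => x `^ a)) => //.
  apply/differentiable_continuous/derivable1_diffP.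
  by have [] := is_derive1_powR a (f0 z Az).
have dfa z v : A z -> is_derive z v (fun x => f x `^ a)
    (a * f z `^ (a - 1) * 'D_v f z).
  move=> Az; apply: (is_derive_comp1 (g := fun x : R => x `^ a)).
    exact/derivableP/(Ck_derivable cf Az).
  exact: is_derive1_powR (f0 z Az).
split.
  move=> z; rewrite inE => Az.
  apply: (@continuous_comp _ _ _ f (fun x : R => x `^ a)).
    exact: Ck_cont cf Az.
  apply/differentiable_continuous/derivable1_diffP.
  by have [] := is_derive1_powR a (f0 z Az).
move=> v; split; first by move=> z Az; have [] := dfa z v Az.
have ck := CkM oA (CkM oA (Ck_cst k A a) (IH (a - 1) (CkS cf))) (Ck_derive v cf).
by apply: (Ck_ext oA) ck => z Az; have [_ ->] := dfa z v Az.
Qed.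

Lemma Ck_linear (W W' : normedModType R) k A (L : W -> W') (f : V -> W) :
  (forall (a : R) u v, L (a *: u + v) = a *: L u + L v) ->
  (exists C : R, forall v, `|L v| <= C * `|v|) -> open A ->
  Ck k A f -> Ck k A (fun z => L (f z)) /\
  (0 < k -> forall z v, A z -> 'D_v (fun z => L (f z)) z = L ('D_v f z))%N.
Proof.
move=> lin bd oA.
have sL z := sdiff_linear z lin bd.
have cL z : {for z, continuous L} by exact: sdiff_continuous (sL z).
have dL (g : V -> W) z v : derivable g z v ->
    is_derive z v (fun z => L (g z)) (L ('D_v g z)).
  move=> dg; have E : (fun h : R => h^-1 *: (((fun z => L (g z)) \o shift z) (h *: v)
      - L (g z))) = L \o (fun h => h^-1 *: ((g \o shift z) (h *: v) - g z)).
    by apply/funext => h /=; rewrite (sdiffZ (sL (g z))) (sdiffB (sL (g z))).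
  have lim_ : (fun h : R => h^-1 *: (((fun z => L (g z)) \o shift z) (h *: v)
      - L (g z))) @ 0^' --> L ('D_v g z).
    by rewrite E; apply: continuous_cvg; [exact: cL|exact: dg].
  by split; [apply/cvg_ex; eexists; exact: lim_|exact: cvg_lim lim_].
elim: k f => [|k IH] f cf.
  split=> //; split => // z; rewrite inE => Az.
  by apply: (@continuous_comp _ _ _ f L); [exact: Ck_cont cf Az|exact: cL].
have DE z v : A z -> 'D_v (fun z => L (f z)) z = L ('D_v f z).
  by move=> Az; have [_ ->] := dL f z v (Ck_derivable cf Az).
split=> [|_ //]; split.
  move=> z; rewrite inE => Az.
  by apply: (@continuous_comp _ _ _ f L); [exact: Ck_cont cf Az|exact: cL].
move=> v; split.
  by move=> z Az; have [] := dL f z v (Ck_derivable cf Az).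
by apply: (Ck_ext oA) (IH _ (Ck_derive v cf)).1 => z Az; rewrite DE.
Qed.

Lemma Ck_fst (W W' : normedModType R) k A (f : V -> W * W') : open A ->
  Ck k A f -> Ck k A (fun z => (f z).1) /\
  (0 < k -> forall z v, A z -> 'D_v (fun z => (f z).1) z = ('D_v f z).1)%N.
Proof.
move=> oA cf; apply: (Ck_linear (L := fun x : W * W' => x.1)) => //.
by exists 1 => v; rewrite mul1r prod_normE le_max lexx.
Qed.

Lemma Ck_snd (W W' : normedModType R) k A (f : V -> W * W') : open A ->
  Ck k A f -> Ck k A (fun z => (f z).2) /\
  (0 < k -> forall z v, A z -> 'D_v (fun z => (f z).2) z = ('D_v f z).2)%N.
Proof.
move=> oA cf; apply: (Ck_linear (L := fun x : W * W' => x.2)) => //.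
by exists 1 => v; rewrite mul1r prod_normE le_max lexx orbT.
Qed.

End CkAlgebra.

Section C1Vector.
Context (R : realType).

(** Spaces in which C^1 maps take values strictly differentiably. *)
Definition C1_strict (W : normedModType R) :=
  forall (V : normedModType R) (A : set V) (f : V -> W) z,
    fin_dim V -> open A -> Ck 1 A f -> A z -> sdiff f z (fun v => 'D_v f z).

Lemma C1_strict_real : C1_strict R.
Proof. by move=> V A f z; exact: C1_sdiff. Qed.

Lemma C1_strict_prod (W W' : normedModType R) :
  C1_strict W -> C1_strict W' -> C1_strict (W * W')%type.
Proof.
move=> HW HW' V A f z fV oA cf Az.
have [c1 d1] := Ck_fst oA cf; have [c2 d2] := Ck_snd oA cf.
have s := sdiff_pair (HW _ _ _ _ fV oA c1 Az) (HW' _ _ _ _ fV oA c2 Az).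
have Ef : (fun x => ((f x).1, (f x).2)) = f by apply/funext => x; case: (f x).
rewrite Ef in s.
by rewrite (_ : (fun v => 'D_v f z) = (fun v => ('D_v (fun z => (f z).1) z,
  'D_v (fun z => (f z).2) z))) //; apply/funext => v; rewrite d1 // d2 //; case: ('D_v f z).
Qed.

End C1Vector.

Section CkComposition.
Context (R : realType) (V W : normedModType R).

Lemma Ck_comp k (A : set V) (B : set W) (f : W -> R) (g : V -> W) :
  fin_dim V -> fin_dim W -> C1_strict W -> open A -> open B ->
  (forall z, A z -> B (g z)) -> Ck k A g -> Ck k B f ->
  Ck k A (fun z => f (g z)) /\
  (0 < k -> forall z v, A z ->
    'D_v (fun z => f (g z)) z = 'D_('D_v g z) f (g z))%N.
Proof.
move=> fV fW sW oA oB AB.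
have [d [e [x [xl xe xn]]]] := fW.
have cont (h : W -> R) j i : Ck i A g -> Ck j B h ->
    {in A, continuous (fun z => h (g z))}.
  move=> cg ch z; rewrite inE => Az.
  apply: (@continuous_comp _ _ _ g h); first exact: Ck_cont cg Az.
  exact: Ck_cont ch (AB z Az).
have DE (h : W -> R) z v : Ck 1 A g -> Ck 1 B h -> A z ->
    is_derive z v (fun z => h (g z)) ('D_('D_v g z) h (g z)).
  move=> cg ch Az.
  have sg := sW _ _ _ _ fV oA cg Az.
  have sh := C1_sdiff fW oB ch (AB z Az).
  have [d1 d2] := sdiff_derive (sdiff_comp sg sh) v.
  by split.
have Dsum (h : W -> R) y v : Ck 1 B h -> B y ->
    'D_v h y = \sum_i x i v * 'D_(e i) h y.
  move=> ch By; have sh := C1_sdiff fW oB ch By.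
  have HH (r : seq 'I_d) (c : 'I_d -> R) :
    'D_(\sum_(i <- r) c i *: e i) h y = \sum_(i <- r) c i * 'D_(e i) h y.
    elim: r => [|i r IH]; first by rewrite !big_nil (sdiff0 sh).
    by rewrite !big_cons (sdiffD sh) (sdiffZ sh) IH.
  by rewrite {1}(xe v) HH.
move=> cg; elim: k f cg => [|k IH] f cg cf.
  by split => //; split => //; exact: (cont _ 0%N 0%N).
have cg1 : Ck 1 A g by apply: Ck_le cg.
have cf1 : Ck 1 B f by apply: Ck_le cf.
split; last by move=> _ z v Az; have [_ ->] := DE f z v cg1 cf1 Az.
split; first exact: (cont _ k.+1 k.+1).
move=> v; split.
  by move=> z Az; have [] := DE f z v cg1 cf1 Az.
have cx i : Ck k A (fun z => x i ('D_v g z)).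
  apply: (Ck_linear (L := x i) _ _ oA (Ck_derive v cg)).1.
    by move=> a u w; rewrite xl.
  by exists 1 => w; rewrite mul1r.
have ck := Ck_sum (index_enum 'I_d) oA
  (fun i => CkM oA (cx i) (IH _ (CkS cg) (Ck_derive (e i) cf)).1).
apply: (Ck_ext oA) ck => z Az /=.
by have [_ ->] := DE f z v cg1 cf1 Az; rewrite (Dsum f _ _ cf1 (AB z Az)).
Qed.

End CkComposition.

Section Schwarz.
Context (R : realType) (V : normedModType R).

(** Symmetry of second derivatives: the second difference quotient over a small
    parallelogram is, by the mean value theorem applied twice, a value of
    either mixed derivative near the point. *)
Lemma Schwarz (A : set V) (f : V -> R) z v w : open A -> Ck 2 A f -> A z ->
  'D_v (fun x => 'D_w f x) z = 'D_w (fun x => 'D_v f x) z.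
Proof.
move=> oA cf Az.
have half (a b : V) (eps : R) : 0 < eps -> exists2 r : R, 0 < r & forall s : R, 0 < s -> s < r ->
    `|f (z + s *: a + s *: b) - f (z + s *: a) - (f (z + s *: b) - f z)
      - s * (s * 'D_b (fun x => 'D_a f x) z)| <= eps * s * s.
  move=> e0.
  have /cvgrPdist_lt/(_ _ e0)/nbhs_ballP[q /= q0 Hq] :=
    Ck_cont (Ck_derive b (Ck_derive a cf)) Az.
  have /nbhs_ballP[p /= p0 Hp] : nbhs z A by exact: open_nbhs_nbhs.
  pose N := `|a| + `|b| + 1.
  have N0 : 0 < N by rewrite ltr_wpDl // addr_ge0.
  exists (Num.min q p / N); first by rewrite divr_gt0 // lt_min q0.
  move=> s s0; rewrite ltr_pdivlMr // lt_min => /andP[sq sp].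
  have mov (t u : R) : `|t| <= s -> `|u| <= s -> `|t *: a + u *: b| < s * N.
    move=> ts us; rewrite (le_lt_trans (ler_normD _ _)) // !normrZ.
    have h1 : `|t| * `|a| <= s * `|a| by rewrite ler_wpM2r.
    have h2 : `|u| * `|b| <= s * `|b| by rewrite ler_wpM2r.
    by rewrite /N !mulrDr mulr1; lra.
  have inA (t u : R) : `|t| <= s -> `|u| <= s -> A (z + t *: a + u *: b).
    move=> ts us; apply: Hp; rewrite -ball_normE /= -addrA opprD addrA subrr sub0r.
    by rewrite normrN (lt_trans (mov _ _ ts us)).
  pose g (y : V) := f (y + s *: b) - f y.
  have ss : `|s| <= s by rewrite gtr0_norm.
  have s00 : `|0 : R| <= s by rewrite normr0 ltW.
  have inA0 (t : R) : `|t| <= s -> A (z + t *: a).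
    by move=> ts; have := inA _ _ ts s00; rewrite scale0r addr0.
  pose D := 'D_b (fun x => 'D_a f x) z.
  have gd (t : R) : `|t| <= s -> is_derive (z + t *: a) a g
      ('D_a f (z + t *: a + s *: b) - 'D_a f (z + t *: a)).
    move=> ts; apply: is_deriveB; last first.
      by apply: derivableP; exact: Ck_derivable cf (inA0 _ ts).
    apply/is_derive_lineP.
    rewrite (_ : (fun s0 : R => _) = fun u : R => f (z + t *: a + s *: b + u *: a)).
      by apply/(is_derive_lineP f _ a); apply: derivableP; exact: Ck_derivable cf (inA _ _ ts ss).
    by apply/funext => u; rewrite addrAC.
  have := @line_increment _ _ g z a s (s * D) (eps * s).
  rewrite (gtr0_norm s0) /g; apply => t ts.
  have [dg ->] := gd t ts; split => //.
  have := @line_increment _ _ (fun x => 'D_a f x) (z + t *: a) b s D eps.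
  rewrite (gtr0_norm s0); apply => u us; split.
    exact: Ck_derivable (Ck_derive a cf) (inA _ _ ts us).
  rewrite distrC ltW //; apply: Hq; rewrite -ball_normE /= -addrA opprD addrA subrr.
  by rewrite sub0r normrN (lt_trans (mov _ _ ts us)).
have H : forall eps : R, 0 < eps ->
    `|'D_v (fun x => 'D_w f x) z - 'D_w (fun x => 'D_v f x) z| <= eps.
  move=> eps e0; have e2 : 0 < eps / 2 by rewrite divr_gt0.
  have [r r0 Hr] := half v w _ e2; have [q q0 Hq] := half w v _ e2.
  have m0 : 0 < Num.min r q by rewrite lt_min r0.
  pose s := Num.min r q / 2.
  have s0 : 0 < s by rewrite divr_gt0.
  have sm : s < Num.min r q by rewrite /s ltr_pdivrMr //; lra.
  move: (sm); rewrite lt_min => /andP[sr sq].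
  have := Hr s s0 sr; have := Hq s s0 sq.
  rewrite [z + s *: w + s *: v]addrAC.
  set P := f _; set Q := f (z + s *: w); set Q' := f (z + s *: v).
  set X := 'D_w _ z; set Y := 'D_v _ z; set F := f z => h1 h2.
  have ss0 : 0 < s * s by rewrite mulr_gt0.
  rewrite -(ler_pM2r ss0) -[X in _ * X <= _](gtr0_norm ss0) -normrM.
  have -> : (Y - X) * (s * s) =
    (P - Q' - (Q - F) - s * (s * X)) - (P - Q - (Q' - F) - s * (s * Y)) by ring.
  rewrite (le_trans (ler_normB _ _)) //.
  have : eps * (s * s) = eps / 2 * s * s + eps / 2 * s * s by field.
  move=> ->; exact: lerD h2 h1.
apply/eqP; rewrite -subr_eq0 -normr_le0; apply/ler_addgt0Pl => e e0.
by rewrite addr0 H.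
Qed.

End Schwarz.

(** * Complex directions and the Levi form *)

Section FiniteDimensionalSpaces.
Context (R : realType).

Lemma fin_dimC1 : fin_dim (C1 R).
Proof. by apply: fin_dim_prod; exact: fin_dim_real. Qed.

Lemma fin_dimC2 : fin_dim (C2 R).
Proof. by apply: fin_dim_prod; exact: fin_dimC1. Qed.

Lemma fin_dimC1R : fin_dim (C1 R * R)%type.
Proof. by apply: fin_dim_prod; [exact: fin_dimC1|exact: fin_dim_real]. Qed.

Lemma C1_strictC1 : C1_strict (C1 R).
Proof. by apply: C1_strict_prod; exact: C1_strict_real. Qed.

Lemma C1_strictC2 : C1_strict (C2 R).
Proof. by apply: C1_strict_prod; exact: C1_strictC1. Qed.

Lemma J1J1 (v : C1 R) : J1 (J1 v) = - v.
Proof. by case: v. Qed.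

Lemma J1_linear (a : R) (u v : C1 R) : J1 (a *: u + v) = a *: J1 u + J1 v.
Proof.
by case: u v => u1 u2 [v1 v2]; congr pair => /=; rewrite opprD -mulrN.
Qed.

Lemma J2J2 (v : C2 R) : J2 (J2 v) = - v.
Proof. by case: v => v w; rewrite /J2 /= !J1J1. Qed.

Lemma J2_linear (a : R) (u v : C2 R) : J2 (a *: u + v) = a *: J2 u + J2 v.
Proof. by case: u v => u1 u2 [v1 v2]; rewrite /J2 /= !J1_linear. Qed.

Lemma normC1 (v : C1 R) : `|v| = Num.max `|v.1| `|v.2|.
Proof. exact: prod_normE. Qed.

Lemma normC2 (v : C2 R) : `|v| = Num.max `|v.1| `|v.2|.
Proof. exact: prod_normE. Qed.

Lemma normJ1 (v : C1 R) : `|J1 v| = `|v|.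
Proof. by rewrite !normC1 /= normrN maxC. Qed.

Lemma J2_bounded : exists C : R, forall v : C2 R, `|J2 v| <= C * `|v|.
Proof. by exists 1 => v; rewrite mul1r !normC2 /= !normJ1. Qed.

Lemma J2Z (a : R) (u : C2 R) : J2 (a *: u) = a *: J2 u.
Proof. exact: (sdiffZ (sdiff_linear 0 J2_linear J2_bounded)). Qed.

Lemma J2D (u v : C2 R) : J2 (u + v) = J2 u + J2 v.
Proof. exact: (sdiffD (sdiff_linear 0 J2_linear J2_bounded)). Qed.

End FiniteDimensionalSpaces.

Section DirectionalDerivative.
Context (R : realType) (V : normedModType R).

(** Opaque, so that two iterated derivatives are compared through their properties
and never through the limits that define them. *)
Fact pd_spec : {p : (V -> R) -> V -> V -> R | forall f v z, 'D_v f z = p f v z}.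
Proof. by exists (fun f v z => 'D_v f z). Qed.

Definition pd : (V -> R) -> V -> V -> R := sval pd_spec.

Lemma pdE f v z : 'D_v f z = pd f v z.
Proof. exact: (svalP pd_spec). Qed.

Lemma pdE_fun f v : (fun z => 'D_v f z) = pd f v.
Proof. by apply/funext => z; rewrite pdE. Qed.

Lemma Ck_pd k (A : set V) f v : Ck k.+1 A f -> Ck k A (pd f v).
Proof. by move=> cf; rewrite -pdE_fun; exact: Ck_derive. Qed.

Lemma pd_near (f g : V -> R) v z : {near z, f =1 g} -> pd f v z = pd g v z.
Proof. by rewrite -!pdE; exact: near_eq_derive. Qed.

Lemma pd_is_derive k (A : set V) f v z : Ck k.+1 A f -> A z ->
  is_derive z v f (pd f v z).
Proof.
move=> cf Az; rewrite -pdE; apply: derivableP; exact: Ck_derivable cf Az.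
Qed.

Hypothesis fV : fin_dim V.
Variables (A : set V) (f : V -> R) (z : V).
Hypothesis (oA : open A) (Az : A z) (cf : Ck 1 A f).

Lemma pd_sdiff : sdiff f z (fun v => pd f v z).
Proof.
have -> : (fun v => pd f v z) = (fun v => 'D_v f z).
  by apply/funext => v; rewrite pdE.
exact: C1_sdiff fV oA cf Az.
Qed.

Lemma pdDv (u v : V) : pd f (u + v) z = pd f u z + pd f v z.
Proof. exact: (sdiffD pd_sdiff). Qed.

Lemma pdZv (a : R) (v : V) : pd f (a *: v) z = a * pd f v z.
Proof. exact: (sdiffZ pd_sdiff). Qed.

Lemma pdNv (v : V) : pd f (- v) z = - pd f v z.
Proof. exact: (sdiffN pd_sdiff). Qed.

End DirectionalDerivative.

Section LeviForm.
Context (R : realType) (V : normedModType R) (J : V -> V).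

(** The polarized Levi form, normalized as a real symmetric bilinear form. *)
Definition levi (f : V -> R) (z v w : V) : R :=
  pd (pd f w) v z + pd (pd f (J w)) (J v) z.

Hypothesis fV : fin_dim V.
Hypothesis Jlin : forall (a : R) u v, J (a *: u + v) = a *: J u + J v.
Hypothesis JJ : forall v, J (J v) = - v.
Variables (A : set V) (f : V -> R) (z : V).
Hypothesis (oA : open A) (Az : A z) (cf : Ck 2 A f).

Lemma pd2Dl u v w : pd (pd f w) (u + v) z = pd (pd f w) u z + pd (pd f w) v z.
Proof. exact: (pdDv fV oA Az (Ck_pd w cf)). Qed.

Lemma pd2Zl a v w : pd (pd f w) (a *: v) z = a * pd (pd f w) v z.
Proof. exact: (pdZv fV oA Az (Ck_pd w cf)). Qed.

Lemma pd2C v w : pd (pd f w) v z = pd (pd f v) w z.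
Proof. by rewrite -!pdE -!pdE_fun; exact: Schwarz oA cf Az. Qed.

Let J0 : J 0 = 0.
Proof. by apply: (addrI (J 0)); rewrite addr0 -{1}[J 0]scale1r -Jlin scale1r addr0. Qed.

Let JZ a v : J (a *: v) = a *: J v.
Proof. by rewrite -[a *: v]addr0 Jlin J0 addr0. Qed.

Let JD u v : J (u + v) = J u + J v.
Proof. by rewrite -[u]scale1r Jlin !scale1r. Qed.

Lemma leviC v w : levi f z v w = levi f z w v.
Proof. by rewrite /levi pd2C [X in _ + X]pd2C. Qed.

Lemma leviDl u v w : levi f z (u + v) w = levi f z u w + levi f z v w.
Proof. by rewrite /levi JD !pd2Dl addrACA. Qed.

Lemma leviZl a v w : levi f z (a *: v) w = a * levi f z v w.
Proof. by rewrite /levi JZ !pd2Zl mulrDr. Qed.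

Lemma leviDr u v w : levi f z w (u + v) = levi f z w u + levi f z w v.
Proof. by rewrite leviC leviDl ![levi f z _ w]leviC. Qed.

Lemma leviZr a v w : levi f z w (a *: v) = a * levi f z w v.
Proof. by rewrite leviC leviZl [levi f z _ w]leviC. Qed.

Lemma pd2NN v w : pd (pd f (- w)) (- v) z = pd (pd f w) v z.
Proof.
rewrite -[- v]scaleN1r -[- w]scaleN1r pd2Zl pd2C pd2Zl pd2C.
by rewrite mulrA mulrNN mulr1 mul1r.
Qed.

Lemma leviJJ v w : levi f z (J v) (J w) = levi f z v w.
Proof. by rewrite /levi !JJ pd2NN addrC. Qed.

Lemma leviJl v w : levi f z (J v) w = - levi f z v (J w).
Proof. by rewrite -leviJJ JJ -scaleN1r leviZl mulN1r. Qed.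

Lemma leviJr v : levi f z v (J v) = 0.
Proof. by have := leviJl v v; rewrite leviC => H; lra. Qed.

Lemma levi_expand a b x y s t :
  levi f z (x *: a + y *: J a + (s *: b + t *: J b))
           (x *: a + y *: J a + (s *: b + t *: J b)) =
  (x ^+ 2 + y ^+ 2) * levi f z a a + (s ^+ 2 + t ^+ 2) * levi f z b b +
  ((x * s + y * t) * levi f z a b + (x * t - y * s) * levi f z a (J b)) *+ 2.
Proof.
rewrite !leviDl !leviDr !leviZl !leviZr.
rewrite !leviJJ !(leviC b a) !(leviC b (J a)) !(leviC (J b) a) !leviJl !leviJr.
by ring.
Qed.

End LeviForm.

Section Wirtinger2.
Context (R : realType) (V : normedModType R) (J : V -> V).
Local Open Scope complex_scope.
Hypothesis fV : fin_dim V.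
Variables (A : set V) (u : V -> R) (z : V).
Hypothesis (oA : open A) (Az : A z) (cu : Ck 2 A u).

Let half (a b c d : R) :
  ((a +i* b) + 'i * (c +i* d)) / 2%:R = ((a - d) / 2) +i* ((b + c) / 2).
Proof.
have -> : (2%:R : R[i]) = (2%:R : R)%:C by rewrite rmorph_nat.
rewrite -fmorphV /=; simpc.
by [].
Qed.

Lemma ddbarE e e' : ddbar J e e' u z =
  (levi J u z e e' / 4) +i*
  ((pd (pd u (J e')) e z - pd (pd u e') (J e) z) / 4).
Proof.
rewrite /ddbar /d_dz.
have E : d_dzbar J e' (fun x => (u x)%:C) =
    fun x => (pd u e' x / 2) +i* (pd u (J e') x / 2).
  apply/funext => x; rewrite /d_dzbar /cderive /= !derive_cst half.
  by rewrite subr0 add0r -[fun x0 => u x0]/u !pdE.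
rewrite E /cderive /=.
have d2 v w : 'D_v (fun x => pd u w x / 2) z = pd (pd u w) v z / 2.
  by rewrite deriveMr; [rewrite pdE mulrC|exact: Ck_derivable (Ck_pd w cu) Az].
rewrite !d2 -mulrN -[- (_ +i* _)]/(_ +i* _) half /levi.
by congr Complex; field.
Qed.

End Wirtinger2.

Section ComplexHessian.
Context (R : realType).
Local Open Scope complex_scope.
Variables (A : set (C2 R)) (u : C2 R -> R) (z : C2 R).
Hypothesis (oA : open A) (Az : A z) (cu : Ck 2 A u).

Lemma C2_basis (x y s t : R) :
  x *: e2 R ord0 + y *: J2 (e2 R ord0) +
  (s *: e2 R (lift ord0 ord0) + t *: J2 (e2 R (lift ord0 ord0))) = ((x, y), (s, t)).
Proof.
rewrite /e2 /J2 /J1 /=.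
transitivity (((x * 1 + y * - 0 + (s * 0 + t * - 0), x * 0 + y * 1 + (s * 0 + t * 0)),
     (x * 0 + y * - 0 + (s * 1 + t * - 0), x * 0 + y * 0 + (s * 0 + t * 1))) : C2 R).
  by [].
by congr (_, _, (_, _)); ring.
Qed.

Lemma pos_complex_hessianP : pos_complex_hessian u z <->
  forall w : C2 R, w != 0 -> 0 < levi (@J2 R) u z w w.
Proof.
pose row (w : C2 R) : 'rV[R[i]]_2 :=
  \row_j (if j == ord0 then w.1.1 +i* w.1.2 else w.2.1 +i* w.2.2).
pose L := levi (@J2 R) u z.
pose N v w := pd (pd u (J2 w)) v z - pd (pd u w) (J2 v) z.
have dE j k : ddbar (@J2 R) (e2 R j) (e2 R k) u z =
    (L (e2 R j) (e2 R k) / 4) +i* (N (e2 R j) (e2 R k) / 4).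
  by rewrite (ddbarE _ Az cu).
have NE v w : N v w = levi (@J2 R) u z v (J2 w).
  rewrite /levi J2J2 (pd2C oA Az cu (J2 v)) -scaleN1r.
  by rewrite (pd2Zl (fin_dimC2 R) oA Az cu) mulN1r (pd2C oA Az cu w).
have lE w : levi (@J2 R) u z w w = (w.1.1 ^+ 2 + w.1.2 ^+ 2) * L (e2 R ord0) (e2 R ord0)
   + (w.2.1 ^+ 2 + w.2.2 ^+ 2) * L (e2 R (lift ord0 ord0)) (e2 R (lift ord0 ord0))
   + ((w.1.1 * w.2.1 + w.1.2 * w.2.2) * L (e2 R ord0) (e2 R (lift ord0 ord0))
     + (w.1.1 * w.2.2 - w.1.2 * w.2.1) * N (e2 R ord0) (e2 R (lift ord0 ord0))) *+ 2.
  rewrite NE -(levi_expand (fin_dimC2 R) (@J2_linear R) (@J2J2 R) oA Az cu).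
  have -> // : w.1.1 *: e2 R ord0 + w.1.2 *: J2 (e2 R ord0) +
    (w.2.1 *: e2 R (lift ord0 ord0) + w.2.2 *: J2 (e2 R (lift ord0 ord0))) = w.
  by case: w => [[x y] [s t]]; exact: C2_basis.
have key w : \sum_(j < 2) \sum_(k < 2)
    ddbar (@J2 R) (e2 R j) (e2 R k) u z * row w 0 j * conjc (row w 0 k) =
    (levi (@J2 R) u z w w / 4)%:C.
  have sum2 (F : 'I_2 -> 'I_2 -> R[i]) : \sum_(j < 2) \sum_(k < 2) F j k =
      F ord0 ord0 + F ord0 (lift ord0 ord0) +
      (F (lift ord0 ord0) ord0 + F (lift ord0 ord0) (lift ord0 ord0)).
    by rewrite !big_ord_recl !big_ord0 !addr0.
  rewrite lE sum2 !dE.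
  set a := e2 R ord0; set b := e2 R (lift ord0 ord0).
  rewrite !mxE /= !NE.
  have LC v v' : levi (@J2 R) u z v v' = levi (@J2 R) u z v' v.
    exact: (leviC _ oA Az cu).
  have LJ v : levi (@J2 R) u z v (J2 v) = 0.
    exact: (leviJr (fin_dimC2 R) (@J2_linear R) (@J2J2 R) oA Az cu).
  have Lba : levi (@J2 R) u z b (J2 a) = - levi (@J2 R) u z a (J2 b).
    by rewrite LC (leviJl (fin_dimC2 R) (@J2_linear R) (@J2J2 R) oA Az cu).
  rewrite /L !LJ Lba (LC b a).
  move: (levi _ _ _ a a) (levi _ _ _ b b) (levi _ _ _ a b) (levi _ _ _ a (J2 b)).
  case: w => [[x y] [s t]] /= p q r m; simpc.
  by congr Complex; field.
have pos (x : R) : (0 < (x / 4)%:C) = (0 < x).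
  by rewrite ltcR pmulr_lgt0 // invr_gt0.
have row0 w : w != 0 -> row w != 0.
  apply: contraNneq => /matrixP rw0.
  have := rw0 0 ord0; have := rw0 0 (lift ord0 ord0); rewrite !mxE /=.
  by case: w {rw0} => [[x y] [s t]] /= [-> ->] [-> ->].
split=> [H w w0|H r r0].
  by have := H _ (row0 w w0); rewrite key pos.
pose w : C2 R := ((complex.Re (r 0 ord0), complex.Im (r 0 ord0)),
  (complex.Re (r 0 (lift ord0 ord0)), complex.Im (r 0 (lift ord0 ord0)))).
have rE : r = row w.
  apply/rowP => j; rewrite mxE /w /=.
  case: (unliftP ord0 j) => [k|] -> /=; last by case: (r 0 ord0).
  by rewrite (ord1 k); case: (r 0 _).
rewrite rE key pos; apply: H; apply: contra_neq r0 => w0.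
rewrite rE w0; apply/rowP => j; rewrite !mxE; by case: ifP.
Qed.

End ComplexHessian.

(** * The maximum principle for complex-differentiable functions *)

Section FrechetDifferential.
Context (R : realType).

(** Differentiability at a point in the epsilon form, with an explicit
    differential. *)
Definition hdiff (V W : normedModType R) (f : V -> W) (z : V) (L : V -> W) :=
  [/\ forall (a : R) u v, L (a *: u + v) = a *: L u + L v,
      exists2 C : R, 0 < C & forall v, `|L v| <= C * `|v| &
      forall e : R, 0 < e -> exists2 r : R, 0 < r &
        forall h, `|h| < r -> `|f (z + h) - f z - L h| <= e * `|h|].

Lemma differentiable_hdiff (V W : normedModType R) (f : V -> W) z :
  differentiable f z -> hdiff f z ('d f z).
Proof.
move=> df; split.
- by move=> a u v; rewrite linearP.
- by have [C C0 H] := linear_lipschitz (diff_continuous df); exists C.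
- move=> e e0.
  have /eqaddoP/(_ _ e0)/nbhs_ballP[r /= r0 Hr] := diff_locally df.
  exists r => // h hr; have := Hr h; rewrite -ball_normE /= sub0r normrN => /(_ hr).
  by rewrite !fctE /= [h + z]addrC opprD addrA.
Qed.

Section Consequences.
Context (V W : normedModType R) (f : V -> W) (z : V) (L : V -> W).
Hypothesis fL : hdiff f z L.

Lemma hdiff0 : L 0 = 0.
Proof.
case: fL => /(_ 1 0 0) + _ _; rewrite !scale1r addr0 => E.
by apply: (addrI (L 0)); rewrite addr0 -E.
Qed.

Lemma hdiffZ a v : L (a *: v) = a *: L v.
Proof. by case: (fL) => /(_ a v 0) + _ _; rewrite !addr0 hdiff0 addr0. Qed.

Lemma hdiffD u v : L (u + v) = L u + L v.
Proof. by case: (fL) => /(_ 1 u v) + _ _; rewrite !scale1r. Qed.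

Lemma hdiffB u v : L (u - v) = L u - L v.
Proof. by rewrite hdiffD -scaleN1r hdiffZ scaleN1r. Qed.

Lemma hdiff_lip : exists2 C : R, 0 < C & exists2 r : R, 0 < r &
  forall h, `|h| < r -> `|f (z + h) - f z| <= C * `|h|.
Proof.
case: (fL) => _ [C C0 LC] /(_ 1 ltr01) [r r0 H].
exists (1 + C); first by rewrite addr_gt0.
exists r => // h hr; rewrite -[f _ - _](subrK (L h)).
by rewrite (le_trans (ler_normD _ _)) // mulrDl lerD // H.
Qed.

Lemma hdiff_continuous : {for z, continuous f}.
Proof.
have [C C0 [r r0 H]] := hdiff_lip.
apply/cvgrPdist_lt => e e0; apply/nbhs_ballP.
exists (Num.min r (e / C)); first by rewrite /= lt_min r0 divr_gt0.
move=> y; rewrite -ball_normE /= lt_min => /andP[zr ze].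
have := H (y - z); rewrite subrKC distrC => /(_ zr)/le_lt_trans.
by rewrite [`|f z - _|]distrC; apply; rewrite mulrC -ltr_pdivlMr.
Qed.

End Consequences.

Lemma hdiff_comp (U V W : normedModType R) (f : V -> W) (g : U -> V) z L M :
  hdiff g z M -> hdiff f (g z) L -> hdiff (f \o g) z (L \o M).
Proof.
move=> gM fL; have [K K0 [s s0 gK]] := hdiff_lip gM.
case: (gM) => Ml [C C0 MC] gr; case: (fL) => Ll [D D0 LD] fr; split.
- by move=> a u v /=; rewrite Ml Ll.
- exists (D * C); first by rewrite mulr_gt0.
  by move=> v /=; rewrite (le_trans (LD _)) // -mulrA ler_wpM2l // ltW.
- move=> e e0.
  have e1 : 0 < e / 2 / K by rewrite !divr_gt0.
  have [r1 r10 H1] := fr _ e1.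
  have e2 : 0 < e / 2 / D by rewrite !divr_gt0.
  have [r2 r20 H2] := gr _ e2.
  exists (Num.min s (Num.min r2 (r1 / K))).
    by rewrite !lt_min s0 r20 divr_gt0.
  move=> h; rewrite !lt_min => /and3P[hs h2 h1] /=.
  set k := g (z + h) - g z.
  have kh : `|k| <= K * `|h| by exact: gK.
  have kr : `|k| < r1 by rewrite (le_lt_trans kh) // mulrC -ltr_pdivlMr.
  have -> : f (g (z + h)) - f (g z) - L (M h) =
      (f (g z + k) - f (g z) - L k) + L (k - M h).
    have -> : g (z + h) = g z + k by rewrite /k subrKC.
    by rewrite (hdiffB fL k (M h)) [RHS]addrA subrK.
  rewrite (le_trans (ler_normD _ _)) // [e]splitr mulrDl lerD //.
    rewrite (le_trans (H1 _ kr)) // (@le_trans _ _ (e / 2 / K * (K * `|h|))) //.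
      by apply: ler_wpM2l => //; exact: ltW.
    by rewrite mulrA divfK // gt_eqF.
  rewrite (le_trans (LD _)) // (@le_trans _ _ (D * (e / 2 / D * `|h|))) //.
    by apply: ler_wpM2l; [exact: ltW|exact: H2].
  by rewrite mulrA [D * _]mulrC divfK // gt_eqF.
Qed.

End FrechetDifferential.

Section PartialIncrements.
Context (R : realType).
Variables (F : C1 R -> R) (z : C1 R) (L : C1 R -> R).
Hypothesis dF : hdiff F z L.

Let dE (h k : R) : L (h, k) = h * L (1, 0) + k * L (0, 1).
Proof.
have -> : ((h, k) : C1 R) = h *: (1, 0) + k *: (0, 1).
  transitivity ((h * 1 + k * 0, h * 0 + k * 1) : C1 R) => //.
  by congr pair; ring.
by rewrite (hdiffD dF) !(hdiffZ dF).
Qed.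

Lemma partial_increment1 (e : R) : 0 < e -> exists2 r : R, 0 < r & forall s1 s2 t,
  `|s1 - z.1| < r -> `|s2 - z.1| < r -> `|t - z.2| < r ->
  `|F (s2, t) - F (s1, t) - L (1, 0) * (s2 - s1)| <=
    e * (`|s1 - z.1| + `|s2 - z.1| + `|t - z.2| *+ 2).
Proof.
move=> e0; have [_ _ /(_ _ e0)[r r0 Hr]] := dF; exists r => // s1 s2 t h1 h2 h3.
have H s : `|s - z.1| < r -> `|F (s, t) - F z - L (s - z.1, t - z.2)|
     <= e * (`|s - z.1| + `|t - z.2|).
  move=> sr; have := Hr (s - z.1, t - z.2); rewrite normC1 /= gt_max sr h3 => /(_ isT).
  have -> : z + (s - z.1, t - z.2) = (s, t).
    by case: (z) => p q; congr pair; rewrite /= subrKC.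
  move/le_trans; apply; apply: ler_wpM2l; first exact: ltW.
  by rewrite ge_max lerDl normr_ge0 lerDr normr_ge0.
have := lerD (H _ h2) (H _ h1); rewrite (dE (s2 - z.1)) (dE (s1 - z.1)) => H12.
have -> : F (s2, t) - F (s1, t) - L (1, 0) * (s2 - s1) =
  (F (s2, t) - F z - ((s2 - z.1) * L (1, 0) + (t - z.2) * L (0, 1))) -
  (F (s1, t) - F z - ((s1 - z.1) * L (1, 0) + (t - z.2) * L (0, 1))).
  by ring.
rewrite (le_trans (ler_normB _ _)) // (le_trans H12) // -mulrDr.
apply: ler_wpM2l; first exact: ltW.
by rewrite addrACA [X in X + _]addrC -mulr2n.
Qed.

Lemma partial_increment2 (e : R) : 0 < e -> exists2 r : R, 0 < r & forall s t1 t2,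
  `|s - z.1| < r -> `|t1 - z.2| < r -> `|t2 - z.2| < r ->
  `|F (s, t2) - F (s, t1) - L (0, 1) * (t2 - t1)| <=
    e * (`|t1 - z.2| + `|t2 - z.2| + `|s - z.1| *+ 2).
Proof.
move=> e0; have [_ _ /(_ _ e0)[r r0 Hr]] := dF; exists r => // s t1 t2 h3 h1 h2.
have H t : `|t - z.2| < r -> `|F (s, t) - F z - L (s - z.1, t - z.2)|
     <= e * (`|t - z.2| + `|s - z.1|).
  move=> tr; have := Hr (s - z.1, t - z.2); rewrite normC1 /= gt_max tr h3 => /(_ isT).
  have -> : z + (s - z.1, t - z.2) = (s, t).
    by case: (z) => p q; congr pair; rewrite /= subrKC.
  move/le_trans; apply; apply: ler_wpM2l; first exact: ltW.
  by rewrite ge_max lerDl normr_ge0 lerDr normr_ge0.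
have := lerD (H _ h2) (H _ h1); rewrite (dE _ (t2 - z.2)) (dE _ (t1 - z.2)) => H12.
have -> : F (s, t2) - F (s, t1) - L (0, 1) * (t2 - t1) =
  (F (s, t2) - F z - ((s - z.1) * L (1, 0) + (t2 - z.2) * L (0, 1))) -
  (F (s, t1) - F z - ((s - z.1) * L (1, 0) + (t1 - z.2) * L (0, 1))).
  by ring.
rewrite (le_trans (ler_normB _ _)) // (le_trans H12) // -mulrDr.
apply: ler_wpM2l; first exact: ltW.
by rewrite addrACA [X in X + _]addrC -mulr2n.
Qed.

End PartialIncrements.

Lemma dist_in_itv (R : realType) (x y z w r : R) : x <= w <= y -> x <= z <= y ->
  y - x < r -> `|w - z| <= y - x /\ `|w - z| < r.
Proof.
move=> /andP[a b] /andP[c d] yr.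
have : `|w - z| <= y - x by rewrite ler_norml; apply/andP; split; lra.
by move=> h; split => //; exact: le_lt_trans h yr.
Qed.

Section Goursat.
Context (R : realType).

Lemma antiderivative (a b : R) (f : R -> R) : continuous f ->
  exists G : R -> R, forall x, a < x < b -> is_derive x 1 G (f x).
Proof.
move=> cf; exists (fun x => (\int[lebesgue_measure]_(t in `[a, x]) f t)%R).
move=> x /andP[ax xb].
have intf : lebesgue_measure.-integrable `[a, b] (EFin \o f).
  apply: continuous_compact_integrable; first exact: segment_compact.
  exact: continuous_subspaceT.
have [d1 d2] := continuous_FTC1_closed xb intf ax (cf x).
by split; [exact: d1|rewrite -derive1E; exact: d2].
Qed.

Lemma increment_bound (G g : R -> R) (a b D e : R) : a <= b ->
  (forall x, a <= x <= b -> is_derive x 1 G (g x) /\ `|g x - D| <= e) ->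
  `|G b - G a - D * (b - a)| <= e * (b - a).
Proof.
move=> ab H.
have ba0 : 0 <= b - a by rewrite subr_ge0.
have [] := @MVT_segment _ G g a b ab.
- move=> x; rewrite in_itv /= => /andP[ax xb].
  by apply: (H x _).1; rewrite !ltW.
- apply: derivable_within_continuous => x; rewrite in_itv /= => axb.
  by have [[]] := H x axb.
- move=> c; rewrite in_itv /= => acb ->.
  rewrite -mulrBl normrM (ger0_norm ba0) ler_wpM2r //.
  by have [] := H c acb.
Qed.

Section Quartering.
Variables (J : R -> R -> R -> R -> R) (a b c d : R).
Hypothesis Js : forall s1 s2 s3 t1 t2,
  J s1 s3 t1 t2 = J s1 s2 t1 t2 + J s2 s3 t1 t2.
Hypothesis Jt : forall s1 s2 t1 t2 t3,
  J s1 s2 t1 t3 = J s1 s2 t1 t2 + J s1 s2 t2 t3.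

Let l n := (b - a) / 2 ^+ n.
Let m n := (d - c) / 2 ^+ n.

Let lS n : l n = l n.+1 + l n.+1.
Proof. by rewrite /l exprS; field; rewrite expf_neq0. Qed.

Let mS n : m n = m n.+1 + m n.+1.
Proof. by rewrite /m exprS; field; rewrite expf_neq0. Qed.

Let quarter (k : R) (q : nat * (R * R)) :=
  k / 4 ^+ q.1 <= `|J q.2.1 (q.2.1 + l q.1) q.2.2 (q.2.2 + m q.1)|.

Let next (q q' : nat * (R * R)) :=
  [/\ q'.1 = q.1.+1,
      q.2.1 <= q'.2.1, q'.2.1 + l q'.1 <= q.2.1 + l q.1,
      q.2.2 <= q'.2.2 & q'.2.2 + m q'.1 <= q.2.2 + m q.1].

Hypothesis (ab : a <= b) (cd : c <= d).

Let l0 n : 0 <= l n. Proof. by rewrite divr_ge0 ?subr_ge0 // exprn_ge0. Qed.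
Let m0 n : 0 <= m n. Proof. by rewrite divr_ge0 ?subr_ge0 // exprn_ge0. Qed.

Let exists_next k q : quarter k q -> exists2 q', quarter k q' & next q q'.
Proof.
case: q => n [x y]; rewrite /quarter /= => H.
have H4 : k / 4 ^+ n = k / 4 ^+ n.+1 *+ 4.
  by rewrite exprS -mulr_natr; field; rewrite expf_neq0.
set k' := k / 4 ^+ n.+1 in H4.
have E : J x (x + l n) y (y + m n) =
    J x (x + l n.+1) y (y + m n.+1)
    + J x (x + l n.+1) (y + m n.+1) (y + m n.+1 + m n.+1)
    + (J (x + l n.+1) (x + l n.+1 + l n.+1) y (y + m n.+1)
    + J (x + l n.+1) (x + l n.+1 + l n.+1) (y + m n.+1) (y + m n.+1 + m n.+1)).
  rewrite [l n]lS [m n]mS [x + (_ + _)]addrA [y + (_ + _)]addrA.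
  by rewrite (Js _ (x + l n.+1)) (Jt x _ y (y + m n.+1))
    (Jt (x + l n.+1) _ y (y + m n.+1)).
have [h1|h1] := leP k' `|J x (x + l n.+1) y (y + m n.+1)|.
  exists (n.+1, (x, y)) => //; split => //=; first by rewrite [l n]lS addrA lerDl.
  by rewrite [m n]mS addrA lerDl.
have [h2|h2] := leP k' `|J x (x + l n.+1) (y + m n.+1) (y + m n.+1 + m n.+1)|.
  exists (n.+1, (x, y + m n.+1)) => //; split => //=.
  - by rewrite [l n]lS addrA lerDl.
  - by rewrite lerDl.
  - by rewrite [m n]mS addrA.
have [h3|h3] := leP k' `|J (x + l n.+1) (x + l n.+1 + l n.+1) y (y + m n.+1)|.
  exists (n.+1, (x + l n.+1, y)) => //; split => //=.
  - by rewrite lerDl.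
  - by rewrite [l n]lS addrA.
  - by rewrite [m n]mS addrA lerDl.
have [h4|h4] := leP k' `|J (x + l n.+1) (x + l n.+1 + l n.+1) (y + m n.+1) (y + m n.+1 + m n.+1)|.
  exists (n.+1, (x + l n.+1, y + m n.+1)) => //; split => //=.
  - by rewrite lerDl.
  - by rewrite [l n]lS addrA.
  - by rewrite lerDl.
  - by rewrite [m n]mS addrA.
move: H; rewrite leNgt => /negP[]; rewrite E H4.
move: h1 h2 h3 h4; set A := J _ _ _ _; set B := J _ _ _ _.
set C := J _ _ _ _; set D := J _ _ _ _ => h1 h2 h3 h4.
rewrite (le_lt_trans (ler_normD _ _)) //.
have := ler_normD A B; have := ler_normD C D.
move: `|A + B| `|C + D| `|A| `|B| `|C| `|D| h1 h2 h3 h4 => ? ? ? ? ? ? ? ? ? ? ? ?.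
by rewrite -mulr_natr; lra.
Qed.

(** Goursat's argument: an additive function of rectangles which is
    infinitesimal with respect to the squared size at every point vanishes. *)
Lemma quartering :
  (forall p q, a <= p <= b -> c <= q <= d -> forall e : R, 0 < e ->
    exists2 r : R, 0 < r & forall s1 s2 t1 t2, a <= s1 -> s1 <= p <= s2 -> s2 <= b ->
      c <= t1 -> t1 <= q <= t2 -> t2 <= d -> s2 - s1 < r -> t2 - t1 < r ->
      `|J s1 s2 t1 t2| <= e * ((s2 - s1) + (t2 - t1)) ^+ 2) ->
  J a b c d = 0.
Proof.
move=> small; apply/eqP; rewrite -normr_le0 leNgt; apply/negP => J0.
pose k := `|J a b c d|.
pose T := {q : nat * (R * R) | quarter k q}.
have q0 : quarter k (0%N, (a, c)).
  by rewrite /quarter /= /l /m expr0 !divr1 !subrKC.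
have [q1|f [f0 fS]] := @dependent_choice T (fun q q' => next (sval q) (sval q')) _ (exist (fun q => quarter k q) _ q0).
  have /cid2[q' kq' nq] := exists_next (svalP q1).
  by exists (exist _ q' kq').
pose x n := (sval (f n)).2.1; pose y n := (sval (f n)).2.2.
have fn n : (sval (f n)).1 = n.
  by elim: n => [|n IH]; [rewrite f0|have [-> _ _ _ _] := fS n; rewrite IH].
have xS n : x n <= x n.+1 /\ x n.+1 + l n.+1 <= x n + l n.
  by have [_ ? + _ _] := fS n; rewrite !fn.
have yS n : y n <= y n.+1 /\ y n.+1 + m n.+1 <= y n + m n.
  by have [_ _ _ ? +] := fS n; rewrite !fn.
have nested (u w : nat -> R) : (forall n, 0 <= w n) ->
    (forall n, u n <= u n.+1 /\ u n.+1 + w n.+1 <= u n + w n) ->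
    exists p, forall n, u n <= p <= u n + w n.
  move=> w0 H.
  have up n i : u n <= u (n + i)%N.
    elim: i => [|i IH]; first by rewrite addn0.
    by rewrite addnS (le_trans IH) //; have [] := H (n + i)%N.
  have dn n i : u (n + i)%N + w (n + i)%N <= u n + w n.
    elim: i => [|i IH]; first by rewrite addn0.
    by rewrite addnS (le_trans _ IH) //; have [] := H (n + i)%N.
  have bd n j : u j <= u n + w n.
    have [nj|jn] := leqP n j.
      by rewrite -(subnKC nj) (le_trans _ (dn n (j - n)%N)) // lerDl.
    rewrite -{1}(subnKC (ltnW jn)) in w0 *.
    by rewrite (le_trans (up j (n - j)%N)) // subnKC ?lerDl // ltnW.
  have ubu n : ubound (range u) (u n + w n) by move=> _ [j _ <-]; exact: bd.
  exists (sup (range u)) => n; apply/andP; split.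
    apply: ub_le_sup; first by exists (u 0%N + w 0%N); exact: ubu.
    by exists n.
  by apply: ge_sup; [exists (u 0%N); exists 0%N|exact: ubu].
have [p xp] := nested _ _ l0 xS; have [q yq] := nested _ _ m0 yS.
have x0 : x 0%N = a by rewrite /x f0. have y0 : y 0%N = c by rewrite /y f0.
have la : l 0%N = b - a by rewrite /l expr0 divr1.
have mc : m 0%N = d - c by rewrite /m expr0 divr1.
have pab : a <= p <= b by have := xp 0%N; rewrite x0 la subrKC.
have qcd : c <= q <= d by have := yq 0%N; rewrite y0 mc subrKC.
pose S := (b - a) + (d - c).
have S0 : 0 <= S by rewrite addr_ge0 // subr_ge0.
have e0 : 0 < k / (S ^+ 2 + 1) by rewrite divr_gt0 // ltr_wpDl // exprn_ge0.
have [r r0 Hr] := small _ _ pab qcd _ e0.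
have [n nr] : exists n, S / 2 ^+ n < r.
  have [N NS] : exists N : nat, S / r < N%:R.
    by exists (Num.truncn (S / r)).+1; exact: truncnS_gt.
  exists N; rewrite ltr_pdivrMr ?exprn_gt0 // mulrC -ltr_pdivrMr //.
  by rewrite (lt_trans NS) // -natrX ltr_nat ltn_expl.
have xa : a <= x n.
  by elim: (n) => [|i IH]; [rewrite x0|rewrite (le_trans IH) //; have [] := xS i].
have yc : c <= y n.
  by elim: (n) => [|i IH]; [rewrite y0|rewrite (le_trans IH) //; have [] := yS i].
have xb : x n + l n <= b.
  elim: (n) => [|i IH]; first by rewrite x0 la subrKC.
  by rewrite (le_trans _ IH) //; have [] := xS i.
have yd : y n + m n <= d.
  elim: (n) => [|i IH]; first by rewrite y0 mc subrKC.
  by rewrite (le_trans _ IH) //; have [] := yS i.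
have S2 : 0 < 2 ^+ n :> R by rewrite exprn_gt0.
have lS' : l n <= S / 2 ^+ n by rewrite ler_pM2r ?invr_gt0 // /S lerDl subr_ge0.
have mS' : m n <= S / 2 ^+ n by rewrite ler_pM2r ?invr_gt0 // /S lerDr subr_ge0.
have := Hr (x n) (x n + l n) (y n) (y n + m n) xa (xp n) xb yc (yq n) yd.
rewrite ![_ + _ - _]addrAC !subrr !add0r => /(_ (le_lt_trans lS' nr) (le_lt_trans mS' nr)).
have := svalP (f n); rewrite /quarter fn -/(x n) -/(y n) => h1 h2.
have := le_trans h1 h2.
have -> : l n + m n = S / 2 ^+ n by rewrite /l /m /S [RHS]mulrDl.
have -> : (4 : R) ^+ n = (2 ^+ n) ^+ 2 by rewrite -exprM mulnC exprM; congr (_ ^+ _); rewrite -natrX.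
rewrite exprMn exprVn mulrA ler_pM2r ?invr_gt0 ?exprn_gt0 // => h.
have : k / (S ^+ 2 + 1) * S ^+ 2 < k.
  rewrite mulrAC ltr_pdivrMr; last by rewrite ltr_wpDl // exprn_ge0.
  by rewrite ltr_pM2l // ltrDl.
by rewrite ltNge h.
Qed.

End Quartering.

(** If [A ds] and [B] satisfy dA/ds = dB/dt on a half-plane and [B] has period
    [T] in t, the mean of [A] over a period is independent of s. Integrals are
    represented by increments of antiderivatives. *)
Lemma period_integral (A B : C1 R -> R) (T s0 : R) : 0 <= T ->
  (forall z, z.1 < s0 -> exists LA LB, [/\ hdiff A z LA, hdiff B z LB &
     LA (1, 0) = LB (0, 1)]) ->
  (forall s, B (s, T) = B (s, 0)) ->
  forall s1 s2, s1 <= s2 -> s2 < s0 -> exists G1 G2 : R -> R,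
   [/\ forall t, 0 <= t <= T -> is_derive t 1 G1 (A (s1, t)),
       forall t, 0 <= t <= T -> is_derive t 1 G2 (A (s2, t)) &
       G1 T - G1 0 = G2 T - G2 0].
Proof.
move=> T0 dAB per s1 s2 s12 s20.
have cts (F : C1 R -> R) : (forall z, z.1 < s0 -> {for z, continuous F}) ->
    forall s, s < s0 -> continuous (fun t => F (s, t)).
  move=> cF s ss t; apply: (@continuous_comp _ _ _ (fun t => (s, t)) F).
    exact: (cvg_pair (cvg_cst s) cvg_id).
  exact: cF.
have dA z : z.1 < s0 -> {for z, continuous A}.
  by move=> /dAB[LA [LB [h _ _]]]; exact: hdiff_continuous h.
have dB z : z.1 < s0 -> {for z, continuous B}.
  by move=> /dAB[LA [LB [_ h _]]]; exact: hdiff_continuous h.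
pose w := (s2 + s0) / 2.
have w2 : s2 < w by rewrite /w; lra.
have w0 : w < s0 by rewrite /w; lra.
(* Antiderivatives of A in the second variable and of B in the first one; the
   clamping of s makes the functions to be integrated globally continuous. *)
have cmin (t : R) : continuous (fun s => B (Num.min s w, t)).
  move=> s; apply: (@continuous_comp _ _ _ (fun s => (Num.min s w, t)) B).
    have cm : {for s, continuous (fun s => Num.min s w)}.
      by apply: continuous_min => //; exact: cvg_cst.
    exact: (cvg_pair cm (cvg_cst t)).
  by apply: dB; rewrite /= gt_min w0 orbT.
have [PA HA] : exists PA : R -> R -> R, forall s, s < s0 -> forall t, 0 <= t <= T ->
    is_derive t 1 (PA s) (A (s, t)).
  have H s : exists G : R -> R, s < s0 -> forall t, 0 <= t <= T -> is_derive t 1 G (A (s, t)).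
    have [ss|ss] := ltP s s0; last by exists (fun=> 0).
    have [G HG] := antiderivative (-1) (T + 1) (cts A dA s ss).
    by exists G => _ t /andP[t0 tT]; apply: HG; apply/andP; split; lra.
  by exists (fun s => sval (cid (H s))) => s; exact: (svalP (cid (H s))).
have [PB HB] : exists PB : R -> R -> R, forall t s, s1 <= s <= s2 ->
    is_derive s 1 (PB t) (B (s, t)).
  have H t : exists G : R -> R, forall s, s1 <= s <= s2 -> is_derive s 1 G (B (s, t)).
    have [G HG] := antiderivative (s1 - 1) (s2 + 1) (cmin t).
    exists G => s /andP[h1 h2]; have := HG s; rewrite min_l; last lra.
    by apply; apply/andP; split; lra.
  by exists (fun t => sval (cid (H t))) => t; exact: (svalP (cid (H t))).
pose J a b c d := (PA b d - PA b c - PA a d + PA a c) - (PB d b - PB d a - PB c b + PB c a).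
have J0 : J s1 s2 0 T = 0.
  apply: quartering => //; [by move=> *; rewrite /J; ring|by move=> *; rewrite /J; ring|].
  move=> p q ps qt e e0.
  have ps0 : (p, q).1 < s0 by case/andP: ps => /= _ ?; lra.
  have [LA [LB [dAp dBp E]]] := dAB (p, q) ps0.
  have e1 : 0 < e / 8 by rewrite divr_gt0.
  have [r1 r10 H1] := partial_increment1 dAp e1.
  have [r2 r20 H2] := partial_increment2 dBp e1.
  exists (Num.min r1 r2); first by rewrite lt_min r10.
  move=> u1 u2 t1 t2 su1 u1pu2 us2 ct1 t1qt2 td.
  rewrite !lt_min => /andP[du1 du2] /andP[dt1 dt2].
  have [/andP[u1p pu2] /andP[t1q qt2]] := (u1pu2, t1qt2).
  have u12 : u1 <= u2 by exact: le_trans pu2.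
  have t12 : t1 <= t2 by exact: le_trans qt2.
  set ds := u2 - u1; set dt := t2 - t1.
  have ds0 : 0 <= ds by rewrite subr_ge0.
  have dt0 : 0 <= dt by rewrite subr_ge0.
  have e8 (n1 n2 n3 d d' : R) : n1 <= d -> n2 <= d -> n3 <= d' -> 0 <= d -> 0 <= d' ->
      e / 8 * (n1 + n2 + n3 *+ 2) <= e / 2 * (d + d').
    move=> h1 h2 h3 h4 h5.
    rewrite (_ : e / 2 = e / 8 * 4); last by field.
    rewrite -[leRHS]mulrA; apply: ler_wpM2l; first exact: ltW.
    have := lerD (lerD h1 h2) (lerD h3 h3); rewrite -mulr2n => /le_trans; apply.
    by clear -h4 h5; rewrite mulr_natl; lra.
  have EA : `|PA u2 t2 - PA u1 t2 - (PA u2 t1 - PA u1 t1) - LA (1, 0) * ds * dt|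
      <= e / 2 * (ds + dt) * dt.
    apply: (@increment_bound (fun t => PA u2 t - PA u1 t) (fun t => A (u2, t) - A (u1, t))) => //.
    move=> t tt; split.
      apply: is_deriveB; apply: HA.
      - exact: le_lt_trans us2 s20.
      - by case/andP: tt => ? ?; rewrite (le_trans ct1) //=; exact: le_trans td.
      - exact: le_lt_trans (le_trans u12 us2) s20.
      - by case/andP: tt => ? ?; rewrite (le_trans ct1) //=; exact: le_trans td.
    have [b1 b1'] := dist_in_itv (introT andP (conj (lexx u1) u12)) u1pu2 du1.
    have [b2 b2'] := dist_in_itv (introT andP (conj u12 (lexx u2))) u1pu2 du1.
    have [b3 b3'] := dist_in_itv tt t1qt2 dt1.
    exact: le_trans (H1 _ _ _ b1' b2' b3') (e8 _ _ _ _ _ b1 b2 b3 ds0 dt0).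
  have EB : `|PB t2 u2 - PB t1 u2 - (PB t2 u1 - PB t1 u1) - LB (0, 1) * dt * ds|
      <= e / 2 * (ds + dt) * ds.
    apply: (@increment_bound (fun s => PB t2 s - PB t1 s) (fun s => B (s, t2) - B (s, t1))) => //.
    move=> s ss; split.
      by apply: is_deriveB; apply: HB; case/andP: ss => ? ?; rewrite (le_trans su1) //=;
        exact: le_trans us2.
    have [b1 b1'] := dist_in_itv (introT andP (conj (lexx t1) t12)) t1qt2 dt2.
    have [b2 b2'] := dist_in_itv (introT andP (conj t12 (lexx t2))) t1qt2 dt2.
    have [b3 b3'] := dist_in_itv ss u1pu2 du2.
    rewrite [ds + dt]addrC.
    exact: le_trans (H2 _ _ _ b3' b1' b2') (e8 _ _ _ _ _ b1 b2 b3 dt0 ds0).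
  move: EA EB; rewrite -E => EA EB.
  have -> : J u1 u2 t1 t2 =
     (PA u2 t2 - PA u1 t2 - (PA u2 t1 - PA u1 t1) - LA (1, 0) * ds * dt) -
     (PB t2 u2 - PB t1 u2 - (PB t2 u1 - PB t1 u1) - LA (1, 0) * dt * ds).
    by rewrite /J; ring.
  rewrite (le_trans (ler_normB _ _)) // (le_trans (lerD EA EB)) //.
  have -> : e / 2 * (ds + dt) * dt + e / 2 * (ds + dt) * ds = e / 2 * (ds + dt) ^+ 2.
    by ring.
  apply: ler_wpM2r; first by rewrite exprn_ge0 // addr_ge0.
  by rewrite ler_pdivrMr // ler_peMr ?ler1n // ltW.
exists (PA s1), (PA s2); split; [exact: HA (le_lt_trans s12 s20)|exact: HA s20|].
have PB0 : PB T s2 - PB 0 s2 = PB T s1 - PB 0 s1.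
  apply/eqP; rewrite -subr_eq0 -normr_le0.
  have := @increment_bound (fun s => PB T s - PB 0 s) (fun s => B (s, T) - B (s, 0)) s1 s2 0 0 s12.
  rewrite !mul0r subr0; apply => s ss; split.
    by apply: is_deriveB; exact: HB.
  by rewrite per subrr subr0 normr0.
by move: J0; rewrite /J; lra.
Qed.

End Goursat.

Section MaximumPrinciple.
Context (R : realType).

Let polar (z : C1 R) : C1 R := (expR z.1 * cos z.2, expR z.1 * sin z.2).

Let polar_diff z : exists L, [/\ hdiff polar z L,
  L (1, 0) = polar z & L (0, 1) = J1 (polar z)].
Proof.
have d1 v : is_derive z v (fun x : C1 R => x.1) v.1.
  by have [? <-] := sdiff_derive (sdiff_fst z) v; exact: DeriveDef.
have d2 v : is_derive z v (fun x : C1 R => x.2) v.2.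
  by have [? <-] := sdiff_derive (sdiff_snd z) v; exact: DeriveDef.
have de v : is_derive z v (fun x : C1 R => expR x.1) (expR z.1 * v.1).
  exact: (is_derive_comp1 (d1 v) (is_derive_expR z.1)).
have dc v : is_derive z v (fun x : C1 R => cos x.2) (- sin z.2 * v.2).
  exact: (is_derive_comp1 (d2 v) (is_derive_cos z.2)).
have ds v : is_derive z v (fun x : C1 R => sin x.2) (cos z.2 * v.2).
  exact: (is_derive_comp1 (d2 v) (is_derive_sin z.2)).
have df : differentiable (fun x : C1 R => x.1) z by have [] := sdiff_differentiable (sdiff_fst z).
have dg : differentiable (fun x : C1 R => x.2) z by have [] := sdiff_differentiable (sdiff_snd z).
have D1 (g : R -> R) (a b : R) : is_derive a 1 g b -> differentiable g a.
  by move=> [dga _]; exact/derivable1_diffP.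
have De : differentiable (fun x : C1 R => expR x.1) z.
  by apply: differentiable_comp df _; exact: D1 (is_derive_expR z.1).
have Dc : differentiable (fun x : C1 R => cos x.2) z.
  by apply: differentiable_comp dg _; exact: D1 (is_derive_cos z.2).
have Ds : differentiable (fun x : C1 R => sin x.2) z.
  by apply: differentiable_comp dg _; exact: D1 (is_derive_sin z.2).
have P1 := differentiableM De Dc; have P2 := differentiableM De Ds.
have dP : differentiable polar z by exact: differentiable_pair.
have dE v : 'd polar z v = ('D_v (fun x : C1 R => expR x.1 * cos x.2) z,
    'D_v (fun x : C1 R => expR x.1 * sin x.2) z).
  rewrite (diff_pair P1 P2) /=; congr pair; by rewrite deriveE.
have E1 v : 'D_v (fun x : C1 R => expR x.1 * cos x.2) z =
    expR z.1 * (- sin z.2 * v.2) + cos z.2 * (expR z.1 * v.1).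
  by have [_ ->] := is_deriveM (de v) (dc v).
have E2 v : 'D_v (fun x : C1 R => expR x.1 * sin x.2) z =
    expR z.1 * (cos z.2 * v.2) + sin z.2 * (expR z.1 * v.1).
  by have [_ ->] := is_deriveM (de v) (ds v).
exists ('d polar z); split; [exact: differentiable_hdiff| |];
  rewrite dE E1 E2 /polar /J1 /=; congr pair; ring.
Qed.

(** A harmonic function with a conjugate has no strict local minimum of order
    two: its means over circles are all equal. The functions are only complex
    differentiable, as the coordinate changes of the surface are. *)
Lemma no_strict_minimum (H K : C1 R -> R) (r c : R) : 0 < r -> 0 < c ->
  (forall z, `|z| < r -> exists LH LK, [/\ hdiff H z LH, hdiff K z LK &
     forall v, LK (J1 v) = LH v]) ->
  H 0 = 0 -> ~ (forall z, `|z| < r -> c * (z.1 ^+ 2 + z.2 ^+ 2) <= H z).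
Proof.
move=> r0 c0 HK H0 Hmin.
pose A := H \o polar; pose B := K \o polar.
have npolar z : `|polar z| <= expR z.1.
  rewrite normC1 ge_max /= !normrM (ger0_norm (expR_ge0 _)).
  by apply/andP; split; rewrite ler_piMr ?expR_ge0 // ler_norml;
    rewrite ?cos_le1 ?cos_geN1 ?sin_le1 ?sin_geN1.
have pr z : z.1 < ln r -> `|polar z| < r.
  move=> zr; rewrite (le_lt_trans (npolar z)) // -[ltRHS]lnK ?ltr_expR //.
have T0 : 0 <= pi *+ 2 :> R by rewrite mulrn_wge0 // pi_ge0.
have T1 : 0 < pi *+ 2 :> R by rewrite mulrn_wgt0 // pi_gt0.
have AB z : z.1 < ln r -> exists LA LB, [/\ hdiff A z LA, hdiff B z LB &
     LA (1, 0) = LB (0, 1)].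
  move=> /pr/HK[LH [LK [dH dK E]]]; have [P [dp p1 p2]] := polar_diff z.
  exists (LH \o P), (LK \o P); split; [exact: hdiff_comp|exact: hdiff_comp|].
  by rewrite /= p1 p2 E.
have per s : B (s, pi *+ 2) = B (s, 0).
  by rewrite /B /polar /= cos2pi sin2pi cos0 sin0.
pose s2 := ln r - 1.
have s2r : s2 < ln r by rewrite /s2; lra.
pose m := c * expR s2 ^+ 2.
have m0 : 0 < m by rewrite mulr_gt0 // exprn_gt0 // expR_gt0.
have A2 t : m <= A (s2, t).
  rewrite (le_trans _ (Hmin _ (pr _ _))) //= /m ler_pM2l //.
  by rewrite !exprMn -mulrDr cos2Dsin2 mulr1.
have cH : {for 0, continuous H}.
  have [LH [LK [dH _ _]]] := HK 0 ltac:(by rewrite normr0).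
  exact: hdiff_continuous dH.
have m2 : 0 < m / 2 by rewrite divr_gt0.
have /cvgrPdist_lt/(_ _ m2)/nbhs_ballP[q /= q0 Hq] := cH.
pose s1 := Num.min s2 (ln q - 1).
have s12 : s1 <= s2 by rewrite /s1 ge_min lexx.
have A1 t : A (s1, t) <= m / 2.
  have : ball 0 q (polar (s1, t)).
    rewrite -ball_normE /= sub0r normrN (le_lt_trans (npolar _)) //=.
    rewrite -[ltRHS]lnK // ltr_expR (@le_lt_trans _ _ (ln q - 1)) //; last lra.
    by rewrite /s1 ge_min lexx orbT.
  move=> /Hq /=; rewrite H0 sub0r normrN /A /=.
  by move=> /ltW; apply: le_trans; exact: ler_norm.
have [G1 [G2 [g1 g2 E]]] := period_integral T0 AB per s12 s2r.
have mvt (G g : R -> R) : (forall t, 0 <= t <= pi *+ 2 -> is_derive t 1 G (g t)) ->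
    exists t, G (pi *+ 2) - G 0 = g t * (pi *+ 2).
  move=> dG; have [] := @MVT_segment _ G g 0 (pi *+ 2) T0.
  - by move=> x; rewrite in_itv /= => /andP[x0 x1]; apply: dG; rewrite !ltW.
  - by apply: derivable_within_continuous => x; rewrite in_itv /= => /dG[].
  - by move=> t _ ->; exists t; rewrite subr0.
have [t1 E1] := mvt _ _ g1; have [t2 E2] := mvt _ _ g2.
move: E; rewrite E1 E2 => /(mulIf (lt0r_neq0 T1)) E.
by have := A1 t1; have := A2 t2; rewrite E; lra.
Qed.

End MaximumPrinciple.

Section Taylor.
Context (R : realType) (V : normedModType R).
Hypothesis fV : fin_dim V.
Variables (A : set V) (f : V -> R) (z : V).
Hypothesis (oA : open A) (Az : A z) (cf : Ck 2 A f).

Lemma pd_coord : exists (d : nat) (e : 'I_d -> V) (x : 'I_d -> V -> R), coordinates e x /\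
  forall (g : V -> R) y v, Ck 1 A g -> A y -> pd g v y = \sum_i x i v * pd g (e i) y.
Proof.
have [d [e [x exV]]] := fV; exists d, e, x; split => // g y v cg Ay.
have [xl xe xn] := exV.
have sg := pd_sdiff fV oA Ay cg.
have HH (r : seq 'I_d) (c : 'I_d -> R) :
    pd g (\sum_(i <- r) c i *: e i) y = \sum_(i <- r) c i * pd g (e i) y.
  elim: r => [|i r IH]; first by rewrite !big_nil (sdiff0 sg).
  by rewrite !big_cons (sdiffD sg) (sdiffZ sg) IH.
by rewrite {1}(xe v) HH.
Qed.

Lemma pd2_bounded : exists2 C : R, 0 < C &
  forall v w, `|pd (pd f w) v z| <= C * `|v| * `|w|.
Proof.
have [d [e [x [[xl xe xn] E]]]] := pd_coord.
exists (\sum_i \sum_j `|pd (pd f (e i)) (e j) z| + 1).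
  by rewrite ltr_wpDl // sumr_ge0 // => i _; rewrite sumr_ge0.
move=> v w.
have cp v' : Ck 1 A (pd f v') by exact: Ck_pd.
rewrite (pd2C oA Az cf) (E _ _ w (cp v) Az).
rewrite (@le_trans _ _ (\sum_i \sum_j `|pd (pd f (e i)) (e j) z| * `|v| * `|w|)) //.
  rewrite (le_trans (ler_norm_sum _ _ _)) // ler_sum // => i _.
  rewrite (pd2C oA Az cf) (E _ _ v (cp (e i)) Az) normrM.
  rewrite (@le_trans _ _ (`|w| * \sum_j `|v| * `|pd (pd f (e i)) (e j) z|)) //.
    apply: ler_pM => //; rewrite (le_trans (ler_norm_sum _ _ _)) // ler_sum // => j _.
    by rewrite normrM ler_wpM2r.
  rewrite mulr_sumr ler_sum // => j _.
  by rewrite mulrC [`|v| * _]mulrC.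
rewrite -mulrA mulrDl mul1r.
rewrite (_ : \sum_i _ = (\sum_i \sum_j `|pd (pd f (e i)) (e j) z|) * (`|v| * `|w|)).
  by rewrite lerDl mulr_ge0.
rewrite mulr_suml; apply: eq_bigr => i _; rewrite mulr_suml.
by apply: eq_bigr => j _; rewrite mulrA.
Qed.

Lemma Taylor2 (eps : R) : 0 < eps -> exists2 r : R, 0 < r & forall k, `|k| < r ->
  `|f (z + k) - f z - pd f k z - pd (pd f k) k z / 2| <= eps * `|k| ^+ 2.
Proof.
move=> e0; have [d [e [x [[xl xe xn] E]]]] := pd_coord.
have e1 : 0 < eps / d.+1%:R by rewrite divr_gt0.
have /choice[r Hr] : forall i : 'I_d, exists r : R, 0 < r /\
    (forall y, ball z r y -> `|pd f (e i) y - pd f (e i) z - pd (pd f (e i)) (y - z) z|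
        <= eps / d.+1%:R * `|y - z|).
  move=> i; have [_ _ /(_ _ e1)[r r0 H]] := pd_sdiff fV oA Az (Ck_pd (e i) cf).
  by exists r; split => // y zy; apply: H => //; exact: ballxx.
have /nbhs_ballP[a /= a0 Ha] : nbhs z A by exact: open_nbhs_nbhs.
pose m := \big[Num.min/a]_i r i.
have m0 : 0 < m by rewrite /m; elim/big_ind : _ => // [u v u0 v0|i _]; [rewrite lt_min u0|have [] := Hr i].
have mr i : m <= r i by rewrite /m; exact: bigmin_le_cond.
have ma : m <= a by rewrite /m; exact: bigmin_le_id.
exists m => // k km.
have H (t : R) : 0 <= t <= 1 -> A (z + t *: k) /\
    `|pd f k (z + t *: k) - pd f k z - t * pd (pd f k) k z| <= eps * `|k| ^+ 2.
  move=> /andP[t0 t1].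
  have tk : `|t *: k| <= `|k| by rewrite normrZ ger0_norm // ler_piMl.
  have bm : `|t *: k| < m by rewrite (le_lt_trans tk).
  have Atk : A (z + t *: k).
    apply: Ha; rewrite -ball_normE /= opprD addrA subrr sub0r normrN.
    by rewrite (lt_le_trans bm).
  split=> //.
  have cf1 : Ck 1 A f by exact: CkS.
  rewrite (E f _ k cf1 Atk) (E f z k cf1 Az).
  rewrite (E _ _ k (Ck_pd k cf) Az).
  rewrite mulr_sumr -!sumrB (le_trans (ler_norm_sum _ _ _)) //.
  rewrite (@le_trans _ _ (\sum_(i < d) eps / d.+1%:R * `|k| ^+ 2)) //.
    rewrite ler_sum // => i _.
    have [_ /(_ (z + t *: k))] := Hr i.
    rewrite -ball_normE /= opprD addrA subrr sub0r normrN (lt_le_trans bm (mr i)) => /(_ isT).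
    rewrite [z + _ - _]addrAC subrr add0r (pdZv fV oA Az (Ck_pd (e i) cf)) => h.
    rewrite (pd2C oA Az cf (e i) k).
    rewrite mulrCA -!mulrBr normrM expr2 mulrCA.
    apply: ler_pM => //; rewrite (le_trans h) //.
    by rewrite ler_wpM2l // ltW.
  rewrite sumr_const card_ord -[leLHS]mulr_natl mulrA.
  rewrite ler_wpM2r ?exprn_ge0 // mulrCA ler_piMr ?ltW //.
  by rewrite ltr_pdivrMr // mul1r ltr_nat.
have := @increment_bound _ (fun t : R => f (z + t *: k) - (pd f k z * t + pd (pd f k) k z * (t ^+ 2 / 2)))
  (fun t => pd f k (z + t *: k) - (pd f k z + t * pd (pd f k) k z)) 0 1 0 (eps * `|k| ^+ 2) ler01.
have -> : f (z + k) - f z - pd f k z - pd (pd f k) k z / 2 =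
  f (z + 1 *: k) - (pd f k z * 1 + pd (pd f k) k z * (1 ^+ 2 / 2)) -
  (f (z + 0 *: k) - (pd f k z * 0 + pd (pd f k) k z * (0 ^+ 2 / 2))) - 0 * (1 - 0).
  by rewrite scale1r scale0r addr0; field.
move=> Hinc; rewrite -[leRHS]mulr1 -[X in _ <= _ * X](subr0 1); apply: Hinc => t t01; have [At Ht] := H t t01; split; last first.
  by rewrite subr0 opprD addrA.
apply: is_deriveB.
  have := @is_derive_line _ _ _ f z k t (Ck_derivable cf At).
  by rewrite pdE.
have D := is_deriveD (is_deriveZ (pd f k z) (is_derive_id t (1 : R)))
  (is_deriveZ (pd (pd f k) k z / 2) (is_deriveX 2 (is_derive_id t (1 : R)))).
have -> : (fun x0 : R => pd f k z * x0 + pd (pd f k) k z * (x0 ^+ 2 / 2)) =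
    pd f k z \*: (@id R) + (pd (pd f k) k z / 2) \*: ((@id R) ^+ 2).
  by apply/funext => x0; rewrite !fctE /= /GRing.scale /=; field.
apply: is_derive_eq D _.
by rewrite /GRing.scale /=; field.
Qed.

End Taylor.

Section LinearQuadratic.
Context (R : realType) (V : normedModType R).

Lemma hdiff_linear_quadratic (l : V -> R) (b : V -> V -> R) (C : R) z : 0 < C ->
  (forall (a : R) u v, l (a *: u + v) = a * l u + l v) ->
  (forall v, `|l v| <= C * `|v|) ->
  (forall (a : R) u v w, b (a *: u + v) w = a * b u w + b v w) ->
  (forall (a : R) u v w, b w (a *: u + v) = a * b w u + b w v) ->
  (forall v w, `|b v w| <= C * `|v| * `|w|) ->
  hdiff (fun k => l k + b k k) z (fun v => l v + (b z v + b v z)).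
Proof.
move=> C0 ll lC bl br bC; split.
- by move=> a u v; rewrite ll bl br /GRing.scale /=; ring.
- exists (C + C * `|z| *+ 2); first by rewrite ltr_pwDl // mulrn_wge0 // mulr_ge0 // ltW.
  move=> v; rewrite (le_trans (ler_normD _ _)) // mulrDl lerD //.
  rewrite (le_trans (ler_normD _ _)) // mulr2n mulrDl lerD //.
  by rewrite mulrAC.
- move=> e e0; exists (e / C); first by rewrite divr_gt0.
  move=> h hC.
  have bD u v w : b (u + v) w = b u w + b v w by have := bl 1 u v w; rewrite scale1r mul1r.
  have bD' u v w : b w (u + v) = b w u + b w v by have := br 1 u v w; rewrite scale1r mul1r.
  have lD u v : l (u + v) = l u + l v by have := ll 1 u v; rewrite scale1r mul1r.
  have -> : l (z + h) + b (z + h) (z + h) - (l z + b z z) - (l h + (b z h + b h z)) = b h h.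
    by rewrite !bD !bD' lD; ring.
  rewrite (le_trans (bC _ _)) // ler_wpM2r //.
  by rewrite mulrC -ler_pdivlMr // ltW.
Qed.

End LinearQuadratic.

Section LeviInvariance.
Context (R : realType).

Lemma normJ2 (v : C2 R) : `|J2 v| = `|v|.
Proof. by rewrite !normC2 /= !normJ1. Qed.

Section Expansion.
Variables (A : set (C2 R)) (u : C2 R -> R) (phi : C1 R -> C2 R) (D : C1 R -> C1 R -> C2 R) (r0 : R).
Hypothesis (oA : open A) (cu : Ck 2 A u) (Ap : A (phi 0)) (r00 : 0 < r0).
Hypothesis phiD : forall z, `|z| < r0 -> hdiff phi z (D z).
Hypothesis DJ : forall z v, `|z| < r0 -> D z (J1 v) = J2 (D z v).

Let p := phi 0.
Let l v := pd u v p.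
Let Q v w := pd (pd u w) v p.
Let L := levi (@J2 R) u p.
Let a := D 0 (1, 0).

Let Ql c x y w : Q (c *: x + y) w = c * Q x w + Q y w.
Proof. by rewrite /Q (pd2Dl (fin_dimC2 R) oA Ap cu) (pd2Zl (fin_dimC2 R) oA Ap cu). Qed.

Let QC v w : Q v w = Q w v.
Proof. exact: (pd2C oA Ap cu). Qed.

Let Qr c x y w : Q w (c *: x + y) = c * Q w x + Q w y.
Proof. by rewrite QC Ql ![Q _ w]QC. Qed.

Let ll c x y : l (c *: x + y) = c * l x + l y.
Proof.
rewrite /l (pdDv (fin_dimC2 R) oA Ap (CkS cu)).
by rewrite (pdZv (fin_dimC2 R) oA Ap (CkS cu)).
Qed.

Let H k := l k + (Q k k - Q (J2 k) (J2 k)) / 4.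
Let K k := - l (J2 k) - Q k (J2 k) / 2.

Let HK : exists dH dK : C2 R -> C2 R -> R, [/\ forall k, hdiff H k (dH k),
  forall k, hdiff K k (dK k) & forall k v, dK k (J2 v) = dH k v].
Proof.
have [C C0 QC'] := pd2_bounded (fin_dimC2 R) oA Ap cu.
have [_ [C' lC'] _] := pd_sdiff (fin_dimC2 R) oA Ap (CkS cu).
pose M := C + `|C'| + 1.
have M0 : 0 < M by rewrite ltr_wpDl // addr_ge0 // ltW.
have lM v : `|l v| <= M * `|v|.
  rewrite (le_trans (lC' v)) // ler_wpM2r // (le_trans (ler_norm _)) //.
  by rewrite /M -addrA addrCA lerDl addr_ge0 // ltW.
have QM v w : `|Q v w| <= M * `|v| * `|w|.
  rewrite (le_trans (QC' v w)) // -!mulrA ler_wpM2r ?mulr_ge0 //.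
  by rewrite /M -addrA lerDl addr_ge0.
pose b1 k k' := (Q k k' - Q (J2 k) (J2 k')) / 4.
pose b2 k k' := - Q k (J2 k') / 2.
exists (fun k v => l v + (b1 k v + b1 v k)), (fun k v => - l (J2 v) + (b2 k v + b2 v k)).
split=> [k|k|k v].
- apply: (@hdiff_linear_quadratic _ _ l b1 M) => //.
  + by move=> c x y w; rewrite /b1 J2_linear !Ql; field.
  + by move=> c x y w; rewrite /b1 J2_linear !Qr; field.
  + move=> v w; rewrite /b1 normrM [`|4^-1|]ger0_norm // ler_pdivrMr //.
    rewrite (le_trans (ler_normB _ _)) // (le_trans (lerD (QM _ _) (QM _ _))) //.
    have X0 : 0 <= M * `|v| * `|w| by rewrite !mulr_ge0 // ltW.
    by rewrite !normJ2; move: (M * `|v| * `|w|) X0 => X X0; lra.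
- rewrite (_ : K = fun k => - l (J2 k) + b2 k k).
    apply: (@hdiff_linear_quadratic _ _ (fun v => - l (J2 v)) b2 M) => //.
    + by move=> c x y; rewrite J2_linear ll; ring.
    + by move=> v; rewrite normrN (le_trans (lM _)) // normJ2.
    + by move=> c x y w; rewrite /b2 Ql; field.
    + by move=> c x y w; rewrite /b2 J2_linear Qr; field.
    + move=> v w; rewrite /b2 normrM normrN [`|2^-1|]ger0_norm // ler_pdivrMr //.
      rewrite (le_trans (QM _ _)) // normJ2 ler_peMr ?ler1n // !mulr_ge0 //.
      exact: ltW.
  by apply/funext => k'; rewrite /K /b2 mulNr.
- have Q2 x y : Q x (- y) = - Q x y.
    by have := Qr (-1) y 0 x; rewrite addr0 scaleN1r mulN1r => ->;
      have := Qr 1 0 0 x; rewrite scaler0 addr0 mul1r => E; lra.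
  have lN x : l (- x) = - l x.
    by have := ll (-1) x 0; rewrite addr0 scaleN1r mulN1r => ->;
      have := ll 1 0 0; rewrite scaler0 addr0 mul1r => E; lra.
  by rewrite /b1 /b2 J2J2 lN Q2 (QC (J2 v) (J2 k)) (QC v k); field.
Qed.

(** The real function [u \o phi] is, up to the second order, the real part of a
    complex-differentiable function plus the Levi form of [u]. *)
Lemma holomorphic_expansion : exists F G : C1 R -> R,
  [/\ forall z, `|z| < r0 -> exists LF LG, [/\ hdiff F z LF, hdiff G z LG &
        forall v, LG (J1 v) = LF v],
      F 0 = 0 &
      forall e : R, 0 < e -> exists2 r : R, 0 < r & forall z, `|z| < r ->
        `|u (phi z) - u p - F z - L a a / 4 * (z.1 ^+ 2 + z.2 ^+ 2)| <=
          e * (z.1 ^+ 2 + z.2 ^+ 2)].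
Proof.
have [dH [dK [hH hK E]]] := HK.
pose k z := phi z - p.
have hk z : `|z| < r0 -> hdiff k z (D z).
  move=> /phiD[lin bd est]; split => // e e0; have [r rp Hr] := est e e0.
  by exists r => // h hr; rewrite /k opprB addrA subrK; exact: Hr.
exists (H \o k), (K \o k); split.
- move=> z zr; exists (dH (k z) \o D z), (dK (k z) \o D z).
  split; [exact: hdiff_comp (hk z zr) _|exact: hdiff_comp (hk z zr) _|].
  by move=> v /=; rewrite DJ // E.
- rewrite /= /k subrr /H.
  have -> : l 0 = 0 by have := ll 1 0 0; rewrite scaler0 addr0 mul1r => E'; lra.
  have -> : Q 0 0 = 0 by have := Ql 1 0 0 0; rewrite scaler0 addr0 mul1r => E'; lra.
  have -> : J2 (0 : C2 R) = 0 by rewrite /J2 /J1 /= oppr0.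
  have -> : Q 0 0 = 0 by have := Ql 1 0 0 0; rewrite scaler0 addr0 mul1r => E'; lra.
  by rewrite subrr mul0r addr0.
have [C C0 QB] := pd2_bounded (fin_dimC2 R) oA Ap cu.
have h0 : hdiff phi 0 (D 0) by apply: phiD; rewrite normr0.
have [lin0 [B B0 DB] est0] := h0.
move=> e e0.
pose e1 := Num.min 1 (e / (4 * (C * (B + B + 1)))).
pose e2 := e / (2 * (B + 1) ^+ 2).
have BB : 0 < B + B + 1 by rewrite addr_gt0 // addr_gt0.
have e10 : 0 < e1 by rewrite lt_min ltr01 divr_gt0 // mulr_gt0 // mulr_gt0.
have e20 : 0 < e2 by rewrite divr_gt0 // mulr_gt0 // exprn_gt0 // addr_gt0.
have [r1 r10 H1] := est0 _ e10.
have [r2 r20 H2] := Taylor2 (fin_dimC2 R) oA Ap cu e20.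
exists (Num.min r1 (r2 / (B + 1))).
  by rewrite lt_min r10 divr_gt0 // addr_gt0.
move=> z; rewrite lt_min => /andP[z1 z2].
have := H1 z z1; rewrite add0r -/p -/(k z).
set rho := k z - D 0 z => Hrho.
have kz : k z = D 0 z + rho by rewrite /rho subrKC.
have e11 : e1 <= 1 by rewrite /e1 ge_min lexx.
have nk : `|k z| <= (B + 1) * `|z|.
  rewrite kz (le_trans (ler_normD _ _)) // mulrDl lerD // (le_trans Hrho) //.
  by rewrite ler_wpM2r.
have nk2 : `|k z| < r2.
  by rewrite (le_lt_trans nk) // mulrC -ltr_pdivlMr // addr_gt0.
have nz : `|z| ^+ 2 <= z.1 ^+ 2 + z.2 ^+ 2.
  by rewrite normC1 maxEle; case: ifP => _; rewrite real_normK ?num_real //;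
    rewrite ?lerDl ?lerDr sqr_ge0.
have Dz : D 0 z = z.1 *: a + z.2 *: J2 a.
  rewrite /a -DJ ?normr0 // /J1 /= oppr0.
  rewrite -(hdiffZ h0) -(hdiffZ h0) -(hdiffD h0); congr (D 0 _).
  case: (z) => x y; transitivity ((x * 1 + y * 0, x * 0 + y * 1) : C1 R) => //.
  by congr pair; rewrite /=; ring.
have LD0 : L (D 0 z) (D 0 z) = (z.1 ^+ 2 + z.2 ^+ 2) * L a a.
  have := levi_expand (fin_dimC2 R) (@J2_linear R) (@J2J2 R) oA Ap cu a a z.1 z.2 0 0.
  by rewrite !scale0r !addr0 -Dz -/L => ->; ring.
have LB v w : `|L v w| <= (C * `|v| * `|w|) *+ 2.
  rewrite /L /levi (le_trans (ler_normD _ _)) // mulr2n lerD //.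
  by rewrite (le_trans (QB _ _)) // !normJ2.
have LDl x y w : L (x + y) w = L x w + L y w.
  exact: (leviDl (fin_dimC2 R) (@J2_linear R) oA Ap cu).
have LDr x y w : L w (x + y) = L w x + L w y.
  exact: (leviDr (fin_dimC2 R) (@J2_linear R) oA Ap cu).
have Lk : L (k z) (k z) = L (D 0 z) (D 0 z) + L (D 0 z) rho + L rho (k z).
  by rewrite -LDr -kz -LDl -kz.
have Tk := H2 _ nk2; rewrite -/p in Tk.
have pk : p + k z = phi z by rewrite /k subrKC.
rewrite pk -/(l _) -/(Q _ _) in Tk.
have -> : u (phi z) - u p - (H \o k) z - L a a / 4 * (z.1 ^+ 2 + z.2 ^+ 2) =
   (u (phi z) - u p - l (k z) - Q (k z) (k z) / 2) + (L (D 0 z) rho + L rho (k z)) / 4.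
  have : L (k z) (k z) = Q (k z) (k z) + Q (J2 (k z)) (J2 (k z)) by [].
  rewrite Lk LD0 /H /=.
  move: (Q (k z) (k z)) (Q (J2 (k z)) (J2 (k z))) (L a a) (L (D 0 z) rho) (L rho (k z)).
  move: (l (k z)) (u (phi z)) (u p) (z.1 ^+ 2 + z.2 ^+ 2) => q1 q2 q3 q4 q5 q6 q7 q8 q9 LQ.
  have -> : q6 = (q4 * q7 + q8 + q9) - q5 + (q5 + q6) - (q4 * q7 + q8 + q9) by ring.
  by rewrite -LQ; field.
rewrite (le_trans (ler_normD _ _)) // [e]splitr [leRHS]mulrDl lerD //.
  rewrite (le_trans Tk) // (@le_trans _ _ (e2 * ((B + 1) ^+ 2 * `|z| ^+ 2))) //.
    apply: ler_wpM2l; first exact: ltW.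
    by rewrite -exprMn ler_pXn2r // nnegrE // mulr_ge0 // addr_ge0 // ltW.
  rewrite (@le_trans _ _ (e / 2 * `|z| ^+ 2)) //.
    rewrite /e2 le_eqVlt; apply/orP; left; apply/eqP; field.
    by rewrite gt_eqF // addr_gt0.
  by apply: ler_wpM2l => //; rewrite divr_ge0 // ltW.
rewrite normrM [`|4^-1|]ger0_norm // ler_pdivrMr //.
rewrite (@le_trans _ _ ((C * (B + B + 1) * e1 * `|z| ^+ 2) *+ 2)) //.
  rewrite (le_trans (ler_normD _ _)) // (le_trans (lerD (LB _ _) (LB _ _))) //.
  rewrite -mulrnDl lerMn2r /= -!mulrA -mulrDr; apply: ler_wpM2l; first exact: ltW.
  rewrite [`|D 0 z| * _]mulrC -mulrDr.
  rewrite [leRHS](_ : _ = (e1 * `|z|) * (B * `|z| + (B + 1) * `|z|)); last by ring.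
  by apply: ler_pM => //; rewrite lerD.
rewrite (@le_trans _ _ (e * 2 * `|z| ^+ 2)) //; last first.
  rewrite (_ : e / 2 * _ * 4 = e * 2 * (z.1 ^+ 2 + z.2 ^+ 2)); last by field.
  by apply: ler_wpM2l => //; rewrite mulr_ge0 // ltW.
rewrite -mulr_natr mulrAC; apply: ler_wpM2r; first exact: exprn_ge0.
have CB : 0 < C * (B + B + 1) by rewrite mulr_gt0.
have : C * (B + B + 1) * e1 <= e / 4.
  rewrite mulrC -ler_pdivlMr // (le_trans (_ : e1 <= e / (4 * (C * (B + B + 1))))) //.
    by rewrite /e1 ge_min lexx orbT.
  by rewrite invfM mulrA.
move=> h; rewrite ler_pM2r //; apply: (le_trans h).
by rewrite ler_pdivrMr // ler_peMr ?ler1n // ltW.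
Qed.

End Expansion.

(** The Levi form is invariant under complex-differentiable changes of
    variables, although these are not known to be of class C^2: along a complex
    line the two expansions differ by a harmonic function. *)
Lemma levi_comp (A B : set (C2 R)) (kap : C2 R -> C2 R) (u : C2 R -> R) z w :
  open A -> open B -> holomorphic (@J2 R) (@J2 R) A kap ->
  (forall x, A x -> B (kap x)) -> Ck 2 B u -> Ck 2 A (u \o kap) -> A z ->
  levi (@J2 R) (u \o kap) z w w = levi (@J2 R) u (kap z) ('d kap z w) ('d kap z w).
Proof.
move=> oA oB hk AB cu cuk Az.
pose phi2 (x : C1 R) := z + (x.1 *: w + x.2 *: J2 w).
pose M (x : C1 R) := x.1 *: w + x.2 *: J2 w.
pose phi1 := kap \o phi2.
have M0 : phi2 0 = z by rewrite /phi2 !scale0r !addr0.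
have Mlin (a : R) (x y : C1 R) : M (a *: x + y) = a *: M x + M y.
  have E1 : (a *: x + y).1 = a * x.1 + y.1 by [].
  have E2 : (a *: x + y).2 = a * x.2 + y.2 by [].
  by rewrite /M E1 E2 !scalerDl scalerDr !scalerA addrACA.
have MB x : `|M x| <= (`|w| *+ 2 + 1) * `|x|.
  rewrite (le_trans (ler_normD _ _)) // !normrZ normJ2 mulrDl mul1r mulr2n mulrDl.
  rewrite (le_trans _ (_ : `|w| * `|x| + `|w| * `|x| <= _)) ?lerDl //.
  by rewrite lerD // mulrC; apply: ler_wpM2l => //; rewrite normC1 le_max lexx ?orbT.
have h2 x : hdiff phi2 x M.
  split=> //; first by exists (`|w| *+ 2 + 1) => //; rewrite ltr_wpDl // mulrn_wge0.
  move=> e e0; exists 1 => // h _.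
  have -> : phi2 (x + h) - phi2 x - M h = 0.
    have MD : M (x + h) = M x + M h by have := Mlin 1 x h; rewrite !scale1r.
    rewrite /phi2 -/(M _) -/(M _) MD; set X := M x; set Y := M h.
    by rewrite [z + (X + Y)]addrA [_ - (z + X)]addrAC subrr add0r subrr.
  by rewrite normr0 mulr_ge0 // ltW.
have MJ v : M (J1 v) = J2 (M v).
  by rewrite /M /J1 /= J2D !J2Z J2J2 addrC scaleNr scalerN.
have /nbhs_ballP[a /= a0 Ha] : nbhs z A by exact: open_nbhs_nbhs.
pose r0 := a / (`|w| *+ 2 + 1).
have W0 : 0 < `|w| *+ 2 + 1 by rewrite ltr_wpDl // mulrn_wge0.
have r00 : 0 < r0 by rewrite divr_gt0.
have inA x : `|x| < r0 -> A (phi2 x).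
  move=> xr; apply: Ha; rewrite -ball_normE /= /phi2 opprD addrA subrr sub0r normrN.
  by rewrite (le_lt_trans (MB x)) // mulrC -ltr_pdivlMr.
have [F2 [G2 [c2 z2 x2]]] := @holomorphic_expansion A (u \o kap) phi2 (fun=> M) r0 oA cuk
  (eq_ind_r A Az M0) r00 (fun x _ => h2 x) (fun x v _ => MJ v).
have Bk : B (phi1 0) by rewrite /phi1 /= M0; exact: AB.
have h1 x : `|x| < r0 -> hdiff phi1 x ('d kap (phi2 x) \o M).
  move=> xr; apply: hdiff_comp (h2 x) _; apply: differentiable_hdiff.
  by have [] := hk _ (inA _ xr).
have DJ1 x v : `|x| < r0 -> ('d kap (phi2 x) \o M) (J1 v) = J2 (('d kap (phi2 x) \o M) v).
  by move=> xr /=; rewrite MJ; have [_ ->] := hk _ (inA _ xr).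
have [F1 [G1 [c1 z1 x1]]] := holomorphic_expansion oB cu Bk r00 h1 DJ1.
have M1 : M (1, 0) = w by rewrite /M /= scale1r scale0r addr0.
move: x1 x2; rewrite /= M1 /phi1 /= M0.
set L1 := levi _ u _ _ _; set L2 := levi _ (u \o kap) _ _ _ => x1 x2.
have key (F F' G G' : C1 R -> R) (l l' : R) :
    (forall z, `|z| < r0 -> exists LF LG, [/\ hdiff F z LF, hdiff G z LG &
        forall v, LG (J1 v) = LF v]) ->
    (forall z, `|z| < r0 -> exists LF LG, [/\ hdiff F' z LF, hdiff G' z LG &
        forall v, LG (J1 v) = LF v]) -> F 0 = 0 -> F' 0 = 0 ->
    (forall e : R, 0 < e -> exists2 r : R, 0 < r & forall x, `|x| < r ->
        `|u (kap (phi2 x)) - u (kap z) - F x - l / 4 * (x.1 ^+ 2 + x.2 ^+ 2)| <=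
          e * (x.1 ^+ 2 + x.2 ^+ 2)) ->
    (forall e : R, 0 < e -> exists2 r : R, 0 < r & forall x, `|x| < r ->
        `|u (kap (phi2 x)) - u (kap z) - F' x - l' / 4 * (x.1 ^+ 2 + x.2 ^+ 2)| <=
          e * (x.1 ^+ 2 + x.2 ^+ 2)) -> l <= l'.
  move=> cF cF' F0 F0' xF xF'; rewrite leNgt; apply/negP => ll.
  pose e := (l - l') / 16.
  have e0 : 0 < e by rewrite divr_gt0 // subr_gt0.
  have [r rp Hr] := xF e e0; have [r' rp' Hr'] := xF' e e0.
  pose q := Num.min r0 (Num.min r r').
  have q0 : 0 < q by rewrite !lt_min r00 rp.
  apply: (@no_strict_minimum _ (fun x => F' x - F x) (fun x => G' x - G x) q e q0 e0).
  - move=> x; rewrite lt_min => /andP[/[dup] xr0 /cF[LF [LG [hF hG E]]] _].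
    have [LF' [LG' [hF' hG' E']]] := cF' _ xr0.
    have hB (f g : C1 R -> R) L L' : hdiff f x L -> hdiff g x L' ->
        hdiff (fun y => f y - g y) x (fun v => L v - L' v).
      move=> [lin [C C0 LC] est] [lin' [C' C0' LC'] est']; split.
      + by move=> b v v'; rewrite lin lin' /GRing.scale /=; ring.
      + exists (C + C'); first by rewrite addr_gt0.
        by move=> v; rewrite (le_trans (ler_normB _ _)) // mulrDl lerD.
      + move=> d d0; have d2 : 0 < d / 2 by rewrite divr_gt0.
        have [s s0 Hs] := est _ d2; have [s' s0' Hs'] := est' _ d2.
        exists (Num.min s s'); first by rewrite lt_min s0.
        move=> h; rewrite lt_min => /andP[hs hs'].
        have := lerD (Hs _ hs) (Hs' _ hs'); rewrite -mulrDl -splitr.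
        move=> /(le_trans (ler_normB _ _)).
        by rewrite [X in `|X|](_ : _ = f (x + h) - g (x + h) - (f x - g x) - (L h - L' h)); [|ring].
    exists (fun v => LF' v - LF v), (fun v => LG' v - LG v).
    by split; [exact: hB|exact: hB|move=> v; rewrite E E'].
  - by rewrite F0 F0' subrr.
  - move=> x; rewrite !lt_min => /and3P[_ xr xr'].
    have := Hr _ xr; have := Hr' _ xr'.
    set N := x.1 ^+ 2 + x.2 ^+ 2.
    have N0 : 0 <= N by rewrite addr_ge0 // sqr_ge0.
    set U := u _ - u _.
    rewrite !ler_norml => /andP[a1 a2] /andP[a3 a4].
    have eN : l / 4 * N = l' / 4 * N + 4 * (e * N) by rewrite /e; field.
    have eN0 : 0 <= e * N by rewrite mulr_ge0 // ltW.
    by clear -a1 a2 a3 a4 eN eN0; lra.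
apply/eqP; rewrite eq_le; apply/andP; split.
  exact: key c2 c1 z2 z1 x2 x1.
exact: key c1 c2 z1 z2 x1 x2.
Qed.

End LeviInvariance.

(** * Boundary asymptotics of the complex Hessian of a power *)

Section FilterLimits.
Context (R : realType) (V : normedModType R) (T : Type) (F : set_system T).
Context {FF : Filter F}.

Lemma cvg_sum_seq (I : Type) (r : seq I) (g : I -> T -> R) (l : I -> R) :
  (forall i, g i @ F --> l i) ->
  (fun t => \sum_(i <- r) g i t) @ F --> \sum_(i <- r) l i.
Proof.
move=> H; elim: r => [|i r IH].
  by under eq_fun do rewrite big_nil; rewrite big_nil; exact: cvg_cst.
under eq_fun do rewrite big_cons; rewrite big_cons.
exact: cvgD (H i) IH.
Qed.

Lemma cvg_near_eq (f g : T -> R) (l : R) : g @ F --> l ->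
  (\forall t \near F, f t = g t) -> f @ F --> l.
Proof.
move=> gl fg; apply: cvg_trans gl; apply: near_eq_cvg.
by apply: filterS fg => t ->.
Qed.

Lemma cvg_sum_prod (I : Type) (r : seq I) (a b : I -> T -> R) (la lb : I -> R) :
  (forall i, a i @ F --> la i) -> (forall i, b i @ F --> lb i) ->
  (fun t => \sum_(i <- r) a i t * b i t) @ F --> \sum_(i <- r) la i * lb i.
Proof. by move=> Ha Hb; apply: cvg_sum_seq => i; exact: cvgM. Qed.

Lemma cvg_coordinate d (e : 'I_d -> V) x i (u : T -> V) u0 : coordinates e x ->
  u @ F --> u0 -> (fun t => x i (u t)) @ F --> x i u0.
Proof.
move=> [xl _ xn] cu.
have s : sdiff (x i) u0 (x i).
  by apply: sdiff_linear; [move=> a v w; rewrite xl|exists 1 => v; rewrite mul1r].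
exact: (continuous_cvg _ (sdiff_continuous s)).
Qed.

Hypothesis fV : fin_dim V.
Variables (A : set V) (p : V).
Hypothesis (oA : open A) (Ap : A p).

Lemma cvg_Ck k (f : V -> R) (q : T -> V) : Ck k A f -> q @ F --> p ->
  (fun t => f (q t)) @ F --> f p.
Proof. by move=> cf; apply: continuous_cvg; exact: Ck_cont cf Ap. Qed.

Let nearA (q : T -> V) : q @ F --> p -> \forall t \near F, A (q t).
Proof. by move=> cq; apply: cq; exact: open_nbhs_nbhs. Qed.

Lemma cvg_pd k (f : V -> R) (q u : T -> V) u0 : Ck k.+1 A f -> q @ F --> p -> u @ F --> u0 ->
  (fun t => pd f (u t) (q t)) @ F --> pd f u0 p.
Proof.
move=> cf cq cu; have cf1 : Ck 1 A f by apply: Ck_le cf.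
have [d [e [x [ex E]]]] := pd_coord fV oA.
rewrite (E f p u0 cf1 Ap).
have H := cvg_sum_prod (r := index_enum 'I_d) (fun i => cvg_coordinate (i := i) ex cu)
  (fun i => cvg_Ck (Ck_pd (e i) cf1) cq).
apply: (cvg_near_eq H).
near=> t; rewrite (E f (q t) (u t) cf1) //.
by near: t; exact: nearA.
Unshelve. all: by end_near. Qed.

Lemma cvg_pd2 k (f : V -> R) (q u w : T -> V) u0 w0 : Ck k.+2 A f ->
  q @ F --> p -> u @ F --> u0 -> w @ F --> w0 ->
  (fun t => pd (pd f (w t)) (u t) (q t)) @ F --> pd (pd f w0) u0 p.
Proof.
move=> cf cq cu cw; have cf2 : Ck 2 A f by apply: Ck_le cf.
have [d [e [x [ex E]]]] := pd_coord fV oA.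
have EE y : A y -> forall w u, pd (pd f w) u y = \sum_i x i w * pd (pd f (e i)) u y.
  move=> Ay w' u'; rewrite (pd2C oA Ay cf2) (E (pd f u') y w' (Ck_pd _ cf2) Ay).
  by apply: eq_bigr => i _; rewrite (pd2C oA Ay cf2).
rewrite (EE p Ap).
have H := cvg_sum_prod (r := index_enum 'I_d) (fun i => cvg_coordinate (i := i) ex cw)
  (fun i => cvg_pd (Ck_pd (e i) cf2) cq cu).
apply: (cvg_near_eq H).
near=> t; rewrite (EE (q t)) //.
by near: t; exact: nearA.
Unshelve. all: by end_near. Qed.

(** Difference quotients in the direction [v] from a moving base point [m]. *)
Section Quotients.
Variables (m : T -> V) (s : T -> R) (v : V).
Hypothesis (cm : m @ F --> p) (cs : s @ F --> (0 : R)) (s0 : \forall t \near F, 0 < s t).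

Let q t := m t + s t *: v.

Lemma cvg_moving : q @ F --> p.
Proof.
rewrite -[p]addr0 -(scale0r v).
by apply: cvgD => //; apply: cvgZ => //; exact: cvg_cst.
Qed.

Lemma cvg_quotient k (g : V -> R) : Ck k.+1 A g ->
  (fun t => (g (q t) - g (m t)) / s t) @ F --> pd g v p.
Proof.
move=> cg; have cg1 : Ck 1 A g by apply: Ck_le cg.
have sg := pd_sdiff fV oA Ap cg1; have [_ _ H] := sg.
apply/cvgrPdist_le => eps e0.
have v0 : 0 < `|v| + 1 by rewrite ltr_wpDl.
have [r r0 Hr] := H _ (divr_gt0 e0 v0).
have bm : \forall t \near F, ball p r (m t) by apply: cm; exact: nbhsx_ballx.
have bq : \forall t \near F, ball p r (q t) by apply: cvg_moving; exact: nbhsx_ballx.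
near=> t.
have st : 0 < s t by near: t.
have := Hr (q t) (m t) _ _; rewrite {1 2}/q.
have -> : m t + s t *: v - m t = s t *: v by rewrite addrAC subrr add0r.
rewrite (pdZv fV oA Ap cg1) normrZ (gtr0_norm st) => h.
have -> : pd g v p - (g (q t) - g (m t)) / s t =
    - ((g (q t) - g (m t) - s t * pd g v p) / s t) by field; rewrite gt_eqF.
rewrite normrN normrM [`|(s t)^-1|]gtr0_norm ?invr_gt0 // ler_pdivrMr //.
apply: le_trans (h _ _) _; [by near: t|by near: t|].
rewrite [leLHS](_ : _ = eps * s t * (`|v| / (`|v| + 1))); last by field; rewrite gt_eqF.
by rewrite ler_piMr ?mulr_ge0 ?ltW // ltr_pdivrMr // mul1r ltrDl.
Unshelve. all: by end_near. Qed.

Lemma cvg_quotient_pd k (f : V -> R) (u : T -> V) u0 : Ck k.+2 A f -> u @ F --> u0 ->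
  (fun t => (pd f (u t) (q t) - pd f (u t) (m t)) / s t) @ F --> pd (pd f u0) v p.
Proof.
move=> cf cu; have cf2 : Ck 2 A f by apply: Ck_le cf.
have cf1 := CkS cf2.
have [d [e [x [ex E]]]] := pd_coord fV oA.
rewrite (pd2C oA Ap cf2) (E (pd f v) p u0 (Ck_pd _ cf2) Ap).
have cq i : (fun t => (pd f (e i) (q t) - pd f (e i) (m t)) / s t) @ F --> pd (pd f v) (e i) p.
  by rewrite (pd2C oA Ap cf2); exact: cvg_quotient (Ck_pd (e i) cf2).
have H := cvg_sum_prod (r := index_enum 'I_d) (fun i => cvg_coordinate (i := i) ex cu) cq.
apply: (cvg_near_eq H).
near=> t.
rewrite (E f (q t) (u t) cf1); last by near: t; apply: nearA; exact: cvg_moving.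
rewrite (E f (m t) (u t) cf1); last by near: t; exact: nearA.
by rewrite -sumrB mulr_suml; apply: eq_bigr => i _; rewrite -mulrBr mulrA.
Unshelve. all: by end_near. Qed.

Lemma cvg_quotient_pd2 k (f : V -> R) (u w : T -> V) u0 w0 : Ck k.+3 A f ->
  u @ F --> u0 -> w @ F --> w0 ->
  (fun t => (pd (pd f (w t)) (u t) (q t) - pd (pd f (w t)) (u t) (m t)) / s t) @ F
    --> pd (pd (pd f w0) u0) v p.
Proof.
move=> cf cu cw; have cf3 : Ck 3 A f by apply: Ck_le cf.
have cf2 := CkS cf3.
have [d [e [x [ex E]]]] := pd_coord fV oA.
have EE y : A y -> forall w u, pd (pd f w) u y = \sum_i x i w * pd (pd f (e i)) u y.
  move=> Ay w' u'; rewrite (pd2C oA Ay cf2) (E (pd f u') y w' (Ck_pd _ cf2) Ay).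
  by apply: eq_bigr => i _; rewrite (pd2C oA Ay cf2).
have E3 : pd (pd (pd f w0) u0) v p = \sum_i x i w0 * pd (pd (pd f (e i)) u0) v p.
  have ne : {near p, pd (pd f w0) u0 =1 pd (pd f u0) w0}.
    near=> y; apply: (pd2C oA _ cf2); near: y; exact: open_nbhs_nbhs.
  rewrite (pd_near v ne) (pd2C oA Ap (Ck_pd u0 cf3)).
  rewrite (E (pd (pd f u0) v) p w0 (Ck_pd _ (Ck_pd _ cf3)) Ap).
  apply: eq_bigr => i _; rewrite (pd2C oA Ap (Ck_pd u0 cf3)).
  congr (_ * _); apply: pd_near; near=> y; apply: (pd2C oA _ cf2).
  by near: y; exact: open_nbhs_nbhs.
rewrite E3.
have H := cvg_sum_prod (r := index_enum 'I_d) (fun i => cvg_coordinate (i := i) ex cw)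
  (fun i => cvg_quotient_pd (Ck_pd (e i) cf3) cu).
apply: (cvg_near_eq H).
near=> t.
rewrite (EE (q t)); last by near: t; apply: nearA; exact: cvg_moving.
rewrite (EE (m t)); last by near: t; exact: nearA.
by rewrite -sumrB mulr_suml; apply: eq_bigr => i _; rewrite -mulrBr mulrA.
Unshelve. all: by end_near. Qed.

End Quotients.

End FilterLimits.

Section PowerHessian.
Context (R : realType) (V : normedModType R) (J : V -> V).

Lemma levi_power_expand (eta : R) (A : set V) (f : V -> R) q v w : open A ->
  Ck 2 A f -> (forall x, A x -> 0 < f x) -> A q ->
  levi J (fun x => - (f x `^ eta)) q v w =
  eta * f q `^ eta * (- levi J f q v w / f q +
  (1 - eta) * (pd f v q * pd f w q + pd f (J v) q * pd f (J w) q) / f q ^+ 2).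
Proof.
move=> oA cf f0 Aq.
have d1 b y : A y -> pd (fun x => - (f x `^ eta)) b y =
    - (eta * f y `^ (eta - 1)) * pd f b y.
  move=> Ay; have h := is_derive_comp1 (pd_is_derive b cf Ay) (is_derive1_powR eta (f0 y Ay)).
  by rewrite -[LHS]pdE mulNr; have [_] := is_deriveN h.
have d2 a b : pd (pd (fun x => - (f x `^ eta)) b) a q =
   - (eta * f q `^ (eta - 1)) * pd (pd f b) a q
   - eta * ((eta - 1) * f q `^ (eta - 1 - 1)) * pd f a q * pd f b q.
  have ne : {near q, pd (fun x => - (f x `^ eta)) b =1
      fun y => - (eta * f y `^ (eta - 1)) * pd f b y}.
    by near=> y; apply: d1; near: y; exact: open_nbhs_nbhs.
  rewrite (pd_near a ne).
  have h := is_derive_comp1 (pd_is_derive a cf Aq) (is_derive1_powR (eta - 1) (f0 q Aq)).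
  have h' := pd_is_derive a (Ck_pd b cf) Aq.
  have h2 : is_derive q a (fun y => - (eta * f y `^ (eta - 1)))
      (- (eta * ((eta - 1) * f q `^ (eta - 1 - 1) * pd f a q))).
    exact: is_deriveN (is_deriveZ eta h).
  rewrite -[LHS]pdE; have [_ E] := is_deriveM h2 h'.
  apply: etrans E _; rewrite /GRing.scale /=; ring.
rewrite /levi !d2.
have fq := f0 q Aq.
have E1 : f q `^ (eta - 1) = f q `^ eta / f q.
  rewrite powRB ?powRr1 ?ltW //.
  by apply/implyP => _; rewrite gt_eqF.
have E2 : f q `^ (eta - 1 - 1) = f q `^ eta / f q ^+ 2.
  rewrite powRB ?powRr1 ?E1 ?ltW //; last by apply/implyP => _; rewrite gt_eqF.
  by rewrite -mulrA -invfM expr2.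
rewrite E1 E2; field; exact: lt0r_neq0.
Unshelve. all: by end_near. Qed.

End PowerHessian.

(** Up to the positive factor eta f^eta, the Levi form of - f^eta. *)
Definition power_form (R : realType) (eta : R) (f : C2 R -> R) (q v w : C2 R) : R :=
  - levi (@J2 R) f q v w / f q +
  (1 - eta) * (pd f v q * pd f w q + pd f (J2 v) q * pd f (J2 w) q) / f q ^+ 2.

Lemma levi_power (R : realType) (eta : R) (A : set (C2 R)) (f : C2 R -> R) q v w : open A ->
  Ck 2 A f -> (forall x, A x -> 0 < f x) -> A q ->
  levi (@J2 R) (fun x => - (f x `^ eta)) q v w =
  eta * f q `^ eta * power_form eta f q v w.
Proof. exact: levi_power_expand. Qed.

Section ComplexCramer.
Context (R : realType).
Implicit Types (e v w : C2 R).

Definition cmul (a b : C1 R) : C1 R := (a.1 * b.1 - a.2 * b.2, a.1 * b.2 + a.2 * b.1).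

(** The complex determinant of two vectors. *)
Definition cdet e v : C1 R := cmul e.1 v.2 - cmul e.2 v.1.

Lemma cdetE (x y z t x' y' z' t' : R) : cdet ((x, y), (z, t)) ((x', y'), (z', t')) =
  (x * z' - y * t' - (z * x' - t * y'), x * t' + y * z' - (z * y' + t * x')).
Proof. by []. Qed.

Definition cdet2 e v : R := (cdet e v).1 ^+ 2 + (cdet e v).2 ^+ 2.

Definition cscale (a : C1 R) v : C2 R := a.1 *: v + a.2 *: J2 v.

Lemma cscaleE a v : cscale a v = (cmul a v.1, cmul a v.2).
Proof.
case: a v => [a b] [[x y] [z t]]; rewrite /cscale /cmul /J2 /J1 /=.
transitivity (((a * x + b * - y, a * y + b * x), (a * z + b * - t, a * t + b * z)) : C2 R); first by [].
by congr (_, _, (_, _)); ring.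
Qed.

Definition cramer1 e v w : C1 R := (cdet2 e v)^-1 *: cmul ((cdet e v).1, - (cdet e v).2) (cdet w v).
Definition cramer2 e v w : C1 R := (cdet2 e v)^-1 *: cmul ((cdet e v).1, - (cdet e v).2) (cdet e w).

Lemma Cramer e v w : cdet2 e v != 0 ->
  w = cscale (cramer1 e v w) e + cscale (cramer2 e v w) v.
Proof.
rewrite !cscaleE /cramer1 /cramer2 => D0.
have [D DE] : exists D, D = cdet2 e v by exists (cdet2 e v).
rewrite -DE in D0 *.
case: e v w DE => [[a b] [c d]] [[a' b'] [c' d']] [[x y] [z t]].
rewrite /cdet2 /cdet /cmul /= => DE.
apply/eqP; rewrite !xpair_eqE /= /GRing.scale /=.
apply/andP; split; apply/andP; split; apply/eqP.
- apply: (mulfI D0); rewrite {1}DE.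
  by field.
- apply: (mulfI D0); rewrite {1}DE; by field.
- apply: (mulfI D0); rewrite {1}DE; by field.
- apply: (mulfI D0); rewrite {1}DE; by field.
Qed.

Lemma cdet2_eq0 e v : e != 0 -> cdet2 e v = 0 -> exists a b, v = a *: e + b *: J2 e.
Proof.
move=> e0 D0.
have [d1 d2] : (cdet e v).1 = 0 /\ (cdet e v).2 = 0.
  move/eqP: D0; rewrite /cdet2 paddr_eq0 ?sqr_ge0 // !sqrf_eq0.
  by case/andP => /eqP-> /eqP->.
pose n := e.1.1 ^+ 2 + e.1.2 ^+ 2 + e.2.1 ^+ 2 + e.2.2 ^+ 2.
pose a : C1 R := cmul (e.1.1, - e.1.2) v.1 + cmul (e.2.1, - e.2.2) v.2.
have n0 : n != 0.
  apply: contra_neq e0 => /eqP; rewrite /n !paddr_eq0 ?addr_ge0 ?sqr_ge0 // !sqrf_eq0.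
  case: (e) => [[? ?] [? ?]] /=.
  by case/andP => /andP[/andP[/eqP-> /eqP->] /eqP->] /eqP->.
have nv : n *: v = cscale a e.
  rewrite cscaleE /a /n; move: d1 d2.
  case: (e) (v) => [[x y] [z t]] [[x' y'] [z' t']]; rewrite cdetE /= => d1 d2.
  transitivity ((((x ^+ 2 + y ^+ 2 + z ^+ 2 + t ^+ 2) * x', (x ^+ 2 + y ^+ 2 + z ^+ 2 + t ^+ 2) * y'),
    ((x ^+ 2 + y ^+ 2 + z ^+ 2 + t ^+ 2) * z', (x ^+ 2 + y ^+ 2 + z ^+ 2 + t ^+ 2) * t')) : C2 R); first by [].
  transitivity (((((x * x' + y * y' + (z * z' + t * t')) * x - (x * y' - y * x' + (z * t' - t * z')) * y),
   ((x * x' + y * y' + (z * z' + t * t')) * y + (x * y' - y * x' + (z * t' - t * z')) * x)),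
   (((x * x' + y * y' + (z * z' + t * t')) * z - (x * y' - y * x' + (z * t' - t * z')) * t),
   ((x * x' + y * y' + (z * z' + t * t')) * t + (x * y' - y * x' + (z * t' - t * z')) * z))) : C2 R).
    have E1 : x * z' - y * t' - (z * x' - t * y') = 0 by exact: d1.
    have E2 : x * t' + y * z' - (z * y' + t * x') = 0 by exact: d2.
    congr (_, _, (_, _)).
    - apply/eqP; rewrite -subr_eq0; apply/eqP.
      rewrite [LHS](_ : _ = - z * (x * z' - y * t' - (z * x' - t * y')) - t * (x * t' + y * z' - (z * y' + t * x'))); last by ring.
      by rewrite E1 E2 !mulr0 subr0.
    - apply/eqP; rewrite -subr_eq0; apply/eqP.
      rewrite [LHS](_ : _ = t * (x * z' - y * t' - (z * x' - t * y')) - z * (x * t' + y * z' - (z * y' + t * x'))); last by ring.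
      by rewrite E1 E2 !mulr0 subr0.
    - apply/eqP; rewrite -subr_eq0; apply/eqP.
      rewrite [LHS](_ : _ = x * (x * z' - y * t' - (z * x' - t * y')) + y * (x * t' + y * z' - (z * y' + t * x'))); last by ring.
      by rewrite E1 E2 !mulr0 addr0.
    - apply/eqP; rewrite -subr_eq0; apply/eqP.
      rewrite [LHS](_ : _ = - y * (x * z' - y * t' - (z * x' - t * y')) + x * (x * t' + y * z' - (z * y' + t * x'))); last by ring.
      by rewrite E1 E2 !mulr0 addr0.
  rewrite /cmul /=.
  by congr (_, _, (_, _)); ring.
exists (n^-1 * a.1), (n^-1 * a.2).
by rewrite -!scalerA -scalerDr -/(cscale a e) -nv scalerA mulVf // scale1r.
Qed.

(** A real linear form that vanishes on the complex line of [e] but not at [v]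
shows that [e] and [v] are independent over the complex numbers. *)
Lemma cdet2_neq0 (l : C2 R -> R) e v : (forall a u u', l (a *: u + u') = a * l u + l u') ->
  e != 0 -> l e = 0 -> l (J2 e) = 0 -> l v != 0 -> cdet2 e v != 0.
Proof.
move=> lin e0 le lJe; apply: contra_neq => /(cdet2_eq0 e0)[a [b ->]].
have l0 : l 0 = 0 by have := lin (-1) 0 0; rewrite scaler0 addr0 mulN1r addNr.
by rewrite lin le -[b *: _]addr0 lin lJe l0 !mulr0 !addr0.
Qed.

Lemma cvg_cdet2 (T : Type) (F : set_system T) {FF : Filter F} (a b : T -> C2 R) a0 b0 :
  a @ F --> a0 -> b @ F --> b0 -> (fun t => cdet2 (a t) (b t)) @ F --> cdet2 a0 b0.
Proof.
move=> ca cb.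
have c11 (u : T -> C2 R) (u0 : C2 R) : u @ F --> u0 -> (fun t => (u t).1.1) @ F --> u0.1.1.
  by move=> cu; apply: cvg_comp (cvg_comp _ _ cu cvg_fst) cvg_fst.
have c12 (u : T -> C2 R) (u0 : C2 R) : u @ F --> u0 -> (fun t => (u t).1.2) @ F --> u0.1.2.
  by move=> cu; apply: cvg_comp (cvg_comp _ _ cu cvg_fst) cvg_snd.
have c21 (u : T -> C2 R) (u0 : C2 R) : u @ F --> u0 -> (fun t => (u t).2.1) @ F --> u0.2.1.
  by move=> cu; apply: cvg_comp (cvg_comp _ _ cu cvg_snd) cvg_fst.
have c22 (u : T -> C2 R) (u0 : C2 R) : u @ F --> u0 -> (fun t => (u t).2.2) @ F --> u0.2.2.
  by move=> cu; apply: cvg_comp (cvg_comp _ _ cu cvg_snd) cvg_snd.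
have lD (u w : T -> R) (x y : R) : u @ F --> x -> w @ F --> y ->
    (fun t => u t + w t) @ F --> x + y by exact: cvgD.
have lB (u w : T -> R) (x y : R) : u @ F --> x -> w @ F --> y ->
    (fun t => u t - w t) @ F --> x - y by exact: cvgB.
have lM (u w : T -> R) (x y : R) : u @ F --> x -> w @ F --> y ->
    (fun t => u t * w t) @ F --> x * y by exact: cvgM.
rewrite /cdet2 /cdet /cmul /=.
have lX (u : T -> R) (x : R) : u @ F --> x -> (fun t => u t ^+ 2) @ F --> x ^+ 2.
  by move=> cu; exact: (lM _ _ _ _ cu cu).
apply: (lD); apply: (lX); apply: (lB).
- by apply: (lB); apply: (lM); auto.
- by apply: (lB); apply: (lM); auto.
- by apply: (lD); apply: (lM); auto.
- by apply: (lD); apply: (lM); auto.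
Qed.

End ComplexCramer.

Section Contact.
Context (R : realType).
Implicit Types (e v w : C2 R).

Lemma cvg_J2 (T : Type) (F : set_system T) {FF : Filter F} (u : T -> C2 R) u0 :
  u @ F --> u0 -> (fun t => J2 (u t)) @ F --> J2 u0.
Proof.
move=> cu; have s : sdiff (@J2 R) u0 (@J2 R).
  apply: sdiff_linear; first exact: J2_linear.
  by exists 1 => v; rewrite mul1r normJ2.
exact: (continuous_cvg _ (sdiff_continuous s)).
Qed.

Variables (A : set (C2 R)) (f : C2 R -> R) (p e0 V K : C2 R) (h hx hy L : R).
Hypothesis (oA : open A) (Ap : A p) (cf : Ck 3 A f) (h0 : 0 < h).
Hypothesis hE : pd f V p = h.
Hypothesis hJ : pd f (J2 V) p = 0.
Hypothesis hxE : pd (pd f e0) V p + pd f K p = hx.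
Hypothesis hyE : pd (pd f (J2 e0)) V p + pd f (J2 K) p = hy.
Hypothesis lxE : levi (@J2 R) f p e0 V = hx.
Hypothesis lyE : levi (@J2 R) f p e0 (J2 V) = - hy.
Hypothesis LE : pd (pd (pd f e0) e0) V p + pd (pd (pd f (J2 e0)) (J2 e0)) V p +
  2 * levi (@J2 R) f p e0 K = L.

Definition contact (x : C2 R * R * C2 R) : Prop :=
  [/\ 0 < x.1.2, f x.1.1 = 0, pd f x.2 x.1.1 = 0, pd f (J2 x.2) x.1.1 = 0 &
      levi (@J2 R) f x.1.1 x.2 x.2 = 0].

Section Limits.
Variables (T : Type) (F : set_system T).
Context {FF : Filter F}.
Variables (m e : T -> C2 R) (s : T -> R).
Hypothesis (cm : m @ F --> p) (ce : e @ F --> e0) (cs : s @ F --> (0 : R)).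
Hypothesis nc : \forall t \near F, contact (m t, s t, e t).

Let q t := m t + s t *: V.
Let es t := e t + s t *: K.
Let lD (a b : T -> R) (x y : R) : a @ F --> x -> b @ F --> y ->
  (fun t => a t + b t) @ F --> x + y.
Proof. exact: cvgD. Qed.
Let lM (a b : T -> R) (x y : R) : a @ F --> x -> b @ F --> y ->
  (fun t => a t * b t) @ F --> x * y.
Proof. exact: cvgM. Qed.
Let lN (a : T -> R) (x : R) : a @ F --> x -> (fun t => - a t) @ F --> - x.
Proof. exact: cvgN. Qed.
Let lC (x : R) : (fun _ : T => x) @ F --> x.
Proof. exact: cvg_cst. Qed.
Let lK (x : C2 R) : (fun _ : T => x) @ F --> x.
Proof. exact: cvg_cst. Qed.

Let lB (a b : T -> R) (x y : R) : a @ F --> x -> b @ F --> y ->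
  (fun t => a t - b t) @ F --> x - y.
Proof. exact: cvgB. Qed.

Let s0 : \forall t \near F, 0 < s t.
Proof. by apply: filterS nc => t []. Qed.

Let cq : q @ F --> p. Proof. exact: cvg_moving. Qed.
Let ces : es @ F --> e0. Proof. exact: cvg_moving. Qed.

Let cf1 : Ck 1 A f. Proof. exact: Ck_le cf. Qed.
Let cf2 : Ck 2 A f. Proof. exact: Ck_le cf. Qed.

Let fV := fin_dimC2 R.

Let nA : \forall t \near F, A (q t).
Proof. by apply: cq; exact: open_nbhs_nbhs. Qed.

Lemma contact_value : (fun t => f (q t) / s t) @ F --> h.
Proof.
rewrite -hE; apply: cvg_near_eq (cvg_quotient fV oA Ap cm cs s0 cf1) _.
by apply: filterS nc => t [_ /= -> _ _ _]; rewrite subr0.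
Qed.

Lemma contact_quotient_pd (u u' : T -> C2 R) (u0 k : C2 R) :
  u @ F --> u0 -> (\forall t \near F, pd f (u t) (m t) = 0) ->
  (\forall t \near F, u' t = u t + s t *: k) ->
  (fun t => pd f (u' t) (q t) / s t) @ F --> pd (pd f u0) V p + pd f k p.
Proof.
move=> cu zu Eu.
have H := lD (cvg_quotient_pd (FF := FF) (v := V) fV oA Ap cm cs s0 cf cu)
               (cvg_pd (FF := FF) fV oA Ap cf cq (@lK k)).
apply: cvg_near_eq H _.
near=> t; have -> : u' t = u t + s t *: k by near: t.
have st : 0 < s t by near: t.
have At : A (q t) by near: t.
rewrite (pdDv fV oA At cf1) (pdZv fV oA At cf1) /= -/(q t).
have -> : pd f (u t) (m t) = 0 by near: t.
by field; rewrite gt_eqF.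
Unshelve. all: by end_near. Qed.

Lemma contact_pd : (fun t => pd f (es t) (q t) / s t) @ F --> hx.
Proof.
rewrite -hxE; apply: (contact_quotient_pd ce); first by apply: filterS nc => t [].
exact: nearW.
Qed.

Lemma contact_pdJ : (fun t => pd f (J2 (es t)) (q t) / s t) @ F --> hy.
Proof.
rewrite -hyE; apply: (contact_quotient_pd (cvg_J2 ce)).
  by apply: filterS nc => t [].
by apply: nearW => t; rewrite J2D J2Z.
Qed.

Lemma cvg_levi (u w : T -> C2 R) u0 w0 : u @ F --> u0 -> w @ F --> w0 ->
  (fun t => levi (@J2 R) f (q t) (u t) (w t)) @ F --> levi (@J2 R) f p u0 w0.
Proof.
move=> cu cw.
exact: (lD (cvg_pd2 (FF := FF) fV oA Ap cf cq cu cw)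
  (cvg_pd2 (FF := FF) fV oA Ap cf cq (cvg_J2 (FF := FF) cu) (cvg_J2 (FF := FF) cw))).
Qed.

Lemma contact_levi :
  (fun t => levi (@J2 R) f (q t) (es t) (es t) / s t) @ F --> L.
Proof.
have cJ := cvg_J2 (FF := FF) ce.
have H1 := lD (cvg_quotient_pd2 (FF := FF) (v := V) fV oA Ap cm cs s0 cf ce ce)
               (cvg_quotient_pd2 (FF := FF) (v := V) fV oA Ap cm cs s0 cf cJ cJ).
have H2 := lD H1 (lM (@lC 2) (cvg_levi ce (@lK K))).
have H3 := lD H2 (lM cs (cvg_levi (@lK K) (@lK K))).
rewrite mul0r addr0 LE in H3; apply: cvg_near_eq H3 _.
near=> t.
have st : 0 < s t by near: t.
have At : A (q t) by near: t.
have : contact (m t, s t, e t) by near: t.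
move=> [_ _ _ _]; rewrite {1}/levi /= => E.
rewrite /es (leviDl fV (@J2_linear R) oA At cf2) (leviZl fV (@J2_linear R) oA At cf2).
rewrite !(leviDr fV (@J2_linear R) oA At cf2) !(leviZr fV (@J2_linear R) oA At cf2).
rewrite (leviC _ oA At cf2 K (e t)).
set l1 := levi _ _ _ (e t) K; set l2 := levi _ _ _ K K.
rewrite /levi -/(q t).
rewrite (_ : forall a b c d : R, a + b = 0 -> (c - a) / s t + (d - b) / s t = (c + d) / s t) //.
  by rewrite -/(q t); field; rewrite gt_eqF.
by move=> a b c d ab; rewrite -mulrDl addrACA -opprD ab subr0.
Unshelve. all: by end_near. Qed.

Variable eta : R.

Let S := (hx ^+ 2 + hy ^+ 2) / h ^+ 2.

Let h00 : h != 0. Proof. by rewrite gt_eqF. Qed.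

Lemma contact_form_tangent : (fun t => power_form eta f (q t) (es t) (es t)) @ F -->
  - (L / h) + (1 - eta) * S.
Proof.
have cV : (fun t => (f (q t) / s t)^-1) @ F --> h^-1 by exact: cvgV h00 contact_value.
have H1 := lN (lM contact_levi cV).
have H2 := lD (lM contact_pd contact_pd) (lM contact_pdJ contact_pdJ).
have H3 := lM (lM (@lC (1 - eta)) H2) (lM cV cV).
have H4 := lD H1 H3.
rewrite (_ : - (L / h) + (1 - eta) * S =
  - (L * h^-1) + (1 - eta) * (hx * hx + hy * hy) * (h^-1 * h^-1)); last first.
  by rewrite /S; field.
apply: cvg_near_eq H4 _.
near=> t.
have st : s t != 0 by rewrite gt_eqF //; near: t.
rewrite /power_form /=; have [->|fq] := eqVneq (f (q t)) 0.
  by rewrite expr0n /= mul0r invr0 !mulr0 oppr0.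
by field; rewrite fq st.
Unshelve. all: by end_near. Qed.

Lemma contact_form_transverse : (fun t => power_form eta f (q t) (s t *: V) (s t *: V)) @ F -->
  1 - eta.
Proof.
have cV : (fun t => (f (q t) / s t)^-1) @ F --> h^-1 by exact: cvgV h00 contact_value.
have H1 := lN (lM (lM cs (cvg_levi (@lK V) (@lK V))) cV).
have c1 := cvg_pd (FF := FF) fV oA Ap cf cq (@lK V).
have c2 := cvg_pd (FF := FF) fV oA Ap cf cq (@lK (J2 V)).
have H2 := lD (lM c1 c1) (lM c2 c2).
have H3 := lM (lM (@lC (1 - eta)) H2) (lM cV cV).
have H4 := lD H1 H3.
rewrite hE hJ in H4.
rewrite (_ : 1 - eta = - (0 * levi (@J2 R) f p V V * h^-1) +
   (1 - eta) * (h * h + 0 * 0) * (h^-1 * h^-1)); last by field.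
apply: cvg_near_eq H4 _.
near=> t.
have st : s t != 0 by rewrite gt_eqF //; near: t.
have At : A (q t) by near: t.
rewrite /power_form /= (leviZl fV (@J2_linear R) oA At cf2) (leviZr fV (@J2_linear R) oA At cf2).
rewrite J2Z !(pdZv fV oA At cf1).
have [->|fq] := eqVneq (f (q t)) 0.
  by rewrite expr0n /= mul0r invr0 !mulr0 oppr0.
by field; rewrite fq st.
Unshelve. all: by end_near. Qed.

Lemma contact_form_mixed : (fun t => power_form eta f (q t) (es t) (s t *: V)) @ F -->
  - (eta * hx / h).
Proof.
have cV : (fun t => (f (q t) / s t)^-1) @ F --> h^-1 by exact: cvgV h00 contact_value.
have H1 := lN (lM (cvg_levi ces (@lK V)) cV).
have c1 := cvg_pd (FF := FF) fV oA Ap cf cq (@lK V).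
have c2 := cvg_pd (FF := FF) fV oA Ap cf cq (@lK (J2 V)).
have H2 := lD (lM contact_pd c1) (lM contact_pdJ c2).
have H3 := lM (lM (@lC (1 - eta)) H2) (lM cV cV).
have H4 := lD H1 H3.
rewrite hE hJ lxE in H4.
rewrite (_ : - (eta * hx / h) = - (hx * h^-1) +
   (1 - eta) * (hx * h + hy * 0) * (h^-1 * h^-1)); last by field.
apply: cvg_near_eq H4 _.
near=> t.
have st : s t != 0 by rewrite gt_eqF //; near: t.
have At : A (q t) by near: t.
rewrite /power_form /= (leviZr fV (@J2_linear R) oA At cf2).
rewrite J2Z !(pdZv fV oA At cf1).
have [->|fq] := eqVneq (f (q t)) 0.
  by rewrite expr0n /= mul0r invr0 !mulr0 oppr0.
by field; rewrite fq st.
Unshelve. all: by end_near. Qed.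

Lemma contact_form_mixedJ :
  (fun t => power_form eta f (q t) (es t) (J2 (s t *: V))) @ F --> eta * hy / h.
Proof.
have cV : (fun t => (f (q t) / s t)^-1) @ F --> h^-1 by exact: cvgV h00 contact_value.
have H1 := lN (lM (cvg_levi ces (@lK (J2 V))) cV).
have c1 := cvg_pd (FF := FF) fV oA Ap cf cq (@lK V).
have c2 := cvg_pd (FF := FF) fV oA Ap cf cq (@lK (J2 V)).
have H2 := lB (lM contact_pd c2) (lM contact_pdJ c1).
have H3 := lM (lM (@lC (1 - eta)) H2) (lM cV cV).
have H4 := lD H1 H3.
rewrite hE hJ lyE in H4.
rewrite (_ : eta * hy / h = - (- hy * h^-1) +
   (1 - eta) * (hx * 0 - hy * h) * (h^-1 * h^-1)); last by field.
apply: cvg_near_eq H4 _.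
near=> t.
have st : s t != 0 by rewrite gt_eqF //; near: t.
have At : A (q t) by near: t.
rewrite /power_form /= J2Z J2Z J2J2 (leviZr fV (@J2_linear R) oA At cf2).
rewrite !(pdZv fV oA At cf1) (pdNv fV oA At cf1).
have [->|fq] := eqVneq (f (q t)) 0.
  by rewrite expr0n /= mul0r invr0 !mulr0 oppr0.
by field; rewrite fq st.
Unshelve. all: by end_near. Qed.

End Limits.

(** The limit of the determinant of [power_form] on the complex span of the
two directions, up to terms that vanish. *)
Definition contact_det (eta : R) : R :=
  - (1 - eta) * (L / h) + (1 - 2 * eta) * ((hx ^+ 2 + hy ^+ 2) / h ^+ 2).

Lemma contact_detE (eta : R) :
  (- (L / h) + (1 - eta) * ((hx ^+ 2 + hy ^+ 2) / h ^+ 2)) * (1 - eta) -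
  ((- (eta * hx / h)) ^+ 2 + (eta * hy / h) ^+ 2) = contact_det eta.
Proof. by rewrite /contact_det; field; rewrite gt_eqF. Qed.

Section Form.
Variables (eta : R) (q : C2 R) (Aq : A q).
Let N := power_form eta f q.
Let fV := fin_dimC2 R.
Let cf1 : Ck 1 A f. Proof. exact: Ck_le cf. Qed.
Let cf2 : Ck 2 A f. Proof. exact: Ck_le cf. Qed.

Lemma power_form_expand (a b : C2 R) (x y s t : R) :
  let w := x *: a + y *: J2 a + (s *: b + t *: J2 b) in
  N w w = (x ^+ 2 + y ^+ 2) * N a a + (s ^+ 2 + t ^+ 2) * N b b +
  ((x * s + y * t) * N a b + (x * t - y * s) * N a (J2 b)) *+ 2.
Proof.
rewrite /N /power_form (levi_expand fV (@J2_linear R) (@J2J2 R) oA Aq cf2).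
rewrite !J2D !J2Z !J2J2 !(pdDv fV oA Aq cf1) !(pdZv fV oA Aq cf1) !(pdNv fV oA Aq cf1).
by ring.
Qed.

Lemma power_form_pos (a b w : C2 R) : 0 < N b b ->
  0 < N a a * N b b - (N a b ^+ 2 + N a (J2 b) ^+ 2) ->
  w != 0 -> (exists x y s t, w = x *: a + y *: J2 a + (s *: b + t *: J2 b)) ->
  0 < N w w.
Proof.
move=> b0 d0 w0 [x [y [s [t wE]]]].
have := power_form_expand a b x y s t; rewrite /= -wE => NE.
move: b0 d0 NE; move: (N a a) (N b b) (N a b) (N a (J2 b)) => A0 C B1 B2 C0 D0 NE.
have E : C * N w w = (C * s + x * B1 - y * B2) ^+ 2 + (C * t + x * B2 + y * B1) ^+ 2
    + (A0 * C - (B1 ^+ 2 + B2 ^+ 2)) * (x ^+ 2 + y ^+ 2) by rewrite NE; ring.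
rewrite -(pmulr_rgt0 _ C0) E.
have [xy|] := eqVneq (x ^+ 2 + y ^+ 2) 0.
  have : x = 0 by have := sqr_ge0 x; have := sqr_ge0 y => *; apply/eqP; rewrite -sqrf_eq0 eq_le; apply/andP; split; lra.
  have : y = 0 by have := sqr_ge0 x; have := sqr_ge0 y => *; apply/eqP; rewrite -sqrf_eq0 eq_le; apply/andP; split; lra.
  move=> y0 x0; rewrite x0 y0 !mul0r expr0n /= !addr0 mulr0 addr0 subr0.
  rewrite !exprMn -mulrDr pmulr_rgt0 ?exprn_gt0 //.
  have [/eqP st|st] := eqVneq (s ^+ 2 + t ^+ 2) 0; last by rewrite lt_neqAle eq_sym st addr_ge0 ?sqr_ge0.
  move: st; rewrite paddr_eq0 ?sqr_ge0 // !sqrf_eq0 => /andP[/eqP s0 /eqP t0].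
  by move: w0; rewrite wE x0 y0 s0 t0 !scale0r !addr0 eqxx.
move=> xy; have xy0 : 0 < x ^+ 2 + y ^+ 2 by rewrite lt_neqAle eq_sym xy addr_ge0 ?sqr_ge0.
by rewrite ltr_wpDl ?mulr_gt0 // addr_ge0 ?sqr_ge0.
Qed.

End Form.

(** Test vectors [e + s K + s (mu1 V + mu2 J V)] at the point [p + s V], with
[mu] minimizing the limit of the form. *)
Lemma contact_necessary (eta : R) : 0 < eta < 1 ->
  f p = 0 -> pd f e0 p = 0 -> pd f (J2 e0) p = 0 -> levi (@J2 R) f p e0 e0 = 0 ->
  (\forall s \near 0^'+, forall w, w != 0 -> 0 < power_form eta f (p + s *: V) w w) ->
  0 <= contact_det eta.
Proof.
move=> /andP[eta0 eta1] fp f1 f2 f3 pos.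
have nc : \forall s \near (0 : R)^'+, contact (p, s, e0).
  by near=> s; split => //=; near: s; exact: nbhs_right_gt.
have cs : (fun s : R => s) @ (0 : R)^'+ --> (0 : R) by apply: cvg_within.
have ce : (fun _ : R => e0) @ (0 : R)^'+ --> e0 by exact: cvg_cst.
have cm : (fun _ : R => p) @ (0 : R)^'+ --> p by exact: cvg_cst.
have cA := contact_form_tangent (FF := at_right_proper_filter _) cm ce cs nc (eta := eta).
have cC := contact_form_transverse (FF := at_right_proper_filter _) cm cs nc (eta := eta).
have cB := contact_form_mixed (FF := at_right_proper_filter _) cm ce cs nc (eta := eta).
have cD := contact_form_mixedJ (FF := at_right_proper_filter _) cm ce cs nc (eta := eta).
have := contact_detE eta.
move: cA cC cB cD.
move: (- (L / h) + _) (- (eta * hx / h)) (eta * hy / h) => A0 B1 B2 cA cC cB cD <-.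
have lD (a b : R -> R) (x y : R) : a @ 0^'+ --> x -> b @ 0^'+ --> y ->
    (fun t => a t + b t) @ 0^'+ --> x + y by exact: cvgD.
have lZ (a : R -> R) (k x : R) : a @ 0^'+ --> x ->
    (fun t => k * a t) @ 0^'+ --> k * x by move=> ca; exact: cvgM (cvg_cst _) ca.
have C0 : 0 < 1 - eta by rewrite subr_gt0.
pose a := - (B1 / (1 - eta)); pose b := - (B2 / (1 - eta)).
have H3 := lD _ _ _ _ (lD _ _ _ _ cA (lZ _ (a ^+ 2 + b ^+ 2) _ cC))
  (lD _ _ _ _ (lZ _ (2 * a) _ cB) (lZ _ (2 * b) _ cD)).
suff : 0 <= A0 + (a ^+ 2 + b ^+ 2) * (1 - eta) + (2 * a * B1 + 2 * b * B2).
  rewrite -(pmulr_lge0 _ C0) /a /b; congr (0 <= _); field; exact: lt0r_neq0.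
apply: (cvgr_to_ge H3).
near=> s.
have As : A (p + s *: V).
  near: s; have : (fun s : R => p + s *: V) @ (0 : R)^'+ --> p by exact: (cvg_moving V cm cs).
  by apply; exact: open_nbhs_nbhs.
have ps : forall w, w != 0 -> 0 < power_form eta f (p + s *: V) w w by near: s.
have := power_form_expand eta As (e0 + s *: K) (s *: V) 1 0 a b.
set w := (X in let w := X in _).
move=> /= E.
rewrite [X in 0 <= X](_ : _ = power_form eta f (p + s *: V) w w); last by rewrite E; ring.
have [->|/ps/ltW//] := eqVneq w 0.
have := power_form_expand eta As 0 0 0 0 0 0.
move=> /=; rewrite !scale0r !addr0 => ->.
by rewrite le_eqVlt; apply/orP; left; apply/eqP; ring.
Unshelve. all: by end_near. Qed.

Lemma contact_sufficient (eta : R) : 0 < eta < 1 ->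
  f p = 0 -> pd f e0 p = 0 -> pd f (J2 e0) p = 0 -> e0 != 0 -> 0 < contact_det eta ->
  exists2 r : R, 0 < r & forall m s e, ball p r m -> s < r -> ball e0 r e ->
    contact (m, s, e) -> forall w, w != 0 -> 0 < power_form eta f (m + s *: V) w w.
Proof.
move=> /andP[eta0 eta1] fp f1 f2 e00 D0.
have C0 : 0 < 1 - eta by rewrite subr_gt0.
pose F := within contact (nbhs (p, (0 : R), e0)).
have FF : Filter F by apply: within_filter; exact: nbhs_filter.
have nc : \forall x \near F, contact (x.1.1, x.1.2, x.2).
  by apply: (@filterE _ (nbhs (p, (0 : R), e0))) => -[[]].
have cm : (fun x : C2 R * R * C2 R => x.1.1) @ F --> p.
  by apply: cvg_within_filter; apply: cvg_comp cvg_fst cvg_fst.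
have cs : (fun x : C2 R * R * C2 R => x.1.2) @ F --> (0 : R).
  by apply: cvg_within_filter; apply: cvg_comp cvg_fst cvg_snd.
have ce : (fun x : C2 R * R * C2 R => x.2) @ F --> e0.
  by apply: cvg_within_filter; exact: cvg_snd.
have cA := contact_form_tangent (FF := FF) cm ce cs nc (eta := eta).
have cC := contact_form_transverse (FF := FF) cm cs nc (eta := eta).
have cB := contact_form_mixed (FF := FF) cm ce cs nc (eta := eta).
have cD := contact_form_mixedJ (FF := FF) cm ce cs nc (eta := eta).
have lM (a b : C2 R * R * C2 R -> R) (x y : R) : a @ F --> x -> b @ F --> y ->
    (fun t => a t * b t) @ F --> x * y by exact: cvgM.
have lD (a b : C2 R * R * C2 R -> R) (x y : R) : a @ F --> x -> b @ F --> y ->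
    (fun t => a t + b t) @ F --> x + y by exact: cvgD.
have lB (a b : C2 R * R * C2 R -> R) (x y : R) : a @ F --> x -> b @ F --> y ->
    (fun t => a t - b t) @ F --> x - y by exact: cvgB.
have cE := lB _ _ _ _ (lM _ _ _ _ cA cC) (lD _ _ _ _ (lM _ _ _ _ cB cB) (lM _ _ _ _ cD cD)).
have dV : cdet2 e0 V != 0.
  apply: (@cdet2_neq0 _ (fun v => pd f v p)) => //; last by rewrite hE gt_eqF.
  have cf1 : Ck 1 A f by exact: Ck_le cf.
  by move=> a u u'; rewrite (pdDv (fin_dimC2 R) oA Ap cf1) (pdZv (fin_dimC2 R) oA Ap cf1).
have ces : (fun x : C2 R * R * C2 R => x.2 + x.1.2 *: K) @ F --> e0 by exact: (cvg_moving (FF := FF) K ce cs).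
have cW : (fun x : C2 R * R * C2 R => cdet2 (x.2 + x.1.2 *: K) V) @ F --> cdet2 e0 V.
  exact: cvg_cdet2 ces (cvg_cst V).
have cq : (fun x : C2 R * R * C2 R => x.1.1 + x.1.2 *: V) @ F --> p by exact: (cvg_moving (FF := FF) V cm cs).
have : F [set x | forall w, w != 0 -> 0 < power_form eta f (x.1.1 + x.1.2 *: V) w w].
  near=> x => /= w w0.
  have Ax : A (x.1.1 + x.1.2 *: V) by near: x; apply: cq; exact: open_nbhs_nbhs.
  have x0 : 0 < x.1.2 by have [] : contact (x.1.1, x.1.2, x.2) by near: x.
  apply: (power_form_pos Ax (a := x.2 + x.1.2 *: K) (b := x.1.2 *: V)) => //.
  - by near: x; exact: (cvgr_gt _ cC).
  - near: x; apply: (cvgr_gt _ cE).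
    by rewrite -!expr2 contact_detE.
  - have dx : cdet2 (x.2 + x.1.2 *: K) V != 0.
      by near: x; apply: (cvgr_neq0 _ cW).
    have wE := Cramer w dx.
    move: (cramer1 _ _ _) (cramer2 _ _ _) wE => l u ->.
    exists l.1, l.2, (u.1 / x.1.2), (u.2 / x.1.2).
    by rewrite J2Z !scalerA !divfK ?gt_eqF.
rewrite /F /within /= => /nbhs_ballP[r /= r0 H]; exists r => // m s e bm sr be ct w w0.
have [s0 _ _ _ _] := ct; apply: (H (m, s, e)) => //=.
split; [split|] => //=.
by rewrite /ball /= sub0r normrN gtr0_norm.
Unshelve. all: by end_near. Qed.

End Contact.

(** * Calculus along a foliation by complex curves *)

Section VectorDerivative.
Context (R : realType) (V W : normedModType R).

Fact vd_spec : {p : (V -> W) -> V -> V -> W | forall f v z, 'D_v f z = p f v z}.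
Proof. by exists (fun f v z => 'D_v f z). Qed.

(** Opaque for the same reason as [pd]. *)
Definition vd : (V -> W) -> V -> V -> W := sval vd_spec.

Lemma vdE f v z : 'D_v f z = vd f v z.
Proof. exact: (svalP vd_spec). Qed.

Lemma vdE_fun f v : (fun z => 'D_v f z) = vd f v.
Proof. by apply/funext => z; rewrite vdE. Qed.

Lemma Ck_vd k (A : set V) g v : Ck k.+1 A g -> Ck k A (vd g v).
Proof. by move=> cg; rewrite -vdE_fun; exact: Ck_derive. Qed.

Lemma vd_near (f g : V -> W) v z : {near z, f =1 g} -> vd f v z = vd g v z.
Proof. by rewrite -!vdE; exact: near_eq_derive. Qed.

Lemma vd_sdiffE (f : V -> W) L v z : sdiff f z L -> vd f v z = L v.
Proof. by move=> /sdiff_derive/(_ v)[_ <-]; rewrite vdE. Qed.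

Hypotheses (fV : fin_dim V) (sW : C1_strict W).
Variable A : set V.
Hypothesis oA : open A.

Lemma vd_sdiff g z : Ck 1 A g -> A z -> sdiff g z (fun v => vd g v z).
Proof.
move=> cg Az; have -> : (fun v => vd g v z) = (fun v => 'D_v g z).
  by apply/funext => v; rewrite vdE.
exact: sW fV oA cg Az.
Qed.

Lemma pd_coordinate d (e : 'I_d -> W) x i g v z : coordinates e x -> Ck 1 A g -> A z ->
  pd (fun y => x i (g y)) v z = x i (vd g v z).
Proof.
move=> [xl _ xn] cg Az; rewrite -pdE -vdE.
have lin (a : R) u w : x i (a *: u + w) = a *: x i u + x i w by rewrite xl.
have bd : exists C : R, forall w, `|x i w| <= C * `|w| by exists 1 => w; rewrite mul1r.
exact: (Ck_linear lin bd oA cg).2.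
Qed.

Lemma Ck_coordinate d (e : 'I_d -> W) x i k g : coordinates e x -> Ck k A g ->
  Ck k A (fun y => x i (g y)).
Proof.
move=> [xl _ xn] cg.
apply: (Ck_linear (L := x i) _ _ oA cg).1; first by move=> a u w; rewrite xl.
by exists 1 => w; rewrite mul1r.
Qed.

Lemma vdC g u v z : fin_dim W -> Ck 2 A g -> A z ->
  vd (vd g v) u z = vd (vd g u) v z.
Proof.
move=> [d [e [x ex]]] cg Az; have [xl xe xn] := ex.
rewrite (xe (vd (vd g v) u z)) (xe (vd (vd g u) v z)).
apply: eq_bigr => i _; congr (_ *: _).
have H a b : x i (vd (vd g a) b z) = pd (pd (fun y => x i (g y)) a) b z.
  rewrite -(pd_coordinate _ _ ex (Ck_vd a cg) Az); apply: pd_near.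
  near=> y; apply/esym/(pd_coordinate _ _ ex (CkS cg)).
  by near: y; exact: open_nbhs_nbhs.
by rewrite !H (pd2C oA Az (Ck_coordinate i ex cg)).
Unshelve. all: by end_near. Qed.

End VectorDerivative.

Section Along.
Context (R : realType) (V W : normedModType R).
Hypotheses (fV : fin_dim V) (fW : fin_dim W) (sW : C1_strict W).
Variables (B : set W).
Hypothesis oB : open B.

Lemma is_derive_coordinate d (e : 'I_d -> W) x i (w : V -> W) H z u :
  coordinates e x -> sdiff w z H -> is_derive z u (fun y => x i (w y)) (x i (H u)).
Proof.
move=> [xl _ xn] sw.
have s : sdiff (x i) (w z) (x i).
  by apply: sdiff_linear; [move=> a v v'; rewrite xl|exists 1 => v; rewrite mul1r].
by have [d1 d2] := sdiff_derive (sdiff_comp sw s) u; split.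
Qed.

Lemma is_derive_sum_prod (I : Type) (r : seq I) (a b : I -> V -> R) (da db : I -> R) z u :
  (forall i, is_derive z u (a i) (da i)) -> (forall i, is_derive z u (b i) (db i)) ->
  is_derive z u (fun y => \sum_(i <- r) a i y * b i y)
    (\sum_(i <- r) (da i * b i z + a i z * db i)).
Proof.
move=> Ha Hb; elim: r => [|i r IH].
  under eq_fun do rewrite big_nil; rewrite big_nil; exact: is_derive_cst.
under eq_fun do rewrite big_cons; rewrite big_cons.
have H := is_deriveD (is_deriveM (Ha i) (Hb i)) IH.
by apply: is_derive_eq H _; rewrite /GRing.scale /=; ring.
Qed.

Lemma is_derive_comp_sdiff (f : W -> R) (g : V -> W) G z u : Ck 1 B f -> sdiff g z G ->
  B (g z) -> is_derive z u (fun y => f (g y)) (pd f (G u) (g z)).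
Proof.
move=> cf sg Bz; have [d1 d2] := sdiff_derive (sdiff_comp sg (pd_sdiff fW oB Bz cf)) u.
by split.
Qed.

Let nearB (g : V -> W) G z : sdiff g z G -> B (g z) -> \forall y \near z, B (g y).
Proof. by move=> sg Bz; apply: (sdiff_continuous sg); exact: open_nbhs_nbhs. Qed.

(** The product rule for a first derivative of [f] in a varying direction. *)
Lemma pd_along (f : W -> R) (g w : V -> W) G H z u : Ck 2 B f ->
  sdiff g z G -> sdiff w z H -> B (g z) ->
  pd (fun y => pd f (w y) (g y)) u z =
  pd f (H u) (g z) + pd (pd f (w z)) (G u) (g z).
Proof.
move=> cf sg sw Bz; have cf1 := CkS cf.
have [d [e [x [ex E]]]] := pd_coord fW oB.
have D := is_derive_sum_prod (index_enum 'I_d) (fun i => is_derive_coordinate i u ex sw)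
  (fun i => is_derive_comp_sdiff u (Ck_pd (e i) cf) sg Bz).
have nE : {near z, (fun y => pd f (w y) (g y)) =1
    (fun y => \sum_i x i (w y) * pd f (e i) (g y))}.
  by near=> y; rewrite (E f) //; near: y; exact: nearB sg Bz.
rewrite (pd_near u nE) -pdE; have [_ ->] := D.
rewrite big_split /= -(E f _ _ cf1 Bz); congr (_ + _).
rewrite (pd2C oB Bz cf) (E _ _ _ (Ck_pd (G u) cf) Bz).
by apply: eq_bigr => i _; rewrite (pd2C oB Bz cf).
Unshelve. all: by end_near. Qed.

Lemma Ck_pd_along k (A : set V) (f : W -> R) (g w : V -> W) : open A ->
  (forall z, A z -> B (g z)) -> Ck k.+1 B f -> Ck k A g -> Ck k A w ->
  Ck k A (fun y => pd f (w y) (g y)).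
Proof.
move=> oA AB cf cg cw; have cf1 : Ck 1 B f by apply: Ck_le cf.
have [d [e [x [ex E]]]] := pd_coord fW oB.
have ck := Ck_sum (index_enum 'I_d) oA (fun i => CkM oA (Ck_coordinate oA i ex cw)
  (Ck_comp fV fW sW oA oB AB cg (Ck_pd (e i) cf)).1).
by apply: (Ck_ext oA) ck => z Az /=; rewrite (E f) //; exact: AB.
Qed.

Lemma pd2_along (f : W -> R) (g v w : V -> W) G H K z u : Ck 3 B f ->
  sdiff g z G -> sdiff w z H -> sdiff v z K -> B (g z) ->
  is_derive z u (fun y => pd (pd f (w y)) (v y) (g y))
  (pd (pd f (H u)) (v z) (g z) + pd (pd f (w z)) (K u) (g z) +
  pd (pd (pd f (w z)) (v z)) (G u) (g z)).
Proof.
move=> cf sg sw sv Bz; have cf2 := CkS cf.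
have [d [e [x [ex E]]]] := pd_coord fW oB.
have EE y : B y -> forall w u, pd (pd f w) u y = \sum_i x i w * pd (pd f (e i)) u y.
  move=> By w' u'; rewrite (pd2C oB By cf2) (E (pd f u') y w' (Ck_pd _ cf2) By).
  by apply: eq_bigr => i _; rewrite (pd2C oB By cf2).
have Di i : is_derive z u (fun y => pd (pd f (e i)) (v y) (g y))
    (pd (pd f (e i)) (K u) (g z) + pd (pd (pd f (e i)) (v z)) (G u) (g z)).
  rewrite -(pd_along _ (Ck_pd (e i) cf) sg sv Bz) -pdE; apply: derivableP.
  have D := is_derive_sum_prod (index_enum 'I_d) (fun j => is_derive_coordinate j u ex sv)
    (fun j => is_derive_comp_sdiff u (Ck_pd (e j) (Ck_pd (e i) cf)) sg Bz).
  have nE : {near z, (fun y => pd (pd f (e i)) (v y) (g y)) =1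
      (fun y => \sum_j x j (v y) * pd (pd f (e i)) (e j) (g y))}.
    near=> y; rewrite (E (pd f (e i))) //; first exact: (CkS (Ck_pd _ cf)).
    by near: y; exact: nearB sg Bz.
  have [D1 _] := D; by apply: near_eq_derivable D1; apply: filterS nE => y ->.
have D := is_derive_sum_prod (index_enum 'I_d) (fun i => is_derive_coordinate i u ex sw) Di.
have nE : {near z, (fun y => pd (pd f (w y)) (v y) (g y)) =1
    (fun y => \sum_i x i (w y) * pd (pd f (e i)) (v y) (g y))}.
  by near=> y; rewrite EE //; near: y; exact: nearB sg Bz.
apply: (@near_eq_is_derive _ _ _ (fun y => \sum_i x i (w y) * pd (pd f (e i)) (v y) (g y))).
  by apply: filterS nE => y ->.
apply: (is_derive_eq D).
rewrite big_split /= -(EE _ Bz) -addrA; congr (_ + _).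
under eq_bigr => i _ do rewrite mulrDr.
rewrite big_split /= -(EE _ Bz); congr (_ + _).
have ne a b : {near g z, pd (pd f a) b =1 pd (pd f b) a}.
  near=> y; apply: (pd2C oB _ cf2); near: y; exact: open_nbhs_nbhs.
rewrite (pd_near _ (ne _ _)) (pd2C oB Bz (Ck_pd _ cf)).
rewrite (E (pd (pd f (v z)) (G u)) _ _ (Ck_pd _ (Ck_pd _ cf)) Bz).
apply: eq_bigr => i _; congr (_ * _); rewrite [RHS](pd2C oB Bz (Ck_pd _ cf)).
exact: pd_near (ne _ _).
Unshelve. all: by end_near. Qed.

End Along.

Section FoliatedMap.
Context (R : realType).

Definition dirx : C1 R * R := ((1, 0), 0).
Definition diry : C1 R * R := ((0, 1), 0).
Definition dirt : C1 R * R := ((0, 0), 1).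

Variables (A : set (C1 R * R)) (Phi : C1 R * R -> C2 R) (B : set (C2 R)) (f : C2 R -> R).
Hypotheses (oA : open A) (oB : open B) (cPhi : Ck 3 A Phi) (cf : Ck 3 B f).
Hypothesis AB : forall x, A x -> B (Phi x).
Hypothesis f0 : forall x, A x -> f (Phi x) = 0.
Hypothesis CR : forall x, A x -> vd Phi diry x = J2 (vd Phi dirx x).

Let fV := fin_dimC1R R.
Let fW := fin_dimC2 R.
Let sW := @C1_strictC2 R.

Let e := vd Phi dirx.
Let W := vd Phi dirt.
Let Wx := vd (vd Phi dirt) dirx.

Let cf1 : Ck 1 B f. Proof. exact: Ck_le cf. Qed.
Let cf2 : Ck 2 B f. Proof. exact: Ck_le cf. Qed.
Let ce : Ck 2 A e. Proof. exact: Ck_vd cPhi. Qed.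
Let cW : Ck 2 A W. Proof. exact: Ck_vd cPhi. Qed.
Let cPhi1 : Ck 1 A Phi. Proof. exact: Ck_le cPhi. Qed.
Let cPhi2 : Ck 2 A Phi. Proof. exact: Ck_le cPhi. Qed.

Let near_of (P : C1 R * R -> Prop) x : A x -> (forall y, A y -> P y) -> \forall y \near x, P y.
Proof.
by move=> Ax AP; apply: filterS AP _; exact: open_nbhs_nbhs.
Qed.

Let pd0 (g : C1 R * R -> R) x v : A x -> (forall y, A y -> g y = 0) -> pd g v x = 0.
Proof.
move=> Ax g0; rewrite (@pd_near _ _ g (fun=> 0) v x); last exact: near_of.
by rewrite -pdE derive_cst.
Qed.

Let sPhi x : A x -> sdiff Phi x (fun v => vd Phi v x).
Proof. by move=> Ax; exact: (vd_sdiff fV sW oA cPhi1 Ax). Qed.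

Let sv v x : A x -> sdiff (vd Phi v) x (fun u => vd (vd Phi v) u x).
Proof. by move=> Ax; apply: (vd_sdiff fV sW oA _ Ax); exact: CkS (Ck_vd v cPhi). Qed.

Let sJ (w : C1 R * R -> C2 R) L x : sdiff w x L -> sdiff (fun y => J2 (w y)) x (fun u => J2 (L u)).
Proof.
move=> sw; apply: (sdiff_comp sw).
exact: sdiff_linear (@J2_linear R) (J2_bounded R).
Qed.

Let CkJ k (w : C1 R * R -> C2 R) : Ck k A w -> Ck k A (fun y => J2 (w y)).
Proof. by move=> cw; exact: (Ck_linear (@J2_linear R) (J2_bounded R) oA cw).1. Qed.

Lemma foliation_tangent v x : A x -> pd f (vd Phi v x) (Phi x) = 0.
Proof.
move=> Ax; have [_ E] := is_derive_comp_sdiff fW oB v cf1 (sPhi Ax) (AB Ax).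
by rewrite -E pdE; exact: pd0.
Qed.

Lemma foliation_tangentJ x : A x -> pd f (J2 (e x)) (Phi x) = 0.
Proof. by move=> Ax; rewrite -CR // foliation_tangent. Qed.

Let vdJe u x : A x -> vd (vd Phi diry) u x = J2 (vd e u x).
Proof.
move=> Ax; rewrite (@vd_near _ _ _ _ (fun y => J2 (e y))); last exact: near_of.
exact: vd_sdiffE (sJ (sv _ Ax)).
Qed.

Let vd_ye x : A x -> vd e diry x = J2 (vd e dirx x).
Proof. by move=> Ax; rewrite /e (vdC oA _ _ fW cPhi2 Ax) vdJe. Qed.

Let vd_yW x : A x -> vd W diry x = J2 (Wx x).
Proof.
move=> Ax; rewrite /W (vdC oA _ _ fW cPhi2 Ax) vdJe //.
by congr J2; rewrite /Wx (vdC oA _ _ fW cPhi2 Ax).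
Qed.

Lemma foliation_levi x : A x -> levi (@J2 R) f (Phi x) (e x) (e x) = 0.
Proof.
move=> Ax.
have h1 := pd_along fW oB dirx cf2 (sPhi Ax) (sv dirx Ax) (AB Ax).
have h2 := pd_along fW oB diry cf2 (sPhi Ax) (sv diry Ax) (AB Ax).
rewrite (pd0 _ Ax) in h1; last by move=> y Ay; exact: foliation_tangent.
rewrite (pd0 _ Ax) in h2; last by move=> y Ay; exact: foliation_tangent.
rewrite vdJe // vd_ye // J2J2 (pdNv fW oB (AB Ax) cf1) in h2.
by rewrite CR // in h2; rewrite /levi -/(e x) in h1 h2 *; lra.
Qed.

(** The normal derivative [pd f (J W)] of the defining function, read in the
leaves: up to sign, the quantity whose power is harmonic. *)
Definition normal_deriv x := pd f (J2 (W x)) (Phi x).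

Lemma Ck_normal_deriv : Ck 2 A normal_deriv.
Proof. exact: (Ck_pd_along fV fW sW oB oA AB cf cPhi2 (CkJ cW)). Qed.

Lemma normal_derivxE x : A x -> pd normal_deriv dirx x =
  pd (pd f (J2 (W x))) (e x) (Phi x) + pd f (J2 (Wx x)) (Phi x).
Proof.
by move=> Ax; rewrite (pd_along fW oB dirx cf2 (sPhi Ax) (sJ (sv dirt Ax)) (AB Ax)) addrC.
Qed.

Lemma normal_derivyE x : A x -> pd normal_deriv diry x =
  pd (pd f (J2 (W x))) (J2 (e x)) (Phi x) + pd f (J2 (J2 (Wx x))) (Phi x).
Proof.
move=> Ax; rewrite (pd_along fW oB diry cf2 (sPhi Ax) (sJ (sv dirt Ax)) (AB Ax)) addrC.
by rewrite CR // -[vd (vd Phi dirt) diry x]/(vd W diry x) vd_yW.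
Qed.

Lemma normal_derivx x : A x ->
  pd normal_deriv dirx x = levi (@J2 R) f (Phi x) (e x) (J2 (W x)).
Proof.
move=> Ax; rewrite normal_derivxE //.
have := pd_along fW oB diry cf2 (sPhi Ax) (sv dirt Ax) (AB Ax).
rewrite (pd0 _ Ax); last by move=> y Ay; exact: foliation_tangent.
rewrite -[vd (vd Phi dirt) diry x]/(vd W diry x) vd_yW // CR // -/(e x) -/(W x) => E.
rewrite /levi J2J2 -scaleN1r.
rewrite (pd2C oB (AB Ax) cf2 (J2 (e x))) (pd2Zl fW oB (AB Ax) cf2) (pd2C oB (AB Ax) cf2 (W x)).
by rewrite mulN1r; lra.
Qed.

Lemma normal_derivy x : A x ->
  pd normal_deriv diry x = levi (@J2 R) f (Phi x) (e x) (W x).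
Proof.
move=> Ax; rewrite normal_derivyE //.
have := pd_along fW oB dirx cf2 (sPhi Ax) (sv dirt Ax) (AB Ax).
rewrite (pd0 _ Ax); last by move=> y Ay; exact: foliation_tangent.
rewrite -[vd (vd Phi dirt) dirx x]/(Wx x) -/(e x) -/(W x) => E.
rewrite /levi J2J2 (pdNv fW oB (AB Ax) cf1).
by lra.
Qed.

Lemma levi_along (v w : C1 R * R -> C2 R) K H x u : A x -> sdiff v x K -> sdiff w x H ->
  pd (fun y => levi (@J2 R) f (Phi y) (v y) (w y)) u x =
  levi (@J2 R) f (Phi x) (K u) (w x) + levi (@J2 R) f (Phi x) (v x) (H u) +
  (pd (pd (pd f (w x)) (v x)) (vd Phi u x) (Phi x) +
   pd (pd (pd f (J2 (w x))) (J2 (v x))) (vd Phi u x) (Phi x)).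
Proof.
move=> Ax s1 s2; have Bx := AB Ax.
have D := is_deriveD (pd2_along fW oB u cf (sPhi Ax) s2 s1 Bx)
  (pd2_along fW oB u cf (sPhi Ax) (sJ s2) (sJ s1) Bx).
rewrite -pdE; have [_] := D; rewrite {1}/levi => ->; rewrite /levi.
ring.
Qed.

Lemma normal_deriv_laplacian x : A x ->
  pd (pd normal_deriv dirx) dirx x + pd (pd normal_deriv diry) diry x =
  pd (pd (pd f (e x)) (e x)) (J2 (W x)) (Phi x) +
  pd (pd (pd f (J2 (e x))) (J2 (e x))) (J2 (W x)) (Phi x) +
  2 * levi (@J2 R) f (Phi x) (e x) (J2 (Wx x)).
Proof.
move=> Ax.
rewrite (@pd_near _ _ _ (fun y => levi (@J2 R) f (Phi y) (e y) (J2 (W y)))); last first.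
  by apply: near_of => // y; exact: normal_derivx.
rewrite (levi_along dirx Ax (sv dirx Ax) (sJ (sv dirt Ax))).
rewrite (@pd_near _ _ (pd _ diry) (fun y => levi (@J2 R) f (Phi y) (e y) (W y))); last first.
  by apply: near_of => // y; exact: normal_derivy.
rewrite (levi_along diry Ax (sv dirx Ax) (sv dirt Ax)).
have -> : vd (vd Phi dirx) diry x = J2 (vd e dirx x) by exact: vd_ye.
have -> : vd (vd Phi dirt) diry x = J2 (Wx x) by exact: vd_yW.
rewrite CR // -/(e x) -/(W x) -[vd (vd Phi dirt) dirx x]/(Wx x) -[vd (vd Phi dirx) dirx x]/(vd e dirx x).
rewrite (leviJl fW (@J2_linear R) (@J2J2 R) oB (AB Ax) cf2 (vd e dirx x)) J2J2.
have Bx := AB Ax.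
have ne a b : {near Phi x, pd (pd f a) b =1 pd (pd f b) a}.
  near=> y; apply: (pd2C oB _ cf2); near: y; exact: open_nbhs_nbhs.
have s12 a b c : pd (pd (pd f a) b) c (Phi x) = pd (pd (pd f b) a) c (Phi x).
  by rewrite (pd_near _ (ne _ _)).
have s23 a b c : pd (pd (pd f a) b) c (Phi x) = pd (pd (pd f a) c) b (Phi x).
  by rewrite (pd2C oB Bx (Ck_pd _ cf)).
have ninv a b c : pd (pd (pd f (- a)) b) c (Phi x) = - pd (pd (pd f a) b) c (Phi x).
  rewrite (s12 (- a)) (s23 b (- a)) (pdNv fW oB Bx (Ck_pd _ (Ck_pd _ cf))).
  by rewrite (s23 b c a) (s12 b a c).
rewrite ninv.
rewrite (s12 (J2 (W x)) (e x)) (s23 (e x) (J2 (W x))).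
rewrite (s12 (J2 (W x)) (J2 (e x))) (s23 (J2 (e x)) (J2 (W x))).
rewrite (s23 (W x) (J2 (e x)) (e x)).
ring.
Unshelve. all: by end_near. Qed.

End FoliatedMap.

Lemma continuous_at_ball (R : realType) (V W : normedModType R) (f : V -> W) x r :
  {for x, continuous f} -> 0 < r ->
  exists2 d : R, 0 < d & forall y, ball x d y -> ball (f x) r (f y).
Proof.
move=> cf r0; have /nbhs_ballP[d /= d0 H] : nbhs x (f @^-1` (ball (f x) r)).
  by apply: cf; exact: nbhsx_ballx.
by exists d.
Qed.

Section ContinuousExponent.
Context (R : realType).

(** The critical exponent is a zero of the affine function [contact_det]. *)
Lemma contact_det_sup (h hx hy L eta : R) (P : R -> Prop) : 0 < h -> 0 < eta < 1 ->
  sup [set x : R | 0 < x < 1 /\ P x] = eta ->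
  (forall x, 0 < x < 1 -> P x -> 0 <= contact_det h hx hy L x) ->
  (forall x, 0 < x < 1 -> 0 < contact_det h hx hy L x -> P x) ->
  contact_det h hx hy L eta = 0.
Proof.
move=> h0 /andP[eta0 eta1] supE nec suf.
set E := [set x : R | _] in supE.
have E0 : E !=set0.
  by apply/set0P/negP => /eqP E0; move: eta0; rewrite -supE E0 sup0 ltxx.
have ubE : has_ubound E by exists 1 => x [/andP[_ /ltW]].
have cE x y : contact_det h hx hy L y - contact_det h hx hy L x =
    (y - x) * (L / h - 2 * ((hx ^+ 2 + hy ^+ 2) / h ^+ 2)).
  by rewrite /contact_det; ring.
set k := L / h - _ in cE.
have k0 : 0 < `|k| + 1 by rewrite ltr_wpDl.
apply/eqP; rewrite eq_le; apply/andP; split.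
  rewrite leNgt; apply/negP => D0.
  pose d := Num.min ((1 - eta) / 2) (contact_det h hx hy L eta / (2 * (`|k| + 1))).
  have d0 : 0 < d by rewrite lt_min !divr_gt0 ?mulr_gt0 ?subr_gt0.
  have d1 : d <= (1 - eta) / 2 by rewrite /d ge_min lexx.
  have d2 : d * (2 * (`|k| + 1)) <= contact_det h hx hy L eta.
    by rewrite -ler_pdivlMr ?mulr_gt0 // /d ge_min lexx orbT.
  have : E (eta + d).
    have I : 0 < eta + d < 1 by apply/andP; split; lra.
    split => //; apply: suf => //.
    have := cE eta (eta + d); rewrite (_ : eta + d - eta = d); last by ring.
    move=> H.
    have : - (d * `|k|) <= d * k by rewrite -mulrN ler_pM2l // lerNl -normrN ler_norm.
    by move=> H2; have := mulr_ge0 (ltW d0) (normr_ge0 k); lra.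
  by move/(ub_le_sup ubE); rewrite supE gerDl leNgt d0.
rewrite leNgt; apply/negP => D0.
pose d := - contact_det h hx hy L eta / (2 * (`|k| + 1)).
have d0 : 0 < d by rewrite divr_gt0 ?mulr_gt0 ?oppr_gt0.
have [x [Ix Px] xd] := sup_adherent d0 (conj E0 ubE).
have xe : x <= eta by rewrite -supE; exact: ub_le_sup.
rewrite supE in xd.
have := nec x Ix Px; apply/negP; rewrite -ltNge.
have := cE eta x => H.
have d2 : d * (2 * (`|k| + 1)) = - contact_det h hx hy L eta by rewrite /d divfK // gt_eqF ?mulr_gt0.
have : (x - eta) * k <= d * `|k|.
  rewrite (le_trans (ler_norm _)) // normrM ler_wpM2r // ler0_norm ?subr_le0 //; lra.
move=> H2; have := mulr_ge0 (ltW d0) (normr_ge0 k); lra.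
Qed.

End ContinuousExponent.

Section BoundaryPoint.
Context (R : realType).
Variables (A : set (C1 R * R)) (Phi : C1 R * R -> C2 R) (B : set (C2 R)) (f rho : C2 R -> R).
Hypotheses (oA : open A) (oB : open B) (cPhi : Ck 3 A Phi) (cf : Ck 3 B f) (cr : Ck 1 B rho).
Hypothesis AB : forall x, A x -> B (Phi x).
Hypothesis f0 : forall x, A x -> f (Phi x) = 0.
Hypothesis rho0 : forall x, A x -> rho (Phi x) = 0.
Hypothesis CR : forall x, A x -> vd Phi (diry R) x = J2 (vd Phi (dirx R) x).
Hypothesis imm : forall x v, A x -> vd Phi v x = 0 -> v = 0.

Let fV := fin_dimC1R R.
Let fW := fin_dimC2 R.
Let sW := @C1_strictC2 R.
Let e := vd Phi (dirx R).
Let W := vd Phi (dirt R).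
Let h := normal_deriv Phi f.

Let cf1 : Ck 1 B f. Proof. exact: Ck_le cf. Qed.
Let cf2 : Ck 2 B f. Proof. exact: Ck_le cf. Qed.
Let cPhi1 : Ck 1 A Phi. Proof. exact: Ck_le cPhi. Qed.

Let ce2 : Ck 2 A e. Proof. exact: Ck_vd cPhi. Qed.

Let sPhi x : A x -> sdiff Phi x (fun v => vd Phi v x).
Proof. by move=> Ax; exact: (vd_sdiff fV sW oA cPhi1 Ax). Qed.

Lemma leaf_direction_neq0 x : A x -> e x != 0.
Proof.
by move=> Ax; apply/eqP => /(imm Ax) /(congr1 (fun v => v.1.1)) /eqP; rewrite /= oner_eq0.
Qed.

Lemma cdet2_frame x : A x -> cdet2 (e x) (W x) != 0.
Proof.
move=> Ax; apply/eqP => /(cdet2_eq0 (leaf_direction_neq0 Ax))[a [b E]].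
have s := sPhi Ax.
have : vd Phi (dirt R - (a *: dirx R + b *: diry R)) x = 0.
  by rewrite (sdiffB s) (sdiffD s) !(sdiffZ s) CR // -/(e x) -E subrr.
by move/(imm Ax)/(congr1 (fun v => v.2))/eqP; rewrite /= !scaler0 addr0 subr0 oner_eq0.
Qed.

(** The differential of a function vanishing on the image of [Phi] is determined
by its value on [J W]. *)
Lemma pd_frame (k : C2 R -> R) x v : A x -> Ck 1 B k -> (forall x, A x -> k (Phi x) = 0) ->
  pd k v (Phi x) = (cramer2 (e x) (W x) v).2 * pd k (J2 (W x)) (Phi x).
Proof.
move=> Ax ck k0.
have Dk u : pd k (vd Phi u x) (Phi x) = 0.
  have [_ E] := is_derive_comp_sdiff fW oB u ck (sPhi Ax) (AB Ax).
  rewrite -E (@near_eq_derive _ _ _ _ (fun=> 0)) ?derive_cst //.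
  by apply: filterS k0 _; exact: open_nbhs_nbhs.
rewrite {1}(Cramer v (cdet2_frame Ax)) /cscale.
rewrite !(pdDv fW oB (AB Ax) ck) !(pdZv fW oB (AB Ax) ck).
by rewrite -CR // !Dk !mulr0 !add0r.
Qed.

Lemma normal_deriv_neq0 (k : C2 R -> R) x : A x -> Ck 1 B k ->
  (forall x, A x -> k (Phi x) = 0) -> (exists v, pd k v (Phi x) != 0) ->
  normal_deriv Phi k x != 0.
Proof.
move=> Ax ck k0 [v]; rewrite (pd_frame v Ax ck k0); apply: contra_neq.
by rewrite /normal_deriv => ->; rewrite mulr0.
Qed.

Variable x0 : C1 R * R.
Hypothesis Ax0 : A x0.
Let p := Phi x0.
Hypothesis drho : exists v, pd rho v p != 0.
Hypothesis df : exists v, pd f v p != 0.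
Hypothesis fpos : forall y, B y -> 0 < rho y -> 0 < f y.
Hypothesis homeo : forall r, 0 < r ->
  \forall y \near p, rho y = 0 -> exists x, [/\ A x, ball x0 r x & Phi x = y].

Let Bp : B p. Proof. exact: AB. Qed.

Let sg : R := if 0 < h x0 then 1 else -1.
Let sg2 : sg * sg = 1. Proof. by rewrite /sg; case: ifP => _; ring. Qed.
Let V := sg *: J2 (W x0).
Let K := sg *: J2 (vd (vd Phi (dirt R)) (dirx R) x0).

Let h0 : 0 < sg * h x0.
Proof.
rewrite /sg; case: ifP => [|/negbT]; first by rewrite mul1r.
rewrite -leNgt le_eqVlt (negbTE (normal_deriv_neq0 Ax0 cf1 f0 df)) /= => H.
by rewrite mulN1r oppr_gt0.
Qed.

Let hE : pd f V p = sg * h x0.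
Proof. by rewrite /V (pdZv fW oB Bp cf1). Qed.

Let f00 : f p = 0. Proof. exact: f0. Qed.
Let rho00 : rho p = 0. Proof. exact: rho0. Qed.

(** [f] and [rho] vanish on the same hypersurface and [f] is positive where [rho]
is, hence their derivatives in a transverse direction have the same sign. *)
Let rhoV : 0 < pd rho V p.
Proof.
have rn : pd rho V p != 0.
  rewrite /V (pdZv fW oB Bp cr) mulf_neq0 //; last exact: (normal_deriv_neq0 Ax0 cr rho0 drho).
  by apply/eqP => E; move: sg2; rewrite E mul0r => /eqP; rewrite eq_sym oner_eq0.
rewrite lt_neqAle eq_sym rn /= leNgt; apply/negP => r0.
have cs : (fun s : R => s) @ (0 : R)^'+ --> (0 : R) by apply: cvg_within.
have cm : (fun _ : R => p) @ (0 : R)^'+ --> p by exact: cvg_cst.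
have sp : \forall s \near (0 : R)^'+, 0 < s by exact: nbhs_right_gt.
have c1 := cvg_quotient (FF := at_right_proper_filter _) (v := - V) fW oB Bp cm cs sp cr.
have c2 := cvg_quotient (FF := at_right_proper_filter _) (v := - V) fW oB Bp cm cs sp cf1.
rewrite (pdNv fW oB Bp cr) in c1; rewrite (pdNv fW oB Bp cf1) in c2.
have bad : \forall s \near (0 : R)^'+, False.
  near=> s.
  have s0 : 0 < s by near: s.
  have Bs : B (p + s *: - V).
    near: s; have : (fun s : R => p + s *: - V) @ (0 : R)^'+ --> p by exact: (cvg_moving _ cm cs).
    by apply; exact: open_nbhs_nbhs.
  have q1 : 0 < (rho (p + s *: - V) - rho p) / s.
    by near: s; apply: (cvgr_gt _ c1); rewrite oppr_gt0.
  have q2 : (f (p + s *: - V) - f p) / s < 0.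
    by near: s; apply: (cvgr_lt _ c2); rewrite oppr_lt0 hE.
  rewrite rho00 subr0 pmulr_lgt0 ?invr_gt0 // in q1.
  rewrite f00 subr0 pmulr_llt0 ?invr_gt0 // in q2.
  by have := fpos Bs q1; rewrite ltNge ltW.
by have [s] := @filter_ex _ _ (at_right_proper_filter (0 : R)) _ bad.
Unshelve. all: by end_near. Qed.

(** Points where [rho] is positive project along [V] to the hypersurface. *)
Let foot r : 0 < r -> \forall q \near p, 0 < rho q -> exists x s,
  [/\ A x, ball x0 r x, 0 < s < r, ball p r (Phi x) & q = Phi x + s *: V].
Proof.
move=> r0.
have [r1 r10 H1] := continuous_at_ball (Ck_cont cPhi Ax0) r0.
have m0 : 0 < Num.min r r1 by rewrite lt_min r0.
have /nbhs_ballP[d /= d0 Hd] := homeo m0.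
have /nbhs_ballP[b /= b0 Hb] : nbhs p B by exact: open_nbhs_nbhs.
have cs : (fun s : R => s) @ (0 : R)^'+ --> (0 : R) by apply: cvg_within.
have cm : (fun _ : R => p) @ (0 : R)^'+ --> p by exact: cvg_cst.
have sp : \forall s \near (0 : R)^'+, 0 < s by exact: nbhs_right_gt.
have c1 := cvg_quotient (FF := at_right_proper_filter _) (v := - V) fW oB Bp cm cs sp cr.
rewrite (pdNv fW oB Bp cr) in c1.
pose N := `|V| + 1.
have N0 : 0 < N by rewrite ltr_wpDl.
pose D := Num.min d b / 2.
have D0 : 0 < D by rewrite divr_gt0 // lt_min d0.
have [s [s0 sr sD sneg]] : exists s, [/\ 0 < s, s < r, s * N < D & rho (p + s *: - V) < 0].
  apply: (@filter_ex _ _ (at_right_proper_filter (0 : R))).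
  near=> s.
  have s0 : 0 < s by near: s.
  have sr : s < r by near: s; exact: nbhs_right_lt.
  split => //.
  - rewrite -ltr_pdivlMr //; near: s; apply: nbhs_right_lt; exact: divr_gt0.
  - have : (rho (p + s *: - V) - rho p) / s < 0.
      by near: s; apply: (cvgr_lt _ c1); rewrite oppr_lt0.
    by rewrite rho00 subr0 pmulr_llt0 ?invr_gt0.
have inB q (t : R) : ball p D q -> 0 <= t <= s -> ball p (Num.min d b) (q + t *: - V).
  rewrite -!ball_normE /= => bq /andP[t0 ts].
  rewrite opprD addrA (le_lt_trans (ler_normB _ _)) // normrZ normrN (ger0_norm t0).
  have : t * `|V| <= s * N by rewrite ler_pM // /N lerDl.
  have : Num.min d b = D + D by rewrite /D -splitr.
  move: sD bq; lra.
have Bq q (t : R) : ball p D q -> 0 <= t <= s -> B (q + t *: - V).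
  move=> bq ts; apply: Hb; have := inB q t bq ts; rewrite -!ball_normE /= lt_min.
  by case/andP.
have cq : (fun q => rho (q + s *: - V)) @ p --> rho (p + s *: - V).
  have bp : ball p D p by exact: ballxx.
  have cr1 : {for p + s *: - V, continuous rho}.
    by apply: Ck_cont cr _; apply: Bq => //; rewrite lexx andbT; exact: ltW.
  have cq1 : (fun q => q + s *: - V) @ p --> p + s *: - V.
    by apply: cvgD; [exact: cvg_id|exact: cvg_cst].
  exact: (continuous_cvg _ cr1 cq1).
near=> q => rq.
have bq : ball p D q by near: q; exact: nbhsx_ballx.
have qneg : rho (q + s *: - V) < 0 by near: q; apply: (cvgr_lt _ cq).
pose g (t : R) := rho (q + t *: - V).
have cg : {within `[0, s], continuous g}.
  apply: continuous_in_subspaceT => t; rewrite inE /= in_itv /= => tI.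
  apply: (@continuous_comp _ _ _ (fun t : R => q + t *: - V) rho).
    by apply: cvgD; [exact: cvg_cst|apply: cvgZ; [exact: cvg_id|exact: cvg_cst]].
  by apply: Ck_cont cr _; exact: Bq.
have g0 : g 0 = rho q by rewrite /g scale0r addr0.
have [|t] := @IVT _ g 0 s 0 (ltW s0) cg.
  by rewrite g0 ge_min le_max (ltW rq) (ltW qneg) orbT.
rewrite in_itv /= => tI gt.
have t0 : 0 < t.
  rewrite lt_neqAle (andP tI).1 andbT; apply/eqP => t0.
  by move: gt; rewrite -t0 g0 => E; move: rq; rewrite E ltxx.
have [|x [Ax bx Px]] := Hd (q + t *: - V) _ gt.
  by have := inB q t bq tI; rewrite -!ball_normE /= lt_min => /andP[].
have [bxr bxr1] : ball x0 r x /\ ball x0 r1 x.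
  by move: bx; rewrite -!ball_normE /= lt_min => /andP[].
exists x, t; split => //.
- by rewrite t0 /= (le_lt_trans (andP tI).2).
- exact: H1.
- by rewrite Px scalerN subrK.
Unshelve. all: by end_near. Qed.

Let hx := pd h (dirx R) x0.
Let hy := pd h (diry R) x0.
Let lap := pd (pd h (dirx R)) (dirx R) x0 + pd (pd h (diry R)) (diry R) x0.

Let hJ : pd f (J2 V) p = 0.
Proof.
rewrite /V J2Z J2J2 (pdZv fW oB Bp cf1) (pdNv fW oB Bp cf1).
by rewrite (foliation_tangent oA oB cPhi cf AB f0 _ Ax0) oppr0 mulr0.
Qed.

Let hxE : pd (pd f (e x0)) V p + pd f K p = sg * hx.
Proof.
rewrite /hx (normal_derivxE oA oB cPhi cf AB Ax0) (pd2C oB Bp cf2) /V /K.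
rewrite (pd2C oB Bp cf2) (pd2Zl fW oB Bp cf2) (pdZv fW oB Bp cf1).
by rewrite (pd2C oB Bp cf2) mulrDr.
Qed.

Let hyE : pd (pd f (J2 (e x0))) V p + pd f (J2 K) p = sg * hy.
Proof.
rewrite /hy (normal_derivyE oA oB cPhi cf AB CR Ax0) /V /K J2Z.
rewrite (pd2Zl fW oB Bp cf2) (pdZv fW oB Bp cf1).
by rewrite (pd2C oB Bp cf2) mulrDr.
Qed.

Let lxE : levi (@J2 R) f p (e x0) V = sg * hx.
Proof.
by rewrite (leviZr fW (@J2_linear R) oB Bp cf2) /hx (normal_derivx oA oB cPhi cf AB f0 CR Ax0).
Qed.

Let lyE : levi (@J2 R) f p (e x0) (J2 V) = - (sg * hy).
Proof.
rewrite /V J2Z (leviZr fW (@J2_linear R) oB Bp cf2) J2J2 -scaleN1r.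
rewrite (leviZr fW (@J2_linear R) oB Bp cf2) /hy.
by rewrite (normal_derivy oA oB cPhi cf AB f0 CR Ax0) mulN1r mulrN.
Qed.

Let LE : pd (pd (pd f (e x0)) (e x0)) V p + pd (pd (pd f (J2 (e x0))) (J2 (e x0))) V p +
  2 * levi (@J2 R) f p (e x0) K = sg * lap.
Proof.
rewrite /lap (normal_deriv_laplacian oA oB cPhi cf AB f0 CR Ax0) /V /K.
rewrite (leviZr fW (@J2_linear R) oB Bp cf2).
by rewrite !(pdZv fW oB Bp (Ck_pd _ (Ck_pd _ cf))); ring.
Qed.

Let contactP x s : A x -> 0 < s -> contact f (Phi x, s, e x).
Proof.
move=> Ax s0; split => //=; first exact: f0.
- exact: (foliation_tangent oA oB cPhi cf AB f0 _ Ax).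
- exact: (foliation_tangentJ oA oB cPhi cf AB f0 CR Ax).
- exact: (foliation_levi oA oB cPhi cf AB f0 CR Ax).
Qed.

(** Since [contact_det] is affine in the exponent and its sign decides positivity, it
vanishes at the supremum; the sign of [h] cancels, as both terms are even in [h]. *)
Lemma exponent_laplacian (eta : R) : 0 < eta < 1 ->
  sup [set y : R | 0 < y < 1 /\ \forall q \near p, 0 < rho q ->
    forall w, w != 0 -> 0 < levi (@J2 R) (fun x => - (f x `^ y)) q w w] = eta ->
  pd (pd h (dirx R)) (dirx R) x0 + pd (pd h (diry R)) (diry R) x0 =
  (1 - eta / (1 - eta)) * (pd h (dirx R) x0 ^+ 2 + pd h (diry R) x0 ^+ 2) / h x0.
Proof.
move=> eta01 supE; rewrite -/hx -/hy -/lap.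
pose B' := B `&` [set y | 0 < f y].
have oB' : open B'.
  rewrite openE => y [By fy]; apply: filterI; first exact: open_nbhs_nbhs.
  by apply: (cvgr_gt _ (Ck_cont cf By)).
have cfB' : Ck 2 B' f by apply: Ck_sub cf2 => y [].
have leviE y q w : B q -> 0 < y -> 0 < f q ->
    (0 < levi (@J2 R) (fun x => - (f x `^ y)) q w w) = (0 < power_form y f q w w).
  move=> Bq y0 fq; rewrite (levi_power y w w oB' cfB') //; last by move=> ? [].
  by rewrite pmulr_rgt0 // mulr_gt0 // powR_gt0.
have nB : \forall q \near p, B q by exact: open_nbhs_nbhs.
have E0 : e x0 != 0 by exact: leaf_direction_neq0.
have [_ _ cp1 cp2 cp3] := contactP Ax0 ltr01.
suff : contact_det (sg * h x0) (sg * hx) (sg * hy) (sg * lap) eta = 0.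
  have hn : h x0 != 0 by apply/eqP => hh; move: h0; rewrite hh mulr0 ltxx.
  have sn : sg != 0 by apply/eqP => hh; move: h0; rewrite hh mul0r ltxx.
  have en : 1 - eta != 0 by rewrite gt_eqF // subr_gt0; case/andP: eta01.
  move=> D; apply: (mulfI en); apply: (divIf hn).
  move/eqP: D; rewrite /contact_det.
  have -> : - (1 - eta) * (sg * lap / (sg * h x0)) +
      (1 - 2 * eta) * (((sg * hx) ^+ 2 + (sg * hy) ^+ 2) / (sg * h x0) ^+ 2) =
    (1 - 2 * eta) * (hx ^+ 2 + hy ^+ 2) / h x0 / h x0 - (1 - eta) * lap / h x0.
    by field; rewrite hn sn.
  rewrite subr_eq0 => /eqP <-; field; by rewrite hn en.
apply: (contact_det_sup _ _ supE) => //.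
- move=> y y01 Py; apply: (contact_necessary oB Bp cf h0 hE hJ hxE hyE lxE lyE LE y01 f00 cp1 cp2 cp3).
  have cs : (fun s : R => s) @ (0 : R)^'+ --> (0 : R) by apply: cvg_within.
  have cm : (fun _ : R => p) @ (0 : R)^'+ --> p by exact: cvg_cst.
  have sp : \forall s \near (0 : R)^'+, 0 < s by exact: nbhs_right_gt.
  have cq : (fun s : R => p + s *: V) @ (0 : R)^'+ --> p by exact: (cvg_moving _ cm cs).
  have c1 := cvg_quotient (FF := at_right_proper_filter _) (v := V) fW oB Bp cm cs sp cr.
  near=> s => w w0.
  have s0 : 0 < s by near: s.
  have q1 : 0 < (rho (p + s *: V) - rho p) / s by near: s; exact: (cvgr_gt _ c1).
  rewrite rho00 subr0 pmulr_lgt0 ?invr_gt0 // in q1.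
  have Bs : B (p + s *: V) by near: s; exact: cq.
  rewrite -leviE //; [|by case/andP: y01|exact: fpos].
  have : 0 < rho (p + s *: V) -> forall w : C2 R, w != 0 ->
    0 < levi (@J2 R) (fun x => - (f x `^ y)) (p + s *: V) w w by near: s; exact: (cq _ Py).
  exact.
- move=> y y01 Dy.
  have [r r0 Hr] := contact_sufficient oB Bp cf h0 hE hJ hxE hyE lxE lyE LE y01
    f00 cp1 cp2 E0 Dy.
  have [r1 r10 H1] := continuous_at_ball (Ck_cont ce2 Ax0) r0.
  have m0 : 0 < Num.min r r1 by rewrite lt_min r0.
  near=> q => rq w w0.
  have Bq : B q by near: q.
  rewrite leviE //; [|by case/andP: y01|exact: fpos].
  have : 0 < rho q -> exists x s, [/\ A x, ball x0 (Num.min r r1) x, 0 < s < Num.min r r1,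
      ball p (Num.min r r1) (Phi x) & q = Phi x + s *: V] by near: q; exact: foot.
  move=> /(_ rq)[x [s [Ax bx /andP[s0]]]]; rewrite lt_min => /andP[sr _] bp ->.
  apply: (Hr _ _ (e x)) => //.
  - by move: bp; rewrite -!ball_normE /= lt_min => /andP[].
  - by apply: H1; move: bx; rewrite -!ball_normE /= lt_min => /andP[].
  - exact: contactP.
Unshelve. all: by end_near. Qed.

End BoundaryPoint.

(** * Defining functions and foliated charts on the surface *)

Lemma open_setM_box (V W : topologicalType) (A : set V) (B : set W) :
  open A -> open B -> open (A `*` B).
Proof.
move=> oA oB; rewrite openE => -[x y] [/= Ax By]; exists (A, B) => //=.
by split; exact: open_nbhs_nbhs.
Qed.

Lemma diff_left_inverse (R : realType) (V W : normedModType R) (f : V -> W) (g : W -> V) z w :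
  differentiable f z -> differentiable g (f z) -> {near z, g \o f =1 id} ->
  'd f z w = 0 -> w = 0.
Proof.
move=> d1 d2 ne dw.
have := near_eq_derive w ne; rewrite derive_id deriveE; last exact: differentiable_comp.
by rewrite (diff_comp d1 d2) /= dw linear0.
Qed.

Section Charts.
Context (R : realType) (X : complexSurface R).
Implicit Types (a : chart R X) (c : fchart X).

Lemma chart_image_open a (O : set X) : is_chart a -> open O ->
  open (cmap a @` (cdom a `&` O)).
Proof.
move=> [oD oI cm ci canc] oO.
have -> : cmap a @` (cdom a `&` O) = (cmap a @` cdom a) `&` cinv a @^-1` O.
  apply/seteqP; split => [y [q [Dq Oq] <-]|y [[q Dq <-]]] /=.
    by split; [exists q|rewrite canc ?inE].
  by rewrite canc ?inE // => Oq; exists q.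
rewrite openE => y [Iy Oy]; apply: filterI; first exact: open_nbhs_nbhs.
by apply: ci; [rewrite inE|exact: open_nbhs_nbhs].
Qed.

Lemma chart_canc a q : is_chart a -> cdom a q -> cinv a (cmap a q) = q.
Proof. by move=> [_ _ _ _ canc] Dq; rewrite canc ?inE. Qed.

Lemma chart_image a (O : set X) y : is_chart a -> (cmap a @` (cdom a `&` O)) y ->
  [/\ cdom a (cinv a y), O (cinv a y) & cmap a (cinv a y) = y].
Proof. by move=> ca [q [Dq Oq] <-]; rewrite chart_canc. Qed.

Lemma foliated_chart_par M c x : foliated_chart M c -> (fD c `*` fT c) x ->
  [/\ fdom c (fpar c x), fz c (fpar c x) = x.1 & ft c (fpar c x) = x.2].
Proof. by move=> [_ _ [_ H _ _ _] _ _]; exact: H. Qed.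

Lemma foliated_chart_dom M c p : foliated_chart M c -> fdom c p ->
  [/\ fD c (fz c p), fT c (ft c p) & fpar c (fz c p, ft c p) = p].
Proof. by move=> [_ _ [H _ _ _ _] _ _]; exact: H. Qed.

Lemma foliated_chart_sub M c : foliated_chart M c -> fdom c `<=` M.
Proof. by move=> [[U _ ->] _ _ _ _] x []. Qed.

Lemma foliated_box_open M c : foliated_chart M c -> open (fD c `*` fT c).
Proof. by move=> [_ [oD _ oT _] _ _ _]; exact: open_setM_box. Qed.

Lemma foliated_par_cont M c x : foliated_chart M c -> (fD c `*` fT c) x ->
  {for x, continuous (fpar c)}.
Proof. by move=> [_ _ [_ _ _ _ H] _ _] Dx; apply: H; rewrite inE. Qed.

Lemma foliated_preimage_open M c (O : set X) : foliated_chart M c -> open O ->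
  open ((fD c `*` fT c) `&` fpar c @^-1` O).
Proof.
move=> fc oO; rewrite openE => x [Dx Ox]; apply: filterI.
  by apply: open_nbhs_nbhs; split => //; exact: foliated_box_open fc.
by apply: (foliated_par_cont fc Dx); exact: open_nbhs_nbhs.
Qed.

(** The chart is a homeomorphism onto its box. *)
Lemma foliated_coord_near M c p (N : set (C1 R * R)) : foliated_chart M c -> fdom c p ->
  nbhs (fz c p, ft c p) N ->
  \forall q \near p, M q -> fdom c q /\ N (fz c q, ft c q).
Proof.
move=> fc dp; have [[U oU dE] _ [_ _ cz ct _] _ _] := fc.
move=> [[N1 N2] /= [n1 n2] sub].
have h1 : \forall q \near p, fdom c q -> N1 (fz c q).
  by have /subspace_continuousP/(_ p dp _ n1) := cz.
have h2 : \forall q \near p, fdom c q -> N2 (ft c q).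
  by have /subspace_continuousP/(_ p dp _ n2) := ct.
have hO : \forall q \near p, U q.
  by apply: open_nbhs_nbhs; split => //; move: dp; rewrite dE => -[].
near=> q => Mq.
have Oq : U q by near: q.
have dq : fdom c q by rewrite dE.
split => //; apply: sub; split => /=; move: dq; near: q; first exact: h1.
exact: h2.
Unshelve. all: by end_near. Qed.

Lemma CkX_sub k (O O' : set X) (f : X -> R) : O' `<=` O -> CkX k O f -> CkX k O' f.
Proof.
move=> sub cf a aa; apply: Ck_sub (cf a aa) => y [q [Dq Oq] <-].
by exists q => //; split => //; exact: sub.
Qed.

End Charts.

Section DefiningData.
Context (R : realType) (X : complexSurface R).
Variables (Omega : set X) (delta : X -> R).
Let M := bd Omega.
Implicit Types (a : chart R X) (c : fchart X) (O : set X) (f rho : X -> R).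

(** Near a boundary point: a chart, a smooth extension [f] of the boundary
distance, and a local defining function [rho]. *)
Definition defining a O f rho : Prop :=
  [/\ [/\ atlas a, open O & O `<=` cdom a],
      CkX 3 O f /\ CkX 3 O rho,
      forall q, O q -> closure Omega q -> f q = delta q,
      Omega `&` O = [set q | O q /\ 0 < rho q] /\
      M `&` O = [set q | O q /\ rho q = 0] &
      forall q, O q -> M q -> d_neq0 rho q].

Hypothesis oOm : open Omega.
Hypothesis hbd : Ck_boundary 3 Omega.
Hypothesis hdelta : boundary_distance 3 Omega delta.

Lemma defining_exists p : M p -> exists a O f rho,
  [/\ defining a O f rho, O p & d_neq0 f p].
Proof.
move=> Mp; have [a aa ap] := atlas_cover p.
have [V1 [rho [[oV1 V1p] cr E1 E2 dr]]] := hbd Mp.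
have [ext _ _] := hdelta.
have [V2 [f [[oV2 V2p] cf fE df]]] := ext p (proj1 Mp).
pose O := cdom a `&` (V1 `&` V2).
have [oD _ _ _ _] := atlas_chart aa.
exists a, O, f, rho; split; [|by []|exact: df Mp].
split.
- split; [exact: aa| |by move=> q []].
  by apply: openI; [|exact: openI].
- by split; [apply: CkX_sub cf => q [_ []]|apply: CkX_sub cr => q [_ []]].
- by move=> q [_ [_ Oq]]; exact: fE.
- split; apply/seteqP; split => q.
  + move=> [Om [Dq [V1q V2q]]]; split => //.
    by have : (Omega `&` V1) q by []; rewrite E1 => -[].
  + move=> [[Dq [V1q V2q]] r0]; split => //.
    by have : [set q | V1 q /\ 0 < rho q] q by []; rewrite -E1 => -[].
  + move=> [Om [Dq [V1q V2q]]]; split => //.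
    by have : (M `&` V1) q by []; rewrite E2 => -[].
  + move=> [[Dq [V1q V2q]] r0]; split => //.
    by have : [set q | V1 q /\ rho q = 0] q by []; rewrite -E2 => -[].
- by move=> q [_ [Oq _]]; exact: dr.
Qed.

Section InChart.
Variables (a : chart R X) (O : set X) (f rho : X -> R) (c : fchart X).
Hypotheses (hd : defining a O f rho) (fc : foliated_chart M c).

Definition dbase := cmap a @` (cdom a `&` O).
Definition dbox := (fD c `*` fT c) `&` fpar c @^-1` O.
Definition dpar := cmap a \o fpar c.

Let aa : atlas a. Proof. by have [[]] := hd. Qed.
Let ac : is_chart a. Proof. exact: atlas_chart aa. Qed.
Let oO : open O. Proof. by have [[]] := hd. Qed.
Let subO : O `<=` cdom a. Proof. by have [[]] := hd. Qed.

Lemma dbase_open : open dbase. Proof. exact: chart_image_open. Qed.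

Lemma dbaseP y : dbase y -> [/\ cdom a (cinv a y), O (cinv a y) & cmap a (cinv a y) = y].
Proof. exact: chart_image. Qed.

Lemma dbase_cmap q : O q -> dbase (cmap a q).
Proof. by move=> Oq; exists q => //; split => //; exact: subO. Qed.

Lemma dbox_open : open dbox. Proof. exact: foliated_preimage_open fc oO. Qed.

Lemma dbox_M x : dbox x -> M (fpar c x).
Proof.
by move=> [Dx _]; have [dx _ _] := foliated_chart_par fc Dx; exact: foliated_chart_sub fc _ dx.
Qed.

Lemma dpar_canc x : dbox x -> cinv a (dpar x) = fpar c x.
Proof. by move=> [_ Ox]; rewrite /dpar /= chart_canc //; exact: subO. Qed.

Lemma Ck_dpar : Ck 3 dbox dpar.
Proof.
have [_ _ _ H _] := fc; have [ck _] := H a aa.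
by apply: Ck_sub ck => x [Dx Ox]; split => //; exact: subO.
Qed.

Lemma dpar_immersion x v : dbox x -> vd dpar v x = 0 -> v = 0.
Proof.
have [_ _ _ H _] := fc; have [_ im] := H a aa.
by move=> [Dx Ox]; rewrite -vdE; apply: im; split => //; exact: subO.
Qed.

Lemma dpar_base x : dbox x -> dbase (dpar x).
Proof. by move=> [_ Ox]; exact: dbase_cmap. Qed.

Lemma Ck_df : Ck 3 dbase (f \o cinv a).
Proof. by have [_ [cf _] _ _ _] := hd; exact: cf. Qed.

Lemma Ck_drho : Ck 3 dbase (rho \o cinv a).
Proof. by have [_ [_ cr] _ _ _] := hd; exact: cr. Qed.

Lemma df_zero x : dbox x -> (f \o cinv a) (dpar x) = 0.
Proof.
move=> Ax; rewrite /= dpar_canc //; have Mx := dbox_M Ax.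
have [_ _ fE _ _] := hd; have [_ _ d0] := hdelta.
by rewrite fE ?d0 //; [case: Ax|case: Mx].
Qed.

Lemma drho_zero x : dbox x -> (rho \o cinv a) (dpar x) = 0.
Proof.
move=> Ax; rewrite /= dpar_canc //; have Mx := dbox_M Ax.
have [_ _ _ [_ E] _] := hd.
have : (M `&` O) (fpar c x) by split => //; case: Ax.
by rewrite E => -[].
Qed.

Lemma dpar_CR x : dbox x -> vd dpar (diry R) x = J2 (vd dpar (dirx R) x).
Proof.
move=> Ax; case: x Ax => z t Ax.
have [_ _ _ _ H] := fc.
have [dg Jg] : differentiable (fun z => cmap a (fpar c (z, t))) z /\
    forall v, 'd (fun z => cmap a (fpar c (z, t))) z (J1 v) =
      J2 ('d (fun z => cmap a (fpar c (z, t))) z v).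
  by apply: (H a aa t _ z); case: Ax => -[/= Dz Tt] Ox; [|split => //; exact: subO].
have E v : 'd (fun z => cmap a (fpar c (z, t))) z v = vd dpar (v, 0) (z, t).
  rewrite -deriveE // -vdE.
  have DE : (fun h : R => h^-1 *: ((dpar \o shift (z, t)) (h *: ((v, 0) : C1 R * R)) - dpar (z, t))) =
      (fun h : R => h^-1 *: (((fun z => cmap a (fpar c (z, t))) \o shift z) (h *: v) - cmap a (fpar c (z, t)))).
    apply/funext => s /=; congr (_ *: (_ - _)); congr (cmap a (fpar c _)).
    by congr pair; rewrite /= scaler0 add0r.
  by rewrite /derive DE.
have := Jg (1, 0); rewrite !E => <-; congr vd.
by rewrite /diry /J1 /= oppr0.
Qed.

Lemma df_pos y : dbase y -> 0 < (rho \o cinv a) y -> 0 < (f \o cinv a) y.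
Proof.
move=> /dbaseP[Dy Oy _] /= ry; have [_ _ fE [E _] _] := hd.
have [Om _] : (Omega `&` O) (cinv a y) by rewrite E.
have [_ OmE _] := hdelta.
have : [set p | closure Omega p /\ 0 < delta p] (cinv a y) by rewrite -OmE.
by case=> cl d0; rewrite fE.
Qed.

Lemma drho_neq0 x : dbox x -> exists v, pd (rho \o cinv a) v (dpar x) != 0.
Proof.
move=> Ax; have [_ _ _ _ H] := hd.
have Ox : O (fpar c x) by case: Ax.
by have [v] := H _ Ox (dbox_M Ax) a aa (subO Ox); rewrite pdE; exists v.
Qed.

Lemma dpar_homeo x0 r : dbox x0 -> 0 < r -> \forall y \near dpar x0,
  (rho \o cinv a) y = 0 -> exists x, [/\ dbox x, ball x0 r x & dpar x = y].
Proof.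
move=> Ax0 r0; have [_ _ _ [_ E] _] := hd.
have [Dx0 Ox0] := Ax0.
have [dx E1 E2] := foliated_chart_par fc Dx0.
have n0 : nbhs (fz c (fpar c x0), ft c (fpar c x0)) (ball x0 r `&` (fD c `*` fT c)).
  rewrite E1 E2 -surjective_pairing; apply: filterI; first exact: nbhsx_ballx.
  by apply: open_nbhs_nbhs; split => //; exact: foliated_box_open fc.
have nq := foliated_coord_near fc dx n0.
have [_ _ _ ci _] := ac.
have nc : (cinv a) @ (dpar x0) --> fpar c x0.
  rewrite -(dpar_canc Ax0); apply: ci; rewrite inE; exists (fpar c x0) => //.
  exact: subO.
have nb : \forall y \near dpar x0, dbase y.
  by apply: open_nbhs_nbhs; split; [exact: dbase_open|exact: dpar_base].
have ny : \forall y \near dpar x0, M (cinv a y) -> fdom c (cinv a y) /\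
    (ball x0 r `&` (fD c `*` fT c)) (fz c (cinv a y), ft c (cinv a y)) := nc _ nq.
apply: filterS2 nb ny => y /dbaseP[Dy Oy Ey] ny ry.
have [My _] : (M `&` O) (cinv a y) by rewrite E.
have [dy [b1 b2]] := ny My.
have [_ _ pE] := foliated_chart_dom fc dy.
exists (fz c (cinv a y), ft c (cinv a y)); split => //.
- by split => //; rewrite /preimage /= pE.
- by rewrite /dpar /= pE.
Qed.

Definition dnormal := normal_deriv dpar (f \o cinv a).

Lemma Ck_dnormal : Ck 2 dbox dnormal.
Proof.
apply: (Ck_normal_deriv dbox_open dbase_open Ck_dpar Ck_df dpar_base).
Qed.

Lemma dnormal_neq0 x : dbox x -> d_neq0 f (fpar c x) -> dnormal x != 0.
Proof.
move=> Ax df.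
apply: (normal_deriv_neq0 dbox_open dbase_open Ck_dpar dpar_base dpar_CR dpar_immersion Ax
  (Ck_le _ Ck_df) df_zero) => //.
have [|v] := df a aa; first by apply: subO; case: Ax.
by rewrite pdE; exists v.
Qed.


(** Strict plurisubharmonicity of a power of the boundary distance near a
boundary point, read in the chart of the defining data. *)
Definition psh_exponent (p : X) (y : R) : Prop := exists2 U : set X, open_nbhs p U &
  strictly_psh (U `&` Omega) (fun q => - (delta q `^ y)).

Definition chart_exponent (p : X) (y : R) : Prop := \forall q \near cmap a p,
  0 < (rho \o cinv a) q -> forall w, w != 0 ->
  0 < levi (@J2 R) (fun x => - ((f \o cinv a) x `^ y)) q w w.

Lemma levi_near (u v : C2 R -> R) z w w' : {near z, u =1 v} ->
  levi (@J2 R) u z w w' = levi (@J2 R) v z w w'.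
Proof.
move=> uv.
have H b : {near z, pd u b =1 pd v b}.
  by move/near_join: uv; apply: filterS => y; exact: pd_near.
by rewrite /levi (pd_near _ (H _)) (pd_near _ (H _)).
Qed.

Let OmE q : O q -> Omega q -> 0 < f q /\ f q = delta q.
Proof.
move=> Oq Om; have [_ _ fE _ _] := hd; have [_ E _] := hdelta.
by move: (Om); rewrite E => -[cl d0]; rewrite fE.
Qed.

Lemma psh_chart_exponent p y : O p -> psh_exponent p y -> chart_exponent p y.
Proof.
move=> Op [U [oU Up] [cu pos]].
pose B' := cmap a @` (cdom a `&` (O `&` (U `&` Omega))).
have oB' : open B' by apply: chart_image_open => //; do 2 apply: openI => //.
have nb : \forall q \near cmap a p, (cmap a @` (cdom a `&` (O `&` U))) q.
  apply: open_nbhs_nbhs; split; last by exists p => //; split => //; exact: subO.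
  by apply: chart_image_open => //; exact: openI.
apply: filterS nb => q nq /= rq w w0.
have [Dq [Oq Uq] qE] := chart_image ac nq.
have Omq : Omega (cinv a q).
  have [_ _ _ [E _] _] := hd.
  by have : [set q | O q /\ 0 < rho q] (cinv a q) by []; rewrite -E => -[].
have Bq : B' q by exists (cinv a q).
have ck : Ck 2 B' ((fun q => - (delta q `^ y)) \o cinv a).
  by apply: Ck_sub (cu a aa) => z [q' [Dq' [Oq' H]] <-]; exists q'.
rewrite (@levi_near _ ((fun q => - (delta q `^ y)) \o cinv a)); last first.
  have : \forall z \near q, B' z by exact: open_nbhs_nbhs.
  apply: filterS => z /(chart_image ac)[_ [Oz [_ Omz]] _] /=.
  by have [_ ->] := OmE Oz Omz.
have := pos a aa (cinv a q) Dq (conj Uq Omq); rewrite qE => /(pos_complex_hessianP oB' Bq ck).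
exact.
Qed.

Let transition_injective a' z w : atlas a' -> (cmap a' @` (cdom a' `&` cdom a)) z ->
  w != 0 -> 'd (cmap a \o cinv a') z w != 0.
Proof.
move=> aa' Az; apply: contra_neq => dw.
have ac' := atlas_chart aa'.
have [Dz Daz zE] := chart_image ac' Az.
have [d1 _] := atlas_holomorphic aa' aa Az.
have Az' : (cmap a @` (cdom a `&` cdom a')) ((cmap a \o cinv a') z) by exists (cinv a' z).
have [d2 _] := atlas_holomorphic aa aa' Az'.
have ne : {near z, (cmap a' \o cinv a) \o (cmap a \o cinv a') =1 id}.
  have [oDa _ _ _ _] := ac.
  have : \forall y \near z, (cmap a' @` (cdom a' `&` cdom a)) y.
    by apply: open_nbhs_nbhs; split => //; exact: chart_image_open.
  apply: filterS => y /(chart_image ac')[Dy Day yE] /=.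
  by rewrite chart_canc // yE.
exact: diff_left_inverse d1 d2 ne dw.
Qed.

Lemma chart_psh_exponent p y : O p -> 0 < y -> chart_exponent p y -> psh_exponent p y.
Proof.
move=> Op y0; rewrite /chart_exponent.
move=> /nbhs_ballP[r /= r0 subN].
pose N := ball (cmap a p) r.
have oN : open N by exact: ball_open.
have Np : N (cmap a p) by exact: ballxx.
pose U := O `&` cmap a @^-1` N.
have Dp : cdom a p by exact: subO.
have oU : open U.
  rewrite openE => q [Oq Nq]; apply: filterI; first exact: open_nbhs_nbhs.
  have [_ _ cm _ _] := ac.
  by apply: cm; [rewrite inE; exact: subO|exact: open_nbhs_nbhs].
exists U; first by split.
have oW : open (U `&` Omega) by exact: openI.
have ckf a' : atlas a' -> Ck 2 (cmap a' @` (cdom a' `&` (U `&` Omega)))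
    (fun x => - ((f \o cinv a') x `^ y)).
  move=> aa'; have ac' := atlas_chart aa'.
  have oB := chart_image_open ac' oW.
  apply: CkN => //; apply: Ck_powR => //.
    by move=> z /(chart_image ac')[_ [[Oz _] Omz] _]; have [] := OmE Oz Omz.
  have [_ [cf _] _ _ _] := hd; apply: Ck_sub (Ck_le _ (cf a' aa')) => //.
  by move=> z [q [Dq [[Oq _] _]] <-]; exists q.
have ckd a' : atlas a' -> forall z, (cmap a' @` (cdom a' `&` (U `&` Omega))) z ->
    - ((f \o cinv a') z `^ y) = ((fun q => - (delta q `^ y)) \o cinv a') z.
  move=> aa' z /(chart_image (atlas_chart aa'))[_ [[Oz _] Omz] _] /=.
  by have [_ ->] := OmE Oz Omz.
have ck a' : atlas a' -> Ck 2 (cmap a' @` (cdom a' `&` (U `&` Omega)))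
    ((fun q => - (delta q `^ y)) \o cinv a').
  move=> aa'; apply: (Ck_ext (chart_image_open (atlas_chart aa') oW)) (ckf a' aa').
  exact: ckd.
split; first exact: ck.
move=> a' aa' q Dq [Uq Omq].
have ac' := atlas_chart aa'.
have oB' := chart_image_open ac' oW.
have Bq : (cmap a' @` (cdom a' `&` (U `&` Omega))) (cmap a' q) by exists q.
apply/(pos_complex_hessianP oB' Bq (ck a' aa')) => w w0.
rewrite (@levi_near _ ((fun x => - ((f \o cinv a) x `^ y)) \o (cmap a \o cinv a'))); last first.
  have : \forall z \near cmap a' q, (cmap a' @` (cdom a' `&` (U `&` Omega))) z.
    exact: open_nbhs_nbhs.
  apply: filterS => z Bz; rewrite -(ckd a' aa' z Bz) /=.
  have [_ [[Oz _] _] _] := chart_image ac' Bz.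
  by rewrite chart_canc //; exact: subO.
have sub : cmap a' @` (cdom a' `&` (U `&` Omega)) `<=` cmap a' @` (cdom a' `&` cdom a).
  by move=> z [q' [Dq' [[Oq' _] _]] <-]; exists q' => //; split => //; exact: subO.
rewrite (@levi_comp _ (cmap a' @` (cdom a' `&` (U `&` Omega)))
   (cmap a @` (cdom a `&` (U `&` Omega)))) //.
- have [Oq Nq] := Uq.
  have E : (cmap a \o cinv a') (cmap a' q) = cmap a q by rewrite /= chart_canc.
  apply: (subN ((cmap a \o cinv a') (cmap a' q))).
  + by rewrite E.
  + rewrite E /= chart_canc //; last exact: subO.
    have [_ _ _ [E1 _] _] := hd.
    by have : (Omega `&` O) q by []; rewrite E1 => -[].
  + by apply: transition_injective => //; exact: sub.
- exact: chart_image_open.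
- by move=> z /sub /(atlas_holomorphic aa' aa).
- move=> z Bz; have [_ [Uz Omz] _] := chart_image ac' Bz.
  by exists (cinv a' z) => //; split => //; apply: subO; case: Uz.
- exact: ckf.
- apply: (Ck_ext oB') (ckf a' aa') => z Bz /=.
  have [_ [[Oz _] _] _] := chart_image ac' Bz.
  by rewrite chart_canc //; exact: subO.
Qed.

Lemma dnormal_laplacian x (eta : R) : dbox x -> d_neq0 f (fpar c x) -> 0 < eta < 1 ->
  local_DF_exponent Omega delta (fpar c x) = eta ->
  pd (pd dnormal (dirx R)) (dirx R) x + pd (pd dnormal (diry R)) (diry R) x =
  (1 - eta / (1 - eta)) * (pd dnormal (dirx R) x ^+ 2 + pd dnormal (diry R) x ^+ 2) / dnormal x.
Proof.
move=> Ax df eta01 supE.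
have Ox : O (fpar c x) by case: Ax.
apply: (exponent_laplacian dbox_open dbase_open Ck_dpar Ck_df (Ck_le _ Ck_drho) dpar_base
  df_zero drho_zero dpar_CR dpar_immersion Ax _ _ df_pos _ eta01) => //.
- exact: drho_neq0.
- by have [v] := df a aa (subO Ox); rewrite pdE; exists v.
- by move=> r; exact: dpar_homeo.
- rewrite -supE /local_DF_exponent; congr sup.
  apply/seteqP; split => y /= [y01 H]; split => //.
    by apply: chart_psh_exponent => //; case/andP: y01.
  exact: psh_chart_exponent.
Qed.

End InChart.

End DefiningData.

(** * Changes of foliated charts *)

Section LeftInverse.
Context (R : realType).

Lemma Ck_local (V W : normedModType R) k (A : set V) (f : V -> W) :
  (forall x, A x -> exists2 B, open_nbhs x B & Ck k B f) -> Ck k A f.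
Proof.
elim: k f => [|k IH] f H.
  by split=> // x; rewrite inE => /H[B [_ Bx] cf]; exact: Ck_cont cf Bx.
split=> [x|v]; first by rewrite inE => /H[B [_ Bx] cf]; exact: Ck_cont cf Bx.
split=> [x /H[B [_ Bx] cf]|]; first exact: Ck_derivable cf Bx.
by apply: IH => x /H[B nB cf]; exists B => //; exact: Ck_derive v cf.
Qed.

Lemma fin_dim_bounded (V W : normedModType R) (L : V -> W) : fin_dim V ->
  (forall (a : R) u v, L (a *: u + v) = a *: L u + L v) ->
  exists C : R, forall v, `|L v| <= C * `|v|.
Proof.
move=> [d [e [x [xl xe xn]]]] lin; exists (\sum_i `|L (e i)|) => v.
have L0 : L 0 = 0 by have := lin (-1) 0 0; rewrite scaler0 addr0 scaleN1r addNr.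
have HH (r : seq 'I_d) (c : 'I_d -> R) :
    L (\sum_(i <- r) c i *: e i) = \sum_(i <- r) c i *: L (e i).
  elim: r => [|i r IH]; first by rewrite !big_nil L0.
  by rewrite !big_cons lin IH.
rewrite {1}(xe v) HH (le_trans (ler_norm_sum _ _ _)) // mulr_suml ler_sum // => i _.
by rewrite normrZ mulrC ler_wpM2l.
Qed.

(** A continuous map that becomes strictly differentiable after composition with
an immersion is strictly differentiable. *)
Lemma sdiff_lift (U V W : normedModType R) (Psi : V -> W) (Phi : U -> W) (y : U -> V)
    x0 M N (L : W -> V) :
  sdiff Psi (y x0) M -> sdiff Phi x0 N -> (forall (a : R) u v, L (a *: u + v) = a *: L u + L v) ->
  (exists C : R, forall v, `|L v| <= C * `|v|) -> (forall v, L (M v) = v) ->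
  {for x0, continuous y} -> (\forall x \near x0, Psi (y x) = Phi x) ->
  sdiff y x0 (L \o N).
Proof.
move=> [Ml _ Me] [Nl [CN HN] Ne] Ll [C0 HL0] LM cy E.
pose C := `|C0| + 1.
have Cp : 0 < C by rewrite ltr_wpDl.
have HL v : `|L v| <= C * `|v|.
  by rewrite (le_trans (HL0 v)) // ler_wpM2r // (le_trans (ler_norm _)) // lerDl.
pose K := `|CN| + 1.
have Kp : 0 < K by rewrite ltr_wpDl.
have HNK v : `|N v| <= K * `|v|.
  by rewrite (le_trans (HN v)) // ler_wpM2r // (le_trans (ler_norm _)) // lerDl.
have LB u v : L (u - v) = L u - L v.
  by rewrite addrC -scaleN1r Ll scaleN1r addrC.
split.
- by move=> a u v /=; rewrite Nl Ll.
- by exists (C * K) => v /=; rewrite (le_trans (HL _)) // -mulrA ler_wpM2l // ltW.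
move=> eps e0.
pose e2 := Num.min 1 (eps / (2 * C)).
have e20 : 0 < e2 by rewrite lt_min ltr01 divr_gt0 // mulr_gt0.
pose e1 := Num.min (1 / (2 * C)) (eps / (4 * C * C * (K + 1))).
have K1 : 0 < K + 1 by rewrite addr_gt0.
have e10 : 0 < e1 by rewrite lt_min !divr_gt0 // !mulr_gt0.
have [r1 r10 H1] := Me _ e10; have [r2 r20 H2] := Ne _ e20.
have [d d0 Hd] := continuous_at_ball cy r10.
have /nbhs_ballP[d' /= d'0 Hd'] := E.
exists (Num.min r2 (Num.min d d')); first by rewrite !lt_min r20 d0.
have sub x : ball x0 (Num.min r2 (Num.min d d')) x ->
    [/\ ball x0 r2 x, ball (y x0) r1 (y x) & Psi (y x) = Phi x].
  rewrite -ball_normE /= !lt_min => /and3P[b1 b2 b3].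
  by split; [|apply: Hd|apply: Hd']; rewrite // -ball_normE.
move=> u v /sub[bu yu Eu] /sub[bv yv Ev].
have h1 := H1 _ _ yu yv; have h2 := H2 _ _ bu bv.
rewrite Eu Ev in h1.
set Dx := u - v in h2 *; set Dy := y u - y v in h1 *; set DP := Phi u - Phi v in h1 h2.
have EE : Dy - L (N Dx) = L (DP - N Dx) - L (DP - M Dy).
  by rewrite !LB LM opprB [RHS]addrC addrA subrK.
have n1 : `|Dy - L (N Dx)| <= C * (e2 * `|Dx|) + C * (e1 * `|Dy|).
  rewrite EE (le_trans (ler_normB _ _)) // lerD // (le_trans (HL _)) // ler_wpM2l //; exact: ltW.
have n2 : `|Dy| <= `|Dy - L (N Dx)| + C * (K * `|Dx|).
  rewrite -{1}(subrK (L (N Dx)) Dy) (le_trans (ler_normD _ _)) // lerD2l.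
  by rewrite (le_trans (HL _)) // ler_wpM2l ?HNK //; exact: ltW.
have c1 : C * e1 <= 1 / 2.
  have : e1 <= 1 / (2 * C) by rewrite /e1 ge_min lexx.
  by rewrite ler_pdivlMr ?mulr_gt0 // => H; lra.
have c2 : e2 <= 1 by rewrite /e2 ge_min lexx.
have c3 : C * e2 <= eps / 2.
  have : e2 <= eps / (2 * C) by rewrite /e2 ge_min lexx orbT.
  by rewrite ler_pdivlMr ?mulr_gt0 // => H; lra.
have c4 : e1 * (4 * C * C * (K + 1)) <= eps.
  by rewrite -ler_pdivlMr ?mulr_gt0 // /e1 ge_min lexx orbT.
have x0' : 0 <= `|Dx| by []; have y0' : 0 <= `|Dy| by [].
move: n1 n2 c1 c2 c3 c4 x0' y0' Cp Kp e10 e20.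
move: `|Dy - L (N Dx)| `|Dx| `|Dy| => n X Y n1 n2 c1 c2 c3 c4 X0 Y0 Cp Kp e10 e20.
have s1 : C * (e1 * Y) <= Y / 2.
  by have := ler_wpM2r Y0 c1; lra.
have s2 : C * (e2 * X) <= C * X.
  by have := ler_wpM2r X0 c2; rewrite mul1r => H; rewrite ler_pM2l.
have s3 : Y <= 2 * C * (K + 1) * X by lra.
have s4 : C * e1 * Y <= C * e1 * (2 * C * (K + 1) * X) by rewrite ler_wpM2l // mulr_ge0 // ltW.
have s5 := ler_wpM2r X0 c4; have s6 := ler_wpM2r X0 c3.
lra.
Qed.

End LeftInverse.

Section FrameCoordinates.
Context (R : realType).
Implicit Types (e v w : C2 R).

Definition frame_map e v (x : C1 R * R) : C2 R := x.1.1 *: e + x.1.2 *: J2 e + x.2 *: v.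

Definition frame_coord e v w : C1 R * R := (cramer1 e v w, (cramer2 e v w).1).

Lemma cdet_expand e v (p q r s : R) :
  cdet (p *: e + q *: J2 e + (r *: v + s *: J2 v)) v = cmul (p, q) (cdet e v) /\
  cdet e (p *: e + q *: J2 e + (r *: v + s *: J2 v)) = cmul (r, s) (cdet e v).
Proof.
case: e v => [[x y] [z t]] [[x' y'] [z' t']].
have -> : p *: ((x, y), (z, t)) + q *: J2 ((x, y), (z, t)) + (r *: ((x', y'), (z', t')) + s *: J2 ((x', y'), (z', t')))
  = (((p * x - q * y + (r * x' - s * y'), p * y + q * x + (r * y' + s * x')),
      (p * z - q * t + (r * z' - s * t'), p * t + q * z + (r * t' + s * z'))) : C2 R).
  rewrite /J2 /J1 /=.
  transitivity (((p * x + q * - y + (r * x' + s * - y'), p * y + q * x + (r * y' + s * x')),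
      (p * z + q * - t + (r * z' + s * - t'), p * t + q * z + (r * t' + s * z'))) : C2 R); first by [].
  by congr (_, _, (_, _)); ring.
by rewrite !cdetE /cmul /=; split; congr (_, _); ring.
Qed.

Lemma frame_coordK e v : cdet2 e v != 0 -> forall x, frame_coord e v (frame_map e v x) = x.
Proof.
move=> D0 [[p q] r]; rewrite /frame_coord /cramer1 /cramer2.
have -> : frame_map e v (p, q, r) = p *: e + q *: J2 e + (r *: v + 0 *: J2 v).
  by rewrite scale0r addr0.
have [-> ->] := cdet_expand e v p q r 0.
move: D0; rewrite /cdet2; case: (cdet e v) => x y; rewrite /cmul /= => D0.
transitivity ((((x ^+ 2 + y ^+ 2)^-1 * (x * (p * x - q * y) - - y * (p * y + q * x)),
   (x ^+ 2 + y ^+ 2)^-1 * (x * (p * y + q * x) + - y * (p * x - q * y))),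
   (x ^+ 2 + y ^+ 2)^-1 * (x * (r * x - 0 * y) - - y * (r * y + 0 * x))) : C1 R * R); first by [].
by congr (_, _, _); field.
Qed.

Lemma cdet_linear_l v (a : R) u w : cdet (a *: u + w) v = a *: cdet u v + cdet w v.
Proof.
case: u w v => [[x y] [z t]] [[x1 y1] [z1 t1]] [[x2 y2] [z2 t2]].
transitivity (cdet ((a * x + x1, a * y + y1), (a * z + z1, a * t + t1)) ((x2, y2), (z2, t2))); first by [].
rewrite !cdetE; transitivity ((a * (x * z2 - y * t2 - (z * x2 - t * y2)) + (x1 * z2 - y1 * t2 - (z1 * x2 - t1 * y2)),
  a * (x * t2 + y * z2 - (z * y2 + t * x2)) + (x1 * t2 + y1 * z2 - (z1 * y2 + t1 * x2))) : C1 R); last by [].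
by congr (_, _); ring.
Qed.

Lemma cdet_linear_r v (a : R) u w : cdet v (a *: u + w) = a *: cdet v u + cdet v w.
Proof.
case: u w v => [[x y] [z t]] [[x1 y1] [z1 t1]] [[x2 y2] [z2 t2]].
transitivity (cdet ((x2, y2), (z2, t2)) ((a * x + x1, a * y + y1), (a * z + z1, a * t + t1))); first by [].
rewrite !cdetE; transitivity ((a * (x2 * z - y2 * t - (z2 * x - t2 * y)) + (x2 * z1 - y2 * t1 - (z2 * x1 - t2 * y1)),
  a * (x2 * t + y2 * z - (z2 * y + t2 * x)) + (x2 * t1 + y2 * z1 - (z2 * y1 + t2 * x1))) : C1 R); last by [].
by congr (_, _); ring.
Qed.

Lemma cmul_linear (c : C1 R) (a : R) (u w : C1 R) : cmul c (a *: u + w) = a *: cmul c u + cmul c w.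
Proof.
case: c u w => [p q] [x y] [z t].
transitivity ((p * (a * x + z) - q * (a * y + t), p * (a * y + t) + q * (a * x + z)) : C1 R); first by [].
transitivity ((a * (p * x - q * y) + (p * z - q * t), a * (p * y + q * x) + (p * t + q * z)) : C1 R); last by [].
by congr (_, _); ring.
Qed.

Lemma frame_coord_linear e v (a : R) u w :
  frame_coord e v (a *: u + w) = a *: frame_coord e v u + frame_coord e v w.
Proof.
rewrite /frame_coord /cramer1 /cramer2 cdet_linear_l cdet_linear_r !cmul_linear.
have S (k : R) (A B : C1 R) : k *: (a *: A + B) = a *: (k *: A) + k *: B.
  by rewrite scalerDr !scalerA mulrC.
by rewrite !S.
Qed.

Lemma frame_linear (w b : C1 R) (s p q r : R) :
  p *: ((w, 0) : C1 R * R) + q *: (((- w.2, w.1), 0) : C1 R * R) + r *: ((b, s) : C1 R * R) =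
  (cmul w (p, q) + r *: b, s * r).
Proof.
case: w b => [w1 w2] [b1 b2].
transitivity (((p * w1 + q * - w2 + r * b1, p * w2 + q * w1 + r * b2), p * 0 + q * 0 + r * s) : C1 R * R); first by [].
transitivity (((w1 * p - w2 * q + r * b1, w1 * q + w2 * p + r * b2), s * r) : C1 R * R); last by [].
by congr (_, _, _); ring.
Qed.

End FrameCoordinates.

Section OneSided.
Context (R : realType) (V : normedModType R).

Lemma derive_one_sided (F G : V -> R) z v : derivable F z v -> derivable G z v ->
  F z = G z -> (\forall s \near (0 : R)^'+, F (z + s *: v) = G (z + s *: v)) ->
  'D_v F z = 'D_v G z.
Proof.
move=> dF dG z0 FG.
have cF : (fun h : R => h^-1 *: (F (h *: v + z) - F z)) @ (0 : R)^'+ --> 'D_v F z.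
  exact: cvg_dnbhs_at_right dF.
have cG : (fun h : R => h^-1 *: (G (h *: v + z) - G z)) @ (0 : R)^'+ --> 'D_v G z.
  exact: cvg_dnbhs_at_right dG.
have D : (fun h : R => h^-1 *: (F (h *: v + z) - F z) - h^-1 *: (G (h *: v + z) - G z))
    @ (0 : R)^'+ --> 'D_v F z - 'D_v G z by exact: cvgB cF cG.
have E : \forall h \near (0 : R)^'+,
    h^-1 *: (F (h *: v + z) - F z) - h^-1 *: (G (h *: v + z) - G z) = 0.
  by apply: filterS FG => s; rewrite [s *: v + z]addrC => ->; rewrite z0 subrr.
apply/eqP; rewrite -subr_eq0 eq_le; apply/andP; split.
  by apply: cvgr_to_le D _; apply: filterS E => h ->.
by apply: cvgr_to_ge D _; apply: filterS E => h ->.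
Qed.

End OneSided.

Section Transition.
Context (R : realType) (X : complexSurface R).
Variables (Omega : set X) (delta : X -> R).
Let M := bd Omega.
Hypothesis oOm : open Omega.
Hypothesis hbd : Ck_boundary 3 Omega.
Hypothesis hdelta : boundary_distance 3 Omega delta.

Let fV := fin_dimC1R R.
Let fW := fin_dimC2 R.
Let sW := @C1_strictC2 R.

Lemma sdiff_dpar a O f rho (c : fchart X) x : defining Omega delta a O f rho ->
  foliated_chart M c -> dbox O c x -> sdiff (dpar a c) x (fun v => vd (dpar a c) v x).
Proof.
move=> hd fc Ax; apply: (vd_sdiff fV sW (dbox_open hd fc) _ Ax).
exact: (Ck_le _ (Ck_dpar hd fc)).
Qed.

(** The normal derivative depends neither on the chart of the surface nor on the
extension of the boundary distance: two extensions agree on one side of the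
boundary. *)
Lemma dnormal_indep a O f rho a' O' f' rho' (c : fchart X) x :
  defining Omega delta a O f rho -> defining Omega delta a' O' f' rho' ->
  foliated_chart M c -> dbox O c x -> dbox O' c x ->
  dnormal a f c x = dnormal a' f' c x.
Proof.
move=> hd hd' fc Ax Ax'.
have [[aa oO subO] _ fE [rE _] _] := hd.
have [[aa' oO' subO'] _ fE' _ _] := hd'.
have [ac ac'] := (atlas_chart aa, atlas_chart aa').
have Ox : O (fpar c x) by case: Ax.
have Ox' : O' (fpar c x) by case: Ax'.
pose z := dpar a c x.
have Az : (cmap a @` (cdom a `&` cdom a')) z.
  by exists (fpar c x) => //; split; [exact: subO|exact: subO'].
have [dk Jk] := atlas_holomorphic aa aa' Az.
set kap := cmap a' \o cinv a in dk Jk.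
have kz : kap z = dpar a' c x by rewrite /kap /z /dpar /= chart_canc //; exact: subO.
have [s1 E1] := sdiff_differentiable (sdiff_dpar hd fc Ax).
have [s2 E2] := sdiff_differentiable (sdiff_dpar hd' fc Ax').
have vdk v : vd (dpar a' c) v x = 'd kap z (vd (dpar a c) v x).
  have ne : {near x, dpar a' c =1 kap \o dpar a c}.
    have : \forall y \near x, dbox O c y.
      by apply: open_nbhs_nbhs; split => //; exact: dbox_open hd fc.
    apply: filterS => y [_ Oy]; rewrite /kap /dpar /= chart_canc //; exact: subO.
  rewrite -vdE (near_eq_derive v ne) deriveE; last exact: differentiable_comp.
  by rewrite (diff_comp s1 dk) /= E1.
have oB := dbase_open hd; have oB' := dbase_open hd'.
have Bz : dbase a O z by exact: dpar_base hd _ Ax.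
have Bz' : dbase a' O' (kap z) by rewrite kz; exact: dpar_base hd' _ Ax'.
pose W := vd (dpar a c) (dirt R) x.
have cr := Ck_le (isT : (1 <= 3)%N) (Ck_drho hd).
have rn : pd (rho \o cinv a) (J2 W) z != 0.
  apply: (normal_deriv_neq0 (dbox_open hd fc) oB (Ck_dpar hd fc) (dpar_base hd)
    (dpar_CR hd fc) (dpar_immersion hd fc) Ax cr (drho_zero hd fc)).
  by have [v rv] := drho_neq0 hd fc Ax; exists v.
pose sg : R := if 0 < pd (rho \o cinv a) (J2 W) z then 1 else -1.
have sg0 : sg != 0 by rewrite /sg; case: ifP => _; rewrite ?oppr_eq0 oner_eq0.
pose V := sg *: J2 W.
have rV : 0 < pd (rho \o cinv a) V z.
  rewrite (pdZv fW oB Bz cr) /sg; case: ifP => [|/negbT]; first by rewrite mul1r.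
  by rewrite -leNgt le_eqVlt (negbTE rn) /= mulN1r oppr_gt0.
have cf := Ck_le (isT : (1 <= 3)%N) (Ck_df hd).
have cf' := Ck_le (isT : (1 <= 3)%N) (Ck_df hd').
have [D2 E2'] := sdiff_differentiable (pd_sdiff fW oB' Bz' cf').
have D12 : differentiable ((f' \o cinv a') \o kap) z by exact: differentiable_comp.
have key : 'D_V (f \o cinv a) z = 'D_V ((f' \o cinv a') \o kap) z.
  apply: derive_one_sided.
  - exact: Ck_derivable cf Bz.
  - exact: diff_derivable.
  - rewrite -[LHS]/((f \o cinv a) (dpar a c x)) (df_zero hdelta hd fc Ax).
    by rewrite -[RHS]/((f' \o cinv a') (kap z)) kz (df_zero hdelta hd' fc Ax').
  have cs : (fun s : R => s) @ (0 : R)^'+ --> (0 : R) by apply: cvg_within.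
  have cm : (fun _ : R => z) @ (0 : R)^'+ --> z by exact: cvg_cst.
  have sp : \forall s \near (0 : R)^'+, 0 < s by exact: nbhs_right_gt.
  have c1 := cvg_quotient (FF := at_right_proper_filter _) (v := V) fW oB Bz cm cs sp cr.
  have cq : (fun s : R => z + s *: V) @ (0 : R)^'+ --> z by exact: (cvg_moving _ cm cs).
  have nB : \forall y \near z, (cmap a @` (cdom a `&` (O `&` O'))) y.
    apply: open_nbhs_nbhs; split; last by exists (fpar c x) => //; split => //; exact: subO.
    by apply: chart_image_open => //; exact: openI.
  near=> s.
  have s0 : 0 < s by near: s.
  have q1 : 0 < ((rho \o cinv a) (z + s *: V) - (rho \o cinv a) z) / s.
    by near: s; exact: (cvgr_gt _ c1).
  rewrite (drho_zero hd fc Ax) subr0 pmulr_lgt0 ?invr_gt0 // in q1.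
  have Bs : (cmap a @` (cdom a `&` (O `&` O'))) (z + s *: V) by near: s; exact: (cq _ nB).
  have [Dy [Oy Oy'] yE] := chart_image ac Bs.
  have [Omy _] : (Omega `&` O) (cinv a (z + s *: V)) by rewrite rE.
  rewrite /kap /= chart_canc //; last exact: subO'.
  have cy := @subset_closure _ Omega _ Omy.
  by rewrite fE // fE'.
rewrite pdE deriveE // (diff_comp dk D2) /= E2' in key.
have LV : 'd kap z V = sg *: J2 (vd (dpar a' c) (dirt R) x).
  by rewrite /V linearZ /= Jk vdk.
rewrite LV (pdZv fW oB' Bz' cf') /V (pdZv fW oB Bz cf) kz in key.
exact: (mulfI sg0 key).
Unshelve. all: by end_near. Qed.

(** The derivative of the boundary distance along [J d/dt], at a point of a
foliated chart. *)
Definition leaf_normal (c : fchart X) (x : C1 R * R) : R :=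
  xget 0 [set r | exists a O f rho, [/\ defining Omega delta a O f rho, O (fpar c x),
    d_neq0 f (fpar c x) & r = dnormal a f c x]].

Let choose_data (c : fchart X) x : foliated_chart M c -> (fD c `*` fT c) x ->
  exists a O f rho, [/\ defining Omega delta a O f rho, O (fpar c x),
    d_neq0 f (fpar c x) & leaf_normal c x = dnormal a f c x].
Proof.
move=> fc Dx; rewrite /leaf_normal; set P := [set r | _].
have : P (xget 0 P).
  have [dx _ _] := foliated_chart_par fc Dx.
  have [a [Q [f [rho [hd Op df]]]]] := defining_exists hbd hdelta (foliated_chart_sub fc dx).
  by apply: (@xgetPex _ (0 : R) P); exists (dnormal a f c x), a, Q, f, rho.
by move=> [a [Q [f [rho H]]]]; exists a, Q, f, rho.
Qed.

Lemma leaf_normalE (c : fchart X) a O f rho x : foliated_chart M c ->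
  defining Omega delta a O f rho -> dbox O c x -> leaf_normal c x = dnormal a f c x.
Proof.
move=> fc hd [Dx Ox]; have [a' [Q' [f' [rho' [hd' Ox' _ ->]]]]] := choose_data fc Dx.
exact: dnormal_indep hd' hd fc _ _.
Qed.

Lemma leaf_normal_neq0 (c : fchart X) x : foliated_chart M c -> (fD c `*` fT c) x ->
  leaf_normal c x != 0.
Proof.
move=> fc Dx; have [a [Q [f [rho [hd Ox df ->]]]]] := choose_data fc Dx.
by apply: (dnormal_neq0 hdelta hd fc).
Qed.

Let leaf_normal_near (c : fchart X) x : foliated_chart M c -> (fD c `*` fT c) x ->
  exists a O f rho, [/\ defining Omega delta a O f rho, dbox O c x,
    d_neq0 f (fpar c x), open_nbhs x (dbox O c) &
    forall y, dbox O c y -> leaf_normal c y = dnormal a f c y].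
Proof.
move=> fc Dx; have [a [Q [f [rho [hd Ox df _]]]]] := choose_data fc Dx.
exists a, Q, f, rho; split=> //; first by split => //; exact: dbox_open hd fc.
by move=> y Ay; exact: leaf_normalE fc hd Ay.
Qed.

Lemma Ck_leaf_normal (c : fchart X) : foliated_chart M c ->
  Ck 2 (fD c `*` fT c) (leaf_normal c).
Proof.
move=> fc; apply: Ck_local => x Dx.
have [a [Q [f [rho [hd Ax _ nA E]]]]] := leaf_normal_near fc Dx.
exists (dbox Q c) => //; apply: (Ck_ext (dbox_open hd fc)) (Ck_dnormal hd fc).
by move=> y Ay; rewrite E.
Qed.

(** The local equation, read with the globally defined normal derivative. *)
Lemma leaf_normal_laplacian (c : fchart X) x (eta : R) : foliated_chart M c ->
  (fD c `*` fT c) x -> 0 < eta < 1 ->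
  local_DF_exponent Omega delta (fpar c x) = eta ->
  let N := leaf_normal c in
  pd (pd N (dirx R)) (dirx R) x + pd (pd N (diry R)) (diry R) x =
  (1 - eta / (1 - eta)) * (pd N (dirx R) x ^+ 2 + pd N (diry R) x ^+ 2) / N x.
Proof.
move=> fc Dx eta01 He /=.
have [a [Q [f [rho [hd Ax df [oA _] E]]]]] := leaf_normal_near fc Dx.
have n1 y : dbox Q c y -> {near y, leaf_normal c =1 dnormal a f c}.
  by move=> Ay; apply: filterS E _; exact: open_nbhs_nbhs.
have n2 v : {near x, pd (leaf_normal c) v =1 pd (dnormal a f c) v}.
  have : \forall y \near x, dbox Q c y by exact: open_nbhs_nbhs.
  by apply: filterS => y /n1; exact: pd_near.
rewrite !(pd_near _ (n2 _)) !(pd_near _ (n1 x Ax)) E //.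
have := dnormal_laplacian oOm hdelta hd fc Ax df eta01 He.
exact.
Qed.

Definition ctrans (c d : fchart X) (x : C1 R * R) : C1 R * R :=
  (fz d (fpar c x), ft d (fpar c x)).

Definition overlap (c d : fchart X) := (fD c `*` fT c) `&` fpar c @^-1` fdom d.

Lemma overlap_open (c d : fchart X) : foliated_chart M c -> foliated_chart M d ->
  open (overlap c d).
Proof.
move=> fc fd; have [[U oU dE] _ _ _ _] := fd.
have -> : overlap c d = (fD c `*` fT c) `&` fpar c @^-1` U.
  rewrite /overlap dE; apply/seteqP; split => x [Dx]; first by move=> [_ Ux].
  move=> Ux; split => //; split => //.
  by have [dx _ _] := foliated_chart_par fc Dx; exact: foliated_chart_sub fc _ dx.
exact: foliated_preimage_open fc oU.
Qed.

Lemma ctrans_cont (c d : fchart X) x : foliated_chart M c -> foliated_chart M d ->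
  overlap c d x -> {for x, continuous (ctrans c d)}.
Proof.
move=> fc fd [Dx dx] N nN.
have H := foliated_coord_near fd dx nN.
have H2 : \forall y \near x, M (fpar c y) -> fdom d (fpar c y) /\ N (ctrans c d y).
  exact: (foliated_par_cont fc Dx H).
have H3 : \forall y \near x, (fD c `*` fT c) y.
  by apply: open_nbhs_nbhs; split => //; exact: foliated_box_open fc.
apply: filterS2 H2 H3 => y H2 Dy.
have [cy _ _] := foliated_chart_par fc Dy.
by have [_] := H2 (foliated_chart_sub fc cy).
Qed.

Lemma ctransK (c d : fchart X) x : foliated_chart M d -> overlap c d x ->
  (fD d `*` fT d) (ctrans c d x) /\ fpar d (ctrans c d x) = fpar c x.
Proof. by move=> fd [_ dx]; have [] := foliated_chart_dom fd dx. Qed.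

(** A change of foliated charts is conformal along the leaves and maps leaves to
leaves; transversally it multiplies the normal derivative by [d t_d / d t_c]. *)
Lemma chart_transition (c d : fchart X) x : foliated_chart M c -> foliated_chart M d ->
  overlap c d x -> exists w b s,
  [/\ sdiff (ctrans c d) x (fun v => (cmul w v.1 + v.2 *: b, s * v.2)),
      w != 0, s != 0 & leaf_normal c x = s * leaf_normal d (ctrans c d x)].
Proof.
move=> fc fd ox; have [Dx dx] := ox.
have [a [Q [f [rho [hd Ax df nA E]]]]] := leaf_normal_near fc Dx.
have [Dy yE] := ctransK fd ox.
set y := ctrans c d in Dy yE *.
have Ay : dbox Q d (y x) by split => //; rewrite /preimage /= yE; case: Ax.
have [[aa _ _] _ _ _ _] := hd.
have oA := dbox_open hd fc; have oA' := dbox_open hd fd.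
pose e := vd (dpar a d) (dirx R) (y x); pose W := vd (dpar a d) (dirt R) (y x).
have D0 : cdet2 e W != 0.
  exact: (cdet2_frame oA' (Ck_dpar hd fd) (dpar_CR hd fd) (dpar_immersion hd fd) Ay).
have sPsi := sdiff_dpar hd fd Ay; have sPhi := sdiff_dpar hd fc Ax.
have MW v : vd (dpar a d) v (y x) = frame_map e W v.
  have -> : v = v.1.1 *: dirx R + v.1.2 *: diry R + v.2 *: dirt R.
    case: v => [[p q] r] /=.
    transitivity (((p * 1 + q * 0 + r * 0, p * 0 + q * 1 + r * 0), p * 0 + q * 0 + r * 1) : C1 R * R); last by [].
    by congr (_, _, _); ring.
  rewrite !(sdiffD sPsi) !(sdiffZ sPsi) (dpar_CR hd fd Ay) /frame_map /=.
  by rewrite /GRing.scale /= !mulr0 !mulr1 !addr0 !add0r.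
have ne : \forall z \near x, dpar a d (y z) = dpar a c z.
  have : \forall z \near x, overlap c d z.
    by apply: open_nbhs_nbhs; split => //; exact: overlap_open.
  by apply: filterS => z oz; have [_ zE] := ctransK fd oz; rewrite /dpar /= zE.
pose N := fun v => vd (dpar a c) v x.
have LM v : frame_coord e W (vd (dpar a d) v (y x)) = v by rewrite MW frame_coordK.
have sy : sdiff y x (frame_coord e W \o N).
  apply: (sdiff_lift sPsi sPhi _ _ LM _ ne).
  - exact: frame_coord_linear.
  - exact: fin_dim_bounded fW (@frame_coord_linear _ e W).
  - exact: ctrans_cont.
have MN v : frame_map e W ((frame_coord e W \o N) v) = N v.
  have H : sdiff (dpar a c) x ((fun v => vd (dpar a d) v (y x)) \o (frame_coord e W \o N)).
    by apply: sdiff_near (sdiff_comp sy sPsi); apply: filterS ne.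
  by have := sdiff_unique H sPhi => /(congr1 (fun g => g v)) /=; rewrite MW.
have fB := dbase_open hd.
have B0 : dbase a Q (dpar a c x) := dpar_base hd Ax.
have cf := Ck_le (isT : (1 <= 3)%N) (Ck_df hd).
have yx : dpar a d (y x) = dpar a c x by rewrite /dpar /= yE.
(* the normal covector only sees the [J W] component *)
have pdJ v : pd (f \o cinv a) (J2 (frame_map e W v)) (dpar a c x) = v.2 * leaf_normal d (y x).
  rewrite (leaf_normalE fd hd Ay) /dnormal /normal_deriv -/W.
  rewrite /frame_map !J2D !J2Z J2J2 !(pdDv fW fB B0 cf) !(pdZv fW fB B0 cf) (pdNv fW fB B0 cf).
  have := foliation_tangent oA' fB (Ck_dpar hd fd) (Ck_df hd) (dpar_base hd) (df_zero hdelta hd fd) (dirx R) Ay.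
  have := foliation_tangentJ oA' fB (Ck_dpar hd fd) (Ck_df hd) (dpar_base hd) (df_zero hdelta hd fd) (dpar_CR hd fd) Ay.
  rewrite yx -/e => -> ->.
  by rewrite oppr0 !mulr0 !add0r.
have nd0 := leaf_normal_neq0 fd Dy.
pose L := frame_coord e W \o N.
have Lx2 : (L (dirx R)).2 = 0.
  have := pdJ (L (dirx R)); rewrite MN.
  have -> : pd (f \o cinv a) (J2 (N (dirx R))) (dpar a c x) = 0.
    exact: (foliation_tangentJ oA fB (Ck_dpar hd fc) (Ck_df hd) (dpar_base hd) (df_zero hdelta hd fc) (dpar_CR hd fc) Ax).
  by move/esym/eqP; rewrite mulf_eq0 (negbTE nd0) orbF => /eqP.
pose w := (L (dirx R)).1; pose b := (L (dirt R)).1; pose s := (L (dirt R)).2.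
have Ly : L (diry R) = ((- w.2, w.1), 0).
  rewrite -(LM ((- w.2, w.1), 0)) MW; congr (frame_coord e W _).
  rewrite [LHS](dpar_CR hd fc Ax) -[vd _ _ x]/(N (dirx R)) -(MN (dirx R)).
  rewrite /frame_map -/L -/w Lx2 /= !scale0r !addr0 J2D !J2Z J2J2 addrC scaleNr scalerN.
  by [].
have sE : leaf_normal c x = s * leaf_normal d (y x).
  by rewrite -pdJ MN (leaf_normalE fc hd Ax).
have sL : sdiff y x L := sy.
have LE v : L v = (cmul w v.1 + v.2 *: b, s * v.2).
  have vE : v = v.1.1 *: dirx R + v.1.2 *: diry R + v.2 *: dirt R.
    case: v => [[p q] r] /=.
    transitivity (((p * 1 + q * 0 + r * 0, p * 0 + q * 1 + r * 0), p * 0 + q * 0 + r * 1) : C1 R * R); last by [].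
    by congr (_, _, _); ring.
  rewrite {1}vE !(sdiffD sL) !(sdiffZ sL) Ly.
  have -> : L (dirx R) = (w, 0) by rewrite -Lx2 /w; case: (L _).
  have -> : L (dirt R) = (b, s) by rewrite /b /s; case: (L _).
  by rewrite frame_linear -surjective_pairing.
exists w, b, s; split => //.
- by have <- : L = (fun v => (cmul w v.1 + v.2 *: b, s * v.2)) by apply/funext => v.
- apply/eqP => w0; have : L (dirx R) = 0 by rewrite [LHS]surjective_pairing Lx2 -/w w0.
  move=> /(congr1 (frame_map e W)); rewrite MN /frame_map /= !scale0r !addr0.
  by move=> /(dpar_immersion hd fc Ax) /(congr1 (fun v => v.1.1)) /eqP; rewrite /= oner_eq0.
- apply/eqP => s0; move: sE; rewrite s0 mul0r => /eqP.
  by rewrite (negbTE (leaf_normal_neq0 fc Dx)).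
Qed.

End Transition.

(** * Hausdorff measures *)

Section GeneralHausdorff.
Context (R : realType) (V : normedModType R).
Local Open Scope ereal_scope.

Definition gdiam (E : set V) : \bar R :=
  ereal_sup [set (`|xy.1 - xy.2|%R)%:E | xy in E `*` E].

Definition gpre (alpha eps : R) (A : set V) : \bar R :=
  ereal_inf [set \sum_(0 <= k <oo) (gdiam (E k) `^ alpha) | E in
    [set E : nat -> set V |
       A `<=` \bigcup_k E k /\ forall k, gdiam (E k) <= eps%:E]].

(** The Hausdorff measure on an arbitrary normed space, so that the same theory
serves the line and the plane with the maximum norm. *)
Definition ghaus (alpha : R) (A : set V) : \bar R :=
  ereal_sup [set gpre alpha eps A | eps in [set eps : R | (0 < eps)%R]].

Lemma gdiam0 : gdiam set0 = -oo.
Proof.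
rewrite /gdiam (_ : [set _ | _ in _] = set0) ?ereal_sup0 //.
by apply/seteqP; split => // x [[? ?] [[]]].
Qed.

Lemma gdiam_le_norm E x y : E x -> E y -> (`|x - y|%R)%:E <= gdiam E.
Proof. by move=> Ex Ey; apply: ereal_sup_ubound; exists (x, y). Qed.

Lemma gdiam_le (E : set V) b : (forall x y, E x -> E y -> (`|x - y|%R)%:E <= b) -> gdiam E <= b.
Proof. by move=> H; apply: ge_ereal_sup => _ [[x y] [/= Ex Ey] <-]; exact: H. Qed.

Lemma gdiamS (E F : set V) : E `<=` F -> gdiam E <= gdiam F.
Proof. by move=> EF; apply: gdiam_le => x y /EF Fx /EF Fy; exact: gdiam_le_norm. Qed.

Lemma gdiam_ge0 (E : set V) : E !=set0 -> 0 <= gdiam E.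
Proof. by move=> [x Ex]; rewrite (le_trans _ (gdiam_le_norm Ex Ex)) // subrr normr0. Qed.

Variable alpha : R.
Hypothesis a0 : (0 < alpha)%R.

Lemma gdiam_pow0 : gdiam set0 `^ alpha = 0.
Proof. by rewrite gdiam0 poweRNyr // gt_eqF. Qed.

Lemma gdiam_powS (E F : set V) : E `<=` F -> gdiam E `^ alpha <= gdiam F `^ alpha.
Proof.
move=> EF; have [->|E0] := eqVneq E set0; first by rewrite gdiam_pow0 poweR_ge0.
have [x Ex] : E !=set0 by exact/set0P.
apply: gt0_ler_poweR; last exact: gdiamS.
- exact: ltW.
- by rewrite in_itv /= leey andbT; apply: gdiam_ge0; exists x.
- by rewrite in_itv /= leey andbT; apply: gdiam_ge0; exists x; exact: EF.
Qed.

Section FixedScale.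
Variable eps : R.
Hypothesis e0 : (0 < eps)%R.

Lemma gpre_ge0 A : 0 <= gpre alpha eps A.
Proof.
apply: le_ereal_inf_tmp => x [E _ <-]; apply: nneseries_ge0 => k _ _.
exact: poweR_ge0.
Qed.

Lemma gpre_le A (E : nat -> set V) : A `<=` \bigcup_k E k ->
  (forall k, gdiam (E k) <= eps%:E) ->
  gpre alpha eps A <= \sum_(0 <= k <oo) (gdiam (E k) `^ alpha).
Proof. by move=> AE HE; apply: ereal_inf_lbound; exists E. Qed.

Lemma gpre0 : gpre alpha eps set0 = 0.
Proof.
apply/eqP; rewrite eq_le gpre_ge0 andbT.
apply: (le_trans (gpre_le (E := fun=> set0) _ _)) => //.
  by move=> k; rewrite gdiam0 leNye.
by rewrite eseries0 // => k _ _; exact: gdiam_pow0.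
Qed.

Lemma gpreS : {homo gpre alpha eps : A B / A `<=` B >-> A <= B}.
Proof.
move=> A B AB; apply/ereal_inf_le_tmp => x [E [BE HE] <-].
by exists E => //; split => //; apply: subset_trans AB BE.
Qed.

Lemma gpre_adherent A d : (0 < d)%R -> gpre alpha eps A < +oo ->
  exists E : nat -> set V, [/\ A `<=` \bigcup_k E k, forall k, gdiam (E k) <= eps%:E &
    \sum_(0 <= k <oo) (gdiam (E k) `^ alpha) <= gpre alpha eps A + d%:E].
Proof.
move=> d0 Aoo.
have fin : gpre alpha eps A \is a fin_num by rewrite ge0_fin_numE ?gpre_ge0.
have [x [E [AE HE] <-] lt] := lb_ereal_inf_adherent d0 fin.
by exists E; split => //; exact: ltW.
Qed.

Lemma gpre_sigma_subadditive : sigma_subadditive (gpre alpha eps).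
Proof.
move=> A; have [[i ioo]|] := pselect (exists i, gpre alpha eps (A i) = +oo).
  rewrite (eseries_pinfty _ _ ioo) ?leey// => n _.
  by rewrite -ltNye (lt_le_trans _ (gpre_ge0 _)).
rewrite -forallNE => Aoo.
suff add2e (e : {posnum R}) :
    gpre alpha eps (\bigcup_n A n) <= \sum_(i <oo) gpre alpha eps (A i) + e%:num%:E.
  by apply/lee_addgt0Pr => _/posnumP[].
rewrite (le_trans _ (epsilon_trick _ _ _))//; last first.
  by move=> n; exact: gpre_ge0.
pose P n (B : nat -> set V) := [/\ A n `<=` \bigcup_k B k, forall k, gdiam (B k) <= eps%:E &
  \sum_(0 <= k <oo) (gdiam (B k) `^ alpha) <=
    gpre alpha eps (A n) + (e%:num / (2 ^ n.+1)%:R)%:E].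
have [G PG] : {G : (nat -> set V)^nat & forall n, P n (G n)}.
  apply: (@choice _ _ P) => n; apply: gpre_adherent => //.
  by rewrite lt_neqAle leey andbT; apply/eqP; exact: Aoo.
pose m := fun E : set V => gdiam E `^ alpha.
have m_ge0 x : 0 <= (m \o uncurry G) x by exact: poweR_ge0.
apply: (@le_trans _ _ (\esum_(i in setT) (m \o uncurry G) i)).
  have /card_esym/ppcard_eqP[f] := card_nat2.
  apply: (le_trans (gpre_le (E := uncurry G \o f) _ _)).
  - move=> t [i _] Ait; have [sub _ _] := PG i.
    have [j _ Gt] := sub _ Ait.
    by exists (f^-1%FUN (i, j)) => //=; rewrite invK ?inE.
  - by move=> k; have [_ H _] := PG (f k).1; rewrite /= /uncurry; case: (f k) H => a b /= H.
  rewrite -(esum_pred_image (m \o uncurry G) _ xpredT) ?[fun=> _]set_true//.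
  by rewrite image_eq.
rewrite (_ : esum _ _ = \sum_(i <oo) \sum_(j <oo ) m (G i j)); last first.
  pose J : nat -> set (nat * nat) := fun i => [set (i, j) | j in setT].
  rewrite (_ : setT = \bigcup_k J k); last first.
    by rewrite predeqE => -[a b]; split => // _; exists a => //; exists b.
  rewrite esum_bigcupT /=; last 2 first.
    - apply/trivIsetP => i j _ _ ij.
      rewrite predeqE => -[n k] /=; split => //= -[] [_] _ [<-{n} _].
      by move=> [k' _] [] /esym/eqP; rewrite (negbTE ij).
    - by move=> /= [n k]; exact: poweR_ge0.
  rewrite -(image_id [set: nat]) -fun_true esum_pred_image//; last first.
    by move=> n _; apply: esum_ge0 => -[i j] _; exact: (m_ge0 (i, j)).
  apply: eq_eseriesr => /= j _.
  rewrite -(esum_pred_image (m \o uncurry G) (pair j) predT)//=; last 2 first.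
  - by move=> n _; exact: poweR_ge0.
  - by move=> ? ? _ _; exact: (@can_inj _ _ _ snd).
  by congr esum; rewrite predeqE => -[a b]; split; move=> [i _ <-]; exists i.
apply: lee_nneseries => [n _|n _].
  by move=> _; apply: nneseries_ge0 => k _ _; exact: poweR_ge0.
by have [] := PG n.
Qed.

End FixedScale.

Lemma gpre_le_ghaus eps A : (0 < eps)%R -> gpre alpha eps A <= ghaus alpha A.
Proof. by move=> e0; apply: ereal_sup_ubound; exists eps. Qed.

Lemma ghaus_le A b : (forall eps, (0 < eps)%R -> gpre alpha eps A <= b) -> ghaus alpha A <= b.
Proof. by move=> H; apply: ge_ereal_sup => _ [eps e0 <-]; exact: H. Qed.

Lemma gpre_scale e e' A : (e <= e')%R -> gpre alpha e' A <= gpre alpha e A.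
Proof.
move=> ee; apply/ereal_inf_le_tmp => x [E [AE HE] <-]; exists E => //; split => // k.
by rewrite (le_trans (HE k)) // lee_fin.
Qed.

Lemma ghaus_ge0 A : 0 <= ghaus alpha A.
Proof. by rewrite (le_trans _ (gpre_le_ghaus A ltr01)) // gpre_ge0. Qed.

Lemma ghaus0 : ghaus alpha set0 = 0.
Proof.
apply/eqP; rewrite eq_le ghaus_ge0 andbT.
by apply: ghaus_le => eps e0; rewrite gpre0.
Qed.

Lemma ghausS : {homo ghaus alpha : A B / A `<=` B >-> A <= B}.
Proof.
move=> A B AB; apply: ghaus_le => eps e0.
by rewrite (le_trans (gpreS eps AB)) // gpre_le_ghaus.
Qed.

Lemma ghaus_sigma_subadditive : sigma_subadditive (ghaus alpha).
Proof.
move=> A; apply: ghaus_le => eps e0.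
rewrite (le_trans (gpre_sigma_subadditive eps _)) //.
apply: lee_nneseries => n _; first by move=> _; exact: gpre_ge0.
exact: gpre_le_ghaus.
Qed.

(** Sets at positive distance contribute separately, since a set of small
diameter meets only one of them. *)
Lemma ghaus_separated (A B : set V) (d : R) : (0 < d)%R ->
  (forall x y, A x -> B y -> (d <= `|x - y|)%R) ->
  ghaus alpha A + ghaus alpha B <= ghaus alpha (A `|` B).
Proof.
move=> d0 sep.
have key eps : (0 < eps)%R -> (eps < d)%R ->
    gpre alpha eps A + gpre alpha eps B <= ghaus alpha (A `|` B).
  move=> e0 ed; rewrite (le_trans _ (gpre_le_ghaus _ e0)) //.
  apply: le_ereal_inf_tmp => _ [E [ABE HE] <-].
  have HI C k : gdiam (E k `&` C) <= eps%:E.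
    by rewrite (le_trans _ (HE k)) //; apply: gdiamS => x [].
  have cov C : C `<=` A `|` B -> C `<=` \bigcup_k (E k `&` C).
    by move=> sub x Cx; have [k _ Ek] := ABE _ (sub _ Cx); exists k.
  have h1 := gpre_le (cov A (@subsetUl _ A B)) (HI A).
  have h2 := gpre_le (cov B (@subsetUr _ A B)) (HI B).
  rewrite (le_trans (leeD h1 h2)) // -nneseriesD; [|by move=> *; exact: poweR_ge0..].
  apply: lee_nneseries => k _; first by move=> _; rewrite adde_ge0 // poweR_ge0.
  have [EA|/eqP/set0P[x [Ex Ax]]] := pselect (E k `&` A = set0).
    by rewrite EA gdiam_pow0 add0e; apply: gdiam_powS => x [].
  have -> : E k `&` B = set0.
    apply/seteqP; split => // y [Ey By].
    have := le_trans (gdiam_le_norm Ex Ey) (HE k); rewrite lee_fin leNgt.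
    by rewrite (lt_le_trans ed) // sep.
  by rewrite gdiam_pow0 adde0; apply: gdiam_powS => y [].
have [Too|Tfin] := eqVneq (ghaus alpha (A `|` B)) +oo; first by rewrite Too leey.
have finT C : C `<=` A `|` B -> forall x, 0 <= x -> x <= ghaus alpha C -> x \is a fin_num.
  move=> CT x x0 xC; rewrite ge0_fin_numE // (le_lt_trans xC) //.
  by rewrite (le_lt_trans (ghausS CT)) // ltey.
have sA : A `<=` A `|` B := @subsetUl _ A B.
have sB : B `<=` A `|` B := @subsetUr _ A B.
rewrite -leeBrDr; last exact: (finT B sB _ (ghaus_ge0 B)).
apply: ghaus_le => e1 e10; rewrite leeBrDr; last exact: (finT B sB _ (ghaus_ge0 B)).
have f1 := finT A sA _ (gpre_ge0 e1 A) (gpre_le_ghaus A e10).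
rewrite addeC -leeBrDr //; apply: ghaus_le => e2 e20; rewrite leeBrDr // addeC.
pose e := Num.min (Num.min e1 e2) (d / 2)%R.
have e0 : (0 < e)%R by rewrite !lt_min e10 e20 divr_gt0.
have ed : (e < d)%R.
  rewrite (@le_lt_trans _ _ (d / 2)%R) ?ge_min ?lexx ?orbT //.
  by rewrite ltr_pdivrMr // ltr_pMr // ltr1n.
apply: (le_trans _ (key e e0 ed)); apply: leeD; apply: gpre_scale.
  by rewrite !ge_min lexx.
by rewrite !ge_min lexx orbT.
Qed.

End GeneralHausdorff.

Lemma sum_even_odd (R : realType) (f : nat -> \bar R) m :
  (\sum_(0 <= k < m.*2) f k = \sum_(i < m) f (i.*2 + 0)%N + \sum_(i < m) f (i.*2 + 1)%N)%E.
Proof.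
elim: m => [|m IH]; first by rewrite big_nil !big_ord0 adde0.
rewrite doubleS !big_nat_recr //= IH !big_ord_recr /= addn0 addn1.
by rewrite -!addeA; congr (_ + _)%E; rewrite addeCA.
Qed.

Section HausdorffOuterMeasure.
Context (R : realType) (V : normedModType R) (alpha : {posnum R}).
Local Open Scope ereal_scope.

Let a0 : (0 < alpha%:num)%R. Proof. by []. Qed.

Definition hausO (A : set V) : \bar R := ghaus alpha%:num A.

HB.instance Definition _ := isOuterMeasure.Build R V hausO
  (ghaus0 V a0) (ghaus_ge0 alpha%:num) (@ghausS R V alpha%:num)
  (@ghaus_sigma_subadditive R V alpha%:num).

(** The level sets of a Lipschitz function are measurable: cut the set [phi > 0]
into slices; every other slice being at positive distance from the previous
ones, the sum of the measures of the slices converges. *)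
Lemma hausO_level (phi : V -> R) : (forall x y, `|phi x - phi y| <= `|x - y|)%R ->
  hausO.-caratheodory [set x | (0 < phi x)%R].
Proof.
move=> lip; apply: le_caratheodory_measurable => X.
set U := [set x | (0 < phi x)%R].
suff : hausO (X `&` U) + hausO (X `&` ~` U) <= hausO X by [].
have [->|Xoo] := eqVneq (hausO X) +oo; first by rewrite leey.
pose S k := X `&` [set x | (k.+2%:R^-1 <= phi x < k.+1%:R^-1)%R].
pose P n := X `&` [set x | (n.+1%:R^-1 <= phi x)%R].
have step (k : nat) : (0 < (k.+1%:R^-1 : R) - k.+2%:R^-1)%R.
  by rewrite subr_gt0 ltf_pV2 ?posrE ?ltr0n // ltr_nat.
have inv_le (j k : nat) : (j <= k)%N -> (k.+1%:R^-1 <= j.+1%:R^-1 :> R)%R.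
  by move=> jk; rewrite lef_pV2 ?posrE ?ltr0n // ler_nat.
have sepd x y (c d : R) : (phi x <= c -> d <= phi y -> d - c <= `|y - x|)%R.
  by move=> xc dy; rewrite (le_trans _ (lip y x)) // (le_trans _ (ler_norm _)) // lerB.
(* slices of the same parity are separated *)
have par b n : \sum_(i < n) hausO (S (i.*2 + b)%N) <= hausO (\bigcup_(i in `I_n) S (i.*2 + b)%N).
  elim: n => [|n IH]; first by rewrite big_ord0 outer_measure_ge0.
  rewrite big_ord_recr /= IIS bigcup_setU bigcup_set1.
  apply: (le_trans (leeD IH (lexx _))).
  case: n {IH} => [|n].
    by rewrite II0 bigcup_set0 set0U outer_measure0 add0e.
  pose k := (n.*2 + b)%N.
  apply: (ghaus_separated a0 (step k.+1)) => x y [i /= iN [_ /andP[xl _]]] [_ /andP[_ yr]].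
  rewrite -/k in yr *; have E : (n.+1.*2 + b = k.+2)%N by rewrite doubleS !addSn.
  rewrite E in yr; apply: (le_trans _ (sepd _ _ _ _ (ltW yr) (lexx (phi x)))).
  apply: lerB => //; apply: (le_trans _ xl); apply: inv_le.
  by rewrite /k ltnS leq_add2r leq_double -ltnS.
have bnd n : \sum_(0 <= k < n) hausO (S k) <= hausO X + hausO X.
  apply: (@le_trans _ _ (\sum_(0 <= k < n.*2) hausO (S k))).
    rewrite [leRHS](@big_cat_nat _ _ _ n) //=; last by rewrite -addnn leq_addr.
    by rewrite leeDl // sume_ge0 // => i _; exact: outer_measure_ge0.
  rewrite sum_even_odd; apply: leeD; apply: (le_trans (par _ _)); apply: le_outer_measure => x [i _ []] //.
have Sfin : \sum_(0 <= k <oo) hausO (S k) < +oo.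
  apply: (@le_lt_trans _ _ (hausO X + hausO X)).
    apply: lime_le; first by apply: is_cvg_nneseries => k _ _; exact: outer_measure_ge0.
    by near=> n; exact: bnd.
  by rewrite -ge0_fin_numE ?adde_ge0 ?outer_measure_ge0 // fin_numD ge0_fin_numE ?outer_measure_ge0 // ltey Xoo.
have tail := nneseries_tail_cvg Sfin (fun k _ => outer_measure_ge0 hausO (S k)).
have main n : hausO (X `&` U) + hausO (X `&` ~` U) <= hausO X + \sum_(n <= k <oo) hausO (S k).
  have cov : X `&` U `<=` P n `|` \bigcup_(k in ~` `I_n) S k.
    move=> x [Xx Ux]; have [h|h] := leP (n.+1%:R^-1 : R)%R (phi x); first by left.
    right.
    have ex : exists j, ((j.+1%:R^-1 : R) <= phi x)%R.
      exists (Num.truncn (phi x)^-1).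
      rewrite -[leRHS]invrK lef_pV2 ?posrE ?ltr0n ?invr_gt0 //.
      by rewrite ltW // truncnS_gt.
    case: (ex_minnP ex) => j jx jmin.
    have nj : (n < j)%N.
      by rewrite ltnNge; apply/negP => /inv_le jn; move: h; rewrite ltNge (le_trans jn jx).
    case: j nj jx jmin => // j nj jx jmin; exists j; first by apply/negP; rewrite -leqNgt -ltnS.
    split => //=; rewrite jx /= ltNge; apply/negP => /jmin; by rewrite ltnn.
  have h1 : hausO (X `&` U) <= hausO (P n) + \sum_(n <= k <oo) hausO (S k).
    apply: (le_trans (le_outer_measure hausO _ _ cov)).
    apply: (le_trans (outer_measureU2 _ _ _)); apply: leeD => //.
    exact: outer_measure_sigma_subadditive_tail.
  apply: (le_trans (leeD h1 (lexx _))); rewrite addeAC; apply: leeD => //.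
  apply: (@le_trans _ _ (hausO (P n `|` (X `&` ~` U)))); last first.
    by apply: le_outer_measure => x [[]|[]].
  have i0 : (0 < (n.+1%:R^-1 : R))%R by rewrite invr_gt0 ltr0n.
  apply: (ghaus_separated a0 i0) => x y [_ /= xn] [_ /negP]; rewrite -leNgt => y0.
  by rewrite -[leLHS]subr0; exact: sepd.
have H : (fun n => hausO X + \sum_(n <= k <oo) hausO (S k)) @ \oo --> hausO X + 0.
  apply: cvgeD; [|exact: cvg_cst|exact: tail].
  by rewrite fin_num_adde_defl.
rewrite adde0 in H; rewrite -(cvg_lim _ H) //; apply: lime_ge.
  by apply/cvg_ex; eexists; exact: H.
by near=> n; exact: main.
Unshelve. all: by end_near. Qed.

End HausdorffOuterMeasure.

Section HausdorffLipschitz.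
Context (R : realType) (V W : normedModType R) (alpha : R).
Hypothesis a0 : (0 < alpha)%R.
Local Open Scope ereal_scope.

Lemma gdiam_lipschitz (phi : V -> W) (E : set V) (L : R) : (0 <= L)%R ->
  (forall x y, E x -> E y -> `|phi x - phi y| <= L * `|x - y|)%R ->
  gdiam (phi @` E) `^ alpha <= (L `^ alpha)%:E * gdiam E `^ alpha.
Proof.
move=> L0 lip; have [->|/set0P E0] := eqVneq E set0.
  by rewrite image_set0 !gdiam_pow0 // mule0.
rewrite -poweR_EFin -poweRM //; last exact: gdiam_ge0.
have H : gdiam (phi @` E) <= L%:E * gdiam E.
  apply: gdiam_le => _ _ [x Ex <-] [y Ey <-].
  rewrite (le_trans (_ : _ <= (L * `|x - y|)%:E)) ?lee_fin ?lip //.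
  by rewrite EFinM; apply: lee_wpmul2l => //; exact: gdiam_le_norm.
have p0 : 0 <= gdiam (phi @` E).
  by apply: gdiam_ge0; have [x Ex] := E0; exists (phi x), x.
apply: gt0_ler_poweR; last exact: H.
- exact: ltW.
- by rewrite in_itv /= leey andbT.
- by rewrite in_itv /= leey andbT (le_trans p0 H).
Qed.

(** The image of a cover is a cover with diameters multiplied by at most [L]. *)
Lemma ghaus_lipschitz (phi : V -> W) (B : set V) (L : R) : (0 < L)%R ->
  (forall x y, B x -> B y -> `|phi x - phi y| <= L * `|x - y|)%R ->
  ghaus alpha (phi @` B) <= (L `^ alpha)%:E * ghaus alpha B.
Proof.
move=> L0 lip; apply: ghaus_le => eps e0.
have e1 : (0 < eps / L)%R by rewrite divr_gt0.
have La : (0 < L `^ alpha)%R by rewrite powR_gt0.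
apply: (@le_trans _ _ ((L `^ alpha)%:E * gpre alpha (eps / L) B)); last first.
  by apply: lee_wpmul2l; [rewrite lee_fin ltW|exact: gpre_le_ghaus].
rewrite -lee_pdivrMl //; apply: le_ereal_inf_tmp => _ [E [BE HE] <-].
rewrite lee_pdivrMl // -nneseriesZl; last by move=> *; exact: poweR_ge0.
have lipk k x y : (B `&` E k) x -> (B `&` E k) y -> (`|phi x - phi y| <= L * `|x - y|)%R.
  by move=> [Bx _] [By _]; exact: lip.
apply: (le_trans (@gpre_le _ _ alpha eps _ (fun k => phi @` (B `&` E k)) _ _)).
- move=> _ [x Bx <-]; have [k _ Ek] := BE x Bx; by exists k => //; exists x.
- move=> k; apply: gdiam_le => _ _ [x Ex <-] [y Ey <-]; rewrite lee_fin.
  rewrite (le_trans (lipk k x y Ex Ey)) // mulrC -ler_pdivlMr // -lee_fin.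
  by apply: (le_trans (gdiam_le_norm Ex.2 Ey.2)).
- apply: lee_nneseries => k _; first by move=> _; exact: poweR_ge0.
  apply: (le_trans (gdiam_lipschitz (ltW L0) (lipk k))).
  by apply: lee_wpmul2l; [rewrite lee_fin ltW|apply: (gdiam_powS a0) => x []].
Qed.

End HausdorffLipschitz.

Section HausdorffBorel.
Context (R : realType) (alpha : {posnum R}).
Local Open Scope ereal_scope.

Lemma level_measurable (V : normedModType R) (phi : V -> R) :
  (forall x y, `|phi x - phi y| <= `|x - y|)%R ->
  measurable_fun [set: caratheodory_type (@hausO R V alpha)] (phi : _ -> measurableTypeR R).
Proof.
move=> lip; have H := @measurability _ _ (caratheodory_type (@hausO R V alpha)) (measurableTypeR R)
  setT phi _ (measurable_realfun.RGenOInfty.measurableE R).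
apply: H => _ [_ [a ->] <-].
rewrite setTI; have -> : phi @^-1` `]a, +oo[%classic = [set x | (0 < phi x - a)%R].
  by apply/seteqP; split => x /=; rewrite in_itv /= andbT subr_gt0.
apply: hausO_level => x y.
by rewrite opprB addrA subrK.
Qed.

Lemma hausO_borel (B : set (measurableTypeR R)) : measurable B ->
  (@hausO R R alpha).-caratheodory B.
Proof.
move=> mB; have H := @level_measurable R id (fun x y => lexx _).
by have := H measurableT B mB; rewrite setTI.
Qed.

(** The coordinate functions are 1-Lipschitz and generate the Borel sets. *)
Lemma hausO_borel2 (B : set (measurableTypeR R * measurableTypeR R)) : measurable B ->
  (@hausO R (C1 R) alpha).-caratheodory B.
Proof.
move=> mB.
have l1 (x y : C1 R) : (`|x.1 - y.1| <= `|x - y|)%R by rewrite normC1 le_max lexx.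
have l2 (x y : C1 R) : (`|x.2 - y.2| <= `|x - y|)%R by rewrite normC1 le_max lexx orbT.
have H := measurable_fun_pair (level_measurable l1) (level_measurable l2).
have := H measurableT B mB; rewrite setTI.
by rewrite (_ : _ @^-1` B = B) //; apply/seteqP; split => -[x y].
Qed.

End HausdorffBorel.

Section HausdorffRestriction.
Context (R : realType) (alpha : {posnum R}) (K : set R).
Local Open Scope ereal_scope.

Definition haus_restr (B : set (measurableTypeR R)) : \bar R := hausO alpha (K `&` B).

Hypothesis Kfin : hausO alpha K < +oo.

Lemma haus_restr0 : haus_restr set0 = 0.
Proof. by rewrite /haus_restr setI0; exact: ghaus0. Qed.

Lemma haus_restr_ge0 B : 0 <= haus_restr B.
Proof. exact: ghaus_ge0. Qed.

Lemma haus_restr_sigma_additive : semi_sigma_additive haus_restr.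
Proof.
move=> A mA tA mU.
pose mu := @hausO R R alpha; set B := \bigcup_n A n.
have cA n : mu.-caratheodory (A n) by apply: hausO_borel.
have h1 : \sum_(0 <= k <oo) mu (K `&` A k) <= mu (K `&` B).
  have := @caratheodory_lime_le _ _ mu A cA tA (K `&` B).
  have E k : K `&` B `&` A k = K `&` A k.
    by rewrite -setIA; congr (_ `&` _); apply/setIidPr => x Ax; exists k.
  under eq_eseriesr do rewrite E.
  by apply: le_trans; rewrite leeDl // ghaus_ge0.
have h2 := @outer_measure_bigcup_lim _ _ mu A K.
have E : haus_restr B = \sum_(0 <= k <oo) mu (K `&` A k).
  by apply/eqP; rewrite eq_le h1 h2.
rewrite E; apply: is_cvg_nneseries => k _ _; exact: ghaus_ge0.
Qed.

HB.instance Definition _ := isMeasure.Build _ _ _ haus_restr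
  haus_restr0 haus_restr_ge0 haus_restr_sigma_additive.

End HausdorffRestriction.

Section PlanarLebesgue.
Context (R : realType).
Local Open Scope ereal_scope.

Let two : {posnum R} := ((2%:R : R)%:pos)%R.

(** Planar Lebesgue measure, as a product, and the planar Hausdorff measure of
the maximum norm, whose balls are squares. *)
Notation leb2 := (@lebesgue_measure R \x @lebesgue_measure R)%E.

Definition haus2 (A : set (C1 R)) : \bar R := @hausO R (C1 R) two A.

Lemma pow2E (x : R) : (0 <= x)%R -> x%:E `^ 2 = (x * x)%:E.
Proof. by move=> x0; rewrite poweR_EFin powR_mulrn // expr2. Qed.

Lemma leb2X (I J : interval R) : leb2 ([set` I] `*` [set` J]) =
  lebesgue_measure [set` I] * lebesgue_measure [set` J].
Proof. by rewrite product_measure1E; [|exact: measurable_itv..]. Qed.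

(** A set of diameter [d] lies in a square of side [d]. *)
Lemma square_cover (E : set (C1 R)) : exists Q : set (measurableTypeR R * measurableTypeR R),
  [/\ measurable Q, E `<=` Q & leb2 Q <= gdiam E `^ 2].
Proof.
have [->|/set0P E0] := eqVneq E set0.
  by exists set0; split => //; rewrite measure0 poweR_ge0.
have d0 := gdiam_ge0 E0; have [e Ee] := E0.
case dE : (gdiam E) d0 => [d| |] //= d0; last first.
  exists setT; split; [exact: measurableT|by []|].
  by rewrite pnatr_eq0 leey.
rewrite lee_fin in d0.
have bd (p : C1 R -> R) : (forall x y, `|p x - p y| <= `|x - y|)%R ->
    exists a : R, forall x, E x -> (a <= p x <= a + d)%R.
  move=> lp; pose P := p @` E.
  have dxy x y : E x -> E y -> (p x <= p y + d)%R.
    move=> Ex Ey; rewrite -lerBlDl (le_trans (ler_norm _)) // (le_trans (lp _ _)) //.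
    by rewrite -lee_fin -dE gdiam_le_norm.
  have hi : has_inf P.
    split; first by exists (p e), e.
    by exists (p e - d)%R => _ [x Ex <-]; rewrite lerBlDr dxy.
  exists (inf P) => x Ex; apply/andP; split.
    by apply: ge_inf; [exact: hi.2|exists x].
  rewrite -lerBlDr; apply: lb_le_inf; first exact: hi.1.
  by move=> _ [y Ey <-]; rewrite lerBlDr dxy.
have l1 (x y : C1 R) : (`|x.1 - y.1| <= `|x - y|)%R by rewrite normC1 le_max lexx.
have l2 (x y : C1 R) : (`|x.2 - y.2| <= `|x - y|)%R by rewrite normC1 le_max lexx orbT.
have [a Ha] := bd (fun x => x.1) l1.
have [b Hb] := bd (fun x => x.2) l2.
exists (`[a, (a + d)%R]%classic `*` `[b, (b + d)%R]%classic); split.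
- by apply: measurableX; exact: measurable_itv.
- by move=> x Ex; split; rewrite /= in_itv /=; [exact: Ha|exact: Hb].
- rewrite leb2X.
  rewrite !lebesgue_measure_itv /= !lte_fin !ltrDl.
  have -> : (d `^ 2)%R = (d * d)%R by rewrite powR_mulrn // expr2.
  have E1 c : (c + d - c = d)%R by ring.
  case: (ltP 0%R d) => _; last by rewrite mul0e lee_fin mulr_ge0.
  by rewrite -!EFinB !E1 -EFinM.
Qed.

(** Cover each set of a Hausdorff cover by a square of the same diameter. *)
Lemma leb2_le_haus2 (A : set (measurableTypeR R * measurableTypeR R)) : measurable A ->
  leb2 A <= haus2 A.
Proof.
move=> mA; rewrite (le_trans _ (gpre_le_ghaus _ _ ltr01)) //.
apply: le_ereal_inf_tmp => _ [E [AE _] <-].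
have [Q HQ] := @choice _ _ (fun k Q => [/\ measurable Q, E k `<=` Q & leb2 Q <= gdiam (E k) `^ 2])
  (fun k => square_cover (E k)).
have mQ k : measurable (Q k) by have [] := HQ k.
apply: (@le_trans _ _ (\sum_(0 <= k <oo) leb2 (Q k))).
  apply: (measure_sigma_subadditive leb2) => //.
  by move=> x /AE[k _ Ek]; exists k => //; have [_ sub _] := HQ k; exact: sub.
by apply: lee_nneseries => k _; [move=> _; exact: measure_ge0|have [] := HQ k].
Qed.

Definition square (a : C1 R) (s : R) : set (C1 R) :=
  `[a.1, (a.1 + s)%R[%classic `*` `[a.2, (a.2 + s)%R[%classic.

Lemma gdiam_square a s : (0 <= s)%R -> gdiam (square a s) <= s%:E.
Proof.
move=> s0; apply: gdiam_le => x y [/= x1 x2] [/= y1 y2]; rewrite lee_fin normC1 ge_max /=.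
move: x1 x2 y1 y2; rewrite !in_itv /= => /andP[? ?] /andP[? ?] /andP[? ?] /andP[? ?].
by rewrite !ler_norml; apply/andP; split; apply/andP; split; lra.
Qed.

(** Cutting a square into small ones. *)
Lemma haus2_square a (s : R) : (0 < s)%R -> haus2 (square a s) <= (s * s)%:E.
Proof.
move=> s0; apply: ghaus_le => eps e0.
pose n := (Num.truncn (s / eps)).+1.
pose r : R := (s / n%:R)%R.
have n0 : (0 < n%:R :> R)%R by rewrite ltr0n.
have r0 : (0 < r)%R by rewrite divr_gt0.
have re : (r <= eps)%R.
  rewrite ler_pdivrMr // mulrC -ler_pdivrMr // ltW //.
  by have /andP[] := truncn_itv (ltW (divr_gt0 s0 e0)).
pose E k : set (C1 R) := if (k < n * n)%N then
  square (a.1 + (k %/ n)%:R * r, a.2 + (k %% n)%:R * r)%R r else set0.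
have dE k : gdiam (E k) <= r%:E.
  by rewrite /E; case: ifP => _; [exact: gdiam_square (ltW r0)|rewrite gdiam0 leNye].
have idx (c z : R) : (c <= z < c + s)%R -> exists2 i, (i < n)%N & (c + i%:R * r <= z < c + i%:R * r + r)%R.
  move=> /andP[cz zs]; exists (Num.truncn ((z - c) / r)).
    have h0 : (0 <= (z - c) / r)%R by rewrite divr_ge0 ?subr_ge0 // ltW.
    have /andP[h _] := truncn_itv h0; rewrite -(ltr_nat R) (le_lt_trans h) //.
    by rewrite ltr_pdivrMr // /r mulrC divfK ?gt_eqF // ltrBlDl.
  have h0 : (0 <= (z - c) / r)%R by rewrite divr_ge0 ?subr_ge0 // ltW.
  have /andP[h1 h2] := truncn_itv h0.
  rewrite ler_pdivlMr // in h1; rewrite ltr_pdivrMr // -natr1 mulrDl mul1r in h2.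
  by apply/andP; split; lra.
apply: (le_trans (@gpre_le _ _ _ eps _ E _ _)).
- move=> z [/=]; rewrite !in_itv /= => z1 z2.
  have [i iN Hi] := idx _ _ z1; have [j jN Hj] := idx _ _ z2.
  exists (i * n + j)%N => //; rewrite /E.
  have -> : (i * n + j < n * n)%N.
    by rewrite (@leq_trans (i.+1 * n)) // ?leq_mul2r ?iN ?orbT // mulSn addnC ltn_add2r.
  by rewrite divnMDl // divn_small // addn0 modnMDl modn_small.
- by move=> k; rewrite (le_trans (dE k)) // lee_fin.
- have H k : gdiam (E k) `^ 2 <= (if (k < n * n)%N then (r * r)%:E else 0).
    rewrite /E; case: ifP => _; last by rewrite (@gdiam_pow0 _ _ 2%R).
    rewrite -pow2E ?(ltW r0) //.
    have [->|/set0P S0] := eqVneq (square (a.1 + (k %/ n)%:R * r, a.2 + (k %% n)%:R * r)%R r) set0.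
      by rewrite (@gdiam_pow0 _ _ 2%R) // poweR_ge0.
    apply: gt0_ler_poweR; last exact: gdiam_square (ltW r0).
    + by [].
    + by rewrite in_itv /= leey andbT gdiam_ge0.
    + by rewrite in_itv /= leey andbT lee_fin ltW.
  apply: (@le_trans _ _ (\sum_(0 <= k <oo) (if (k < n * n)%N then (r * r)%:E else 0))).
    by apply: lee_nneseries => k _; [move=> _; exact: poweR_ge0|exact: H].
  have rr0 : 0 <= (r * r)%:E by rewrite lee_fin mulr_ge0 ?ltW.
  rewrite (nneseries_split _ (n * n)); last by move=> k _; case: ifP.
  rewrite [X in _ + X]eseries0; last by move=> k /= kn _; rewrite ltnNge kn.
  rewrite adde0 add0n big_mkord; under eq_bigr do rewrite ltn_ord.
  rewrite sumEFin sumr_const card_ord lee_fin -mulr_natr natrM /r le_eqVlt.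
  by apply/orP; left; apply/eqP; field; rewrite gt_eqF.
Qed.

Lemma square_measurable a s : @measurable _ (measurableTypeR R * measurableTypeR R)%type (square a s).
Proof. by apply: measurableX; exact: measurable_itv. Qed.

Lemma leb2_square a s : (0 < s)%R -> leb2 (square a s) = (s * s)%:E.
Proof.
move=> s0; rewrite /square leb2X.
by rewrite !lebesgue_measure_itv /= !lte_fin !ltrDl s0 -!EFinB addrAC subrr add0r addrAC subrr add0r -EFinM.
Qed.

(** Both measures agree on squares and [leb2 <= haus2], hence they agree on the
measurable subsets of a square. *)
Lemma haus2_leb2 a s (A : set (measurableTypeR R * measurableTypeR R)) : (0 < s)%R ->
  measurable A -> A `<=` square a s -> haus2 A = leb2 A.
Proof.
move=> s0 mA As; apply/eqP; rewrite eq_le leb2_le_haus2 // andbT.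
have mS := square_measurable a s.
have mD := measurableD mS mA.
have cA : (@hausO R (C1 R) two).-caratheodory A by exact: hausO_borel2.
have Es : haus2 (square a s) = haus2 A + haus2 (square a s `\` A).
  by rewrite /haus2 [LHS](cA (square a s)) (setIidr As).
have El : leb2 (square a s) = leb2 A + leb2 (square a s `\` A).
  rewrite -measureU //; [|by apply/seteqP; split => x // [Ax [_ /(_ Ax)]]].
  by rewrite setDUK.
have fin : leb2 (square a s) \is a fin_num by rewrite leb2_square.
have fD : leb2 (square a s `\` A) \is a fin_num.
  rewrite ge0_fin_numE // (@le_lt_trans _ _ (leb2 (square a s))) //.
    by apply: le_measure; rewrite ?inE // => x [].
  by rewrite -ge0_fin_numE.
have h1 : haus2 (square a s) <= leb2 (square a s) by rewrite leb2_square // haus2_square.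
rewrite Es El in h1.
have h2 := leb2_le_haus2 mD.
rewrite -(leeD2rE _ _ fD); apply: le_trans h1; exact: leeD.
Qed.

Definition pushm d d' (T1 : measurableType d) (T2 : measurableType d')
    (m : {measure set T1 -> \bar R}) (f : T1 -> T2)
    (mf : measurable_fun setT f) : {measure set T2 -> \bar R} :=
  measure_function_pushforward__canonical__measure_function_Measure m mf.

Lemma lebesgue_affine (a b : R) (B : set (measurableTypeR R)) : a != 0%R -> measurable B ->
  lebesgue_measure [set y : measurableTypeR R | B (a * y + b)%R] = (`|a|^-1)%:E * lebesgue_measure B.
Proof.
move=> a0 mB.
have mf : measurable_fun setT (fun y : measurableTypeR R => (a * y + b)%R : measurableTypeR R).
  by apply: measurable_realfun.measurable_funD => //; exact: measurable_realfun.measurable_funM.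
have na : (0 <= `|a|)%R by [].
pose mu := mscale (NngNum na) (pushm (@lebesgue_measure R) mf).
have E : lebesgue_measure B = mu B.
  apply: lebesgue_measure_unique => // _ [[c d] _ <-].
  transitivity ((`|a|)%:E * lebesgue_measure [set y : measurableTypeR R | (`]c, d]%classic : set R) (a * y + b)%R]); last by [].
  rewrite lebesgue_measure_itv /= lte_fin.
  have [ap|an] := ltP 0%R a.
    rewrite (_ : [set y | _] = `](c - b) / a, (d - b) / a]%classic)%R; last first.
      apply/seteqP; split => y /=; rewrite !in_itv /= ltr_pdivrMr // ler_pdivlMr // ltrBlDr lerBrDr mulrC.
        by [].
      by [].
    rewrite lebesgue_measure_itv /= lte_fin ltr_pM2r ?invr_gt0 // ltrD2r.
    case: ifP => cd; last by rewrite mule0.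
    by rewrite -EFinB -EFinM gtr0_norm //; congr EFin; field.
  have an' : (a < 0)%R by rewrite lt_neqAle a0.
  rewrite (_ : [set y | _] = `[(d - b) / a, (c - b) / a[%classic)%R; last first.
    apply/seteqP; split => y /=; rewrite !in_itv /= ltr_ndivlMr // ler_ndivrMr // ltrBlDr lerBrDr mulrC andbC.
      by [].
    by [].
  rewrite lebesgue_measure_itv /= lte_fin ltr_nM2r ?invr_lt0 // ltrD2r.
  case: ifP => cd; last by rewrite mule0.
  by rewrite -EFinB -EFinM ltr0_norm //; congr EFin; field.
rewrite [X in _ = _ * X]E (_ : mu _ = (`|a|)%:E * lebesgue_measure [set y : measurableTypeR R | B (a * y + b)%R]) // muleA -EFinM mulVf ?mul1e //.
by rewrite normr_eq0.
Qed.

Implicit Types F : set (measurableTypeR R * measurableTypeR R).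

Let leb2C F : measurable F -> leb2 F = (@lebesgue_measure R \x^ @lebesgue_measure R)%E F.
Proof.
by move=> mF; apply: product_measure_unique => // A B mA mB; exact: product_measure2E.
Qed.

Let measurable_affine (f : measurableTypeR R * measurableTypeR R -> measurableTypeR R * measurableTypeR R) F :
  measurable_fun setT f -> measurable F -> measurable [set z | F (f z)].
Proof. by move=> mf mF; have := mf measurableT F mF; rewrite setTI. Qed.

Let leb2_fiber1 (a : R) (k : R -> R) F : a != 0%R -> measurable F ->
  measurable [set z : measurableTypeR R * measurableTypeR R | F (z.1, (a * z.2 + k z.1)%R)] ->
  leb2 [set z | F (z.1, (a * z.2 + k z.1)%R)] = (`|a|^-1)%:E * leb2 F.
Proof.
move=> a0 mF mG; rewrite /product_measure1 -ge0_integralZl //=; [|exact: measurable_fun_xsection].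
apply: eq_integral => x _ /=; rewrite -(@lebesgue_affine a (k x)) //.
  exact: measurable_xsection.
Qed.

Let leb2_fiber2 (a : R) (k : R -> R) F : a != 0%R -> measurable F ->
  measurable [set z : measurableTypeR R * measurableTypeR R | F ((a * z.1 + k z.2)%R, z.2)] ->
  leb2 [set z | F ((a * z.1 + k z.2)%R, z.2)] = (`|a|^-1)%:E * leb2 F.
Proof.
move=> a0 mF mG; rewrite !leb2C // /product_measure2 -ge0_integralZl //=; [|exact: measurable_fun_ysection].
apply: eq_integral => x _ /=; rewrite -(@lebesgue_affine a (k x)) //.
  exact: measurable_ysection.
Qed.

Definition cnorm2 (w : C1 R) : R := (w.1 ^+ 2 + w.2 ^+ 2)%R.

Let mlin (p q : R) : measurable_fun setT
  (fun z : measurableTypeR R * measurableTypeR R => (p * z.1 + q * z.2)%R : measurableTypeR R).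
Proof.
by apply: measurable_realfun.measurable_funD; apply: measurable_realfun.measurable_funM.
Qed.

Lemma measurable_cmul w F : measurable F -> measurable [set z | F (cmul w z)].
Proof.
apply: measurable_affine; apply: measurable_fun_pair.
  have := mlin w.1 (- w.2); apply: eq_measurable_fun => z _; by rewrite mulNr.
have := mlin w.2 w.1; apply: eq_measurable_fun => z _; by rewrite addrC.
Qed.

(** Multiplication by [w] is a product of shears and scalings of the axes. *)
Lemma leb2_cmul w F : w != 0%R -> measurable F ->
  leb2 [set z | F (cmul w z)] = ((cnorm2 w)^-1)%:E * leb2 F.
Proof.
have main p q G : p != 0%R -> measurable G ->
    leb2 [set z | G (cmul (p, q) z)] = ((cnorm2 (p, q))^-1)%:E * leb2 G.
  move=> p0 mG.
  have n0 : (p ^+ 2 + q ^+ 2 != 0)%R.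
    by rewrite paddr_eq0 ?sqr_ge0 // sqrf_eq0 (negbTE p0).
  pose r : R := ((p ^+ 2 + q ^+ 2) / p)%R.
  have r0 : r != 0%R by rewrite mulf_neq0 // invr_eq0.
  pose G1 : set (measurableTypeR R * measurableTypeR R) := [set z | G (z.1, (1 * z.2 + q / p * z.1)%R)].
  pose G2 : set (measurableTypeR R * measurableTypeR R) := [set z | G1 ((p * z.1 + 0)%R, z.2)].
  pose G3 : set (measurableTypeR R * measurableTypeR R) := [set z | G2 (z.1, (r * z.2 + 0)%R)].
  pose G4 : set (measurableTypeR R * measurableTypeR R) := [set z | G3 ((1 * z.1 + - (q / p) * z.2)%R, z.2)].
  have m1 : measurable G1.
    apply: measurable_affine mG; apply: measurable_fun_pair; first exact: measurable_fst.
    by have := mlin (q / p) 1; apply: eq_measurable_fun => z _; rewrite addrC.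
  have m2 : measurable G2.
    apply: measurable_affine m1; apply: measurable_fun_pair; last exact: measurable_snd.
    by have := mlin p 0; apply: eq_measurable_fun => z _; rewrite mul0r.
  have m3 : measurable G3.
    apply: measurable_affine m2; apply: measurable_fun_pair; first exact: measurable_fst.
    by have := mlin 0 r; apply: eq_measurable_fun => z _; rewrite mul0r add0r addr0.
  have m4 : measurable G4.
    by apply: measurable_affine m3; apply: measurable_fun_pair; [exact: mlin|exact: measurable_snd].
  have -> : [set z | G (cmul (p, q) z)] = G4.
    apply/seteqP; split => -[x y]; rewrite /G4 /G3 /G2 /G1 /cmul /= => H.
      rewrite (_ : p * (1 * x + - (q / p) * y) + 0 = p * x - q * y)%R; last by field.
      by rewrite (_ : 1 * (r * y + 0) + q / p * (p * x - q * y) = p * y + q * x)%R; last by rewrite /r; field.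
    move: H; rewrite (_ : p * (1 * x + - (q / p) * y) + 0 = p * x - q * y)%R; last by field.
    by rewrite (_ : 1 * (r * y + 0) + q / p * (p * x - q * y) = p * y + q * x)%R; last by rewrite /r; field.
  rewrite (leb2_fiber2 (oner_neq0 _) m3 m4) (leb2_fiber1 (k := fun=> 0%R) r0 m2 m3).
  rewrite (leb2_fiber2 (k := fun=> 0%R) p0 m1 m2) (leb2_fiber1 (oner_neq0 _) mG m1).
  rewrite !muleA -!EFinM; congr (_%:E * _).
  rewrite normr1 !invr1 mul1r mulr1 -invfM -normrM /r divfK //.
  by rewrite /cnorm2 ger0_norm // addr_ge0 ?sqr_ge0.
case: w => p q w0 mF; have [p0|p0] := eqVneq p 0%R; last exact: main.
rewrite {}p0 in w0 *.
have q0 : q != 0%R by apply: contra_neq w0 => ->.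
have E : [set z | F (cmul (0, q)%R z)] = [set z | [set z' | F (cmul (1, 1)%R z')] (cmul (q / 2, q / 2)%R z)].
  apply/seteqP; split => -[x y]; rewrite /cmul /= => H.
    rewrite (_ : 1 * (q / 2 * x - q / 2 * y) - 1 * (q / 2 * y + q / 2 * x) = 0 * x - q * y)%R; last by field.
    by rewrite (_ : 1 * (q / 2 * y + q / 2 * x) + 1 * (q / 2 * x - q / 2 * y) = 0 * y + q * x)%R; last by field.
  move: H; rewrite (_ : 1 * (q / 2 * x - q / 2 * y) - 1 * (q / 2 * y + q / 2 * x) = 0 * x - q * y)%R; last by field.
  by rewrite (_ : 1 * (q / 2 * y + q / 2 * x) + 1 * (q / 2 * x - q / 2 * y) = 0 * y + q * x)%R; last by field.
have mF' := measurable_cmul (1, 1)%R mF.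
rewrite E main ?mulf_neq0 ?invr_eq0 ?pnatr_eq0 // main ?oner_eq0 // muleA -EFinM.
congr (_%:E * _); rewrite /cnorm2 /=.
by rewrite -invfM; congr (_^-1)%R; field.
Qed.

Definition cinvw (w : C1 R) : C1 R := (w.1 / cnorm2 w, - w.2 / cnorm2 w)%R.

Lemma cnorm2_gt0 w : w != 0%R -> (0 < cnorm2 w)%R.
Proof.
move=> w0; rewrite lt_neqAle addr_ge0 ?sqr_ge0 // andbT eq_sym.
apply: contra_neq w0; rewrite /cnorm2 => /eqP; rewrite paddr_eq0 ?sqr_ge0 // !sqrf_eq0.
by case: w => p q /= /andP[/eqP -> /eqP ->].
Qed.

Lemma cinvwK w z : w != 0%R -> cmul (cinvw w) (cmul w z) = z.
Proof.
move=> /cnorm2_gt0/lt0r_neq0 n0; case: w n0 => p q; case: z => x y.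
by rewrite /cinvw /cnorm2 /cmul /= => n0; congr pair; field.
Qed.

Lemma cmulwK w z : w != 0%R -> cmul w (cmul (cinvw w) z) = z.
Proof.
move=> /cnorm2_gt0/lt0r_neq0 n0; case: w n0 => p q; case: z => x y.
by rewrite /cinvw /cnorm2 /cmul /= => n0; congr pair; field.
Qed.

Lemma cmul_le (w z : C1 R) : (`|cmul w z| <= 2 * `|w| * `|z|)%R.
Proof.
have H (a b c d : R) : (`|a| <= `|w| -> `|b| <= `|z| -> `|c| <= `|w| -> `|d| <= `|z| ->
   `|a * b| + `|c * d| <= 2 * `|w| * `|z|)%R.
  move=> h1 h2 h3 h4; rewrite !normrM -mulrA mulrDl !mul1r.
  by apply: lerD; apply: ler_pM.
have w1 : (`|w.1| <= `|w|)%R by rewrite normC1 le_max lexx.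
have w2 : (`|w.2| <= `|w|)%R by rewrite normC1 le_max lexx orbT.
have z1 : (`|z.1| <= `|z|)%R by rewrite normC1 le_max lexx.
have z2 : (`|z.2| <= `|z|)%R by rewrite normC1 le_max lexx orbT.
rewrite [X in (X <= _)%R]normC1 ge_max /cmul /=; apply/andP; split.
  by rewrite (le_trans (ler_normB _ _)) // H.
by rewrite (le_trans (ler_normD _ _)) // H.
Qed.

Lemma cmulBr (w z z' : C1 R) : cmul w (z - z')%R = (cmul w z - cmul w z')%R.
Proof. by case: w z z' => p q [x y] [x' y']; rewrite /cmul /=; congr pair => /=; ring. Qed.

(** A map which is close to multiplication by [w] multiplies areas by about
[|w|^2]: after division by [w] it is almost 1-Lipschitz for the maximum norm, and
planar Hausdorff measure controls Lebesgue measure with constant one. *)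
Lemma leb2_near_conformal w (eps : R) (zeta : C1 R -> C1 R) F a s : w != 0%R -> (0 <= eps)%R ->
  (0 < s)%R -> F `<=` square a s -> measurable F ->
  @measurable _ (measurableTypeR R * measurableTypeR R)%type (zeta @` F) ->
  (forall z z', F z -> F z' ->
     `|zeta z - zeta z' - cmul w (z - z')| <= eps * `|z - z'|)%R ->
  leb2 (zeta @` F) <= (cnorm2 w * (1 + 2 * `|cinvw w| * eps) ^+ 2)%:E * leb2 F.
Proof.
move=> w0 e0 s0 Fs mF mG lip; have n0 := cnorm2_gt0 w0.
pose L := (1 + 2 * `|cinvw w| * eps)%R.
have L0 : (0 < L)%R by rewrite ltr_pwDl // !mulr_ge0.
pose G : set (measurableTypeR R * measurableTypeR R) := [set z | (zeta @` F) (cmul w z)].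
have mG' : measurable G by exact: measurable_cmul.
have GE : G = (fun z => cmul (cinvw w) (zeta z)) @` F.
  apply/seteqP; split => z.
    by move=> [y Fy E]; exists y => //; rewrite E cinvwK.
  by move=> [y Fy <-]; exists y => //; rewrite cmulwK.
have lG : leb2 G <= (L ^+ 2)%:E * leb2 F.
  rewrite (le_trans (leb2_le_haus2 mG')) // -(haus2_leb2 s0 mF Fs) GE.
  have -> : (L ^+ 2 = L `^ 2)%R by rewrite powR_mulrn // ltW.
  apply: (@ghaus_lipschitz R (C1 R) (C1 R) 2%R) => // z z' Fz Fz'.
  rewrite -cmulBr.
  have -> : (zeta z - zeta z' = cmul w (z - z') + (zeta z - zeta z' - cmul w (z - z')))%R.
    by rewrite addrCA subrr addr0.
  set r := (zeta z - zeta z' - _)%R.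
  have -> : cmul (cinvw w) (cmul w (z - z') + r)%R = (z - z' + cmul (cinvw w) r)%R.
    rewrite -{2}(@cinvwK w (z - z')%R) //.
    by case: (cinvw w) (cmul w _) r => p q [x y] [x' y']; rewrite /cmul /=; congr pair => /=; ring.
  rewrite (le_trans (ler_normD _ _)) // /L mulrDl mul1r lerD2l (le_trans (cmul_le _ _)) //.
  by rewrite -[leRHS]mulrA; apply: ler_wpM2l; [rewrite mulr_ge0|exact: lip].
rewrite leb2_cmul // in lG.
rewrite EFinM -muleA -lee_pdivrMl //; exact: lG.
Qed.

End PlanarLebesgue.

(** * Comparison of measures and the change of variables *)

Section LocalComparison.
Context d (T : measurableType d) (R : realType).
Local Open Scope ereal_scope.

Lemma le_of_factors (x y : \bar R) : 0 <= y ->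
  (forall k : R, (1 < k)%R -> x <= k%:E * y) -> x <= y.
Proof.
case: y => [y| |] // y0 H; last by rewrite leey.
rewrite lee_fin in y0; apply/lee_addgt0Pr => e e0.
have y1 : (0 < y + 1)%R by rewrite ltr_wpDl.
have k1 : (1 < 1 + e / (y + 1))%R by rewrite ltrDl divr_gt0.
apply: (le_trans (H _ k1)); rewrite -EFinM -EFinD lee_fin mulrDl mul1r lerD2l.
rewrite mulrAC ler_pdivrMr // ler_wpM2l ?(ltW e0) // lerDl //.
Qed.

(** Countably many local comparisons up to a factor close to one give a global
comparison: cut a set along a countable cover. *)
Lemma le_of_local (m' m : set T -> \bar R) (Y : set T) (base : nat -> set T) :
  (forall n, measurable (base n)) ->
  m' set0 = 0 -> (forall B, 0 <= m' B) -> (forall B, 0 <= m B) ->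
  (forall F : nat -> set T, (forall n, measurable (F n)) -> trivIset setT F ->
     \bigcup_n F n `<=` Y -> m' (\bigcup_n F n) <= \sum_(0 <= n <oo) m' (F n)) ->
  (forall F : nat -> set T, (forall n, measurable (F n)) -> trivIset setT F ->
     \bigcup_n F n `<=` Y -> \sum_(0 <= n <oo) m (F n) <= m (\bigcup_n F n)) ->
  (forall k : R, (1 < k)%R -> forall p, Y p -> exists n, base n p /\
     forall B, measurable B -> B `<=` Y -> B `<=` base n -> m' B <= k%:E * m B) ->
  forall B, measurable B -> B `<=` Y -> m' B <= m B.
Proof.
move=> mb m'00 m'0 m0 sub sup loc B mB BY; apply: le_of_factors => // k k1.
have k0 : (0 <= k)%R by rewrite ltW // (lt_trans ltr01).
pose good n := forall B, measurable B -> B `<=` Y -> B `<=` base n -> m' B <= k%:E * m B.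
pose V n := B `&` (if `[< good n >] then base n else set0).
have mV n : measurable (V n) by apply: measurableI => //; case: ifP.
pose F := seqDU V.
have BE : B = \bigcup_n F n.
  rewrite -seqDU_bigcup_eq; apply/seteqP; split => [p Bp|p [n _ []] //].
  have [n [bn gn]] := loc k k1 p (BY p Bp); exists n => //; split=> //.
  by rewrite (asboolT gn).
have mF n : measurable (F n) by exact: seqDU_measurable.
have tF : trivIset setT F by exact: trivIset_seqDU.
have FY : \bigcup_n F n `<=` Y by rewrite -BE.
rewrite BE (le_trans (sub F mF tF FY)) //.
have : k%:E * \sum_(0 <= n <oo) m (F n) <= k%:E * m (\bigcup_n F n).
  by apply: lee_wpmul2l; [rewrite lee_fin|exact: sup].
apply: le_trans; rewrite -nneseriesZl //.
apply: lee_nneseries => [n _ _|n _]; first exact: m'0.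
have FV : F n `<=` V n by exact: subset_seqDU.
have FB : F n `<=` Y by move=> p /FV[/BY].
have : F n `<=` if `[< good n >] then base n else set0 by move=> p /FV[].
case: ifPn => [/asboolP gn|_] sF; first exact: gn.
have -> : F n = set0 by apply/seteqP; split.
by rewrite m'00 mule_ge0 // lee_fin.
Qed.

End LocalComparison.

Section HausdorffChange.
Context (R : realType).
Local Open Scope ereal_scope.

Definition ratbase (n : nat) : set R :=
  if unpickle n is Some q then `](ratr (q : rat * rat).1), (ratr q.2)[%classic else set0.

Lemma ratbase_open n : open (ratbase n).
Proof. by rewrite /ratbase; case: unpickle => [q|]; [exact: interval_open|exact: open0]. Qed.

Lemma ratbaseP (p r : R) : (0 < r)%R -> exists2 n, ratbase n p & ratbase n `<=` ball p r.
Proof.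
move=> r0.
have [q1] := @rat_in_itvoo _ (p - r)%R p ltac:(by rewrite ltrBlDr ltrDl).
have [q2] := @rat_in_itvoo _ p (p + r)%R ltac:(by rewrite ltrDl).
rewrite !in_itv /= => /andP[h1 h2] /andP[h3 h4].
exists (pickle (q1, q2)); rewrite /ratbase pickleK /=.
  by rewrite in_itv /= h1 h4.
move=> x /=; rewrite in_itv /= => /andP[h5 h6].
by rewrite -ball_normE /= ltr_distlC (lt_trans h3) // (lt_trans h6).
Qed.

Lemma sqrt_factor (alpha k : R) : (0 < alpha)%R -> (1 < k)%R ->
  exists2 l : R, (1 < l)%R & ((l * l) `^ alpha = k)%R.
Proof.
move=> a0 k1; have k0 := lt_trans ltr01 k1.
exists (k `^ (2 * alpha)^-1)%R.
  have E : (1 `^ (2 * alpha)^-1 = 1 :> R)%R by rewrite powR1.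
  rewrite -[ltLHS]E.
  by apply: gt0_ltr_powR => //; rewrite ?nnegrE ?(ltW k0) ?invr_gt0 ?mulr_gt0.
rewrite -powRD; last by rewrite (gt_eqF k0) implybT.
rewrite -powRrM (_ : (_ + _) * alpha = 1)%R ?powRr1 ?(ltW k0) //.
by field; rewrite gt_eqF.
Qed.

(** The inverse of a continuous injection of a segment is Borel because the preimages
of closed rays under it are compact. *)
Lemma segment_inverse (tau : R -> R) (a b : R) :
  {within `[a, b], continuous tau} -> {in `[a, b]%classic &, injective tau} ->
  exists sigma : R -> R,
    [/\ measurable_fun setT (sigma : measurableTypeR R -> measurableTypeR R),
        forall t, `[a, b]%classic t -> sigma (tau t) = t &
        @measurable _ (measurableTypeR R) (tau @` `[a, b])].
Proof.
move=> ct it; pose I := `[a, b]%classic : set R.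
have mc (C : set R) : closed C -> @measurable _ (measurableTypeR R) (tau @` (I `&` C)).
  move=> cC; apply: compact_measurable; apply: continuous_compact.
    by apply: continuous_subspaceW ct => x [].
  by apply: compact_closedI => //; exact: segment_compact.
have mI : @measurable _ (measurableTypeR R) (tau @` I).
  by rewrite -(setIT I); apply: mc; exact: closedT.
pose sg t' := xget 0%R [set t | I t /\ tau t = t'].
have sgK t : I t -> sg (tau t) = t.
  move=> It; rewrite /sg; case: xgetP => [y _ [Iy E]|/(_ t)]; last by case.
  by apply: it; rewrite ?inE.
exists (sg \_ (tau @` I)); split => //.
- apply/(measurable_restrictT _ mI).
  apply: (@measurability _ _ (measurableTypeR R) (measurableTypeR R) _ _ _ (measurable_realfun.RGenOInfty.measurableE R)).
  move=> _ [_ [c ->] <-].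
  have -> : tau @` I `&` sg @^-1` `]c, +oo[%classic = (tau @` I) `\` (tau @` (I `&` [set x | x <= c]%R)).
    apply/seteqP; split => t'.
      move=> [[t It <-]] /=; rewrite sgK // in_itv /= andbT => ct'; split; first by exists t.
      move=> [u [Iu /= uc] E]; have := it u t; rewrite !inE => /(_ Iu It E) uE.
      by move: uc; rewrite uE leNgt ct'.
    move=> [[t It <-] nt]; split; first by exists t.
    rewrite /= sgK // in_itv /= andbT ltNge; apply/negP => tc; apply: nt.
    by exists t.
  by apply: measurableD => //; apply: mc; exact: closed_le.
- move=> t It; rewrite patchE ifT ?sgK //; rewrite inE; by exists t.
Qed.

(** An open set is a countable union of segments with rational ends. *)
Lemma image_measurable (tau : R -> R) (G B : set R) : open G ->
  {in G, continuous tau} -> {in G &, injective tau} ->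
  @measurable _ (measurableTypeR R) B -> B `<=` G ->
  @measurable _ (measurableTypeR R) (tau @` B).
Proof.
move=> oG ct it mB BG.
pose P (q q' : rat) := `[< `[ratr q : R, ratr q']%classic `<=` G >].
have -> : tau @` B = \bigcup_(q : rat) \bigcup_(q' : rat)
    (if P q q' then tau @` (B `&` `[ratr q : R, ratr q']%classic) else set0).
  apply/seteqP; split => t'.
    move=> [t Bt <-]; have [r r0 rG] := (iffLR (nbhs_ballP _ _)) (oG t (BG t Bt)).
    have [q1] := @rat_in_itvoo _ (t - r)%R t ltac:(by rewrite ltrBlDr ltrDl).
    have [q2] := @rat_in_itvoo _ t (t + r)%R ltac:(by rewrite ltrDl).
    rewrite !in_itv /= => /andP[h1 h2] /andP[h3 h4].
    exists q1 => //; exists q2 => //.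
    suff -> : P q1 q2 by exists t => //; split => //=; rewrite in_itv /= !ltW.
    apply/asboolP => x /=; rewrite in_itv /= => /andP[h5 h6]; apply: rG.
    by rewrite -ball_normE /= ltr_distlC (lt_le_trans h3) // (le_lt_trans h6).
  by move=> [q _ [q' _]]; case: ifP => // _ [t [Bt _] <-]; exists t.
apply: bigcupT_measurable_rat => q; apply: bigcupT_measurable_rat => q'.
case: ifPn => // /asboolP IG.
have ctI : {within `[ratr q : R, ratr q'], continuous tau}.
  by apply: continuous_in_subspaceT => x; rewrite inE => /IG Gx; apply: ct; rewrite inE.
have itI : {in `[ratr q : R, ratr q']%classic &, injective tau}.
  by move=> x y; rewrite !inE => /IG Gx /IG Gy; apply: it; rewrite inE.
have [sg [msg sgK mI]] := segment_inverse ctI itI.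
have -> : tau @` (B `&` `[ratr q : R, ratr q']%classic) =
    tau @` `[ratr q : R, ratr q'] `&` sg @^-1` B.
  apply/seteqP; split => t'.
    by move=> [t [Bt It] <-]; split; [exists t|rewrite /= sgK].
  by move=> [[t It <-]] /=; rewrite sgK // => Bt; exists t.
by apply: measurableI => //; have := msg measurableT B mB; rewrite setTI.
Qed.

(** A strictly differentiable function is nearly a similarity at small scales. *)
Lemma sdiff_similarity (tau : R -> R) (t s k : R) : (1 < k)%R -> s != 0%R ->
  sdiff tau t (fun h => (s * h)%R) ->
  exists2 r : R, (0 < r)%R & forall x y, ball t r x -> ball t r y ->
    (`|tau x - tau y| <= k * `|s| * `|x - y| /\ `|x - y| <= k / `|s| * `|tau x - tau y|)%R.
Proof.
move=> k1 s0 [_ _ /(_ (`|s| * (1 - k^-1))%R)]; have k0 := lt_trans ltr01 k1.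
have sp : (0 < `|s|)%R by rewrite normr_gt0.
have e0 : (0 < 1 - k^-1)%R by rewrite subr_gt0 invf_lt1.
have ek : (1 + (1 - k^-1) <= k)%R.
  rewrite -subr_ge0 (_ : k - _ = (k - 1) ^+ 2 / k)%R ?divr_ge0 ?sqr_ge0 ?ltW //.
  by field; rewrite gt_eqF.
move=> /(_ (mulr_gt0 sp e0))[r r0 Hr]; exists r => // x y xr yr.
have := Hr x y xr yr; set A := (tau x - tau y)%R; set B := (x - y)%R => h.
have h1 : (`|A| <= `|s| * `|B| + `|A - s * B|)%R.
  by rewrite -normrM -{1}(subrK (s * B) A)%R addrC ler_normD.
have h2 : (`|s| * `|B| <= `|A| + `|A - s * B|)%R.
  by rewrite -normrM -{1}(subKr A (s * B))%R; exact: ler_normB.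
have B0 : (0 <= `|s| * `|B|)%R by rewrite mulr_ge0.
split.
  apply: (@le_trans _ _ ((1 + (1 - k^-1)) * (`|s| * `|B|))%R).
    by rewrite mulrDl mul1r (le_trans h1) // lerD2l (le_trans h) // mulrAC mulrC.
  by rewrite -mulrA ler_wpM2r.
have h3 : (`|s| * `|B| * k^-1 <= `|A|)%R by lra.
rewrite mulrAC ler_pdivlMr // mulrC [leRHS]mulrC.
by rewrite -ler_pdivrMr.
Qed.

Section Change.
Context (alpha : {posnum R}) (K K' G : set R) (tau s : R -> R).
Hypothesis oG : open G.
Hypothesis it : {in G &, injective tau}.
Hypothesis dt : forall t, G t -> s t != 0%R /\ sdiff tau t (fun h => s t * h)%R.
Hypothesis KK : forall t, G t -> K t <-> K' (tau t).
Local Notation a := (alpha%:num).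

Let im (B : set R) : B `<=` G -> K' `&` (tau @` B) = tau @` (K `&` B).
Proof.
move=> BG; apply/seteqP; split => t'.
  by move=> [Kt' [t Bt E]]; exists t => //; split=> //; apply/KK; [exact: BG|rewrite E].
by move=> [t [Kt Bt] <-]; split; [apply/KK => //; exact: BG|exists t].
Qed.

(** A near similarity of ratio [|s t0|] multiplies the Hausdorff measure by about the
power of the ratio; the inverse map gives the converse bound. *)
Lemma haus_local (k : R) (t0 : R) : (1 < k)%R -> G t0 ->
  exists2 r : R, (0 < r)%R & ball t0 r `<=` G /\ forall B, B `<=` ball t0 r ->
   hausO alpha (K' `&` (tau @` B)) <= ((k * `|s t0|) `^ a)%:E * hausO alpha (K `&` B) /\
   hausO alpha (K `&` B) <= ((k / `|s t0|) `^ a)%:E * hausO alpha (K' `&` (tau @` B)).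
Proof.
move=> k1 Gt; have k0 := lt_trans ltr01 k1; have [s0 st] := dt Gt.
have sp : (0 < `|s t0|)%R by rewrite normr_gt0.
have [r1 r10 H1] := sdiff_similarity k1 s0 st.
have [r2 r20 H2] := (iffLR (nbhs_ballP _ _)) (oG Gt).
have r20' : (0 < r2)%R by [].
exists (Num.min r1 r2); first by rewrite lt_min r10.
have b1 : ball t0 (Num.min r1 r2) `<=` ball t0 r1 by apply: le_ball; rewrite ge_min lexx.
have b2 : ball t0 (Num.min r1 r2) `<=` G.
  by move=> x /(@le_ball _ _ _ _ r2 _) bx; apply: H2; apply: bx; rewrite ge_min lexx orbT.
split=> // B Bb; have BG : B `<=` G by move=> x /Bb/b2.
rewrite im //; split.
  apply: ghaus_lipschitz => //; first by rewrite mulr_gt0.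
  by move=> x y [_ /Bb/b1 Bx] [_ /Bb/b1 By]; have [] := H1 x y Bx By.
pose sg t' := xget 0%R [set t | B t /\ tau t = t'].
have sgK t : B t -> sg (tau t) = t.
  move=> Bt; rewrite /sg; case: xgetP => [y _ [By E]|/(_ t)]; last by case.
  by apply: it; rewrite ?inE //; exact: BG.
have {1}-> : K `&` B = sg @` (tau @` (K `&` B)).
  apply/seteqP; split => [t [Kt Bt]|t [_ [u [Ku Bu] <-]]].
    by exists (tau t); [exists t|exact: sgK].
  by rewrite sgK // => <-.
apply: ghaus_lipschitz => //; first by rewrite divr_gt0.
move=> _ _ [x [_ Bx] <-] [y [_ By] <-]; rewrite !sgK //.
by have [] := H1 x y (b1 _ (Bb _ Bx)) (b1 _ (Bb _ By)).
Qed.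

Let ct : {in G, continuous tau}.
Proof. by move=> t; rewrite inE => Gt; have [_] := dt Gt; exact: sdiff_continuous. Qed.

Lemma slope_derive1 t : G t -> derive1 tau t = s t.
Proof. by move=> Gt; have [_ /sdiff_derive/(_ 1%R)[_]] := dt Gt; rewrite derive1E mulr1. Qed.

(** Compare the ratio of increments near [t0] with the slope at [t]. *)
Lemma slope_near (k : R) (t0 : R) : (1 < k)%R -> G t0 ->
  exists2 r : R, (0 < r)%R & forall t, ball t0 r t ->
    G t /\ (`|s t| <= k * `|s t0| /\ `|s t0| <= k * `|s t|)%R.
Proof.
move=> k1 Gt; have [l l1 ll] := sqrt_factor ltr01 k1.
have l0 := lt_trans ltr01 l1.
rewrite powRr1 ?mulr_ge0 ?(ltW l0) // in ll.
have [s0 st] := dt Gt; have [r1 r10 H1] := sdiff_similarity l1 s0 st.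
have [r2 r20 H2] := (iffLR (nbhs_ballP _ _)) (oG Gt).
have r20' : (0 < r2)%R by [].
exists (Num.min r1 r2); first by rewrite lt_min r10.
move=> t bt; have Gt' : G t by apply: H2; apply: le_ball bt; rewrite ge_min lexx orbT.
split=> //; have b1 : ball t0 r1 t by apply: le_ball bt; rewrite ge_min lexx.
have [s0' st'] := dt Gt'; have [r3 r30 H3] := sdiff_similarity l1 s0' st'.
have [y [y1 y3 yt]] : exists y, [/\ ball t0 r1 y, ball t r3 y & y != t].
  move: b1; rewrite -ball_normE /= => b1.
  pose e := (Num.min (r1 - `|t0 - t|) r3 / 2)%R.
  have e0 : (0 < e)%R by rewrite divr_gt0 // lt_min r30 subr_gt0 b1.
  have e1 : (e < r1 - `|t0 - t|)%R.
    by rewrite /e ltr_pdivrMr // (le_lt_trans (_ : _ <= r1 - `|t0 - t|))%R ?ge_min ?lexx // ltr_pMr ?subr_gt0 // ltr1n.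
  have e3 : (e < r3)%R.
    by rewrite /e ltr_pdivrMr // (le_lt_trans (_ : _ <= r3))%R ?ge_min ?lexx ?orbT // ltr_pMr // ltr1n.
  exists (t + e)%R; split.
  - rewrite opprD addrA (le_lt_trans (ler_normB _ _)) // (gtr0_norm e0).
    by lra.
  - by rewrite -?ball_normE /= opprD addrA subrr sub0r normrN gtr0_norm.
  - by rewrite -subr_eq0 addrAC subrr add0r gt_eqF.
have [h1 h2] := H1 t y b1 y1; have [h3 h4] := H3 t y (ballxx t r30) y3.
have n0 : (0 < `|t - y|)%R by rewrite normr_gt0 subr_eq0 eq_sym.
have sp : (0 < `|s t0|)%R by rewrite normr_gt0.
have sp' : (0 < `|s t|)%R by rewrite normr_gt0.
split.
  rewrite -ll -(ler_pM2r n0).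
  rewrite mulrAC ler_pdivlMr // in h4.
  rewrite mulrC (le_trans h4) // -!mulrA ler_pM2l // mulrA; exact: h1.
rewrite -ll -(ler_pM2r n0).
rewrite mulrAC ler_pdivlMr // in h2.
rewrite mulrC (le_trans h2) // -!mulrA ler_pM2l // mulrA; exact: h3.
Qed.

Lemma slope_measurable : measurable_fun (G : set (measurableTypeR R))
  (fun t => (`|derive1 tau t| `^ a)%:E).
Proof.
have mG : @measurable _ (measurableTypeR R) G by exact: open_measurable.
apply/measurable_EFinP.
have cs : {in G, continuous (fun t => `|s t|)%R}.
  move=> t; rewrite inE => Gt; have [s0 _] := dt Gt; have sp : (0 < `|s t|)%R by rewrite normr_gt0.
  apply/cvgrPdist_le => e e0.
  have k1 : (1 < 1 + e / `|s t|)%R by rewrite ltrDl divr_gt0.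
  have [r r0 Hr] := slope_near k1 Gt.
  apply/nbhs_ballP; exists r => // y yr; have [_ [h1 h2]] := Hr y yr.
  rewrite mulrDl mul1r divfK ?gt_eqF // in h1.
  rewrite ler_distlC; apply/andP; split => //.
  have [h|h] := leP (`|s y|)%R (`|s t|)%R; last by rewrite (le_trans _ (ltW h)) // gerBl ltW.
  rewrite lerBlDr (le_trans h2) // mulrDl mul1r lerD2l mulrAC ler_pdivrMr // ler_wpM2l // ltW //.
have ms : measurable_fun (G : set (measurableTypeR R)) ((fun t => `|s t|)%R : _ -> measurableTypeR R).
  exact: open_continuous_measurable_fun.
have mp := measurableT_comp (@measurable_powR R a) ms.
apply: eq_measurable_fun mp => t; rewrite inE => Gt /=.
by rewrite slope_derive1.
Qed.

(** The slope is almost constant on small intervals, so that both sides agree there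
up to a factor close to one. *)
Lemma haus_change (B : set (measurableTypeR R)) : measurable B -> B `<=` G ->
  hausO alpha (K' `&` (tau @` B)) =
  \int[haus_restr alpha K]_(t in B) (`|derive1 tau t| `^ a)%:E.
Proof.
pose m' (B : set (measurableTypeR R)) := hausO alpha (K' `&` (tau @` B)).
pose m (B : set (measurableTypeR R)) := \int[haus_restr alpha K]_(t in B) (`|derive1 tau t| `^ a)%:E.
have f0 t : 0 <= (`|derive1 tau t| `^ a)%:E by rewrite lee_fin powR_ge0.
have m'0 C : 0 <= m' C by exact: ghaus_ge0.
have m0 C : 0 <= m C by apply: integral_ge0.
have m'00 : m' set0 = 0 by rewrite /m' image_set0 setI0; exact: ghaus0.
have m00 : m set0 = 0 by rewrite /m integral_set0.
have imU (F : nat -> set (measurableTypeR R)) : K' `&` (tau @` \bigcup_n F n) = K' `&` \bigcup_n (tau @` F n).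
  by rewrite image_bigcup.
have mE (F : nat -> set (measurableTypeR R)) : (forall n, measurable (F n)) -> trivIset setT F ->
    \bigcup_n F n `<=` G -> m (\bigcup_n F n) = \sum_(0 <= n <oo) m (F n).
  move=> mF tF FG; apply: ge0_integral_bigcup => //.
  by apply: measurable_funS slope_measurable => //; exact: open_measurable.
have m'E (F : nat -> set (measurableTypeR R)) : (forall n, measurable (F n)) -> trivIset setT F ->
    \bigcup_n F n `<=` G -> m' (\bigcup_n F n) = \sum_(0 <= n <oo) m' (F n).
  move=> mF tF FG; rewrite /m' imU; apply/eqP; rewrite eq_le outer_measure_bigcup_lim /=.
  have cA n : (@hausO R R alpha).-caratheodory (tau @` F n).
    apply: hausO_borel; apply: (image_measurable oG ct it (mF n)) => t Ft.
    by apply: FG; exists n.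
  have tA : trivIset setT (fun n => tau @` F n).
    move=> i j _ _ [_ [[t Ft <-] [u Fu E]]]; apply: tF => //; exists t; split => //.
    suff -> : t = u by [].
    by apply: it; rewrite ?inE //; apply: FG; [exists i|exists j].
  have := @caratheodory_lime_le _ _ (@hausO R R alpha) _ cA tA (K' `&` \bigcup_n (tau @` F n)).
  have E k : K' `&` \bigcup_n (tau @` F n) `&` (tau @` F k) = K' `&` (tau @` F k).
    by rewrite -setIA; congr (_ `&` _); apply/setIidPr => x Ax; exists k.
  under eq_eseriesr do rewrite E.
  by apply: le_trans; rewrite leeDl // ghaus_ge0.
have mb n : @measurable _ (measurableTypeR R) (ratbase n).
  by apply: open_measurable; exact: ratbase_open.
have loc k : (1 < k)%R -> forall p, G p -> exists n, ratbase n p /\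
    forall C : set (measurableTypeR R), measurable C -> C `<=` G -> C `<=` ratbase n ->
      m' C <= k%:E * m C /\ m C <= k%:E * m' C.
  move=> k1 p Gp; have [l l1 ll] := sqrt_factor (gt0 alpha) k1.
  have l0 := lt_trans ltr01 l1; have [s0 _] := dt Gp.
  have sp : (0 < `|s p|)%R by rewrite normr_gt0.
  have [r r0 [rG Hr]] := haus_local l1 Gp; have [r' r'0 Hr'] := slope_near l1 Gp.
  have [n np nr] := @ratbaseP p (Num.min r r') ltac:(by rewrite lt_min r0).
  exists n; split=> // C mC CG Cn.
  have C1 : C `<=` ball p r by move=> x /Cn/nr; apply: le_ball; rewrite ge_min lexx.
  have C2 : C `<=` ball p r' by move=> x /Cn/nr; apply: le_ball; rewrite ge_min lexx orbT.
  have [h1 h2] := Hr C C1.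
  have mfC : measurable_fun C (fun t => (`|derive1 tau t| `^ a)%:E).
    by apply: measurable_funS slope_measurable => //; exact: open_measurable.
  have cst r1 : \int[haus_restr alpha K]_(t in C) r1%:E = r1%:E * hausO alpha (K `&` C).
    by have := @integral_cst _ _ _ (haus_restr alpha K : {measure set _ -> \bar R}) C mC r1%:E.
  have lo : ((`|s p| / l) `^ a)%:E * hausO alpha (K `&` C) <= m C.
    rewrite -cst; apply: ge0_le_integral => //; first by move=> x _; rewrite lee_fin powR_ge0.
    move=> x Cx; have [Gx [_ h]] := Hr' x (C2 x Cx).
    rewrite lee_fin slope_derive1 //; apply: ge0_ler_powR; rewrite ?nnegrE ?divr_ge0 ?(ltW l0) //.
    by rewrite ler_pdivrMr // mulrC.
  have up : m C <= ((l * `|s p|) `^ a)%:E * hausO alpha (K `&` C).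
    rewrite -cst; apply: ge0_le_integral => //.
    move=> x Cx; have [Gx [h _]] := Hr' x (C2 x Cx).
    by rewrite lee_fin slope_derive1 //; apply: ge0_ler_powR; rewrite ?nnegrE ?mulr_ge0 ?(ltW l0).
  have powM (x y : R) : (0 <= x -> 0 <= y -> x `^ a * y `^ a = (x * y) `^ a)%R.
    by move=> x0 y0; rewrite powRM.
  split.
    rewrite (le_trans h1) //.
    have -> : ((l * `|s p|) `^ a = k * (`|s p| / l) `^ a)%R.
      by rewrite -ll powM ?mulr_ge0 ?invr_ge0 ?(ltW l0) //; congr (_ `^ _)%R; field; rewrite gt_eqF.
    by rewrite EFinM -muleA lee_wpmul2l // lee_fin ltW // (lt_trans ltr01).
  rewrite (le_trans up) //.
  have -> : k = ((l * `|s p|) `^ a * (l / `|s p|) `^ a)%R.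
    by rewrite -ll powM ?mulr_ge0 ?invr_ge0 ?(ltW l0) //; congr (_ `^ _)%R; field; rewrite gt_eqF.
  by rewrite EFinM -muleA lee_wpmul2l // lee_fin powR_ge0.
move=> mB BG; apply/eqP; rewrite eq_le; apply/andP; split.
  apply: (@le_of_local _ _ _ m' m G ratbase) => //.
  - by move=> F mF tF FG; rewrite m'E.
  - by move=> F mF tF FG; rewrite mE.
  - move=> k k1 p Gp; have [n [np H]] := loc k k1 p Gp; exists n; split=> // C mC CG Cn.
    by have [] := H C mC CG Cn.
apply: (@le_of_local _ _ _ m m' G ratbase) => //.
- by move=> F mF tF FG; rewrite mE.
- by move=> F mF tF FG; rewrite m'E.
- move=> k k1 p Gp; have [n [np H]] := loc k k1 p Gp; exists n; split=> // C mC CG Cn.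
  by have [] := H C mC CG Cn.
Qed.

End Change.

End HausdorffChange.

(** * Comparison of the chart measures *)

Section ProductBorel.
Context (R : realType).

Definition open_base (T : topologicalType) (b : nat -> set T) :=
  (forall n, open (b n)) /\ forall p O, open O -> O p -> exists2 n, b n p & b n `<=` O.

Definition prod_base (T U : topologicalType) (b : nat -> set T) (b' : nat -> set U) (n : nat) :
    set (T * U) := if unpickle n is Some p then b (p : nat * nat).1 `*` b' p.2 else set0.

Lemma prod_baseP (T U : topologicalType) (b : nat -> set T) (b' : nat -> set U) :
  open_base b -> open_base b' -> open_base (prod_base b b').
Proof.
move=> [ob Hb] [ob' Hb']; split.
  by move=> n; rewrite /prod_base; case: unpickle => [p|]; [exact: open_setM_box|exact: open0].
move=> [x y] O oO Oxy; have [[P Q] /= [Px Qy] PQ] := oO _ Oxy.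
move: Px Qy; rewrite !nbhsE => -[P' [oP' P'x] P'P] [Q' [oQ' Q'y] Q'Q].
have [i bi bP] := Hb x P' oP' P'x; have [j bj bQ] := Hb' y Q' oQ' Q'y.
exists (pickle (i, j)); rewrite /prod_base pickleK //=.
by move=> [x' y'] [/= /bP/P'P Px' /bQ/Q'Q Qy']; exact: PQ.
Qed.

Lemma ratbase_base : open_base (@ratbase R).
Proof.
split; first exact: ratbase_open.
move=> p O oO Op; have [r r0 rO] := (iffLR (nbhs_ballP _ _)) (oO p Op).
by have [n np nr] := @ratbaseP R p r r0; exists n => // x /nr/rO.
Qed.

Lemma open_base_cover (T : topologicalType) (b : nat -> set T) (O : set T) :
  open_base b -> open O -> O = \bigcup_n (if `[< b n `<=` O >] then b n else set0).
Proof.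
move=> [_ Hb] oO; apply/seteqP; split => [p Op|p [n _]].
  by have [n bn bO] := Hb p O oO Op; exists n => //; rewrite asboolT.
by case: ifPn => // /asboolP bO; exact: bO.
Qed.

Lemma prod_base_measurable d d' (T : measurableType d) (U : measurableType d')
    (b : nat -> set T) (b' : nat -> set U) : (forall n, measurable (b n)) ->
  (forall n, measurable (b' n)) ->
  forall n, measurable (if unpickle n is Some p then b (p : nat * nat).1 `*` b' p.2 else set0).
Proof. by move=> mb mb' n; case: unpickle => [p|] //; exact: measurableX. Qed.

Definition base2 := prod_base (@ratbase R) (@ratbase R).
Definition base3 := prod_base base2 (@ratbase R).

Lemma base2_measurable n : @measurable _ (measurableTypeR R * measurableTypeR R)%type (base2 n).
Proof.
apply: prod_base_measurable => k; apply: open_measurable; exact: ratbase_open.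
Qed.

Lemma base3_measurable n :
  @measurable _ (measurableTypeR R * measurableTypeR R * measurableTypeR R)%type (base3 n).
Proof.
apply: prod_base_measurable => k; first exact: base2_measurable.
apply: open_measurable; exact: ratbase_open.
Qed.

Lemma open2_measurable (O : set (C1 R)) : open O ->
  @measurable _ (measurableTypeR R * measurableTypeR R)%type O.
Proof.
move=> oO; rewrite (open_base_cover (prod_baseP ratbase_base ratbase_base) oO).
by apply: bigcup_measurable => n _; case: ifP => // _; exact: base2_measurable.
Qed.

Lemma open3_measurable (O : set (C1 R * R)) : open O ->
  @measurable _ (measurableTypeR R * measurableTypeR R * measurableTypeR R)%type O.
Proof.
move=> oO; have B2 := prod_baseP ratbase_base ratbase_base.
rewrite (open_base_cover (prod_baseP B2 ratbase_base) oO).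
by apply: bigcup_measurable => n _; case: ifP => // _; exact: base3_measurable.
Qed.

Lemma second_countable_base (T : topologicalType) : @second_countable T ->
  exists b : nat -> set T, open_base b.
Proof.
move=> [B cB [oB HB]].
have /countable_injP[f finj] := cB.
pose b n := xget (set0 : set T) [set U | B U /\ f U = n].
have bB U : B U -> b (f U) = U.
  move=> BU; rewrite /b; case: xgetP => [V _ [BV E]|/(_ U)]; last by case.
  by apply: finj; rewrite ?inE.
exists b; split.
  by move=> n; rewrite /b; case: xgetP => [V _ [BV _]|_]; [exact: oB|exact: open0].
move=> p O oO Op; have [U [BU Up] UO] := HB p O (open_nbhs_nbhs (conj oO Op)).
by exists (f U); rewrite bB.
Qed.

End ProductBorel.

Lemma pair_ext (T U : Type) (p q : T * U) : p.1 = q.1 -> p.2 = q.2 -> p = q.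
Proof. by case: p q => [? ?] [? ?] /= -> ->. Qed.

Section TransitionBox.
Context (R : realType) (X : complexSurface R) (Omega : set X) (delta : X -> R).
Hypothesis hbd : Ck_boundary 3 Omega.
Hypothesis hdelta : boundary_distance 3 Omega delta.
Let M := bd Omega.
Variables (c d : fchart X).
Hypotheses (fc : foliated_chart M c) (fd : foliated_chart M d).

Lemma sdiff_segment (z v : C1 R) (t u : R) :
  sdiff (fun u : R => (z + u *: v, t)) u (fun h : R => (h *: v, 0 : R)).
Proof.
split.
- move=> a h k; apply/pair_equal_spec; split; last by rewrite /= scaler0 addr0.
  by rewrite -[a *: h]/(a * h) scalerDl -scalerA.
- exists `|v| => h; rewrite (_ : `|(h *: v, 0)| = `|h *: v|); first by rewrite normrZ mulrC.
  by rewrite prod_normE /= normr0; apply/max_idPl.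
- move=> e e0; exists 1 => // x y _ _.
  rewrite (_ : _ - _ = 0); last first.
    apply: pair_ext => /=; last by rewrite subrr subr0.
    by rewrite scalerBl opprD addrACA subrr add0r subrr.
  by rewrite normr0 mulr_ge0 // ltW.
Qed.

(** The transverse coordinate of a transition has zero derivative along the plaques. *)
Lemma trans_transverse_const (z0 z : C1 R) (t r : R) :
  (forall z', ball z0 r z' -> overlap c d (z', t)) -> ball z0 r z ->
  (ctrans c d (z, t)).2 = (ctrans c d (z0, t)).2.
Proof.
move=> H bz; pose v := z - z0; pose g (u : R) : C1 R * R := (z0 + u *: v, t).
have bg u : u \in `[0, 1] -> ball z0 r (z0 + u *: v).
  rewrite in_itv /= => /andP[u0 u1]; move: bz.
  rewrite -!ball_normE /= opprD addNKr normrN normrZ ger0_norm // => bz.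
  by rewrite (le_lt_trans _ bz) // distrC ler_piMl.
pose phi u := (ctrans c d (g u)).2.
have dphi u : u \in `[0, 1] -> sdiff phi u (fun=> 0).
  move=> /bg bu; have [w [b [s [S _ _ _]]]] := chart_transition hbd hdelta fc fd (H _ bu).
  have := sdiff_comp (sdiff_comp (sdiff_segment z0 v t u) S) (sdiff_snd _).
  by congr sdiff; apply/funext => h /=; rewrite mulr0.
have d1 (u : R) : u \in `]0, 1[%R -> is_derive u (1 : R) phi 0.
  move=> u01; have u01' : u \in `[0, 1].
    by move: u01; rewrite !in_itv /= => /andP[/ltW -> /ltW ->].
  by have [h1 h2] := sdiff_derive (dphi u u01') 1; split.
have cphi : {within `[0, 1], continuous phi}.
  by apply: continuous_in_subspaceT => u u01; apply: sdiff_continuous (dphi u _); rewrite inE in u01.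
have [u _] := MVT (@ltr01 R) d1 cphi.
rewrite mul0r => /eqP; rewrite subr_eq0 => /eqP.
by rewrite /phi /g scale1r scale0r addr0 /v subrKC.
Qed.

(** Strict differentiability of the transition at one point controls all increments in a
small box, in particular those along the plaques and those transverse to them. *)
Lemma transition_box (x0 : C1 R * R) (N : set (C1 R * R)) :
  overlap c d x0 -> nbhs x0 N -> exists (w : C1 R) (s : R),
  [/\ w != 0, s != 0,
    leaf_normal Omega delta c x0 = s * leaf_normal Omega delta d (ctrans c d x0),
    'D_((1, 0) : C1 R) (fun z => fz d (fpar c (z, x0.2))) x0.1 = w &
    forall e : R, 0 < e -> exists2 r : R, 0 < r &
      let tau t := (ctrans c d (x0.1, t)).2 in
      [/\ forall z t, ball x0.1 r z -> ball x0.2 r t ->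
          [/\ N (z, t), overlap c d (z, t) & (ctrans c d (z, t)).2 = tau t],
        forall z z' t, ball x0.1 r z -> ball x0.1 r z' -> ball x0.2 r t ->
          `|(ctrans c d (z, t)).1 - (ctrans c d (z', t)).1 - cmul w (z - z')| <= e * `|z - z'|,
        forall t t', ball x0.2 r t -> ball x0.2 r t' -> tau t = tau t' -> t = t',
        sdiff tau x0.2 (fun h => s * h) &
        forall t, ball x0.2 r t -> exists2 s', s' != 0 & sdiff tau t (fun h => s' * h)]].
Proof.
move=> ox Nx; have [w [b [s [S w0 s0 leafE]]]] := chart_transition hbd hdelta fc fd ox.
have oN : nbhs x0 (overlap c d) by apply: open_nbhs_nbhs; split=> //; exact: overlap_open fc fd.
have norm0 (U V : normedModType R) (v : U) : `|(v, 0 : V)| = `|v|.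
  by rewrite prod_normE /= normr0; apply/max_idPl.
have slice2 z t : sdiff (fun z : C1 R => (z, t) : C1 R * R) z (fun h : C1 R => (h, 0)).
  split.
  - by move=> a h k; apply/pair_equal_spec; split; rewrite //= scaler0 addr0.
  - by exists 1 => h; rewrite mul1r norm0.
  - move=> e e0; exists 1 => // y y' _ _.
    rewrite (_ : _ - _ = 0) ?normr0 ?mulr_ge0 // ?ltW //.
    by apply: pair_ext => /=; rewrite ?subrr ?subr0.
have slice t : sdiff (fun t : R => (x0.1, t) : C1 R * R) t (fun h : R => (0, h)).
  split.
  - by move=> a h k; apply/pair_equal_spec; split; rewrite //= scaler0 addr0.
  - by exists 1 => h; rewrite mul1r prod_normE /= normr0 ge_max normr_ge0 lexx.
  - move=> e e0; exists 1 => // y y' _ _.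
    rewrite (_ : _ - _ = 0) ?normr0 ?mulr_ge0 // ?ltW //.
    by apply: pair_ext => /=; rewrite ?subrr ?subr0.
exists w, s; split => //.
- have S' : sdiff (ctrans c d) (x0.1, x0.2) (fun v => (cmul w v.1 + v.2 *: b, s * v.2)).
    by rewrite -surjective_pairing.
  have [_ ->] := sdiff_derive (sdiff_comp (sdiff_comp (slice2 x0.1 x0.2) S') (sdiff_fst _)) (1, 0).
  rewrite /= scale0r addr0 /cmul /=; case: (w) => p q /=.
  by rewrite !mulr0 !mulr1 subr0 add0r.
move=> e e0.
have [_ _ /(_ (Num.min e (`|s| / 2)))[|r1 r10 Hr1]] := S.
  by rewrite lt_min e0 divr_gt0 // normr_gt0.
have /nbhs_ballP[r2 r20 Hr2] : nbhs x0 (N `&` overlap c d) by exact: filterI.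
have r20' : 0 < r2 by [].
exists (Num.min r1 r2); first by rewrite lt_min r10.
have le1 (T : pseudoMetricType R) (p : T) : ball p (Num.min r1 r2) `<=` ball p r1.
  by apply: le_ball; rewrite ge_min lexx.
have le2 (T : pseudoMetricType R) (p : T) : ball p (Num.min r1 r2) `<=` ball p r2.
  by apply: le_ball; rewrite ge_min lexx orbT.
split.
- move=> z t bz bt; have [Nzt ozt] : (N `&` overlap c d) (z, t) by apply: Hr2; split; exact: le2.
  split=> //; apply: (@trans_transverse_const _ _ _ (Num.min r1 r2)) => // z' bz'.
  by have [] : (N `&` overlap c d) (z', t) by apply: Hr2; split; exact: le2.
- move=> z z' t bz bz' bt.
  have := Hr1 (z, t) (z', t) (conj (le1 _ _ _ bz) (le1 _ _ _ bt)) (conj (le1 _ _ _ bz') (le1 _ _ _ bt)).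
  rewrite (_ : (z, t) - (z', t) = (z - z', 0)); last first.
    by apply: pair_ext => /=; rewrite ?subrr.
  rewrite norm0 /= scale0r addr0 prod_normE ge_max /= => /andP[h _].
  by rewrite (le_trans h) // ler_wpM2r // ge_min lexx.
- move=> t t' bt bt' E; apply/eqP; rewrite -subr_eq0 -normr_le0.
  have c0 : ball x0.1 (Num.min r1 r2) x0.1 by apply: ballxx; rewrite lt_min r10.
  have := Hr1 (x0.1, t) (x0.1, t') (conj (le1 _ _ _ c0) (le1 _ _ _ bt)) (conj (le1 _ _ _ c0) (le1 _ _ _ bt')).
  rewrite (_ : (x0.1, t) - (x0.1, t') = (0, t - t')); last first.
    by apply: pair_ext => /=; rewrite ?subrr.
  have -> : `|(0 : C1 R, t - t')| = `|t - t'|.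
    by rewrite prod_normE /= normr0; apply/max_idPr.
  rewrite prod_normE ge_max /= => /andP[_]; rewrite (E : ft d _ = ft d _) subrr sub0r normrN normrM => h.
  have sp : 0 < `|s| by rewrite normr_gt0.
  have : `|s| * `|t - t'| <= `|s| / 2 * `|t - t'|.
    by rewrite (le_trans h) // ler_wpM2r // ge_min lexx orbT.
  rewrite -mulrA ler_pM2l //; have := normr_ge0 (t - t'); lra.
- have S' : sdiff (ctrans c d) (x0.1, x0.2) (fun v => (cmul w v.1 + v.2 *: b, s * v.2)).
    by rewrite -surjective_pairing.
  exact: (sdiff_comp (sdiff_comp (slice x0.2) S') (sdiff_snd _)).
- move=> t bt; have c0 : ball x0.1 (Num.min r1 r2) x0.1 by apply: ballxx; rewrite lt_min r10.
  have [_ ot] : (N `&` overlap c d) (x0.1, t) by apply: Hr2; split; exact: le2.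
  have [w' [b' [s' [S' _ s'0 _]]]] := chart_transition hbd hdelta fc fd ot.
  exists s' => //.
  exact: (sdiff_comp (sdiff_comp (slice t) S') (sdiff_snd _)).
Qed.

End TransitionBox.

Section IntegralRestriction.
Context d (T : measurableType d) (R : realType) (mu : {measure set T -> \bar R}).
Context (D : set T) (mD : measurable D).
Local Open Scope ereal_scope.
Import HBNNSimple.

(** Replacing a domain by a measure allows an integral over the image of a transition
to be pulled back as a push-forward. *)
Lemma integral_le_mrestr (f : T -> \bar R) : (forall x, 0 <= f x) -> measurable_fun setT f ->
  \int[mu]_(x in D) f x <= \int[mrestr mu mD]_x f x.
Proof.
move=> f0 mf; rewrite !ge0_integralE //.
apply: ge_ereal_sup => _ [h /= hf <-]; apply: ereal_sup_ubound; exists h.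
  by move=> x; apply: (le_trans (hf x)); rewrite patch_setT patchE; case: ifP.
rewrite !sintegralEnnsfun; apply: eq_fsbigr => x; rewrite inE /= => x0; congr (_ * _).
rewrite /mrestr; congr (mu _); apply/seteqP; split => [y []//|y hy]; split=> //.
have := hf y; rewrite patchE (hy : h y = x); case: ifPn => [|_]; first by rewrite inE.
by rewrite lee_fin leNgt x0.
Qed.

End IntegralRestriction.

(** Integrating over the transverse coordinate last is what fits the holonomy. *)
Lemma product_measure12E d1 d2 (T1 : measurableType d1) (T2 : measurableType d2) (R : realType)
    (m1 : {sigma_finite_measure set T1 -> \bar R}) (m2 : {sigma_finite_measure set T2 -> \bar R})
    (A : set (T1 * T2)) : measurable A ->
  (m1 \x m2)%E A = (\int[m2]_t m1 (ysection A t))%E.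
Proof.
move=> mA; transitivity ((m1 \x^ m2)%E A); last by [].
by apply: product_measure_unique => // B C mB mC; exact: product_measure2E.
Qed.

Section ProductComparison.
Context (R : realType) (alpha : {posnum R}).
Local Open Scope ereal_scope.

Local Notation leb2 := (@lebesgue_measure R \x @lebesgue_measure R).
Local Notation Rm := (measurableTypeR R).

Lemma leb2_sigma_finite : sigma_finite [set: Rm * Rm] leb2.
Proof.
pose F (n : nat) : set (C1 R) := square (- n.+1%:R, - n.+1%:R)%R (n.+1%:R + n.+1%:R).
exists F => [|n].
  apply/seteqP; split => // -[x y] _; pose m := maxn (Num.truncn `|x|) (Num.truncn `|y|).
  have bnd (u : R) : (Num.truncn `|u| <= m)%N -> (- m.+1%:R <= u < - m.+1%:R + (m.+1%:R + m.+1%:R))%R.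
    move=> um; have /andP[_ h] := truncn_itv (normr_ge0 u).
    have h' : (`|u| < m.+1%:R)%R by rewrite (lt_le_trans h) // ler_nat.
    by move: h'; rewrite addKr ltr_norml => /andP[/ltW -> ->].
  by exists m => //; split; rewrite /= in_itv /= bnd ?leq_maxl ?leq_maxr.
split; first exact: square_measurable.
by rewrite leb2_square ?ltey // addr_gt0.
Qed.

Definition leb2s : {sigma_finite_measure set (Rm * Rm)%type -> \bar R} :=
  HB.pack leb2 (Measure_isSigmaFinite.Build _ _ _ leb2 leb2_sigma_finite).

Lemma product_ysection (nu : {finite_measure set Rm -> \bar R}) (A : set (Rm * Rm * Rm)) :
  measurable A -> chart_measure nu A = \int[nu]_t leb2 (ysection A t).
Proof. by move=> mA; exact: (product_measure12E leb2s nu mA). Qed.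

Lemma ysection_measurable_fun (A : set (Rm * Rm * Rm)) : measurable A ->
  measurable_fun setT (fun t => leb2 (ysection A t)).
Proof. by move=> mA; exact: (measurable_fun_ysection leb2s mA). Qed.

(** A map of a box which is nearly conformal, with factor [w], on the plaques and
which transforms the transverse measures by at most [C] transforms the product
measures by about [|w|^2 C] at most. *)
Lemma product_compare (nu nu' : {finite_measure set Rm -> \bar R}) (w : C1 R) (e C : R)
    (tau : R -> R) (Z : C1 R * R -> C1 R) (q : C1 R) (l a b : R)
    (A A' : set (Rm * Rm * Rm)) :
  w != 0%R -> (0 <= e)%R -> (0 <= C)%R -> (0 < l)%R ->
  {within `[a, b], continuous tau} -> {in `[a, b]%classic &, injective tau} ->
  (forall B : set Rm, measurable B -> B `<=` `[a, b]%classic -> nu' (tau @` B) <= C%:E * nu B) ->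
  measurable A -> measurable A' ->
  (forall x, A x -> square q l x.1 /\ `[a, b]%classic x.2) ->
  A' = (fun x => (Z x, tau x.2)) @` A ->
  (forall z z' t, A (z, t) -> A (z', t) ->
     `|Z (z, t) - Z (z', t) - cmul w (z - z')| <= e * `|z - z'|)%R ->
  chart_measure nu' A' <=
    ((cnorm2 w * (1 + 2 * `|cinvw w| * e) ^+ 2) * C)%:E * chart_measure nu A.
Proof.
move=> w0 e0 C0 l0 ct it nuC mA mA' Abox AE lip.
have [sg [msg sgK mI]] := segment_inverse ct it.
set I := `[a, b]%classic in nuC Abox sgK mI; set k := (cnorm2 w * _)%R.
have k0 : (0 <= k)%R by rewrite mulr_ge0 ?sqr_ge0 // ltW // cnorm2_gt0.
pose phi t := leb2 (ysection A t).
have phi0 t : 0 <= phi t by exact: measure_ge0.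
have mphi : measurable_fun setT phi by exact: ysection_measurable_fun.
have mphis : measurable_fun setT (phi \o sg) by exact: measurableT_comp.
pose P := pushm (mrestr nu' mI) msg.
have Ple S : measurable S -> P S <= mscale (NngNum C0) nu S.
  move=> mS; rewrite (_ : P S = nu' (sg @^-1` S `&` (tau @` I))) //.
  rewrite (_ : mscale _ _ _ = C%:E * nu S) //.
  have -> : sg @^-1` S `&` (tau @` I) = tau @` (S `&` I).
    apply/seteqP; split => t'.
      by move=> [+ [t It E]]; rewrite -E /= sgK // => St; exists t.
    by move=> [t [St It] <-]; split; [rewrite /= sgK|exists t].
  apply: (@le_trans _ _ (C%:E * nu (S `&` I))).
    by apply: nuC => [|t []//]; apply: measurableI => //; exact: measurable_itv.
  apply: lee_wpmul2l; first by rewrite lee_fin.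
  apply: le_measure; rewrite ?inE; [apply: measurableI => //; exact: measurable_itv|exact: mS|by move=> t []].
have step1 t' : leb2 (ysection A' t') <= k%:E * ((phi \o sg) \_ (tau @` I)) t'.
  rewrite patchE; case: ifPn => [|nI]; last first.
    have -> : ysection A' t' = set0.
      apply/seteqP; split => // z; rewrite /ysection /= inE AE => -[x Ax [_ E]].
      by move/negP: nI; apply; rewrite inE; exists x.2 => //; have [] := Abox x Ax.
    by rewrite measure0 mule0.
  rewrite inE => -[t It <-] /=; rewrite sgK //.
  have E : ysection A' (tau t) = (fun z => Z (z, t)) @` (ysection A t).
    apply/seteqP; split => z; rewrite /ysection /= inE.
      rewrite AE => -[[z' t1] Ax /= [<- E]].
      have [_ /= It'] := Abox _ Ax.
      have tt : t1 = t by apply: it; rewrite ?inE.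
      by rewrite tt in Ax *; exists z' => //; rewrite inE.
    by move=> [z']; rewrite inE => Az' <-; rewrite AE; exists (z', t).
  rewrite E; apply: (@leb2_near_conformal R w e (fun z => Z (z, t)) (ysection A t) q l) => //.
  - by move=> z; rewrite /ysection /= inE => /Abox[].
  - exact: measurable_ysection.
  - rewrite -E; exact: measurable_ysection.
  - by move=> z z'; rewrite /ysection /= !inE; exact: lip.
rewrite !product_ysection // mulrC EFinM.
have mpat : measurable_fun setT ((phi \o sg) \_ (tau @` I)).
  apply/(measurable_restrictT _ mI); exact: measurable_funS mphis.
have pat0 x : 0 <= ((phi \o sg) \_ (tau @` I)) x by rewrite patchE; case: ifP.
apply: (@le_trans _ _ (\int[nu']_t' (k%:E * ((phi \o sg) \_ (tau @` I)) t'))).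
  apply: ge0_le_integral => //; first exact: ysection_measurable_fun.
  exact: measurable_funeM.
rewrite (ge0_integralZl nu' measurableT mpat) //.
rewrite -integral_mkcond [C%:E * _]muleC -muleA.
apply: lee_wpmul2l; first by rewrite lee_fin.
rewrite (le_trans (integral_le_mrestr nu' mI (fun t' => phi0 (sg t')) mphis)) //.
rewrite -(@ge0_integral_pushforward _ _ Rm Rm R sg msg (mrestr nu' mI) setT phi) //.
rewrite (le_trans (@ge0_le_measure_integral _ _ _ P (mscale (NngNum C0) nu) Ple phi setT _ _ _)) //.
rewrite ge0_integral_mscale //= muleC //.
Qed.

End ProductComparison.

Section TransverseMeasure.
Context (R : realType) (alpha : {posnum R}).
Local Open Scope ereal_scope.

(** Cutting off the sets of infinite measure makes finiteness structural. *)
Definition haus_fin (K : set R) : set R :=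
  if hausO alpha K < +oo then K else set0.

Definition hmeas (K : set R) : set (measurableTypeR R) -> \bar R := haus_restr alpha (haus_fin K).

HB.instance Definition _ K := Measure.on (hmeas K).

Lemma hmeas_fin K : fin_num_fun (hmeas K).
Proof.
move=> B mB; rewrite ge0_fin_numE; last exact: ghaus_ge0.
apply: (@le_lt_trans _ _ (hausO alpha (haus_fin K))).
  by apply: (le_outer_measure (hausO alpha)) => x [].
by rewrite /haus_fin; case: ifPn => // _; rewrite [hausO _ _](ghaus0 _ (gt0 alpha)) ltry.
Qed.

HB.instance Definition _ K := Measure_isFinite.Build _ _ _ (hmeas K) (@hmeas_fin K).

Lemma hmeasE K B : hausO alpha K < +oo -> hmeas K B = hausO alpha (K `&` B).
Proof. by move=> Kf; rewrite /hmeas /haus_restr /haus_fin Kf. Qed.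

End TransverseMeasure.

Lemma continuous_measurable3 (R : realType) (D : set (C1 R * R)) (f : C1 R * R -> R) :
  open D -> {in D, continuous f} ->
  measurable_fun (D : set (measurableTypeR R * measurableTypeR R * measurableTypeR R)) (f : _ -> measurableTypeR R).
Proof.
move=> oD cf; apply: (@measurability _ _ _ (measurableTypeR R) _ _ _ (measurable_realfun.RGenOInfty.measurableE R)).
move=> _ [_ [a ->] <-]; apply: open3_measurable.
rewrite openE => x [Dx fx]; rewrite /interior.
have cx : {for x, continuous f} by apply: cf; rewrite inE.
apply: filterI; first by apply: open_nbhs_nbhs; split.
by apply: cx; apply: open_nbhs_nbhs; split; [exact: interval_open|].
Qed.

Lemma continuous_ge_near (R : realType) (T : topologicalType) (f : T -> R) (x : T) (a : R) :
  {for x, continuous f} -> a < f x -> nbhs x [set y | a <= f y].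
Proof.
move=> cf af; have nb : nbhs (f x) [set r | a < r].
  by apply: open_nbhs_nbhs; split; first exact: open_gt.
have H : nbhs x (f @^-1` [set r | a < r]) := cf _ nb.
by apply: filterS H => y /= /ltW.
Qed.

Lemma continuous_le_near (R : realType) (T : topologicalType) (f : T -> R) (x : T) (a : R) :
  {for x, continuous f} -> f x < a -> nbhs x [set y | f y <= a].
Proof.
move=> cf af; have nb : nbhs (f x) [set r | r < a].
  by apply: open_nbhs_nbhs; split; first exact: open_lt.
have H : nbhs x (f @^-1` [set r | r < a]) := cf _ nb.
by apply: filterS H => y /= /ltW.
Qed.

Lemma factor_chain (R : realType) (m' m n' n : \bar R) (p q r k : R) :
  (m' <= p%:E * n' -> n' <= q%:E * n -> r%:E * n <= m -> 0 <= n ->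
  (p * q <= k * r)%R -> (0 <= p)%R -> (0 <= k)%R -> m' <= k%:E * m)%E.
Proof.
move=> h1 h2 h3 n0 h4 p0 k0; apply: (le_trans h1).
have h5 : (p%:E * n' <= p%:E * (q%:E * n))%E by apply: lee_wpmul2l; rewrite ?lee_fin.
apply: (le_trans h5); rewrite muleA -EFinM.
have h6 : ((p * q)%:E * n <= (k * r)%:E * n)%E by apply: lee_wpmul2r; rewrite ?lee_fin.
by apply: (le_trans h6); rewrite EFinM -muleA; apply: lee_wpmul2l; rewrite ?lee_fin.
Qed.

Section ChartMeasure.
Context (R : realType) (X : complexSurface R) (Omega : set X) (delta : X -> R).
Hypothesis hbd : Ck_boundary 3 Omega.
Hypothesis hdelta : boundary_distance 3 Omega delta.
Local Notation M := (bd Omega).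
Context (g : fchart X -> X -> R) (S : set X) (alpha : {posnum R}).
Hypothesis hg : leafwise_metric M g.
Hypothesis hS : saturated M S.
Local Notation Rm := (measurableTypeR R).
Local Notation box c := (fD c `*` fT c).
Local Notation K := (leaf_transversal S).
Implicit Types c d : fchart X.

Definition density c (x : C1 R * R) : R :=
  `|leaf_normal Omega delta c x| `^ alpha%:num * g c (fpar c x).

Definition mchart c (B : set X) : \bar R :=
  (\int[chart_measure (hmeas alpha (K c))]_(x in box c `&` fpar c @^-1` B) (density c x)%:E)%E.

Lemma saturated_chart c p q : foliated_chart M c -> fdom c p -> fdom c q -> ft c p = ft c q ->
  S p -> S q.
Proof.
move=> fc dp dq E Sp; have [_ ->] := hS; exists p => //.
by apply: Relation_Operators.rt_step; exists c.
Qed.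

(** Plaques lie in leaves, so that membership in a saturated set depends on the
transverse coordinate only. *)
Lemma leaf_transversalP c x : foliated_chart M c -> box c x -> K c x.2 <-> S (fpar c x).
Proof.
move=> fc bx; have [dx _ tx] := foliated_chart_par fc bx; split=> [[p [Sp dp] E]|Sx].
  by apply: (saturated_chart fc dp dx) => //; rewrite tx.
by exists (fpar c x).
Qed.

Lemma fpar_measurable c (B : set (borel X)) : foliated_chart M c -> measurable B ->
  @measurable _ (Rm * Rm * Rm)%type (box c `&` fpar c @^-1` B).
Proof.
move=> fc mB; have mbox : @measurable _ (Rm * Rm * Rm)%type (box c).
  by apply: open3_measurable; exact: foliated_box_open fc.
have mf : measurable_fun (box c : set (Rm * Rm * Rm)) (fpar c : _ -> borel X).
  apply: (@measurability _ _ _ (borel X) _ _ (@open X) erefl).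
  move=> _ [U oU <-]; apply: open3_measurable; exact: foliated_preimage_open fc oU.
exact: mf.
Qed.

Lemma metric_cont c x : foliated_chart M c -> box c x ->
  {for x, continuous (fun x => g c (fpar c x))}.
Proof.
move=> fc bx; have [dx _ _] := foliated_chart_par fc bx.
have [cg _] := hg.1 c fc.
move=> U nU; have H : within (fdom c) (nbhs (fpar c x)) (g c @^-1` U).
  by rewrite (nbhs_subspace_in dx); exact: cg nU.
have H' := foliated_par_cont fc bx H.
have nb : nbhs x (box c) by apply: open_nbhs_nbhs; split=> //; exact: foliated_box_open fc.
apply: filterS2 nb H' => y yb /(_ _); apply.
by have [] := foliated_chart_par fc yb.
Qed.

Lemma metric_gt0 c x : foliated_chart M c -> box c x -> 0 < g c (fpar c x).
Proof.
move=> fc bx; have [_] := hg.1 c fc; apply.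
by have [] := foliated_chart_par fc bx.
Qed.

Lemma leaf_normal_cont c x : foliated_chart M c -> box c x ->
  {for x, continuous (leaf_normal Omega delta c)}.
Proof.
by move=> fc bx; have [+ _] := Ck_leaf_normal hbd hdelta fc; apply; rewrite inE.
Qed.

(** The sign of the normal derivative is locally constant, so that the power of its
absolute value is smooth. *)
Lemma abs_power_Ck c (A : set (C1 R * R)) (sg : R) : foliated_chart M c -> open A ->
  A `<=` box c -> sg ^+ 2 = 1 -> (forall x, A x -> 0 < sg * leaf_normal Omega delta c x) ->
  Ck 2 A (fun x => `|leaf_normal Omega delta c x| `^ alpha%:num).
Proof.
move=> fc oA Ab s1 pos.
have CN : Ck 2 A (leaf_normal Omega delta c) := Ck_sub Ab (Ck_leaf_normal hbd hdelta fc).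
have CM := CkM oA (Ck_cst 2 A sg) CN.
apply: (Ck_ext oA) (Ck_powR alpha%:num oA pos CM) => x Ax; congr (_ `^ _).
by rewrite -(gtr0_norm (pos x Ax)) normrM -[`|sg|]sqrtr_sqr s1 sqrtr1 mul1r.
Qed.

Lemma abs_power_Ck_box c : foliated_chart M c ->
  Ck 2 (box c) (fun x => `|leaf_normal Omega delta c x| `^ alpha%:num).
Proof.
move=> fc; apply: Ck_local => x bx; have n0 := leaf_normal_neq0 hbd hdelta fc bx.
pose sg := Num.sg (leaf_normal Omega delta c x).
pose A := box c `&` [set y | 0 < sg * leaf_normal Omega delta c y].
have oA : open A.
  rewrite openE => y [yb ys]; rewrite /interior.
  have cy : {for y, continuous (fun y => sg * leaf_normal Omega delta c y)}.
    by apply: cvgM; [exact: cvg_cst|exact: leaf_normal_cont].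
  apply: filterI; first by apply: open_nbhs_nbhs; split=> //; exact: foliated_box_open fc.
  by apply: (cy [set r | 0 < r]); apply: open_nbhs_nbhs; split; [exact: open_gt|].
exists A; first by split=> //; split=> //=; rewrite /sg -normrEsg normr_gt0.
apply: (@abs_power_Ck c A sg) => //; first by move=> y [].
  by rewrite /sg sqr_sg n0.
by move=> y [].
Qed.

Lemma density_cont c x : foliated_chart M c -> box c x -> {for x, continuous (density c)}.
Proof.
move=> fc bx; have [cp _] := abs_power_Ck_box fc.
by apply: cvgM; [apply: cp; rewrite inE|exact: metric_cont].
Qed.

Lemma density_gt0 c x : foliated_chart M c -> box c x -> 0 < density c x.
Proof.
move=> fc bx; rewrite mulr_gt0 ?metric_gt0 // powR_gt0 // normr_gt0.
exact: leaf_normal_neq0 bx.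
Qed.

Lemma density_measurable c : foliated_chart M c ->
  measurable_fun (box c : set (Rm * Rm * Rm)) (EFin \o density c).
Proof.
move=> fc; apply/measurable_EFinP; apply: continuous_measurable3.
  exact: foliated_box_open fc.
by move=> x; rewrite inE => bx; exact: density_cont.
Qed.

(** The two factors of the density compensate the distortion of the measures: the
metric changes by [|w|^2] and the normal derivative by [s]. *)
Lemma density_transition c d x w s : foliated_chart M c -> foliated_chart M d ->
  overlap c d x ->
  leaf_normal Omega delta c x = s * leaf_normal Omega delta d (ctrans c d x) ->
  'D_((1, 0) : C1 R) (fun z => fz d (fpar c (z, x.2))) x.1 = w ->
  density c x = `|s| `^ alpha%:num * cnorm2 w * density d (ctrans c d x).
Proof.
move=> fc fd ox Nx Dw; have [bd' pd'] := ctransK fd ox.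
have [bx dd] := ox; have [dc zc tc] := foliated_chart_par fc bx.
rewrite /density Nx normrM powRM // pd' (hg.2 c d fc fd _ dc dd).
rewrite /sqnorm_dz zc tc Dw /cnorm2; ring.
Qed.

Lemma mchart_bigcup c (F : nat -> set (borel X)) : foliated_chart M c ->
  (forall n, measurable (F n)) -> trivIset setT F ->
  mchart c (\bigcup_n F n) = (\sum_(0 <= n <oo) mchart c (F n))%E.
Proof.
move=> fc mF tF; rewrite /mchart preimage_bigcup setI_bigcupr.
apply: ge0_integral_bigcup.
- by move=> n; exact: fpar_measurable.
- apply: measurable_funS (density_measurable fc).
    by apply: open3_measurable; exact: foliated_box_open fc.
  by move=> x [n _ []].
- by move=> x [n _ [bx _]]; rewrite lee_fin ltW // density_gt0.
- move=> i j _ _ [x [[_ xi] [_ xj]]]; apply: tF => //; by exists (fpar c x).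
Qed.

Lemma mchart_ge0 c B : foliated_chart M c -> (0 <= mchart c B)%E.
Proof.
by move=> fc; apply: integral_ge0 => x [bx _]; rewrite lee_fin ltW // density_gt0.
Qed.

Lemma mchart0 c : mchart c set0 = 0%E.
Proof. by rewrite /mchart preimage_set0 setI0 integral_set0. Qed.

Lemma overlap_coord c d p : foliated_chart M c -> fdom c p -> fdom d p ->
  overlap c d (fz c p, ft c p).
Proof.
move=> fc dc dd; have [h1 h2 h3] := foliated_chart_dom fc dc.
by split; [|rewrite /= h3].
Qed.

Lemma small_factor (w : C1 R) (l : R) : 1 < l ->
  exists2 e : R, 0 < e & (1 + 2 * `|cinvw w| * e) ^+ 2 <= l.
Proof.
move=> l1; have [m m1 mm] := sqrt_factor ltr01 l1.
rewrite powRr1 ?mulr_ge0 ?(ltW (lt_trans ltr01 m1)) // in mm.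
have d0 : 0 < 2 * `|cinvw w| + 1 by rewrite ltr_wpDl // mulr_ge0.
exists ((m - 1) / (2 * `|cinvw w| + 1)); first by rewrite divr_gt0 // subr_gt0.
rewrite -mm -expr2 lerXn2r ?nnegrE //.
- by rewrite addr_ge0 // !mulr_ge0 // ?invr_ge0 ?subr_ge0 ltW.
- by rewrite ltW // (lt_trans ltr01).
rewrite -lerBrDl mulrCA ger_pMr ?subr_gt0 // ler_pdivrMr // mul1r lerDl //.
Qed.

(** Near a common point, the measures defined by two charts agree up to a factor
close to one: the distortion of the plaques, the distortion of the transversals
and the ratio of the densities compensate. *)
Lemma mchart_local c d p (k : R) : foliated_chart M c -> foliated_chart M d ->
  (hausO alpha (K c) < +oo)%E -> (hausO alpha (K d) < +oo)%E ->
  fdom c p -> fdom d p -> 1 < k ->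
  exists U : set X, open_nbhs p U /\ forall B : set (borel X), measurable B ->
    B `<=` fdom c `&` fdom d -> B `<=` U -> (mchart d B <= k%:E * mchart c B)%E.
Proof.
move=> fc fd hc hd dc dd k1.
pose x0 := (fz c p, ft c p); have ox : overlap c d x0 by exact: overlap_coord.
have [b0 _] := ox; have [b0' pd0] := ctransK fd ox; set y0 := ctrans c d x0 in b0' pd0.
have a0 : 0 < 3 + alpha%:num by rewrite addr_gt0.
have [l l1 ll] := sqrt_factor a0 k1; have l0 := lt_trans ltr01 l1.
have c0 := density_gt0 fc b0; have d0 := density_gt0 fd b0'.
pose N := [set x | density c x0 / l <= density c x /\
  density d (ctrans c d x) <= l * density d y0].
have nN : nbhs x0 N.
  have cc := density_cont fc b0.
  have cd : {for x0, continuous (density d \o ctrans c d)}.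
    by apply: continuous_comp; [exact: ctrans_cont fc fd ox|exact: density_cont].
  apply: filterI.
    by apply: (continuous_ge_near cc); rewrite ltr_pdivrMr // ltr_pMr.
  by apply: (continuous_le_near cd); rewrite /= ltr_pMl.
have [w [s [w0 s0 Nx Dw H]]] := transition_box hbd hdelta fc fd ox nN.
have dens := density_transition fc fd ox Nx Dw.
have [e e0 eE] := small_factor w l1.
have [r r0 [Hbox Hlip tinj St0 Sts]] := H e e0.
set tau := fun t => (ctrans c d (x0.1, t)).2 in Hbox Hlip tinj St0 Sts.
pose sl t := derive1 tau t.
have dsl t : ball x0.2 r t -> sl t != 0 /\ sdiff tau t (fun h => sl t * h).
  move=> /Sts[s' s'0 Ss']; have [_ D1] := sdiff_derive Ss' 1.
  have E : sl t = s' by rewrite /sl derive1E D1 mulr1.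
  by rewrite E.
have slx : sl x0.2 = s.
  by have [_ D1] := sdiff_derive St0 1; rewrite /sl derive1E D1 mulr1.
have bc := ballxx x0.1 r0; have bt0 := ballxx x0.2 r0.
have KK t : ball x0.2 r t -> K c t <-> K d (tau t).
  move=> bt; have [_ ot _] := Hbox x0.1 t bc bt; have [bt' _] := ot.
  have [bd' pd'] := ctransK fd ot.
  have h1 := leaf_transversalP fc bt'; have h2 := leaf_transversalP fd bd'.
  by rewrite pd' in h2; split => [/h1/h2//|/h2/h1].
have tinj' : {in (ball x0.2 r : set R) &, injective tau}.
  by move=> t t'; rewrite !inE; exact: tinj.
have [r' r'0 [r'G Hr']] := haus_local alpha (ball_open x0.2 r) tinj' dsl KK l1 bt0.
rewrite slx in Hr'.
pose rho := Num.min r r' / 2.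
have m0 : 0 < Num.min r r' by rewrite lt_min r0.
have rho0 : 0 < rho by rewrite divr_gt0.
have rhom : rho < Num.min r r' by rewrite ltr_pdivrMr // ltr_pMr // ltr1n.
have rr : rho < r by rewrite (lt_le_trans rhom) // ge_min lexx.
have rr' : rho < r' by rewrite (lt_le_trans rhom) // ge_min lexx orbT.
pose a := x0.2 - rho; pose b := x0.2 + rho.
have Iball t r1 : rho < r1 -> `[a, b]%classic t -> ball x0.2 r1 t.
  move=> r1r; rewrite /= in_itv /= => /andP[h1 h2]; rewrite -ball_normE /= ltr_distlC.
  by rewrite (lt_le_trans _ h1) ?(le_lt_trans h2) // /a /b ?ltrD2l // ltrN2.
have nV : nbhs (fz c p, ft c p) (ball x0.1 rho `*` ball x0.2 rho).
  by exists (ball x0.1 rho, ball x0.2 rho) => //; split; exact: nbhsx_ballx.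
have : nbhs p [set q | M q -> fdom c q /\ (ball x0.1 rho `*` ball x0.2 rho) (fz c q, ft c q)].
  exact: foliated_coord_near fc dc nV.
rewrite nbhsE => -[U oU HU].
exists U; split=> // B mB Bcd BU.
pose A := box c `&` fpar c @^-1` B; pose A' := box d `&` fpar d @^-1` B.
have AV x : A x -> ball x0.1 rho x.1 /\ ball x0.2 rho x.2.
  move=> [bx Bx]; have [dx zx tx] := foliated_chart_par fc bx.
  by have [] := HU _ (BU _ Bx) (foliated_chart_sub fc dx); rewrite zx tx.
have leb (T : pseudoMetricType R) (q : T) : ball q rho `<=` ball q r.
  by apply: le_ball; exact: ltW.
have AN x : A x -> [/\ N x, overlap c d x & (ctrans c d x).2 = tau x.2].
  case: x => z t Ax; have [/= bz bt] := AV _ Ax; exact: (Hbox z t (leb _ _ _ bz) (leb _ _ _ bt)).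
have AE : A' = (fun x => ((ctrans c d x).1, tau x.2)) @` A.
  apply/seteqP; split => y.
    move=> [by' By]; have [dy zy ty] := foliated_chart_par fd by'.
    have [cq _] := Bcd _ By; have [h1 h2 h3] := foliated_chart_dom fc cq.
    pose x := (fz c (fpar d y), ft c (fpar d y)).
    have Ax : A x by split; [|rewrite /= /x h3].
    have [_ _ E2] := AN x Ax; exists x => //; rewrite -E2 /ctrans /x h3 zy ty.
    by case: (y).
  move=> [x Ax <-]; have [_ ox' <-] := AN x Ax; have [h1 h2] := ctransK fd ox'.
  by rewrite -surjective_pairing; split=> //=; rewrite h2; case: Ax.
have mA : @measurable _ (Rm * Rm * Rm)%type A by exact: fpar_measurable.
have mA' : @measurable _ (Rm * Rm * Rm)%type A' by exact: fpar_measurable.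
pose C := (l * `|s|) `^ alpha%:num.
have C0 : 0 <= C by exact: powR_ge0.
have ct : {within `[a, b], continuous tau}.
  apply: continuous_in_subspaceT => t; rewrite inE => /(Iball t r rr)/dsl[_]; exact: sdiff_continuous.
have tI : {in `[a, b]%classic &, injective tau}.
  by move=> t t'; rewrite !inE => /(Iball t r rr) h1 /(Iball t' r rr) h2; exact: tinj.
have nuC (D : set Rm) : measurable D -> D `<=` `[a, b]%classic ->
    (hmeas alpha (K d) (tau @` D) <= C%:E * hmeas alpha (K c) D)%E.
  move=> mD DI; rewrite !hmeasE //.
  by have [] := Hr' D _ => // t /DI; exact: Iball.
have r20 : 0 < rho + rho by rewrite addr_gt0.
have Abox x : A x -> square (x0.1.1 - rho, x0.1.2 - rho) (rho + rho) x.1 /\ `[a, b]%classic x.2.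
  move=> /AV[]; case: x => [[z1 z2] t] /=; rewrite -!ball_normE /= normC1 gt_max /= !ltr_distlC.
  move=> /andP[/andP[h1 h2] /andP[h3 h4]] /andP[h5 h6].
  rewrite /square /= !in_itv /=; split; last by rewrite !ltW.
  by rewrite !(ltW h1) !(ltW h3) !addrA !subrK h2 h4.
have lip z z' t : A (z, t) -> A (z', t) ->
   `|(ctrans c d (z, t)).1 - (ctrans c d (z', t)).1 - cmul w (z - z')| <= e * `|z - z'|.
  move=> /AV[/= b1 b2] /AV[/= b3 _]; apply: Hlip; exact: leb.
have cmp := @product_compare R (hmeas alpha (K c)) (hmeas alpha (K d)) w e C tau
  (fun x => (ctrans c d x).1) _ _ a b A A' w0 (ltW e0) C0 r20 ct tI nuC mA mA' Abox AE lip.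
set mc := chart_measure (hmeas alpha (K c)) A in cmp.
have mc0 : (0 <= mc)%E by exact: measure_ge0.
have up : (mchart d B <= (l * density d y0)%:E * chart_measure (hmeas alpha (K d)) A')%E.
  rewrite -integral_cst //; apply: ge0_le_integral => //.
  - by move=> x [bx _]; rewrite lee_fin ltW // density_gt0.
  - apply: measurable_funS (density_measurable fd); last by move=> x [].
    by apply: open3_measurable; exact: foliated_box_open fd.
  - move=> y; rewrite -/A' AE => -[x Ax <-]; have [[_ h] _ <-] := AN x Ax.
    by rewrite lee_fin -surjective_pairing.
have lo : ((density c x0 / l)%:E * mc <= mchart c B)%E.
  rewrite -integral_cst //; apply: ge0_le_integral => //.
  - by move=> x _; rewrite lee_fin divr_ge0 // ltW.
  - apply: measurable_funS (density_measurable fc); last by move=> x [].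
    by apply: open3_measurable; exact: foliated_box_open fc.
  - by move=> x Ax; have [[h _] _ _] := AN x Ax; rewrite lee_fin.
have k0 := lt_trans ltr01 k1.
apply: (factor_chain up cmp lo mc0 _ _ (ltW k0)); last by rewrite mulr_ge0 // ltW.
rewrite dens -/y0.
have n0 := cnorm2_gt0 w0; have sp : 0 < `|s| `^ alpha%:num by rewrite powR_gt0 // normr_gt0.
have lp : 0 < l `^ alpha%:num by rewrite powR_gt0.
have kl : l ^+ 3 * l `^ alpha%:num <= k.
  rewrite -ll -powR_mulrn ?(ltW l0) // -powRD; last by rewrite (gt_eqF l0) implybT.
  apply: ge0_ler_powR; rewrite ?nnegrE ?mulr_ge0 ?(ltW l0) ?(ltW a0) //.
  by rewrite ler_pMr // ltW.
rewrite /C powRM ?(ltW l0) //.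
set P := `|s| `^ alpha%:num in sp *; set Q := l `^ alpha%:num in lp kl *; set D := density d y0 in d0 *.
set f := (1 + _) ^+ 2 in eE *; set n := cnorm2 w in n0 *.
apply: (@le_trans _ _ (l ^+ 3 * Q * (P * n * D / l))); last first.
  have pos : 0 <= P * n * D / l.
    by apply/ltW; apply: divr_gt0 => //; apply: mulr_gt0 => //; apply: mulr_gt0.
  exact: ler_wpM2r pos _ _ kl.
have -> : l ^+ 3 * Q * (P * n * D / l) = (D * n * Q * P * l) * l by field; rewrite gt_eqF.
have -> : l * D * (n * f * (Q * P)) = (D * n * Q * P * l) * f by ring.
have pos : 0 <= D * n * Q * P * l.
  by apply/ltW; do 4 (apply: mulr_gt0 => //).
exact: ler_wpM2l pos _ _ eE.
Qed.

Lemma mchart_le c d (B : set (borel X)) : foliated_chart M c -> foliated_chart M d ->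
  (hausO alpha (K c) < +oo)%E -> (hausO alpha (K d) < +oo)%E ->
  measurable B -> B `<=` fdom c `&` fdom d -> (mchart d B <= mchart c B)%E.
Proof.
move=> fc fd hc hd mB Bcd; have [b [ob Hb]] := second_countable_base (@csurf_second_countable R X).
apply: (@le_of_local _ (borel X) R (mchart d) (mchart c) (fdom c `&` fdom d) b) => //.
- by move=> n; apply: sub_sigma_algebra; exact: ob.
- exact: mchart0.
- by move=> C; exact: mchart_ge0.
- by move=> C; exact: mchart_ge0.
- by move=> F mF tF _; rewrite mchart_bigcup.
- by move=> F mF tF _; rewrite mchart_bigcup.
- move=> k k1 p [pc pd']; have [U [[oU Up] HU]] := mchart_local fc fd hc hd pc pd' k1.
  have [n bn bU] := Hb p U oU Up; exists n; split=> // C mC CY Cb.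
  by apply: HU => // q /Cb/bU.
Qed.

Lemma mchart_eq c d (B : set (borel X)) : foliated_chart M c -> foliated_chart M d ->
  (hausO alpha (K c) < +oo)%E -> (hausO alpha (K d) < +oo)%E ->
  measurable B -> B `<=` fdom c `&` fdom d -> mchart c B = mchart d B.
Proof.
move=> fc fd hc hd mB Bcd; apply/eqP; rewrite eq_le; apply/andP; split.
  by apply: mchart_le => //; rewrite setIC.
exact: mchart_le.
Qed.

End ChartMeasure.

(** * Conformality of the transverse measures and gluing *)

Section TransverseConformal.
Context (R : realType) (X : complexSurface R) (Omega : set X) (delta : X -> R).
Hypothesis hbd : Ck_boundary 3 Omega.
Hypothesis hdelta : boundary_distance 3 Omega delta.
Local Notation M := (bd Omega).
Context (S : set X) (alpha : {posnum R}).
Hypothesis hS : saturated M S.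
Local Notation K := (leaf_transversal S).

Lemma hmeas_outside (A : set R) : hmeas alpha A (~` A) = 0%E.
Proof.
rewrite /hmeas /haus_restr (_ : _ `&` _ = set0); first exact: outer_measure0.
by apply/seteqP; split => // t []; rewrite /haus_fin; case: ifP => // _ At; apply.
Qed.

(** On the set where the holonomy is defined it is locally the second component of a
transition, hence strictly differentiable with nonzero slope, and it maps the
transversals to each other by saturation. *)
Lemma hmeas_conformal (c d : fchart X) (O : set X) (tau : R -> R) :
  foliated_chart M c -> foliated_chart M d ->
  (hausO alpha (K c) < +oo)%E -> (hausO alpha (K d) < +oo)%E ->
  let W := M `&` O in open O -> W `<=` fdom c `&` fdom d ->
  (forall p, W p -> ft d p = tau (ft c p)) -> {in ft c @` W &, injective tau} ->
  forall B : set (measurableTypeR R), measurable B -> B `<=` ft c @` W ->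
   hmeas alpha (K d) (tau @` B) =
   (\int[hmeas alpha (K c)]_(s in B) (`|derive1 tau s| `^ alpha%:num)%:E)%E.
Proof.
move=> fc fd hc hd W oO Wcd Wtau tinj B mB BG.
have near_t t : (ft c @` W) t -> exists r s, [/\ 0 < r, s != 0,
    ball t r `<=` ft c @` W & sdiff tau t (fun h => s * h)].
  move=> [p Wp <-]; have [dc dd] := Wcd p Wp; have [h1 h2 h3] := foliated_chart_dom fc dc.
  pose x0 := (fz c p, ft c p); have ox : overlap c d x0 by exact: (overlap_coord fc dc dd).
  have nN : nbhs x0 (fD c `*` fT c `&` fpar c @^-1` O).
    apply: open_nbhs_nbhs; split; first exact: foliated_preimage_open fc oO.
    by split; [split|rewrite /= h3; case: Wp].
  have [w [s [w0 s0 _ _ H]]] := transition_box hbd hdelta fc fd ox nN.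
  have [r r0 [Hbox _ _ St _]] := H 1 ltr01.
  have key u : ball x0.2 r u -> W (fpar c (x0.1, u)) /\ ft c (fpar c (x0.1, u)) = u.
    move=> bt; have [[bx Ox] _ _] := Hbox x0.1 u (ballxx _ r0) bt.
    have [dx _ tx] := foliated_chart_par fc bx.
    split; [split; [exact: (foliated_chart_sub fc dx)|exact: Ox]|exact: tx].
  exists r, s; split=> // [u /key[Wx tx]|]; first by exists (fpar c (x0.1, u)).
  apply: sdiff_near St; apply/nbhs_ballP; exists r => // u /key[Wx tx] /=.
  by rewrite Wtau // tx.
pose G : set R := ft c @` W.
have oG : open G.
  rewrite openE => t /near_t[r [s [r0 _ rG _]]]; rewrite /interior.
  by apply/nbhs_ballP; exists r.
have dt t : G t -> derive1 tau t != 0 /\ sdiff tau t (fun h => derive1 tau t * h).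
  move=> /near_t[r [s [r0 s0 _ St]]]; have [_ D1] := sdiff_derive St 1.
  have E : derive1 tau t = s by rewrite derive1E D1 mulr1.
  by rewrite E.
have KK t : G t -> K c t <-> K d (tau t).
  move=> [p Wp <-]; have [dc dd] := Wcd p Wp; rewrite -Wtau //.
  have [h1 h2 h3] := foliated_chart_dom fc dc; have [k1 k2 k3] := foliated_chart_dom fd dd.
  have e1 := @leaf_transversalP _ _ Omega S hS c (fz c p, ft c p) fc (conj h1 h2).
  have e2 := @leaf_transversalP _ _ Omega S hS d (fz d p, ft d p) fd (conj k1 k2).
  rewrite h3 in e1; rewrite k3 in e2.
  by split => [/e1/e2//|/e2/e1].
rewrite hmeasE // (haus_change alpha oG tinj dt KK mB BG).
by rewrite /hmeas /haus_fin hc.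
Qed.

End TransverseConformal.

Section Gluing.
Context (R : realType) (X : complexSurface R) (Omega : set X) (delta : X -> R).
Hypothesis hbd : Ck_boundary 3 Omega.
Hypothesis hdelta : boundary_distance 3 Omega delta.
Local Notation M := (bd Omega).
Context (g : fchart X -> X -> R) (S : set X) (alpha : {posnum R}).
Hypothesis hg : leafwise_metric M g.
Hypothesis hS : saturated M S.
Local Notation K := (leaf_transversal S).
Local Notation mch := (mchart Omega delta g S alpha).
Local Open Scope ereal_scope.

Section OneChart.
Variables (c : fchart X) (fc : foliated_chart M c).

Let mch_ge0 B : 0 <= mch c B. Proof. exact: mchart_ge0. Qed.

Let mch_sigma : semi_sigma_additive (mch c : set (borel X) -> \bar R).
Proof.
move=> F mF tF mU; rewrite (mchart_bigcup hbd hdelta S alpha hg fc mF tF).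
by apply: is_cvg_nneseries => n _ _; exact: mch_ge0.
Qed.

Definition mchart_measure : {measure set (borel X) -> \bar R} :=
  HB.pack (mch c : set (borel X) -> \bar R)
    (isMeasure.Build _ _ _ (mch c : set (borel X) -> \bar R) (mchart0 _ _ _ _ _ _) mch_ge0 mch_sigma).

End OneChart.

Lemma bd_closed (A : set X) : closed (bd A).
Proof.
rewrite /bd setDE; apply: closedI; first exact: closed_closure.
by apply: open_closedC; exact: open_interior.
Qed.

Lemma fdom_measurable c : foliated_chart M c -> @measurable _ (borel X) (fdom c).
Proof.
move=> [[U oU ->] _ _ _ _]; apply: measurableI; last exact: sub_sigma_algebra.
rewrite -[M]setCK; apply: measurableC; apply: sub_sigma_algebra.
by apply: closed_openC; exact: bd_closed.
Qed.

Variables (n : nat) (c : nat -> fchart X).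
Hypothesis fc : forall j, foliated_chart M (c j).
Hypothesis hc : forall j, hausO alpha (K (c j)) < +oo.

Let P := seqDU (fun j => fdom (c j)).

Lemma piece_measurable j : @measurable _ (borel X) (P j).
Proof. by apply: seqDU_measurable => k; exact: fdom_measurable. Qed.

Definition glued : {measure set (borel X) -> \bar R} :=
  [the {measure set (borel X) -> \bar R} of
    msum (fun j => mrestr (mchart_measure (fc j)) (piece_measurable j)) n].

(** Because the chart measures agree on the overlaps, the way in which the union of
the charts is cut into disjoint pieces does not matter. *)
Lemma glued_chart i (B : set (borel X)) : (i < n)%N -> measurable B -> B `<=` fdom (c i) ->
  glued B = mch (c i) B.
Proof.
move=> ni mB Bi.
have gE : glued B = \sum_(j < n) mch (c j) (B `&` P j) by [].
have -> : glued B = \sum_(j < n) mchart_measure (fc i) (B `&` P j).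
  rewrite gE; apply: eq_bigr => j _.
  apply: (mchart_eq hbd hdelta hg hS) => //; first by apply: measurableI => //; exact: piece_measurable.
  move=> p [Bp Pp]; split; last exact: Bi.
  exact: (subset_seqDU Pp).
rewrite -measure_semi_additive_ord //.
- congr (mch (c i)); rewrite -(bigcup_mkord n (fun j => B `&` P j)) -setI_bigcupr; apply/setIidl.
  move=> p /Bi dp; have : (\bigcup_(j < n) fdom (c j)) p by exists i.
  by rewrite (bigcup_mkord n P) (bigcup_mkord n (fun j => fdom (c j))) (bigsetU_seqDU (fun j => fdom (c j))).
- by move=> j; apply: measurableI => //; exact: piece_measurable.
- apply/trivIsetP => j k _ _ jk; rewrite setIACA setIid.
  by have /trivIsetP/(_ j k I I jk) := @trivIset_seqDU _ (fun j => fdom (c j)); rewrite -/P => ->; rewrite setI0.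
- by apply: bigsetU_measurable => j _; apply: measurableI => //; exact: piece_measurable.
Qed.

End Gluing.

(** * The harmonic density *)

Section Slice.
Context (R : realType).

Lemma slice_continuous (W : normedModType R) (F : C1 R * R -> W) (z : C1 R) (t : R) :
  {for (z, t), continuous F} -> {for z, continuous (fun z => F (z, t))}.
Proof.
move=> cF; apply: (@continuous_comp _ _ _ (fun z : C1 R => (z, t)) F) => //.
move=> N [[P Q] /= [Pz Qt] PQ]; apply: filterS Pz => y Py.
by apply: PQ; split=> //=; exact: nbhs_singleton Qt.
Qed.

Lemma slice_quotient (W : normedModType R) (F : C1 R * R -> W) (v z : C1 R) (t : R) :
  (fun h : R => h^-1 *: (((fun z => F (z, t)) \o shift z) (h *: v) - F (z, t))) =
  (fun h : R => h^-1 *: ((F \o shift (z, t)) (h *: (v, 0)) - F (z, t))).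
Proof.
apply/funext => h /=; congr (_ *: (F _ - _)).
by apply: pair_ext => //=; rewrite scaler0 add0r.
Qed.

Lemma slice_derivable (W : normedModType R) (F : C1 R * R -> W) (v z : C1 R) (t : R) :
  derivable F (z, t) (v, 0) -> derivable (fun z => F (z, t)) z v.
Proof. by rewrite /derivable slice_quotient. Qed.

Lemma slice_derive (W : normedModType R) (F : C1 R * R -> W) (v z : C1 R) (t : R) :
  'D_v (fun z => F (z, t)) z = 'D_(v, 0) F (z, t).
Proof. by rewrite /derive slice_quotient. Qed.

Lemma Ck_slice (W : normedModType R) k (D : set (C1 R)) (T : set R) (F : C1 R * R -> W) (t : R) :
  T t -> Ck k (D `*` T) F -> Ck k D (fun z => F (z, t)).
Proof.
move=> Tt; elim: k F => [|k IH] F [cF dF]; split => //.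
- by move=> z; rewrite inE => Dz; apply: slice_continuous; apply: cF; rewrite inE.
- by move=> z; rewrite inE => Dz; apply: slice_continuous; apply: cF; rewrite inE.
- move=> v; have [dv ck] := dF (v, 0); split=> [z Dz|].
    by apply: slice_derivable; exact: dv.
  have -> : 'D_v (fun z => F (z, t)) = (fun z => 'D_(v, 0) F (z, t)).
    by apply/funext => z; exact: slice_derive.
  exact: (IH ('D_(v, 0) F) ck).
Qed.

Lemma pd_slice (F : C1 R * R -> R) (v z : C1 R) (t : R) :
  pd (fun z => F (z, t)) v z = pd F (v, 0) (z, t).
Proof. by rewrite -!pdE; exact: (@slice_derive R^o). Qed.

Lemma pd_slice_fun (F : C1 R * R -> R) (v : C1 R) (t : R) :
  pd (fun z => F (z, t)) v = fun z => pd F (v, 0) (z, t).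
Proof. by apply/funext => z; exact: pd_slice. Qed.

Lemma pd_scale (V : normedModType R) (A : set V) (f : V -> R) (k : R) (v z : V) :
  Ck 1 A f -> A z -> pd (fun y => k * f y) v z = k * pd f v z.
Proof.
by move=> cf Az; rewrite -!pdE; apply: deriveZ; have [_ /(_ v)[dw _]] := cf; exact: dw.
Qed.

Lemma pd2_scale (V : normedModType R) (A : set V) (f : V -> R) (k : R) (v z : V) : open A ->
  Ck 2 A f -> A z -> pd (pd (fun y => k * f y) v) v z = k * pd (pd f v) v z.
Proof.
move=> oA cf Az; rewrite -(pd_scale k v (Ck_pd v cf) Az); apply: pd_near.
by apply: filterS (open_nbhs_nbhs (conj oA Az)) => y Ay; exact: (pd_scale _ _ (CkS cf)).
Qed.

(** If the Laplacian of a positive function [f] is [(1 - a) |grad f|^2 / f], then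
[f^a] is harmonic. *)
Lemma harmonic_power (D : set (C1 R)) (f u : C1 R -> R) (a : R) (z : C1 R) : open D ->
  Ck 2 D f -> (forall y, D y -> 0 < f y) -> (forall y, D y -> u y = f y `^ a) -> D z ->
  pd (pd f (1, 0)) (1, 0) z + pd (pd f (0, 1)) (0, 1) z =
    (1 - a) * (pd f (1, 0) z ^+ 2 + pd f (0, 1) z ^+ 2) / f z ->
  ddbar (@J1 R) (1, 0) (1, 0) u z = 0.
Proof.
move=> oD cf f0 uE Dz lap.
have cu : Ck 2 D u.
  by apply: (Ck_ext oD) (Ck_powR a oD f0 cf) => y Dy; rewrite uE.
have J : @J1 R (1, 0) = (0, 1) by rewrite /J1 /= oppr0.
have L : levi (@J1 R) f z (1, 0) (1, 0) = (1 - a) * (pd f (1, 0) z ^+ 2 + pd f (0, 1) z ^+ 2) / f z.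
  by rewrite /levi J.
have fz := f0 z Dz.
have L1 : levi (@J1 R) (fun y => - (f y `^ a)) z (1, 0) (1, 0) = 0.
  rewrite (levi_power_expand _ _ _ _ oD cf f0 Dz) L J -!expr2.
  rewrite (_ : - _ / _ + _ = 0) ?mulr0 //; field; exact: lt0r_neq0.
have N v : pd (pd (fun y => - (f y `^ a)) v) v z = - pd (pd u v) v z.
  rewrite -mulN1r -(pd2_scale (-1) v oD cu Dz); apply: pd_near.
  apply: filterS (open_nbhs_nbhs (conj oD Dz)) => y Dy; apply: pd_near.
  by apply: filterS (open_nbhs_nbhs (conj oD Dy)) => x Dx; rewrite uE // mulN1r.
have L2 : levi (@J1 R) u z (1, 0) (1, 0) = 0.
  by move: L1; rewrite /levi !J !N -opprD => /eqP; rewrite oppr_eq0 => /eqP.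
by rewrite (ddbarE _ Dz cu) L2 (pd2C oD Dz cu) subrr !mul0r.
Qed.

End Slice.

Section SubCharts.
Context (R : realType) (X : complexSurface R) (Omega : set X) (delta : X -> R).
Hypothesis oOm : open Omega.
Hypothesis hbd : Ck_boundary 3 Omega.
Hypothesis hdelta : boundary_distance 3 Omega delta.
Local Notation M := (bd Omega).
Context (g : fchart X -> X -> R) (S : set X) (alpha : {posnum R}).
Hypothesis hg : leafwise_metric M g.
Hypothesis hS : saturated M S.
Local Notation K := (leaf_transversal S).
Local Notation N := (leaf_normal Omega delta).

(** The sign of the normal derivative is fixed near a point, and the harmonicity of its
power is local. *)
Lemma leaf_power_harmonic (c : fchart X) (eta : R) (t : R) : foliated_chart M c ->
  0 < eta < 1 -> alpha%:num = eta / (1 - eta) -> fT c t ->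
  (forall z, fD c z -> local_DF_exponent Omega delta (fpar c (z, t)) = eta) ->
  forall u, (forall z, fD c z -> u z = `|N c (z, t)| `^ alpha%:num) ->
  [/\ forall z, fD c z -> 0 < u z, Ck 2 (fD c) u &
    forall z, fD c z -> ddbar (@J1 R) (1, 0) (1, 0) u z = 0].
Proof.
move=> fc eta01 aE Tt He u uE; have [_ [oD _ _ _] _ _ _] := fc.
have n0 z : fD c z -> N c (z, t) != 0.
  by move=> Dz; apply: (leaf_normal_neq0 hbd hdelta fc).
split.
- by move=> z Dz; rewrite uE // powR_gt0 // normr_gt0 n0.
- apply: (Ck_ext oD) (Ck_slice Tt (abs_power_Ck_box hbd hdelta alpha fc)) => z Dz.
  by rewrite uE.
- move=> z Dz; pose sg := Num.sg (N c (z, t)).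
  have s1 : sg ^+ 2 = 1 by rewrite sqr_sg n0.
  have sn : sg != 0 by rewrite sgr_eq0 n0.
  have CN := Ck_leaf_normal hbd hdelta fc.
  pose f y := sg * N c (y, t).
  have ob := foliated_box_open fc.
  have cF : Ck 2 (fD c `*` fT c) (fun x => sg * N c x).
    exact: CkM ob (Ck_cst 2 _ sg) CN.
  have cf : Ck 2 (fD c) f := Ck_slice Tt cF.
  pose A := fD c `&` [set y | 0 < f y].
  have oA : open A.
    rewrite openE => y [Dy fy]; rewrite /interior; apply: filterI.
      by apply: open_nbhs_nbhs.
    have cy : {for y, continuous f} by exact: Ck_cont cf Dy.
    by apply: (cy [set r | 0 < r]); apply: open_nbhs_nbhs; split; [exact: open_gt|].
  have Az : A z by split=> //=; rewrite /f /sg -normrEsg normr_gt0 n0.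
  apply: (@harmonic_power _ A f u alpha%:num z) => //.
  + by apply: Ck_sub cf => y [].
  + by move=> y [].
  + move=> y [Dy fy]; rewrite uE // -(gtr0_norm fy) normrM.
    by rewrite -[`|sg|]sqrtr_sqr s1 sqrtr1 mul1r.
  + have Bz : (fD c `*` fT c) (z, t) by [].
    have lap := leaf_normal_laplacian oOm hbd hdelta fc Bz eta01 (He z Dz).
    rewrite /= in lap.
    rewrite !(pd_slice_fun (fun x => sg * N c x)) !(pd_slice (pd _ _)).
    rewrite !(pd2_scale _ _ ob CN Bz) !(pd_scale _ _ (CkS CN) Bz) -mulrDr lap aE /f !exprMn s1 !mul1r.
    rewrite -[X in _ = _ / X]/(sg * _) -/(dirx R) -/(diry R).
    rewrite -[in RHS](mul1r (1 - _)) -s1; field.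
    by rewrite n0 // sn s1 /= subr_eq0 eq_sym; case/andP: eta01 => _ /lt_eqF ->.
Qed.

Definition subchart (c : fchart X) (x0 : C1 R * R) (r : R) : fchart X :=
  FChart (fpar c @` (ball x0.1 r `*` ball x0.2 r)) (fz c) (ft c) (ball x0.1 r) (ball x0.2 r) (fpar c).

(** A ball is a union of segments through its centre. *)
Lemma ball_connected (z : C1 R) (r : R) : 0 < r -> connected (ball z r).
Proof.
move=> r0; pose seg (y : C1 R) := (fun u : R => z + u *: (y - z)) @` `[0, 1].
have -> : ball z r = \bigcup_(y in ball z r) seg y.
  apply/seteqP; split => y.
    move=> By; exists y => //; exists 1; first by rewrite /= in_itv /= ler01 lexx.
    by rewrite scale1r subrKC.
  move=> [y' By' [u u01 <-]]; move: By' u01; rewrite -ball_normE /= in_itv /= opprD addNKr normrN => By' /andP[u0 u1].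
  by rewrite normrZ ger0_norm // (le_lt_trans _ By') // distrC ler_piMl.
apply: bigcup_connected.
  exists z => y _; exists 0; first by rewrite /= in_itv /= ler01 lexx.
  by rewrite scale0r addr0.
move=> y _; apply: connected_continuous_connected; first exact: segment_connected.
apply: continuous_subspaceT => u.
by apply: cvgD; [exact: cvg_cst|apply: cvgZl; exact: cvg_id].
Qed.

Lemma subchart_foliated (c : fchart X) x0 r : foliated_chart M c -> 0 < r ->
  ball x0.1 r `*` ball x0.2 r `<=` fD c `*` fT c -> foliated_chart M (subchart c x0 r).
Proof.
move=> fc r0 sub; have sd : fdom (subchart c x0 r) `<=` fdom c.
  by move=> _ [x /sub bx <-]; have [] := foliated_chart_par fc bx.
have dP p : fdom (subchart c x0 r) p ->
    [/\ ball x0.1 r (fz c p), ball x0.2 r (ft c p) & fpar c (fz c p, ft c p) = p].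
  move=> [x bx <-]; have [h1 h2 h3] := foliated_chart_par fc (sub _ bx).
  by case: bx => b1 b2; rewrite h2 h3 -surjective_pairing.
have [ex [oD cD oT iT] [h1 h2 cz ct cp] hA hH] := fc; split.
- exists (interior [set p | M p -> fdom (subchart c x0 r) p]); first exact: open_interior.
  apply/seteqP; split => p.
    move=> dp; split; first exact: (foliated_chart_sub fc (sd _ dp)).
    have [b1 b2 b3] := dP p dp.
    have nb : nbhs (fz c p, ft c p) (ball x0.1 r `*` ball x0.2 r).
      apply: open_nbhs_nbhs; split=> //.
      by apply: open_setM_box; exact: ball_open.
    have H : nbhs p [set q | M q -> fdom c q /\ (ball x0.1 r `*` ball x0.2 r) (fz c q, ft c q)].
      exact: (foliated_coord_near fc (sd _ dp) nb).
    apply: filterS H => q Hq Mq; have [dq bq] := Hq Mq.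
    by exists (fz c q, ft c q) => //; have [] := foliated_chart_dom fc dq.
  by move=> [Mp /interior_subset]; apply.
- split.
  + exact: ball_open.
  + exact: ball_connected.
  + exact: ball_open.
  + move=> x y; rewrite /= -!ball_normE /= => bx By u /andP[u1 u2].
    move: bx By; rewrite !ltr_distlC => /andP[? ?] /andP[? ?].
    by apply/andP; split; lra.
- split.
  + by move=> p /dP[].
  + move=> x bx; have [k1 k2 k3] := foliated_chart_par fc (sub _ bx).
    by split=> //; exists x.
  + exact: continuous_subspaceW sd cz.
  + exact: continuous_subspaceW sd ct.
  + by move=> x; rewrite inE => /sub bx; apply: cp; rewrite inE.
- move=> a Aa; have [k1 k2] := hA a Aa; split.
    by apply: Ck_sub k1 => x [/sub bx ax].
  by move=> x v [/sub bx ax]; exact: k2.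
- move=> a Aa t Tt z [Dz az].
  have bx : (fD c `*` fT c) (z, t) by apply: sub.
  by apply: (hH a Aa t bx.2); split=> //; exact: bx.1.
Qed.

End SubCharts.

(** * Charts with bounded densities and the existence of the measure *)

Section GoodCharts.
Context (R : realType) (X : complexSurface R) (Omega : set X) (delta : X -> R).
Hypothesis hbd : Ck_boundary 3 Omega.
Hypothesis hdelta : boundary_distance 3 Omega delta.
Local Notation M := (bd Omega).
Context (g : fchart X -> X -> R) (S : set X) (alpha : {posnum R}).
Hypothesis hg : leafwise_metric M g.
Hypothesis hS : saturated M S.
Local Notation K := (leaf_transversal S).
Local Notation N := (leaf_normal Omega delta).
Local Notation leb2 := (@lebesgue_measure R \x @lebesgue_measure R)%E.
Local Notation Rm := (measurableTypeR R).
Local Notation box c := (fD c `*` fT c).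

(** The bounds make the logarithm of the harmonic density bounded, the density
integrable, and the mass of the chart positive when its transversal has positive
measure. *)
Definition good (b : fchart X) : Prop :=
  [/\ foliated_chart M b, (hausO alpha (K b) < +oo)%E, (0 < leb2 (fD b) < +oo)%E &
   exists m L : R, 0 < m /\ forall x, box b x -> [/\ m <= `|N b x|, `|N b x| <= L,
      m <= density Omega delta g alpha b x & density Omega delta g alpha b x <= L]].

Lemma subchart_transversal c x0 r : foliated_chart M c -> 0 < r ->
  ball x0.1 r `*` ball x0.2 r `<=` box c -> K (subchart c x0 r) = K c `&` ball x0.2 r.
Proof.
move=> fc r0 sub; apply/seteqP; split => t.
  move=> [p [Sp [x bx E]] <-]; have [h1 h2 h3] := foliated_chart_par fc (sub _ bx).
  rewrite E in h1 h3; split; first by exists p.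
  by rewrite /= h3; case: bx.
move=> [Kt bt]; have bx : (ball x0.1 r `*` ball x0.2 r) (x0.1, t).
  by split=> //; exact: ballxx.
have [h1 h2 h3] := foliated_chart_par fc (sub _ bx).
have := leaf_transversalP hS fc (sub _ bx) => /= e.
exists (fpar c (x0.1, t)) => //; split; first exact/e.
by exists (x0.1, t).
Qed.

Lemma ball_square (z : C1 R) (r : R) : 0 < r ->
  square (z.1 - r / 2, z.2 - r / 2) r `<=` ball z r /\
  ball z r `<=` square (z.1 - r, z.2 - r) (r + r).
Proof.
move=> r0; split=> -[x y]; rewrite -ball_normE /square /= normC1 gt_max /= !ltr_distlC !in_itv /=.
  by move=> [/andP[? ?] /andP[? ?]]; apply/andP; split; apply/andP; split; lra.
by move=> /andP[/andP[? ?] /andP[? ?]]; split; apply/andP; split; lra.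
Qed.

Lemma leb2_ball (z : C1 R) (r : R) : 0 < r -> (0 < leb2 (ball z r) < +oo)%E.
Proof.
move=> r0; have [h1 h2] := ball_square z r0.
have mB : @measurable _ (Rm * Rm)%type (ball z r) by apply: open2_measurable; exact: ball_open.
have r20 : 0 < r + r by rewrite addr_gt0.
apply/andP; split.
  have : (0 < leb2 (square (z.1 - r / 2, z.2 - r / 2)%R r))%E by rewrite leb2_square // lte_fin mulr_gt0.
  move/lt_le_trans; apply; apply: le_measure; rewrite ?inE //; exact: square_measurable.
have : (leb2 (square (z.1 - r, z.2 - r)%R (r + r)%R) < +oo)%E by rewrite leb2_square // ltry.
apply: le_lt_trans; apply: le_measure; rewrite ?inE //; exact: square_measurable.
Qed.

(** Around every point of a chart there is a good chart, by continuity. *)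
Lemma good_subchart c x0 : foliated_chart M c -> (hausO alpha (K c) < +oo)%E -> box c x0 ->
  exists r, [/\ 0 < r, ball x0.1 r `*` ball x0.2 r `<=` box c & good (subchart c x0 r)].
Proof.
move=> fc hc bx0; have n0 := leaf_normal_neq0 hbd hdelta fc bx0.
have d0 := density_gt0 hbd hdelta alpha hg fc bx0.
pose m := Num.min (`|N c x0| / 2) (density Omega delta g alpha c x0 / 2); pose L := Num.max (`|N c x0| + 1) (density Omega delta g alpha c x0 + 1).
have np : 0 < `|N c x0| by rewrite normr_gt0.
have cN : {for x0, continuous (fun x => `|N c x|)}.
  by apply: continuous_comp (leaf_normal_cont hbd hdelta fc bx0) _; exact: norm_continuous.
have cd := density_cont hbd hdelta hg fc bx0 : {for x0, continuous (density Omega delta g alpha c)}.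
have H1 : nbhs x0 [set x | m <= `|N c x|].
  by apply: (continuous_ge_near cN); rewrite /m gt_min ltr_pdivrMr // ltr_pMr // ltr1n.
have H5 : nbhs x0 [set x | m <= density Omega delta g alpha c x].
  by apply: (continuous_ge_near cd); rewrite /m gt_min orbC ltr_pdivrMr // ltr_pMr // ltr1n.
have H2 : nbhs x0 [set x | `|N c x| <= L].
  by apply: (continuous_le_near cN); rewrite /L lt_max ltrDl ltr01.
have H3 : nbhs x0 [set x | density Omega delta g alpha c x <= L].
  by apply: (continuous_le_near cd); rewrite /L lt_max ltrDl ltr01 orbT.
have H4 : nbhs x0 (box c) by apply: open_nbhs_nbhs; split=> //; exact: foliated_box_open fc.
have /nbhs_ballP[r r0 Hr] : nbhs x0 (box c `&` ([set x | m <= `|N c x|] `&`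
    ([set x | `|N c x| <= L] `&` ([set x | density Omega delta g alpha c x <= L] `&`
     [set x | m <= density Omega delta g alpha c x])))).
  by apply: filterI => //; apply: filterI => //; apply: filterI => //; apply: filterI.
have r0' : 0 < r by [].
have sub : ball x0.1 r `*` ball x0.2 r `<=` box c by move=> x bx; have [] := Hr x bx.
have fb := subchart_foliated fc r0' sub.
exists r; split=> //; split=> //.
- apply: le_lt_trans hc; rewrite (subchart_transversal fc r0' sub).
  by apply: (le_outer_measure (hausO alpha)) => t [].
- exact: leb2_ball.
- exists m, L; split; first by rewrite lt_min !divr_gt0.
  move=> x bx; have [bcx [h1 [h2 [h3 h8]]]] := Hr x bx.
  have [h4 _ _] := foliated_chart_par fc bcx; have [h5 h6 h7] := foliated_chart_par fb bx.
  suff -> : density Omega delta g alpha (subchart c x0 r) x = density Omega delta g alpha c x by split.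
  rewrite /density /= (hg.2 _ _ fb fc (fpar c x) h5 h4) /sqnorm_dz /= h6 h7.
  have -> : 'D_((1, 0) : C1 R) (fun z => fz c (fpar c (z, x.2))) x.1 = (1, 0).
    transitivity ('D_((1, 0) : C1 R) (id : C1 R -> C1 R) x.1); last exact: derive_id.
    apply: near_eq_derive; apply: filterS (open_nbhs_nbhs (conj (ball_open x0.1 r) bx.1)) => z bz.
    by have [] := foliated_chart_par fc (sub (z, x.2) (conj bz bx.2)).
  by rewrite expr1n expr0n addr0 mulr1.
Qed.

(** Some good chart meets the transversals in positive measure: a transversal is
covered by countably many small intervals. *)
Lemma good_positive c : foliated_chart M c -> (0 < hausO alpha (K c) < +oo)%E ->
  exists b, good b /\ (0 < hausO alpha (K b))%E.
Proof.
move=> fc /andP[h0 hc]; have [p [Sp dp]] : exists p, S p /\ fdom c p.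
  apply: contrapT => H; move: h0; rewrite (_ : K c = set0) ?outer_measure0 ?ltxx //.
  by apply/seteqP; split => // t [p Hp _]; apply: H; exists p.
have [Dz _ _] := foliated_chart_dom fc dp; pose z0 := fz c p.
apply: contrapT => H; move: h0; apply/negP; rewrite -leNgt.
pose V n := K c `&` (if `[< hausO alpha (K c `&` @ratbase R n) = 0%E >] then @ratbase R n else set0).
have KV : K c `<=` \bigcup_n V n.
  move=> t Kt; have [q [Sq dq] E] := Kt; have [_ Tt _] := foliated_chart_dom fc dq; rewrite E in Tt.
  have bx : box c (z0, t) by [].
  have [r [r0 sub gb]] := good_subchart fc hc bx.
  have [n nt nr] := @ratbaseP R t r r0.
  exists n => //; split=> //; rewrite asboolT //.
  apply/eqP; rewrite eq_le outer_measure_ge0 andbT leNgt; apply/negP => pos.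
  apply: H; exists (subchart c (z0, t) r); split=> //.
  apply: (lt_le_trans pos); rewrite (subchart_transversal fc r0 sub).
  by apply: (le_outer_measure (hausO alpha)) => u [Ku /nr].
apply: (le_trans (le_outer_measure (hausO alpha) _ _ KV)).
apply: (le_trans (outer_measure_sigma_subadditive (hausO alpha) V)).
rewrite eseries0 // => n _ _; rewrite /V; case: ifPn => [/asboolP //|_].
by rewrite setI0 outer_measure0.
Qed.

End GoodCharts.

Section GoodMeasure.
Context (R : realType) (X : complexSurface R) (Omega : set X) (delta : X -> R).
Hypothesis hbd : Ck_boundary 3 Omega.
Hypothesis hdelta : boundary_distance 3 Omega delta.
Local Notation M := (bd Omega).
Context (g : fchart X -> X -> R) (S : set X) (alpha : {posnum R}).
Hypothesis hg : leafwise_metric M g.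
Hypothesis hS : saturated M S.
Local Notation K := (leaf_transversal S).
Local Notation N := (leaf_normal Omega delta).
Local Notation leb2 := (@lebesgue_measure R \x @lebesgue_measure R)%E.
Local Notation Rm := (measurableTypeR R).
Local Notation box c := (fD c `*` fT c).
Local Notation mch := (mchart Omega delta g S alpha).
Local Notation den := (density Omega delta g alpha).

(** Only plaques through points of the transversal carry mass, and these are contained in
the saturated set. *)
Lemma mchart_outside c (B : set (borel X)) : foliated_chart M c -> measurable B ->
  B `<=` ~` S -> mch c B = 0%E.
Proof.
move=> fc mB BS; have mA := fpar_measurable fc mB.
rewrite /mchart; apply: null_set_integral => //.
  apply: measurable_funS (density_measurable hbd hdelta alpha hg fc); last by move=> x [].
  by apply: open3_measurable; exact: foliated_box_open fc.
set A := box c `&` fpar c @^-1` B in mA *.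
transitivity (chart_measure (hmeas alpha (K c)) A); first by [].
rewrite product_ysection //; pose phi t := leb2 (ysection A t).
have mphi : measurable_fun setT phi by exact: ysection_measurable_fun.
have phiK t : K c t -> phi t = 0%E.
  move=> Kt; rewrite /phi (_ : ysection A t = set0) ?measure0 //.
  apply/seteqP; split => // z; rewrite /ysection /= inE => -[bx Bx].
  by apply: (BS _ Bx); apply/(leaf_transversalP hS fc bx).
pose Z := [set t : Rm | phi t != 0%E].
have mZ : measurable Z by have := emeasurable_neq measurableT mphi 0%E; rewrite setTI.
have Z0 : hmeas alpha (K c) Z = 0%E.
  apply/eqP; rewrite eq_le measure_ge0 andbT.
  rewrite -(hmeas_outside alpha (K c)).
  apply: (le_outer_measure (hausO alpha)) => t [Kt Zt]; split=> // Kt'.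
  by move/eqP: Zt; apply; exact: phiK.
have ae : ae_eq (hmeas alpha (K c)) setT phi (cst 0%E).
  exists Z; split=> // t /= H; apply/eqP => pt; apply: H => _; exact: pt.
transitivity (\int[hmeas alpha (K c)]_t (cst 0%E) t)%E; last exact: integral0.
by apply: ae_eq_integral.
Qed.

Lemma box_measure c : foliated_chart M c -> (hausO alpha (K c) < +oo)%E ->
  chart_measure (hmeas alpha (K c)) (box c) = (leb2 (fD c) * hausO alpha (K c))%E.
Proof.
move=> fc hc; have [_ [oD _ oT _] _ _ _] := fc.
rewrite /chart_measure product_measure1E; [|exact: open2_measurable|exact: open_measurable].
have E : hmeas alpha (K c) (fT c) = hausO alpha (K c).
  rewrite hmeasE //; congr (hausO alpha _); apply/setIidl.
  by move=> t [p [_ dp] <-]; have [] := foliated_chart_dom fc dp.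
transitivity (leb2 (fD c) * hmeas alpha (K c) (fT c))%E; first by [].
by rewrite E.
Qed.

Lemma good_mass b : good Omega delta g S alpha b -> (0 < hausO alpha (K b))%E ->
  (0 < mch b (fdom b))%E.
Proof.
move=> [fb hb /andP[D0 _] [m [L [m0 Hb]]]] K0.
have E : box b `&` fpar b @^-1` fdom b = box b.
  by apply/setIidl => x bx; have [] := foliated_chart_par fb bx.
have mbox : @measurable _ (Rm * Rm * Rm)%type (box b).
  by apply: open3_measurable; exact: foliated_box_open fb.
apply: (@lt_le_trans _ _ (m%:E * chart_measure (hmeas alpha (K b)) (box b))%E).
  by rewrite box_measure // !mule_gt0.
rewrite /mchart E -integral_cst //; apply: ge0_le_integral => //.
- by move=> x _; rewrite lee_fin ltW.
- exact: density_measurable.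
- by move=> x bx; have [] := Hb x bx; rewrite lee_fin.
Qed.

Lemma good_integrable b : good Omega delta g S alpha b ->
  (chart_measure (hmeas alpha (K b))).-integrable (box b) (EFin \o den b).
Proof.
move=> [fb hb /andP[_ Doo] [m [L [m0 Hb]]]].
apply: measurable_bounded_integrable.
- by apply: open3_measurable; exact: foliated_box_open fb.
- have H : (chart_measure (hmeas alpha (K b)) (box b) < +oo)%E.
    by rewrite box_measure // lte_mul_pinfty // ge0_fin_numE // measure_ge0.
  exact: H.
- apply/measurable_EFinP; exact: density_measurable.
- exists L; split; first exact: num_real.
  move=> y Ly x bx; have [_ _ h1 h2] := Hb x bx.
  rewrite /= ger0_norm; first by rewrite (le_trans h2) // ltW.
  by rewrite ltW // (lt_le_trans m0).
Qed.

Lemma good_log b : good Omega delta g S alpha b -> exists k : R, forall x, box b x ->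
  0 < `|N b x| `^ alpha%:num /\ `|ln (`|N b x| `^ alpha%:num)| <= k.
Proof.
move=> [fb hb _ [m [L [m0 Hb]]]].
exists (alpha%:num * (`|ln m| + `|ln L|)) => x bx; have [h1 h2 _ _] := Hb x bx.
have n0 : 0 < `|N b x| by exact: lt_le_trans m0 h1.
split; first exact: powR_gt0.
rewrite ln_powR normrM ger0_norm // ler_wpM2l //.
have L0 : 0 < L by exact: lt_le_trans n0 h2.
have l1 : ln m <= ln `|N b x| by rewrite ler_ln.
have l2 : ln `|N b x| <= ln L by rewrite ler_ln.
rewrite ler_norml; have := ler_norm (ln L); have := ler_norm (- ln m).
rewrite normrN => a1 a2; have := normr_ge0 (ln L); have := normr_ge0 (ln m).
by move=> b1 b2; apply/andP; split; lra.
Qed.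

End GoodMeasure.

Section Assembly.
Context (R : realType) (X : complexSurface R) (Omega : set X) (delta : X -> R).
Hypothesis oOm : open Omega.
Hypothesis cOm : compact (closure Omega).
Hypothesis hbd : Ck_boundary 3 Omega.
Hypothesis hdelta : boundary_distance 3 Omega delta.
Local Notation M := (bd Omega).
Context (g : fchart X -> X -> R) (S : set X) (alpha : {posnum R}).
Hypothesis hg : leafwise_metric M g.
Hypothesis hS : saturated M S.
Local Notation K := (leaf_transversal S).
Local Notation N := (leaf_normal Omega delta).
Local Notation good := (good Omega delta g S alpha).

(** Compactness of the boundary gives the cover; the last chart is chosen apart, to
exclude that the transverse measures of all the small boxes vanish. *)
Lemma good_cover (n0 : nat) (c0 : 'I_n0 -> fchart X) : S !=set0 -> foliated_cover M c0 ->
  (forall i, (S `&` fdom (c0 i)) !=set0 -> (0 < hausO alpha (K (c0 i)) < +oo)%E) ->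
  exists (n : nat) (c : nat -> fchart X),
    [/\ forall j, good (c j), M = \bigcup_(j in [set j | (j < n)%N]) fdom (c j) &
        exists2 j, (j < n)%N & (0 < hausO alpha (K (c j)))%E].
Proof.
move=> [p0 Sp0] [fc cov] H.
have Kfin i : (hausO alpha (K (c0 i)) < +oo)%E.
  have [S0|/set0P S0] := eqVneq (S `&` fdom (c0 i)) set0; last by have /andP[] := H i S0.
  by rewrite (_ : K _ = set0) ?outer_measure0 // /leaf_transversal S0 image_set0.
have Mp0 : M p0 by have [sM _] := hS; exact: sM.
have [i0 _ dp0] : (\bigcup_i fdom (c0 i)) p0 by rewrite -cov.
have [bs [gbs pos]] := good_positive hbd hdelta hg hS (fc i0) (H i0 (ex_intro _ p0 (conj Sp0 dp0))).
have ex p : exists b, M p -> good b /\ fdom b p.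
  have [Mp|nM] := pselect (M p); last by exists bs.
  have [i _ dp] : (\bigcup_i fdom (c0 i)) p by rewrite -cov.
  have [h1 h2 h3] := foliated_chart_dom (fc i) dp; pose x0 := (fz (c0 i) p, ft (c0 i) p).
  have [r [r0 _ gb]] := good_subchart hbd hdelta hg hS (fc i) (Kfin i) (conj h1 h2 : (_ `*` _) x0).
  exists (subchart (c0 i) x0 r) => _; split=> //.
  by exists x0 => //; split; exact: ballxx.
have [b Hb] := @choice _ _ (fun p b => M p -> good b /\ fdom b p) ex.
pose f p := interior [set q | M q -> fdom (b p) q].
have cM : compact M.
  apply: (subclosed_compact _ cOm); first exact: bd_closed.
  by move=> p [].
have cov' : M `<=` cover M f.
  move=> p Mp; exists p => //; have [[[[U oU E] _ _ _ _] _ _ _] dp] := Hb p Mp.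
  rewrite /f /interior; have Up : U p by move: dp; rewrite E => -[].
  by apply: filterS (open_nbhs_nbhs (conj oU Up)) => q Uq Mq; rewrite E.
move: cM; rewrite compact_cover => /(_ X M f (fun p _ => open_interior _) cov')[D DM Dcov].
pose s := finmap.enum_fset D.
exists (size s).+1, (fun j => if (j < size s)%N then b (nth p0 s j) else bs); split.
- move=> j; case: ifP => // js; have := mem_nth p0 js => /DM; rewrite inE => Mj.
  by have [] := Hb _ Mj.
- apply/seteqP; split => q.
    move=> Mq; have [p Dp fq] := Dcov q Mq; exists (index p s).
      by rewrite /= ltnS index_size.
    have ps : p \in s by [].
    rewrite index_mem ps nth_index //; exact: (interior_subset fq).
  move=> [j _]; case: ifP => [js|_].
    have := mem_nth p0 js => /DM; rewrite inE => Mj.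
    have [[fb _ _ _] _] := Hb _ Mj => dq; exact: (foliated_chart_sub fb dq).
  have [fb _ _ _] := gbs => dq; exact: (foliated_chart_sub fb dq).
- by exists (size s); rewrite ?ltnn // ltnS.
Qed.

Lemma mchart_ext c (B : set X) (F : C1 R * R -> R) :
  (forall x, (fD c `*` fT c) x -> density Omega delta g alpha c x = F x) ->
  mchart Omega delta g S alpha c B =
  (\int[chart_measure (hmeas alpha (K c))]_(x in (fD c `*` fT c) `&` fpar c @^-1` B) (F x)%:E)%E.
Proof. by move=> E; apply: eq_integral => x; rewrite inE => -[bx _]; rewrite E. Qed.

(** The density is the power of the normal derivative and the transverse measures are
the Hausdorff measures; the boxes are those of a cover by good charts. *)
Lemma conformal_harmonic_exists (eta : R) (n0 : nat) (c0 : 'I_n0 -> fchart X) :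
  0 < eta < 1 -> alpha%:num = eta / (1 - eta) -> S !=set0 -> compact S ->
  (forall p, S p -> local_DF_exponent Omega delta p = eta) ->
  foliated_cover M c0 ->
  (forall i, (S `&` fdom (c0 i)) !=set0 -> (0 < hausO alpha (K (c0 i)) < +oo)%E) ->
  exists mu : {measure set (borel X) -> \bar R}, conformal_harmonic_measure M S g alpha%:num mu.
Proof.
move=> eta01 aE S0 cS HS fc0 H.
have [n [c [gc cov [j0 jn K0]]]] := good_cover S0 fc0 H.
have fc j : foliated_chart M (c j) by have [] := gc j.
have hc j : (hausO alpha (K (c j)) < +oo)%E by have [] := gc j.
have mS : @measurable _ (borel X) (~` S).
  apply: sub_sigma_algebra; apply: closed_openC; apply: compact_closed cS.
  exact: csurf_hausdorff.
have [mu [muE muS]] : exists mu : {measure set (borel X) -> \bar R},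
    (forall i B, (i < n)%N -> @measurable _ (borel X) B -> B `<=` fdom (c i) ->
      mu B = mchart Omega delta g S alpha (c i) B) /\ mu (~` S) = 0%E.
  exists (glued hbd hdelta S alpha hg n fc); split.
    by move=> i B ni mB Bi; exact: glued_chart.
  transitivity (\sum_(j < n) mchart Omega delta g S alpha (c j) (~` S `&` seqDU (fun j => fdom (c j)) j))%E; first by [].
  apply: big1 => j _; apply: (mchart_outside hbd hdelta alpha hg hS (fc j)); last by move=> p [].
  by apply: measurableI => //; apply: (piece_measurable fc).
have den_h i x : (fD (c i) `*` fT (c i)) x ->
    density Omega delta g alpha (c i) x =
    `|N (c i) (fz (c i) (fpar (c i) x), ft (c i) (fpar (c i) x))| `^ alpha%:num * g (c i) (fpar (c i) x).
  move=> bx; have [_ -> ->] := foliated_chart_par (fc i) bx.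
  by rewrite -surjective_pairing.
have mbox i : @measurable _ (measurableTypeR R * measurableTypeR R * measurableTypeR R)%type (fD (c i) `*` fT (c i)).
  by apply: open3_measurable; exact: foliated_box_open (fc i).
exists mu; split => //.
- move=> mu0; have := good_mass hbd hdelta hg (gc j0) K0.
  have mj := fdom_measurable (fc j0).
  rewrite -(muE j0 _ jn mj) // ltNge; move/negP; apply.
  by rewrite -mu0; apply: le_measure; rewrite ?inE.
exists n, (fun i => c i), (fun i => hmeas alpha (K (c i))),
  (fun i p => `|N (c i) (fz (c i) p, ft (c i) p)| `^ alpha%:num); split.
- split=> //; rewrite cov; apply/seteqP; split => p.
    by move=> [j /= jn' dj]; exists (Ordinal jn').
  by move=> [i _ di]; exists i => //=.
- split; first by move=> i; exact: hmeas_outside.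
  move=> i j O tau W oO Wij Wtau tinj B mB BW.
  exact: (hmeas_conformal hbd hdelta hS (fc i) (fc j) (hc i) (hc j) oO Wij Wtau tinj mB BW).
- move=> i F; split; first by move=> p _; exact: powR_ge0.
  split.
    apply: eq_integrable (good_integrable hbd hdelta hg (gc i)) => //.
    by move=> x; rewrite inE => bx; rewrite /F /= den_h.
  have [k Hk] := good_log (gc i); exists k => p _ dp.
  have [h1 h2 h3] := foliated_chart_dom (fc i) dp; exact: (Hk (fz (c i) p, ft (c i) p)).
- move=> i; apply: aeW => t Kt /=.
  have Tt : fT (c i) t by have [p [_ dp] <-] := Kt; have [] := foliated_chart_dom (fc i) dp.
  apply: (leaf_power_harmonic oOm hbd hdelta (fc i) eta01 aE Tt).
    move=> z Dz; apply: HS; have bx : (fD (c i) `*` fT (c i)) (z, t) by [].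
    exact/(leaf_transversalP hS (fc i) bx).
  move=> z Dz; have bx : (fD (c i) `*` fT (c i)) (z, t) by [].
  by have [_ -> ->] := foliated_chart_par (fc i) bx.
- move=> i B mB Bi.
  rewrite (muE i B (ltn_ord i) mB Bi); exact: mchart_ext (den_h i).
Qed.

End Assembly.

Theorem proposition1p3 (R : realType) (X : complexSurface R)
    (Omega : set X) (g : fchart X -> X -> R) (delta : X -> R) (eta : R)
    (S : set X) (n : nat) (c : 'I_n -> fchart X) :
  let M := bd Omega in
  let alpha := (eta^-1 - 1)^-1 in
  rc_domain Omega ->
  Ck_boundary 3 Omega ->
  levi_flat M ->
  leafwise_metric M g ->
  boundary_distance 3 Omega delta ->
  0 < eta < 1 ->
  S !=set0 -> compact S -> saturated M S ->
  (forall p, S p -> local_DF_exponent Omega delta p = eta) ->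
  foliated_cover M c ->
  (forall i, (S `&` fdom (c i)) !=set0 ->
     (0 < hausdorff_measure alpha (leaf_transversal S (c i)) < +oo)%E) ->
  exists mu : {measure set (borel X) -> \bar R},
    conformal_harmonic_measure M S g alpha mu.
Proof.
move=> M alpha [oOm _ _ cOm] hbd _ hg hdelta eta01 S0 cS hS HS fc H.
have /andP[e0 e1] := eta01.
have aE : alpha = eta / (1 - eta).
  have n0 : eta != 0 by rewrite gt_eqF.
  by rewrite /alpha (_ : eta^-1 - 1 = (1 - eta) / eta) ?invf_div // mulrBl mul1r mulfV.
have a0 : 0 < alpha by rewrite aE divr_gt0 // subr_gt0.
exact: (conformal_harmonic_exists (alpha := PosNum a0) oOm cOm hbd hdelta hg hS eta01 aE S0 cS HS fc H).
Qed.
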